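(* Let $(a_i)_{i\in\mathbb Z}$ be a sequence of real numbers in $\ell^2$ such that $\sum_{i\in\mathbb Z}a_i$ converges to some real $A$. Let $p\in\,]2,3]$ and let $(\varepsilon_i)_{i\in\mathbb Z}$, $\varepsilon_i=\varepsilon_0\circ T^i$, be a stationary sequence of martingale differences with respect to $(\mathcal F_i)_{i\in\mathbb Z}$ in $L^p$. Let $X_k=\sum_{j\in\mathbb Z}a_j\varepsilon_{k-j}$, $S_n=X_1+\cdots+X_n$ and $\sigma_n^2=n^{-1}\mathbb E(S_n^2)$. Let $b_0=a_0-A$ and $b_j=a_j$ for $j\ne 0$, and let $A_n=\sum_{j\in\mathbb Z}\big(\sum_{k=1}^n b_{k-j}\big)^2$. If $A_n=o(n)$, then $\sigma_n^2$ converges to $\sigma^2=A^2\,\mathbb E(\varepsilon_0^2)$. If moreover $$\sum_{n=1}^\infty\frac{1}{n^{2-p/2}}\Big\Vert\mathbb E\Big(\frac1n\Big(\sum_{j=1}^n\varepsilon_j\Big)^2\Big|\mathcal F_0\Big)-\mathbb E(\varepsilon_0^2)\Big\Vert_{p/2}<\infty ,$$ then, as $n\to\infty$: 1. If $A_n=O(1)$, then $\zeta_1(P_{n^{-1/2}S_n},G_{\sigma^2})=O(n^{-1/2}\log n)$, for $p=3$. 2. If $A_n=O(n^{(r+2-p)/r})$, then $\zeta_r(P_{n^{-1/2}S_n},G_{\sigma^2})=O(n^{1-p/2})$, for $r\in[p-2,1]$ and $p\ne 3$. 3. If $A_n=O(n^{3-p})$, then $\zeta_r(P_{n^{-1/2}S_n},G_{\sigma^2})=O(n^{1-p/2})$,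 for $r\in\,]1,2]$. 4. If $A_n=O(n^{3-p})$, then $\zeta_r(P_{n^{-1/2}S_n},G_{\sigma_n^2})=O(n^{1-p/2})$, for $r\in\,]2,p]$.
   Context: Setting: $(\Omega,\mathcal A,\mathbb P)$ is a probability space, $T:\Omega\to\Omega$ is a bijective bimeasurable transformation preserving $\mathbb P$, $\mathcal F_0\subseteq\mathcal A$ is a $\sigma$-algebra with $\mathcal F_0\subseteq T^{-1}(\mathcal F_0)$, and $\mathcal F_i=T^{-i}(\mathcal F_0)$. The sequence $\varepsilon_i=\varepsilon_0\circ T^i$ is a martingale differences sequence with respect to $(\mathcal F_i)$ if $\varepsilon_0$ is integrable and $\mathcal F_0$-measurable and $\mathbb E(\varepsilon_0|\mathcal F_{-1})=0$ a.s. $\|\cdot\|_q$ is the $L^q(\mathbb P)$ norm. $P_Z$ is the law of a random variable $Z$; $G_v$ is the normal law $N(0,v)$. Zolotarev distance: for real $r>0$ let $l\ge 0$ be the integer with $l<r\le l+1$. $\Lambda_r$ is the class of real functions $f$ on $\mathbb R$ that are $l$-times continuously differentiable with $|f^{(l)}(x)-f^{(l)}(y)|\le|x-y|^{r-l}$ for all $x,y\in\mathbb R$. For probability measures $\mu,\nu$ on $\mathbb R$, $\zeta_r(\mu,\nu)=\sup\{\int f\,d\mu-\int f\,d\nu: f\in\Lambda_r\}$. *)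

(* Defs.v *)
From HB Require Import structures.
From mathcomp Require Import all_boot all_order all_algebra.
From mathcomp Require Import all_classical all_reals all_analysis.
From mathcomp Require Import measurable_realfun.
Set Implicit Arguments.
Unset Strict Implicit.
Unset Printing Implicit Defensive.
Import Order.TTheory GRing.Theory Num.Theory.
Import numFieldNormedType.Exports.
Local Open Scope classical_set_scope.
Local Open Scope ring_scope.

Definition invertible_measure_preserving d (T : measurableType d)
    (R : realType) (P : probability T R) (tau tauV : T -> T) : Prop :=
  [/\ cancel tau tauV, cancel tauV tau,
      measurable_fun [set: T] tau, measurable_fun [set: T] tauV &
      forall B, measurable B -> P (tau @^-1` B) = P B].

Definition iterz (T : Type) (tau tauV : T -> T) (i : int) : T -> T :=
  match i with
  | Posz n => iter n tau
  | Negz n => iter n.+1 tauV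
  end.

(* F_i = tau^{-i}(F0), the preimage of F0 under tau^i. *)
Definition filtration_of (T : Type) (tau tauV : T -> T)
    (F0 : set (set T)) (i : int) : set (set T) :=
  preimage_set_system [set: T] (iterz tau tauV i) F0.

Definition measurable_wrt d (T : measurableType d) (R : realType)
    (F : set (set T)) (Y : T -> R) : Prop :=
  preimage_set_system [set: T] Y measurable `<=` F.

Definition is_cond_exp d (T : measurableType d) (R : realType)
    (P : probability T R) (F : set (set T)) (X Y : T -> R) : Prop :=
  [/\ measurable_wrt F Y,
      P.-integrable [set: T] (EFin \o Y) &
      forall B, F B ->
        (\int[P]_(w in B) (Y w)%:E = \int[P]_(w in B) (X w)%:E)%E].

(* A version of E(X | F) picked by choice, hence meaningful up to P-null sets
   only; one exists when X is integrable and F is a sub-sigma-algebra. *)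
Definition cond_exp d (T : measurableType d) (R : realType)
    (P : probability T R) (F : set (set T)) (X : T -> R) : T -> R :=
  get [set Y | is_cond_exp P F X Y].

Definition stationary_seq (T : Type) (R : realType) (tau tauV : T -> T)
    (e0 : T -> R) (i : int) : T -> R :=
  e0 \o iterz tau tauV i.

Definition is_mds d (T : measurableType d) (R : realType)
    (P : probability T R) (tau tauV : T -> T) (F0 : set (set T))
    (e0 : T -> R) : Prop :=
  [/\ P.-integrable [set: T] (EFin \o e0),
      measurable_wrt F0 e0 &
      {ae P, forall w, cond_exp P (filtration_of tau tauV F0 (- 1)) e0 w = 0}].

Definition zsum (V : nmodType) (u : int -> V) (mn : nat * nat) : V :=
  \sum_(0 <= j < mn.1) u (- (j.+1)%:Z)%R + \sum_(0 <= j < mn.2.+1) u j%:Z.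

(* Both ends of the range of summation tend to infinity independently. *)
Definition zseries_cvg (R : realType) (u : int -> R) (l : R) : Prop :=
  zsum u @ filter_prod \oo \oo --> l.

Definition zseries_cvg_L2 d (T : measurableType d) (R : realType)
    (P : probability T R) (u : int -> T -> R) (Y : T -> R) : Prop :=
  ('N[P]_2%:E[(fun w => (zsum (fun j => u j w) mn - Y w)%:E)]
     @[mn --> filter_prod \oo \oo] --> 0)%E.

Definition ell2 (R : realType) (u : int -> R) : Prop :=
  (\esum_(i in [set: int]) (u i ^+ 2)%:E < +oo)%E.

Definition bcoef (R : realType) (a : int -> R) (A : R) (j : int) : R :=
  if j == 0 then a 0 - A else a j.

(* [fine] is harmless: the sum is finite as soon as [a] is in ell2. *)
Definition Acoef (R : realType) (a : int -> R) (A : R) (n : nat) : R :=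
  fine (\esum_(j in [set: int])
    ((\sum_(1 <= k < n.+1) bcoef a A (k%:Z - j)) ^+ 2)%:E)%E.

Definition partial_sum d (T : measurableType d) (R : realType)
    (X : int -> {mfun T >-> R}) (n : nat) : {mfun T >-> R} :=
  \sum_(1 <= k < n.+1) X k%:Z.

Definition normalized_sum d (T : measurableType d) (R : realType)
    (X : int -> {mfun T >-> R}) (n : nat) : {mfun T >-> R} :=
  n%:R `^ (- 2^-1) *: partial_sum X n.

Definition sigma2_n d (T : measurableType d) (R : realType)
    (P : probability T R) (X : int -> {mfun T >-> R}) (n : nat) : R :=
  n%:R^-1 * fine ('E_P[(fun w => (partial_sum X n w ^+ 2)%R)])%E.

Definition law d (T : measurableType d) (R : realType) (P : probability T R)
    (Y : {mfun T >-> R}) : probability R R :=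
  distribution P Y.

(* [normal_prob] lives on [measurableTypeR R], whose sigma-algebra is that of
   [R] but whose structure is not convertible to it: it is transported along
   the identity. *)
Definition idTR (R : realType) : measurableTypeR R -> R := idfun.

HB.instance Definition _ (R : realType) :=
  @isMeasurableFun.Build _ _ _ _ (@idTR R) (@measurable_id _ _ setT).

(* The parameter [v] is the variance. The case [v = 0] is separate because
   [normal_prob 0 0] is not the Dirac mass at 0 but the uniform law on
   [0, 1]. *)
Definition normal_law (R : realType) (v : R) : probability R R :=
  if v == 0 then [the probability _ R of dirac (0 : R)]
  else [the probability _ R of
         distribution (normal_prob 0 (Num.sqrt v)) (@idTR R)].

Definition Lambda_class (R : realType) (r : R) : set (R -> R) :=
  [set f | exists l : nat,
    [/\ l%:R < r <= l.+1%:R,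
        forall k x, (k < l)%N -> derivable (derive1n k f) x 1,
        continuous (derive1n l f) &
        forall x y,
          `|derive1n l f x - derive1n l f y| <= `|x - y| `^ (r - l%:R)]].

Definition zolotarev (R : realType) (r : R) (mu nu : probability R R) :
    \bar R :=
  ereal_sup [set (\int[mu]_x (f x)%:E - \int[nu]_x (f x)%:E)%E |
             f in Lambda_class r].

(* Landau's O for an extended-real u, which is thus eventually finite; applying
   the library's O to [fine \o u] would lose this. *)
Definition ebigO (R : realType) (u : nat -> \bar R) (v : nat -> R) : Prop :=
  exists C : R, \forall n \near \oo, (`|u n| <= (C * `|v n|)%:E)%E.

(* Main.v *)
Require Import Defs.
From HB Require Import structures.
From mathcomp Require Import all_boot all_order all_algebra.
From mathcomp Require Import all_classical all_reals all_analysis.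
From mathcomp Require Import measurable_realfun.
From mathcomp Require Import ring lra zify.
Set Implicit Arguments.
Unset Strict Implicit.
Unset Printing Implicit Defensive.
Import Order.TTheory GRing.Theory Num.Theory.
Import numFieldNormedType.Exports.
Local Open Scope classical_set_scope.
Local Open Scope ring_scope.

(** S_n = A M_n + R_n, where M_n = eps_1 + ... + eps_n and R_n is a linear
    combination of the eps_j whose squared coefficients add up to A_n; by
    Burkholder's inequality E|R_n|^p <= C A_n^{p/2}. This gives the limit of
    sigma_n^2, and it reduces the rates to those of M_n once the increments of
    f in Lambda_r are controlled, which requires subtracting from f its Taylor
    polynomial of degree 2 at 0. That polynomial contributes only through the
    variance: for r <= 2 it has degree at most 1, and for r > 2 the Gaussian
    law has the variance of S_n.
    For M_n, smooth f by Gaussian convolution and replace the eps_k by Gaussian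
    variables one at a time. Smoothing preserves the Taylor estimates of f and
    improves them at small scales, and the third-order errors add up to the
    announced rate. The second-order errors contain eps_k^2 - E eps_0^2, which
    is not conditionally centred. They are grouped in blocks of m = 2^l terms,
    each paired with the derivative at the beginning of its block. Going from m
    to 2m costs V_m, the L^{p/2} norm of E(Q_m | F_0) with
    Q_m = sum_{k <= m} (eps_k^2 - E eps_0^2), times the variation of the second
    derivative over m steps, so the total error is governed by
    sum_l 2^{l(p/2 - 2)} V_{2^l}. As V is subadditive and
    E(Q_m | F_0) = E(M_m^2 | F_0) - m E eps_0^2, this sum is finite
    under the hypothesis on the conditional variances. *)

(** * Expectations *)

(** At time k there remain t = n - k steps to replace, hence the bandwidth sqrt(t). One extra
    Gaussian step keeps it at least 1 up to the end; removing that step costs a constant, or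
    n^{(r-2)/2} when r > 2, which the rate dominates. All other errors reduce to one inequality: for
    K m <= n, sum_{1 <= i <= K} gmod r sqrt(i m) y <= C m^{-1} rate y^{p-2}. With m = 1 it bounds
    the third-order errors; for general m, the passage from blocks of length m to blocks of length
    2m. The power y^{p-2} is the one that Hölder's inequality pairs with a square, or with a
    function of L^{p/2}, when only p moments exist. For y of order sqrt(m) it gives m^{-1}
    m^{(p-2)/2} = m^{p/2-2}, the weight of V_m in the dyadic sum. The critical case is r = p - 2,
    where this power bound on [gmod] yields a harmonic series. For r < 1 convergence is recovered by
    bounding [gmod] differently for sqrt(i m) below and above y; for r = 1, p = 3 the logarithm
    remains. These estimates assume variance 1. The general case follows by scaling, and a
    degenerate limit is treated apart. *)

Section expectation.
Context d (T : measurableType d) (R : realType) (P : probability T R).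
Implicit Types (f g : T -> R).

Definition L1 f := P.-integrable [set: T] (EFin \o f).
Definition Ex f := Rintegral P [set: T] f.

Lemma L1_measurable f : L1 f -> measurable_fun [set: T] f.
Proof. by case/integrableP => /measurable_EFinP. Qed.

Lemma L1_dom f g : measurable_fun [set: T] f -> L1 g ->
  (forall x, `|f x| <= g x) -> L1 f.
Proof.
move=> mf ig fg; apply: (le_integrable measurableT _ _ ig).
  exact/measurable_EFinP.
by move=> x _ /=; rewrite lee_fin (le_trans (fg x))// ler_norm.
Qed.

Lemma eq_L1 f g : f =1 g -> L1 f -> L1 g.
Proof. by move=> fg; rewrite (_ : f = g)//; exact/funext. Qed.

Lemma eq_Ex f g : f =1 g -> Ex f = Ex g.
Proof. by move=> fg; rewrite (_ : f = g)//; exact/funext. Qed.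

Lemma L1_cst c : L1 (fun=> c).
Proof. exact: finite_measure_integrable_cst. Qed.

Lemma L1D f g : L1 f -> L1 g -> L1 (fun x => f x + g x).
Proof. by move=> i1 i2; exact: (integrableD measurableT i1 i2). Qed.

Lemma L1Z c f : L1 f -> L1 (fun x => c * f x).
Proof. by move=> i1; exact: (integrableZl measurableT c i1). Qed.

Lemma L1N f : L1 f -> L1 (fun x => - f x).
Proof. by move=> /(L1Z (-1)); apply: eq_L1 => x; rewrite mulN1r. Qed.

Lemma L1B f g : L1 f -> L1 g -> L1 (fun x => f x - g x).
Proof. by move=> i1 i2; apply: L1D => //; exact: L1N. Qed.

Lemma L1_abs f : L1 f -> L1 (fun x => `|f x|).
Proof. by move=> i1; apply: integrable_norm. Qed.

Lemma L1_sum I (s : seq I) (F : I -> T -> R) : (forall i, L1 (F i)) ->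
  L1 (fun x => \sum_(i <- s) F i x).
Proof.
move=> iF; elim: s => [|i s IH].
  by apply: eq_L1 (L1_cst 0) => x; rewrite big_nil.
by apply: eq_L1 (L1D (iF i) IH) => x; rewrite big_cons.
Qed.

Lemma Ex_cst c : Ex (fun=> c) = c.
Proof. by rewrite /Ex Rintegral_cst//; have /= -> := @probability_setT _ _ _ P; rewrite mulr1. Qed.

Lemma ExD f g : L1 f -> L1 g -> Ex (fun x => f x + g x) = Ex f + Ex g.
Proof. by move=> *; exact: RintegralD. Qed.

Lemma ExB f g : L1 f -> L1 g -> Ex (fun x => f x - g x) = Ex f - Ex g.
Proof. by move=> *; exact: RintegralB. Qed.

Lemma ExZ c f : L1 f -> Ex (fun x => c * f x) = c * Ex f.
Proof. by move=> *; exact: RintegralZl. Qed.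

Lemma Ex_sum I (s : seq I) (F : I -> T -> R) : (forall i, L1 (F i)) ->
  Ex (fun x => \sum_(i <- s) F i x) = \sum_(i <- s) Ex (F i).
Proof.
move=> iF; elim: s => [|i s IH].
  by rewrite big_nil -[RHS](Ex_cst 0); apply: eq_Ex => x; rewrite big_nil.
rewrite big_cons -IH -ExD//; last exact: L1_sum.
by apply: eq_Ex => x; rewrite big_cons.
Qed.

Lemma Ex_ge0 f : (forall x, 0 <= f x) -> 0 <= Ex f.
Proof. by move=> f0; exact: Rintegral_ge0. Qed.

Lemma le_Ex f g : L1 f -> L1 g -> (forall x, f x <= g x) -> Ex f <= Ex g.
Proof. by move=> *; exact: le_Rintegral. Qed.

Lemma abs_Ex f : L1 f -> `|Ex f| <= Ex (fun x => `|f x|).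
Proof. by move=> fi; exact: le_normr_Rintegral. Qed.

Lemma abs_Ex_le f g : measurable_fun [set: T] f -> L1 g ->
  (forall x, `|f x| <= g x) -> `|Ex f| <= Ex g.
Proof.
move=> mf gi fg; have fi := L1_dom mf gi fg.
by rewrite (le_trans (abs_Ex fi))// le_Ex//; exact: L1_abs.
Qed.

Lemma Ex_le_cst f c : L1 f -> (forall x, f x <= c) -> Ex f <= c.
Proof. by move=> fi fc; rewrite -[leRHS]Ex_cst; apply: le_Ex => //; exact: L1_cst. Qed.

Lemma EFin_Ex f : L1 f -> (\int[P]_x (f x)%:E)%E = (Ex f)%:E.
Proof. by move=> fi; rewrite /Ex /Rintegral fineK//; exact: integrable_fin_num. Qed.

Lemma L1_ge0 f : measurable_fun [set: T] f -> (forall x, 0 <= f x) ->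
  (\int[P]_x (f x)%:E < +oo)%E -> L1 f.
Proof.
move=> mf f0 fi; apply/integrableP; split; first exact/measurable_EFinP.
rewrite (eq_integral (fun x => (f x)%:E))// => x _.
by rewrite /= ger0_norm.
Qed.

Lemma measurable_powRf f t : measurable_fun [set: T] f ->
  measurable_fun [set: T] (fun x => f x `^ t).
Proof. by move=> mf; apply: (measurableT_comp (measurable_powR t) mf). Qed.

(* Young's inequality for a/(A+e), b/(B+e), integrated; e > 0 guards against A B = 0. *)
Lemma holder_Ex (a b : T -> R) (t : R) : 0 < t < 1 ->
  (forall x, 0 <= a x) -> (forall x, 0 <= b x) -> L1 a -> L1 b ->
  L1 (fun x => a x `^ t * b x `^ (1 - t)) /\
  Ex (fun x => a x `^ t * b x `^ (1 - t)) <= Ex a `^ t * Ex b `^ (1 - t).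
Proof.
move=> /andP[t0 t1] a0 b0 ia ib.
have s0 : 0 < 1 - t by rewrite subr_gt0.
have young (u v : R) : 0 <= u -> 0 <= v ->
    u `^ t * v `^ (1 - t) <= t * u + (1 - t) * v.
  move=> u0 v0.
  have := @conjugate_powR R (u `^ t) (v `^ (1 - t)) t^-1 (1 - t)^-1
    (powR_ge0 _ _) (powR_ge0 _ _).
  rewrite !invr_gt0 !invrK subrKC => /(_ t0 s0 erefl).
  by rewrite -!powRrM !divff ?gt_eqF// !powRr1// (mulrC t) (mulrC (1 - t)).
have mab : measurable_fun [set: T] (fun x => a x `^ t * b x `^ (1 - t)).
  by apply: measurable_funM; apply: measurable_powRf; exact: L1_measurable.
have iab : L1 (fun x => a x `^ t * b x `^ (1 - t)).
  apply: (L1_dom mab (L1D (L1Z t ia) (L1Z (1 - t) ib))) => x.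
  by rewrite ger0_norm ?mulr_ge0 ?powR_ge0// young.
split => //.
have Ea0 : 0 <= Ex a by exact: Ex_ge0.
have Eb0 : 0 <= Ex b by exact: Ex_ge0.
have key A B : Ex a <= A -> Ex b <= B -> 0 < A -> 0 < B ->
    Ex (fun x => a x `^ t * b x `^ (1 - t)) <= A `^ t * B `^ (1 - t).
  move=> aA bB A0 B0.
  have -> : (fun x => a x `^ t * b x `^ (1 - t)) = (fun x =>
     (A `^ t * B `^ (1 - t)) * ((a x / A) `^ t * (b x / B) `^ (1 - t))).
    apply/funext => x.
    rewrite mulrACA -!powRM ?divr_ge0// ?(ltW A0) ?(ltW B0)//.
    by rewrite (mulrC A) (mulrC B) !divfK ?gt_eqF.
  have i2 : L1 (fun x => t / A * a x + (1 - t) / B * b x).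
    by apply: L1D; exact: L1Z.
  have i1 : L1 (fun x => (a x / A) `^ t * (b x / B) `^ (1 - t)).
    apply: (L1_dom _ i2) => [|x].
      by apply: measurable_funM; apply: measurable_powRf;
         apply: measurable_funM => //; exact: L1_measurable.
    rewrite ger0_norm ?mulr_ge0 ?powR_ge0//.
    by rewrite mulrAC -mulrA (mulrAC (1 - t)) -(mulrA (1 - t)) young ?divr_ge0 ?(ltW A0) ?(ltW B0).
  rewrite ExZ// ler_piMr ?mulr_ge0 ?powR_ge0//.
  rewrite (@le_trans _ _ (Ex (fun x => t / A * a x + (1 - t) / B * b x)))//.
    apply: le_Ex => // x.
    by rewrite mulrAC -mulrA (mulrAC (1 - t)) -(mulrA (1 - t)) young ?divr_ge0 ?(ltW A0) ?(ltW B0).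
  rewrite ExD ?ExZ//; [|exact: L1Z..].
  rewrite [leRHS](_ : 1 = t + (1 - t)); last by rewrite subrKC.
  apply: lerD.
    by rewrite -mulrA ler_piMr ?(ltW t0)// mulrC ler_pdivrMr// mul1r.
  by rewrite -mulrA ler_piMr ?(ltW s0)// mulrC ler_pdivrMr// mul1r.
(* [key] is applied with A = Ex a + 1/(n+1) and B = Ex b + 1/(n+1). Continuity of u^e at a limit c =
   0 comes from its one-sided limit there; for c > 0 it comes from differentiability. *)
have lim : (fun n : nat => (Ex a + n.+1%:R^-1) `^ t * (Ex b + n.+1%:R^-1) `^ (1 - t)) @ \oo
    --> Ex a `^ t * Ex b `^ (1 - t).
  have cc (c e : R) : 0 <= c -> 0 < e ->
      (fun n : nat => (c + n.+1%:R^-1) `^ e) @ \oo --> c `^ e.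
    move=> c0 e0.
    have h : (fun n : nat => c + n.+1%:R^-1 : R) @ \oo --> c.
      rewrite -[X in _ --> X]addr0; apply: cvgD; first exact: cvg_cst.
      exact: cvg_harmonic.
    have [->|inv_sqrtn0] := eqVneq c 0.
      rewrite powR0 ?gt_eqF//.
      under eq_fun do rewrite add0r.
      have := @powR_cvg0 R e e0.
      apply: cvg_comp; rewrite /at_right.
      move=> B; rewrite /within/= => /(@cvg_harmonic R)[N _ hN].
      by exists N => // k kN; apply: hN => //=; rewrite invr_gt0.
    have cp : 0 < c by rewrite lt_neqAle eq_sym inv_sqrtn0.
    have hp : {for c, continuous (fun y : R => y `^ e)}.
      apply: differentiable_continuous; apply/derivable1_diffP.
      by apply: derivable_powR; rewrite in_itv/= cp.
    exact: (cvg_comp _ _ h hp).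
  by apply: cvgM; exact: cc.
rewrite -(cvg_lim _ lim)//; apply: limr_ge; first by apply: cvgP lim.
by apply: nearW => n; apply: key; rewrite ?lerDl ?ltr_wpDl.
Unshelve. all: by end_near. Qed.

End expectation.

(** * Invariance of integrals under a measure-preserving map *)

Section measure_preserving.
Context d (T : measurableType d) (R : realType) (P : probability T R).
Variable phi : T -> T.
Hypothesis mphi : measurable_fun [set: T] phi.
Hypothesis mp : forall B, measurable B -> P (phi @^-1` B) = P B.

Let eqP B (f : T -> \bar R) : measurable B ->
  (\int[pushforward P phi]_(x in B) f x = \int[P]_(x in B) f x)%E.
Proof.
move=> mB; apply: eq_measure_integral => A mA _.
exact: mp.
Qed.

Lemma L1_mp (f : T -> R) : L1 P f -> L1 P (f \o phi).
Proof.
move=> fi; have mf := L1_measurable fi.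
apply/integrableP; split.
  by apply/measurable_EFinP; exact: measurableT_comp.
have := ge0_integral_pushforward mphi P measurableT (f := fun x => `|f x|%:E).
rewrite eqP// preimage_setT => /=.
move=> <-//; first by move/integrableP : fi => [].
by apply/measurable_EFinP; apply: measurableT_comp.
Qed.

Lemma Ex_mp_set (f : T -> R) B : measurable B -> L1 P f ->
  Rintegral P (phi @^-1` B) (f \o phi) = Rintegral P B f.
Proof.
move=> mB fi; have mf := L1_measurable fi.
rewrite /Rintegral -(eqP _ mB) integral_pushforward//.
- exact/measurable_EFinP.
- apply: (integrableS measurableT) => //; last exact: L1_mp.
  by rewrite -[X in measurable X]setTI; apply: mphi.
Qed.

Lemma Ex_mp (f : T -> R) : L1 P f -> Ex P (f \o phi) = Ex P f.
Proof. by move=> fi; have := Ex_mp_set measurableT fi; rewrite preimage_setT. Qed.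

End measure_preserving.

(** * Conditional expectations *)

Section sub_sigma_algebra.
Import HBNNSimple HBSimple.
Context d (T : measurableType d) (R : realType) (P : probability T R).
Variable F : set (set T).
Hypothesis sF : sigma_algebra [set: T] F.
Hypothesis Fm : F `<=` measurable.

(* Equivalent to [measurable_wrt F Y] (see [meas_wrtP]), but the closure properties of
   [measurable_fun] apply to it. *)
Definition meas_wrt (Y : T -> R) :=
  @measurable_fun _ _ (g_sigma_algebraType F) R [set: T] Y.

Lemma gsF (B : set T) : <<s F >> B = F B.
Proof.
apply/propext; split => [|FB]; last exact: sub_gen_smallest.
by apply: smallest_sub.
Qed.

Lemma meas_wrtP Y : measurable_wrt F Y <-> meas_wrt Y.
Proof.
split => [h _ B mB|h A [B mB <-]].
  by rewrite /measurable/= gsF; apply: h; exists B.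
by have := h measurableT B mB; rewrite /measurable/= gsF.
Qed.

Let id_meas : @measurable_fun _ _ T (g_sigma_algebraType F) [set: T] idfun.
Proof.
by move=> _ B mB; rewrite setTI preimage_id; apply: Fm; rewrite -gsF.
Qed.

Lemma meas_wrt_measurable Y : meas_wrt Y -> measurable_fun [set: T] Y.
Proof. by move=> h _ B mB; apply: Fm; rewrite -gsF; exact: h. Qed.

Let nnsfun_pull (W : T -> R) : L1 P W ->
  (forall B, F B -> Rintegral P B W = 0) ->
  forall g : {nnsfun (g_sigma_algebraType F) >-> R},
  Ex P (fun x => g x * W x) = 0.
Proof.
move=> iW W0 g.
have mB (y : R) : F (g @^-1` [set y]).
  rewrite -gsF; have := @measurable_funPT _ _ (g_sigma_algebraType F) R g measurableT _ (measurable_set1 y).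
  by rewrite setTI.
have iB y : L1 P (fun x => \1_(g @^-1` [set y]) x * W x).
  apply: (L1_dom _ (L1_abs iW)) => [|x].
    apply: measurable_funM; last exact: L1_measurable iW.
    by apply: measurable_indic; exact: Fm.
  rewrite normrM ler_piMl// indicE; case: (_ \in _) => /=; rewrite ?normr1 ?normr0//.
under [in LHS]eq_fun => x do rewrite fimfunE fsbig_finite//= mulr_suml.
under [in LHS]eq_fun => x do under eq_bigr => y _ do rewrite -mulrA.
rewrite Ex_sum => [|y]; last exact: L1Z.
apply: big1 => y _; rewrite ExZ// (_ : Ex P _ = 0) ?mulr0//.
rewrite -(W0 _ (mB y)) /Ex [RHS]Rintegral_mkcond.
apply: eq_Rintegral => x _; rewrite patchE indicE.
by case: (_ \in _); rewrite ?mul1r ?mul0r.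
Qed.

Let pull_ge0 (W Y : T -> R) : L1 P W ->
  (forall B, F B -> Rintegral P B W = 0) ->
  meas_wrt Y -> (forall x, 0 <= Y x) -> L1 P (fun x => Y x * W x) ->
  Ex P (fun x => Y x * W x) = 0.
Proof.
move=> iW W0 mY Y0 iYW.
have mY' : @measurable_fun _ _ (g_sigma_algebraType F) _ [set: T] (EFin \o Y).
  exact/measurable_EFinP.
pose g := nnsfun_approx measurableT mY'.
have g0 n x : 0 <= g n x by exact: (@fun_ge0 (g_sigma_algebraType F) R (g n) x).
have mg n : measurable_fun [set: T] (g n) by apply: meas_wrt_measurable; exact: measurable_funP.
have := @dominated_convergence _ _ _ P [set: T] measurableT
  (fun n x => (g n x * W x)%:E) (fun x => (Y x * W x)%:E)
  (fun x => `|Y x * W x|%:E).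
case.
- move=> n; apply/measurable_EFinP; apply: measurable_funM => //.
  exact: L1_measurable iW.
- by apply/measurable_EFinP; exact: L1_measurable iYW.
- apply: aeW => x _; apply: cvg_EFin; first by apply: nearW.
  apply: (@cvgM _ _ _ _ (fun n => g n x) (fun=> W x)); last exact: cvg_cst.
  have := @cvg_nnsfun_approx _ _ _ _ measurableT _ mY' (fun x _ => Y0 x) x I.
  by move/fine_cvgP => [].
- exact: L1_abs.
- apply: aeW => x n _ /=; rewrite lee_fin !normrM ler_wpM2r//.
  rewrite !ger0_norm//.
  rewrite /g nnsfun_approxE -lee_fin.
  by apply: (@le_approx _ _ _ [set: T] (EFin \o Y) n x) => // y _; exact: Y0.
move=> _ _; rewrite EFin_Ex//.
rewrite (_ : (fun n => _) = fun=> 0%E); last first.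
  apply/funext => n; rewrite EFin_Ex ?nnsfun_pull//.
  apply: (L1_dom _ (L1_abs iYW)) => [|x].
    by apply: measurable_funM => //; exact: L1_measurable iW.
  rewrite !normrM ler_wpM2r//.
  rewrite !ger0_norm//.
  rewrite /g nnsfun_approxE -lee_fin.
  by apply: (@le_approx _ _ _ [set: T] (EFin \o Y) n x) => // y _; exact: Y0.
move=> h.
move/(cvg_lim (@ereal_hausdorff R)) : h.
by rewrite (_ : [sequence _]_n = fun=> 0%E)// lim_cst// => -[].
Qed.

(** This is the only form in which conditional expectations are used: W is eps_1 or X - E(X | F),
    and Y is an F-measurable weight. It is proved for simple Y, then for Y >= 0 by dominated
    convergence, with |Y W| as dominating function, then by splitting Y into its positive and
    negative parts. *)
Lemma Ex_pullout (W Y : T -> R) : L1 P W ->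
  (forall B, F B -> Rintegral P B W = 0) ->
  meas_wrt Y -> L1 P (fun x => Y x * W x) -> Ex P (fun x => Y x * W x) = 0.
Proof.
move=> iW W0 mY iYW.
have mW := L1_measurable iW; have mYT := meas_wrt_measurable mY.
have i1 : L1 P (fun x => Num.max (Y x) 0 * W x).
  apply: (L1_dom _ (L1_abs iYW)) => [|x].
    by apply: measurable_funM => //; apply: measurable_maxr.
  rewrite !normrM ler_wpM2r//; case: (leP (Y x) 0) => y0; rewrite ?normr0//.
have i2 : L1 P (fun x => Num.max (- Y x) 0 * W x).
  apply: (L1_dom _ (L1_abs iYW)) => [|x].
    by apply: measurable_funM => //; apply: measurable_maxr => //; apply: measurableT_comp.
  rewrite !normrM ler_wpM2r//; case: (leP (- Y x) 0) => y0; rewrite ?normr0 ?normrN//.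
rewrite (_ : (fun x => _) = fun x => Num.max (Y x) 0 * W x - Num.max (- Y x) 0 * W x); last first.
  apply/funext => x; rewrite -mulrBl; congr (_ * _).
  by case: (leP (Y x) 0); case: (leP (- Y x) 0); lra.
rewrite ExB// !pull_ge0// ?subr0// => [|x||x]; rewrite ?le_max ?lexx ?orbT//.
- by apply: measurable_maxr => //; apply: measurableT_comp.
- exact: measurable_maxr.
Qed.

(** The version is the Radon-Nikodym derivative of the charge B -> E(X 1_B) with respect to P, both
    restricted to F. The restriction is expressed as the image under the identity map onto the space
    equipped with the sigma-algebra F. *)
Lemma is_cond_exp_exists (X : T -> R) : L1 P X ->
  exists Y, is_cond_exp P F X Y.
Proof.
move=> iX.
pose mi := isMeasurableFun.Build _ _ _ _ (idfun : T -> g_sigma_algebraType F) id_meas.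
pose idF : {mfun T >-> g_sigma_algebraType F} :=
  MeasurableFun.Pack (MeasurableFun.Class mi).
pose PF : probability (g_sigma_algebraType F) R := distribution P idF.
pose nuF0 : {charge set (g_sigma_algebraType F) -> \bar R} :=
  pushforward (induced_charge iX) idF.
pose nuF := nuF0 id_meas.
have dom : nuF `<< PF.
  apply: dominates_pushforward => //.
  apply/null_content_dominatesP => A mA A0; rewrite /induced_charge.
  apply: null_set_integral => //.
  by apply: (measurable_funS measurableT) => //; exact: measurable_int iX.
have iRN := Radon_Nikodym_integrable dom.
pose Y : T -> R := fun x => fine (Radon_Nikodym nuF PF x).
have mY : meas_wrt Y by apply: measurableT_comp => //; exact: measurable_int iRN.
have YE x : (Y x)%:E = Radon_Nikodym nuF PF x by rewrite /Y fineK//; exact: Radon_Nikodym_fin_num.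
have mYE : measurable_fun [set: g_sigma_algebraType F] (EFin \o Y) by exact/measurable_EFinP.
have iYF : PF.-integrable [set: g_sigma_algebraType F] (EFin \o Y).
  by rewrite (_ : EFin \o Y = Radon_Nikodym nuF PF)//; apply/funext => x; exact: YE.
have iY : L1 P Y.
  apply/integrableP; split.
    by apply/measurable_EFinP; exact: meas_wrt_measurable.
  have /integrableP[_] := iYF.
  rewrite /PF /distribution ge0_integral_pushforward//.
  exact: measurableT_comp.
exists Y; split => //; first exact/meas_wrtP.
move=> B FB.
have mB : @measurable _ (g_sigma_algebraType F) B by rewrite /measurable/= gsF.
have h := @Radon_Nikodym_integral _ _ _ nuF PF B dom mB.
transitivity (\int[PF]_(x in B) (Y x)%:E)%E.
  rewrite [RHS](@integral_pushforward _ _ _ _ _ _ id_meas P B (EFin \o Y))//.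
  apply: (integrableS measurableT) => //.
  exact: Fm.
by rewrite (eq_integral (Radon_Nikodym nuF PF)).
Qed.

Lemma cond_expP (X : T -> R) : L1 P X -> is_cond_exp P F X (cond_exp P F X).
Proof. by move=> /is_cond_exp_exists[Y hY]; apply: (getPex (ex_intro _ Y hY)). Qed.

Lemma is_cond_exp_Rint (X Y : T -> R) : L1 P X -> is_cond_exp P F X Y ->
  forall B, F B -> Rintegral P B (fun x => X x - Y x) = 0.
Proof.
move=> iX [mY iY h] B FB.
have mB := Fm FB.
rewrite RintegralB//; [|exact: (integrableS measurableT)..].
by rewrite /Rintegral h// subrr.
Qed.

End sub_sigma_algebra.

(** * Second-order Taylor estimates *)

Section taylor.
Context (R : realType).
Implicit Types (f h : R -> R) (r x y : R).

Definition taylor2 (h h1 h2 om : R -> R) := forall x y,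
  `|h (x + y) - h x - h1 x * y - h2 x * y ^+ 2 / 2| <= om `|y|.

Section converse.
Variables (h h1 h2 om : R -> R).
Hypothesis ht : taylor2 h h1 h2 om.
Hypothesis om_nd : forall u v, 0 <= u -> u <= v -> om u <= om v.

(* Second, resp. first, difference of the Taylor polynomials at x and x + y,
   taken at the points x, x + y, x + 2 y. *)
Lemma taylor2_coef x y :
  `|h2 (x + y) - h2 x| * y ^+ 2 <= 5 * om (2 * `|y|) /\
  `|h1 (x + y) - h1 x - h2 x * y| * `|y| <= 2 * om (2 * `|y|).
Proof.
have o1 : om `|y| <= om (2 * `|y|) by apply: om_nd => //; rewrite ler_peMl// ler1n.
have := ht x y; have := ht x (2 * y); have := ht (x + y) y; have := ht (x + y) (- y).
have -> : x + 2 * y = x + y + y by ring.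
rewrite normrN addrK normrM (ger0_norm (ler0n _ 2)).
rewrite !ler_norml => /andP[a1 a2] /andP[b1 b2] /andP[c1 c2] /andP[e1 e2].
split.
  rewrite -[y ^+ 2]ger0_norm ?sqr_ge0// -normrM ler_norml; apply/andP; split; lra.
rewrite -normrM ler_norml; apply/andP; split; lra.
Qed.

End converse.

Lemma MVT_everywhere f : (forall x, derivable f x 1) ->
  forall x y, exists2 c, `|c| <= `|y| & f (x + y) - f x = derive1 f (x + c) * y.
Proof.
move=> df x y.
have cf : continuous f.
  by move=> z; apply: differentiable_continuous; apply/derivable1_diffP.
have idf (z : R) : is_derive z (1 : R) f (derive1 f z).
  by apply: DeriveDef => //; rewrite derive1E.
have mvt a b : a < b -> exists2 c, c \in `]a, b[ & f b - f a = derive1 f c * (b - a).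
  by move=> ab; apply: MVT => // ; exact: continuous_subspaceT.
have [y0|y0|->] := ltgtP y 0.
- have [|c] := mvt (x + y) x; first by rewrite gtrDl.
  rewrite in_itv/= => /andP[c1 c2] e.
  exists (c - x); last by rewrite (addrC x (c - x)) subrK; lra.
  by rewrite !ltr0_norm//; lra.
- have [|c] := mvt x (x + y); first by rewrite ltrDl.
  rewrite in_itv/= => /andP[c1 c2] e.
  exists (c - x); last by rewrite (addrC x (c - x)) subrK e; lra.
  by rewrite !gtr0_norm//; lra.
- by exists 0 => //; rewrite addr0 subrr mulr0.
Qed.

Lemma Lambda_taylor2 r f : 0 < r <= 3 -> Lambda_class r f ->
  continuous f /\ exists f1 f2 : R -> R,
    [/\ taylor2 f f1 f2 (fun y => y `^ r),
        r <= 1 -> f1 = (fun=> 0) & r <= 2 -> f2 = (fun=> 0)].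
Proof.
move=> /andP[r0 r3] [l [/andP[lr rl] df cf hf]].
have l3 : (l < 3)%N by rewrite -(ltr_nat R) (lt_le_trans lr).
have mon a b e : 0 <= e -> `|a| <= `|b| -> `|a| `^ e <= `|b| `^ e :> R.
  by move=> e0 ab; apply: ge0_ler_powR; rewrite ?nnegrE.
case: l l3 lr rl df cf hf => [|[|[|//]]] _ lr rl df cf hf.
- split => //; exists (fun=> 0), (fun=> 0); split => // x y.
  by rewrite !mul0r !subr0 (le_trans (hf _ _))// subr0 addrAC subrr add0r.
- have df0 x : derivable f x 1 by exact: (df 0%N).
  split.
    by move=> z; apply: differentiable_continuous; apply/derivable1_diffP.
  exists (derive1 f), (fun=> 0); split => //; last first.
    by move=> /(lt_le_trans lr); rewrite ltxx.
  move=> x y; have [c cy ->] := MVT_everywhere df0 x y.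
  rewrite !mul0r subr0 -mulrBl normrM.
  rewrite -(@mulr_powRB1 _ `|y|)// mulrC ler_wpM2l//.
  have := hf (x + c) x; rewrite /= addrAC subrr add0r => /le_trans; apply.
  by apply: mon; lra.
- have df0 x : derivable f x 1 by exact: (df 0%N).
  have df1 x : derivable (derive1 f) x 1 by exact: (df 1%N).
  split.
    by move=> z; apply: differentiable_continuous; apply/derivable1_diffP.
  exists (derive1 f), (derive1 (derive1 f)); split; first last.
  + by move=> /(lt_le_trans lr); rewrite ltxx.
  + by move=> r1; exfalso; lra.
  move=> x y.
  (* The mean value theorem is applied to the remainder g, whose derivative is f'(x + z) - f'(x) -
     f''(x) z, and then to f'. There remains (f''(x + c') - f''(x)) c y with |c'| <= |c| <= |y|,
     which is at most |y|^{r-2} |y| |y|. *)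
  pose g z := f (x + z) - derive1 f x * z - derive1 (derive1 f) x * z ^+ 2 / 2.
  have dg (z : R) : is_derive z (1 : R) g (derive1 f (x + z) - derive1 f x - derive1 (derive1 f) x * z).
    have d1 : is_derive z (1 : R) (fun z => f (x + z)) (derive1 f (x + z)).
      have idf : is_derive (x + z) (1 : R) f (derive1 f (x + z)).
        by apply: DeriveDef => //; rewrite derive1E.
      have ids : is_derive z (1 : R) (fun z => x + z) (0 + 1) by exact: is_deriveD.
      have := @is_derive1_comp R f (fun z => x + z) z _ _ idf ids.
      by rewrite add0r mulr1.
    have d2 : is_derive z (1 : R) (fun z : R => derive1 f x * z) (derive1 f x).
      by apply: is_derive_eq; rewrite ?scaler0 ?addr0 ?scaler1.
    have d3 : is_derive z (1 : R) (fun z : R => derive1 (derive1 f) x * z ^+ 2 / 2)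
        (derive1 (derive1 f) x * z).
      have -> : (fun z : R => derive1 (derive1 f) x * z ^+ 2 / 2) =
          (derive1 (derive1 f) x / 2) \*: ((fun z : R => z) ^+ 2).
        by apply/funext => u /=; rewrite /GRing.scale/= fctE; ring.
      by apply: is_derive_eq; rewrite /GRing.scale/=; field.
    exact: (is_deriveB (is_deriveB d1 d2) d3).
  have [c cy] := MVT_everywhere (fun z => @ex_derive _ _ _ _ _ _ _ (dg z)) 0 y.
  rewrite !add0r derive1E derive_val {1 2}/g addr0 !mulr0 expr0n/= !mulr0 mul0r !subr0.
  rewrite (_ : _ - f x = f (x + y) - f x - derive1 f x * y - derive1 (derive1 f) x * y ^+ 2 / 2); last by ring.
  move=> ->.
  have [c' c'c ->] := MVT_everywhere df1 x c.
  rewrite -mulrBl !normrM -(@mulr_powRB1 _ `|y|)// mulrC ler_wpM2l//.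
  have h := hf (x + c') x; have e : x + c' - x = c' by ring.
  rewrite e in h.
  rewrite -(@mulr_powRB1 _ `|y|)//; last lra.
  rewrite mulrC ler_pM//.
  rewrite (le_trans h)// (_ : r - 1 - 1 = r - 2%:R); last by lra.
  by apply: mon; [lra|exact: le_trans c'c cy].
Qed.

(** The constants are 5 * 8 and 2 * 8, where 8 = 2^3 bounds the factor 2^r produced by the argument
    2 |y| in [taylor2_coef]. *)
Lemma taylor2_powR_coef r f f1 f2 : 0 < r <= 3 ->
  taylor2 f f1 f2 (fun y => y `^ r) -> forall x y,
  `|f2 (x + y) - f2 x| * y ^+ 2 <= 40 * `|y| `^ r /\
  `|f1 (x + y) - f1 x - f2 x * y| * `|y| <= 16 * `|y| `^ r.
Proof.
move=> /andP[r0 r3] ft x y.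
have mon u v : 0 <= u -> u <= v -> u `^ r <= v `^ r.
  by move=> u0 uv; apply: ge0_ler_powR; rewrite ?nnegrE ?(ltW r0)// (le_trans u0).
have [a b] := taylor2_coef ft mon x y.
have e : (2 * `|y|) `^ r <= 8 * `|y| `^ r.
  rewrite powRM// ler_wpM2r ?powR_ge0// (le_trans (ler_powR _ r3)) ?ler1n//.
  by rewrite powR_mulrn//; lra.
by split; [move: a|move: b]; lra.
Qed.

(* The normalisation f1 0 = f2 0 = 0 makes f comparable to |x|^r. *)
Lemma taylor2_increment r f f1 f2 : 1 < r <= 3 ->
  taylor2 f f1 f2 (fun y => y `^ r) -> (r <= 2 -> f2 = fun=> 0) ->
  f1 0 = 0 -> f2 0 = 0 ->
  forall x y, `|f y - f x| <= 37 * (`|y - x| * (`|x| + `|y|) `^ (r - 1)).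
Proof.
move=> /andP[r1 r3] ft f20 f10 f200 x y.
have r0 : 0 < r by lra.
have [|a b] := taylor2_powR_coef _ ft 0 x; first by rewrite r0.
rewrite add0r f10 f200 !subr0 in a b.
rewrite mul0r subr0 in b.
set u := y - x; set s := `|x| + `|y|.
have us : `|u| <= s by rewrite /s addrC ler_normB.
have s0 : 0 <= s by rewrite addr_ge0.
have xs : `|x| <= s by rewrite lerDl.
have mon v w e : 0 <= e -> 0 <= v -> v <= w -> v `^ e <= w `^ e :> R.
  by move=> e0 v0 vw; apply: ge0_ler_powR; rewrite ?nnegrE// (le_trans v0).
have h1 : `|f1 x| <= 16 * s `^ (r - 1).
  have [->|x0] := eqVneq x 0; first by rewrite f10 normr0 mulr_ge0 ?powR_ge0.
  apply: (@le_trans _ _ (16 * `|x| `^ (r - 1))); last by rewrite ler_wpM2l// mon//; lra.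
  rewrite -(@ler_pM2r _ `|x|) ?normr_gt0// (le_trans b)//.
  by rewrite -(@mulr_powRB1 _ `|x|)//; lra.
have h2 : `|f2 x| * s <= 40 * s `^ (r - 1).
  have [r2|r2] := leP r 2.
    by rewrite f20// normr0 mul0r mulr_ge0 ?powR_ge0.
  have [x0|x0] := eqVneq x 0.
    by rewrite x0 f200 normr0 mul0r mulr_ge0 ?powR_ge0.
  have h : `|f2 x| <= 40 * `|x| `^ (r - 1 - 1).
    rewrite -(@ler_pM2r _ (x ^+ 2)) ?exprn_even_gt0// (le_trans a)//.
    rewrite -(@mulr_powRB1 _ `|x|)// -(@mulr_powRB1 _ `|x| (r - 1))//; last lra.
    by rewrite -real_normK ?num_real//; lra.
  rewrite -(@mulr_powRB1 _ s (r - 1))//; last lra.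
  rewrite mulrCA [leRHS]mulrC ler_wpM2r//.
  by rewrite (le_trans h)// ler_wpM2l// mon//; lra.
have h3 : `|u| `^ r <= `|u| * s `^ (r - 1).
  by rewrite -(@mulr_powRB1 _ `|u|)// ler_wpM2l// mon//; lra.
have := ft x u; rewrite {1}/u subrKC => h.
(* In units of |u| s^{r-1} the three terms contribute 1, 16 and 40 / 2, whence 37. *)
have -> : f y - f x = (f y - f x - f1 x * u - f2 x * u ^+ 2 / 2) + f1 x * u + f2 x * u ^+ 2 / 2 by ring.
rewrite (le_trans (ler_normD _ _))// (le_trans (lerD (ler_normD _ _) (lexx _)))//.
have -> : `|f2 x * u ^+ 2 / 2| = `|f2 x| * `|u| * `|u| / 2.
  by rewrite !normrM normfV (ger0_norm (ler0n _ 2)) mulrA.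
have : `|f2 x| * `|u| * `|u| <= 40 * s `^ (r - 1) * `|u|.
  by rewrite ler_wpM2r// (le_trans _ h2)// ler_wpM2l.
have : `|f1 x * u| <= 16 * s `^ (r - 1) * `|u| by rewrite normrM ler_wpM2r.
by move: h h3; lra.
Qed.

End taylor.

(** * Gaussian expectations *)

Section gaussian.
Context (R : realType).
Notation mu := (@lebesgue_measure R).
Implicit Types (f h : R -> R) (m s t x y dl : R).

Definition gauss : probability (measurableTypeR R) R := normal_prob 0 1.
Definition EN f : R := Ex gauss f.

Lemma cont_meas f : continuous f ->
  measurable_fun [set: measurableTypeR R] f.
Proof. by move=> cf; exact: continuous_measurable_fun. Qed.

(** The change of variables is first made with the abstract Radon-Nikodym derivative, which agrees
    almost everywhere with [normal_pdf] because both have the same integral over every measurable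
    set. *)
Lemma normal_density m s (f : R -> \bar R) :
  measurable_fun [set: measurableTypeR R] f -> (forall x, (0 <= f x)%E) ->
  (\int[normal_prob m s]_x f x = \int[mu]_x (f x * (normal_pdf m s x)%:E))%E.
Proof.
move=> mf f0.
have dom := @normal_prob_dominates R m s.
have rn := Radon_Nikodym_SigmaFinite.change_of_variables dom f0 measurableT mf.
apply: (eq_trans (esym rn)).
have mp := @measurable_normal_pdf R m s.
have mfR : measurable_fun [set: measurableTypeR R]
    (Radon_Nikodym_SigmaFinite.f (normal_prob m s) mu).
  by apply: measurable_int; exact: Radon_Nikodym_SigmaFinite.f_integrable.
apply: ge0_ae_eq_integral => //.
- exact: emeasurable_funM.
- by apply: emeasurable_funM => //; exact/measurable_EFinP.
- by move=> x _; rewrite mule_ge0// Radon_Nikodym_SigmaFinite.f_ge0.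
- by move=> x _; rewrite mule_ge0// lee_fin normal_pdf_ge0.
have : ae_eq mu [set: R] (Radon_Nikodym_SigmaFinite.f (normal_prob m s) mu)
    (fun x => (normal_pdf m s x)%:E).
  apply: integral_ae_eq => //.
  - exact: Radon_Nikodym_SigmaFinite.f_integrable.
  - exact/measurable_EFinP.
  - by move=> E _ mE; rewrite -Radon_Nikodym_SigmaFinite.f_integral.
by apply: filterS => x /= ->.
Qed.

Lemma gauss_density (f : R -> \bar R) :
  measurable_fun [set: measurableTypeR R] f -> (forall x, (0 <= f x)%E) ->
  (\int[gauss]_x f x = \int[mu]_x (f x * (normal_pdf 0 1 x)%:E))%E.
Proof. exact: normal_density. Qed.

Lemma gauss_density_fin f : measurable_fun [set: measurableTypeR R] f ->
  (forall x, 0 <= f x) ->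
  (\int[gauss]_x (f x)%:E = \int[mu]_x (f x * normal_pdf 0 1 x)%:E)%E.
Proof.
move=> mf f0; apply: (eq_trans (gauss_density _ _)).
- exact/measurable_EFinP.
- by move=> x; rewrite lee_fin.
- by apply: eq_integral => x _; rewrite EFinM.
Qed.

Lemma normal_peakE s : 0 < s -> normal_peak s = s^-1 * normal_peak 1.
Proof.
move=> s0; rewrite /normal_peak expr1n mul1r -mulrnAr sqrtrM ?sqr_ge0//.
by rewrite sqrtr_sqr gtr0_norm// invfM.
Qed.

Lemma normal_pdfE' m s x : 0 < s ->
  normal_pdf m s x = s^-1 * normal_peak 1 * expR (- (x - m) ^+ 2 / (s ^+ 2 *+ 2)).
Proof. by move=> s0; rewrite normal_pdfE ?gt_eqF// normal_peakE. Qed.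

Lemma gauss_affine m s h : 0 < s -> continuous h -> (forall x, 0 <= h x) ->
  (\int[gauss]_z (h (m + s * z))%:E =
   \int[mu]_x (h x * normal_pdf m s x)%:E)%E.
Proof.
move=> s0 ch h0.
have ca : continuous (fun z : R => m + s * z).
  move=> z; apply: cvgD; first exact: cvg_cst.
  by apply: cvgM; [exact: cvg_cst|exact: cvg_id].
have ch' : continuous (fun z => h (m + s * z)).
  by move=> z; apply: continuous_comp; [exact: ca|exact: ch].
apply: (eq_trans (gauss_density_fin (cont_meas ch') (fun=> h0 _))).
pose F (u : R) : R := (u - m) / s.
have dF u : is_derive u (1 : R) F s^-1.
  rewrite /F; apply: is_derive_eq.
  by rewrite /GRing.scale/= mulr0 add0r subr0 mulr1.
have F'E : derive1 F = cst s^-1.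
  by apply/funext => u; rewrite derive1E derive_val.
have dF' u : derivable F u 1 by [].
apply: (eq_trans (@increasing_ge0_integration_by_substitutionT _ F
  (fun z => h (m + s * z) * normal_pdf 0 1 z) _ _ _ _ dF' _ _ _ _)).
- by move=> u v uv; rewrite /F ltr_pM2r ?invr_gt0// ltrD2r.
- by rewrite F'E => u; exact: cvg_cst.
- by rewrite F'E; exact: is_cvg_cst.
- by rewrite F'E; exact: is_cvg_cst.
- by apply/gt0_cvgMlNy; [rewrite invr_gt0|exact: cvg_addrr_Ny].
- by apply/gt0_cvgMly; [rewrite invr_gt0|exact: cvg_addrr].
- move=> z; apply: cvgM; first exact: ch'.
  by apply: continuous_normal_pdf; exact: oner_neq0.
- by move=> z; rewrite mulr_ge0// normal_pdf_ge0.
- apply: eq_integral => u _ /=; congr EFin.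
  rewrite F'E /= !fctE /cst.
  rewrite !normal_pdfE'// /F subr0 invr1 mul1r expr1n.
  rewrite (mulrC (u - m)) mulVKf ?gt_eqF// subrKC -!mulrA; congr (_ * _).
  rewrite [RHS]mulrC -!mulrA; congr (_ * _).
  rewrite mulrC; congr (_ * _); congr expR.
  by rewrite -mulr_natr; field; rewrite gt_eqF.
Qed.

(** Cameron-Martin formula: e^{z dl - dl^2/2} is the density of N(dl, 1) with respect to N(0, 1). A
    translation of h is thus traded for a smooth weight, and h itself need not be differentiated. *)
Lemma gauss_shift dl h : continuous h -> (forall x, 0 <= h x) ->
  (\int[gauss]_z (h (z + dl))%:E =
   \int[gauss]_z (h z * expR (z * dl - dl ^+ 2 / 2))%:E)%E.
Proof.
move=> ch h0.
apply: (@eq_trans _ _ (\int[gauss]_z (h (dl + 1 * z))%:E)%E).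
  by apply: eq_integral => z _; rewrite [in RHS]mul1r [in RHS]addrC.
apply: (eq_trans (gauss_affine dl ltr01 ch h0)).
have mk : measurable_fun [set: measurableTypeR R]
    (fun z : R => h z * expR (z * dl - dl ^+ 2 / 2)).
  apply: measurable_funM; first exact: cont_meas.
  apply: measurableT_comp => //; apply: measurable_funB => //.
  by apply: measurable_funM.
apply/esym/(eq_trans (gauss_density_fin mk _)).
  by move=> z; rewrite mulr_ge0// expR_ge0.
apply/esym.
apply: eq_integral => z _; congr EFin.
rewrite !normal_pdfE'// -[RHS]mulrA; congr (_ * _).
rewrite [RHS]mulrCA -expRD; congr (_ * expR _).
by rewrite subr0 -mulr_natr; field.
Qed.

(** Completion of the square in w. If u = x + s w + t z with w, z independent standard normal, then
    u has variance q = s^2 + t^2, and given u the variable w has mean s (u - x) / q and variance t^2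
    / q. *)
Lemma gauss_exponent (u w x s t q : R) : q != 0 -> t != 0 -> q = s ^+ 2 + t ^+ 2 ->
  - (u - x) ^+ 2 / (q *+ 2) + - (w - s * (u - x) / q) ^+ 2 / (t ^+ 2 / q *+ 2) =
  - (u - (x + s * w)) ^+ 2 / (t ^+ 2 *+ 2) + - (w - 0) ^+ 2 / (1 ^+ 2 *+ 2).
Proof.
move=> q0 t0 e.
have -> : q *+ 2 = 2 * q by rewrite mulr_natl.
have -> : t ^+ 2 *+ 2 = 2 * t ^+ 2 by rewrite mulr_natl.
have -> : t ^+ 2 / q *+ 2 = 2 * (t ^+ 2 / q) by rewrite mulr_natl.
rewrite expr1n subr0.
have -> : x = u - (u - x) by rewrite subKr.
move: (u - x) => v; rewrite subKr.
have -> : - (w - s * v / q) ^+ 2 / (2 * (t ^+ 2 / q)) =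
    - (w ^+ 2 * q - 2 * w * s * v + s ^+ 2 * v ^+ 2 / q) / (2 * t ^+ 2) by field; rewrite q0 t0.
have -> : - v ^+ 2 / (2 * q) = - (t ^+ 2 * v ^+ 2 / q) / (2 * t ^+ 2) by field; rewrite q0 t0.
have -> : s ^+ 2 * v ^+ 2 / q = v ^+ 2 - t ^+ 2 * v ^+ 2 / q.
  by rewrite (_ : s ^+ 2 = q - t ^+ 2); [field|rewrite e addrK].
transitivity (- (w ^+ 2 * q - 2 * w * s * v + v ^+ 2) / (2 * t ^+ 2)).
  by field; rewrite q0 t0.
by rewrite e; field.
Qed.

(** After Tonelli's theorem the inner integral is over w at fixed u. There the joint density factors
    into the N(x, s^2 + t^2) density of u and the conditional density of w, whose integral is 1. *)
Lemma gauss_convolution x s t h : 0 < s -> 0 < t -> continuous h ->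
  (forall x, 0 <= h x) ->
  (\int[gauss]_w \int[gauss]_z (h (x + s * w + t * z))%:E =
   \int[gauss]_z (h (x + Num.sqrt (s ^+ 2 + t ^+ 2) * z))%:E)%E.
Proof.
move=> s0 t0 ch h0.
set r := Num.sqrt _.
have r20 : 0 < s ^+ 2 + t ^+ 2 by rewrite addr_gt0// exprn_gt0.
have r0 : 0 < r by rewrite sqrtr_gt0.
have r2 : r ^+ 2 = s ^+ 2 + t ^+ 2 by rewrite sqr_sqrtr// ltW.
have mh := cont_meas ch.
pose k (w u : R) := h u * normal_pdf (x + s * w) t u * normal_pdf 0 1 w.
have k0 w u : 0 <= k w u by rewrite !mulr_ge0// normal_pdf_ge0.
have mpair0 : measurable_fun [set: measurableTypeR R * measurableTypeR R]
    (fun wu => h wu.2 * normal_pdf (x + s * wu.1) t wu.2).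
  apply: measurable_funM; first exact: (measurableT_comp mh measurable_snd).
  under eq_fun do rewrite normal_pdfE'//.
  apply: measurable_funM => //; apply: measurableT_comp => //.
  apply: measurable_funM => //; apply: measurableT_comp => //.
  apply: measurable_funX; apply: measurable_funB => //.
  by apply: measurable_funD => //; apply: measurable_funM.
have mpair : measurable_fun [set: measurableTypeR R * measurableTypeR R]
    (fun wu => (k wu.1 wu.2)%:E).
  apply/measurable_EFinP; apply: measurable_funM => //.
  exact: (measurableT_comp (measurable_normal_pdf 0 1) measurable_fst).
have mF (w : R) : measurable_fun [set: measurableTypeR R]
    (fun u => (h u * normal_pdf (x + s * w) t u)%:E).
  by apply/measurable_EFinP/measurable_funM => //; exact: measurable_normal_pdf.
transitivity (\int[gauss]_w \int[mu]_u (h u * normal_pdf (x + s * w) t u)%:E)%E.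
  by apply: eq_integral => w _; exact: gauss_affine.
transitivity (\int[mu]_w \int[mu]_u (k w u)%:E)%E.
  apply: (eq_trans (gauss_density _ _)).
  - apply: (@measurable_fun_fubini_tonelli_F _ _ _ _ R mu
      (fun wu => (h wu.2 * normal_pdf (x + s * wu.1) t wu.2)%:E)).
    + exact/measurable_EFinP.
    + by move=> wu; rewrite lee_fin mulr_ge0// normal_pdf_ge0.
  - by move=> w; apply: integral_ge0 => u _; rewrite lee_fin mulr_ge0// normal_pdf_ge0.
  - apply: eq_integral => w _; rewrite -ge0_integralZr//.
    + by move=> u _; rewrite lee_fin mulr_ge0// normal_pdf_ge0.
    + by rewrite lee_fin normal_pdf_ge0.
transitivity (\int[mu]_u \int[mu]_w (k w u)%:E)%E.
  apply: (@fubini_tonelli _ _ _ _ _ mu mu (fun wu => (k wu.1 wu.2)%:E)) => //.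
  by move=> wu; rewrite lee_fin.
apply/esym/(eq_trans (gauss_affine x r0 ch h0)).
apply: eq_integral => u _.
pose m' := s * (u - x) / r ^+ 2.
transitivity (\int[mu]_w ((h u * normal_pdf x r u)%:E * (normal_pdf m' (t / r) w)%:E))%E.
  rewrite ge0_integralZl//=.
  - by rewrite integral_normal_pdf mule1.
  - by apply/measurable_EFinP; exact: measurable_normal_pdf.
  - by move=> w _; rewrite lee_fin normal_pdf_ge0.
  - by rewrite lee_fin mulr_ge0// normal_pdf_ge0.
apply: eq_integral => w _; rewrite -EFinM; congr EFin.
rewrite /k -!mulrA; congr (_ * _).
rewrite !normal_pdfE' ?divr_gt0// invr1 mul1r.
rewrite mulrACA [RHS]mulrACA -!expRD; congr (_ * expR _).
  by rewrite invf_div; field; rewrite !gt_eqF.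
by rewrite /m' expr_div_n -(@gauss_exponent u w x s t (r ^+ 2)) ?gt_eqF// exprn_gt0.
Qed.

End gaussian.

(** * Functions of exponential growth under the Gaussian law *)

Section gaussian_expectation.
Context (R : realType).
Notation gauss := (gauss R).
Implicit Types (f h : R -> R) (c m s t x y dl : R).

(** Exponential growth is allowed because translations produce the weights e^{z dl}. The class is
    stable under sums, products and affine substitutions and consists of Gaussian-integrable
    functions, so that integrability never has to be proved again for a particular expression. *)
Definition egrowth h := continuous h /\ exists K c,
  [/\ 0 <= K, 0 <= c & forall x, `|h x| <= K * expR (c * `|x|)].

(** The shift formula for the constant function 1 gives E e^{e N - e^2/2} = 1; then e^{c |z|} <=
    e^{c z} + e^{- c z}. *)
Lemma L1_expR c : L1 gauss (fun z => expR (c * `|z|)).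
Proof.
have h e : L1 gauss (fun z => expR (z * e - e ^+ 2 / 2)).
  apply: L1_ge0 => [|x|]; last 2 first.
  - exact: expR_ge0.
  - have := gauss_shift e (@cst_continuous _ R (1 : R)) (fun=> ler01).
    rewrite (_ : (\int[gauss]__ 1)%E = 1%E); last first.
      by rewrite integral_cst// mul1e; exact: probability_setT.
    by under eq_integral do rewrite mul1r; move=> <-; rewrite ltry.
  - apply: measurableT_comp => //; apply: measurable_funB => //.
    by apply: measurable_funM.
have h2 := L1D (L1Z (expR (c ^+ 2 / 2)) (h c)) (L1Z (expR (c ^+ 2 / 2)) (h (- c))).
apply: (L1_dom _ h2) => [|z].
  by apply: measurableT_comp => //; apply: measurable_funM.
rewrite ger0_norm ?expR_ge0// sqrrN -!expRD !subrKC mulrN (mulrC z).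
by case: (ger0P z) => z0; rewrite ?mulrN ?lerDl ?lerDr expR_ge0.
Qed.

Lemma egrowth_L1 h : egrowth h -> L1 gauss h.
Proof.
case=> ch [K [c [K0 c0 hK]]].
exact: (L1_dom (cont_meas ch) (L1Z K (L1_expR c)) hK).
Qed.

Lemma egrowth_le h f K : continuous f -> egrowth h -> 0 <= K ->
  (forall x, `|f x| <= K * `|h x|) -> egrowth f.
Proof.
move=> cf [_ [L [c [L0 c0 hL]]]] K0 fh; split => //; exists (K * L), c.
split=> [||x]; [exact: mulr_ge0|by []|].
by rewrite (le_trans (fh x))// -mulrA ler_wpM2l.
Qed.

Lemma egrowth_cst c : egrowth (fun=> c).
Proof.
split; first by move=> x; exact: cvg_cst.
exists `|c|, 0; split => // x.
by rewrite mul0r expR0 mulr1.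
Qed.

Lemma egrowthD f h : egrowth f -> egrowth h -> egrowth (fun x => f x + h x).
Proof.
move=> [cf [K [c [K0 c0 fK]]]] [ch [L [e [L0 e0 hL]]]]; split.
  by move=> x; apply: cvgD; [exact: cf|exact: ch].
exists (K + L), (c + e); split => [||x]; [exact: addr_ge0..|].
rewrite (le_trans (ler_normD _ _))// mulrDl lerD//.
  by rewrite (le_trans (fK x))// ler_wpM2l// ler_expR ler_wpM2r// lerDl.
by rewrite (le_trans (hL x))// ler_wpM2l// ler_expR ler_wpM2r// lerDr.
Qed.

Lemma egrowthM f h : egrowth f -> egrowth h -> egrowth (fun x => f x * h x).
Proof.
move=> [cf [K [c [K0 c0 fK]]]] [ch [L [e [L0 e0 hL]]]]; split.
  by move=> x; apply: cvgM; [exact: cf|exact: ch].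
exists (K * L), (c + e); split => [||x]; [exact: mulr_ge0|exact: addr_ge0|].
by rewrite normrM mulrDl expRD mulrACA ler_pM.
Qed.

Lemma egrowthN f : egrowth f -> egrowth (fun x => - f x).
Proof.
move=> ef; apply: (egrowth_le _ ef ler01) => x; last by rewrite normrN mul1r.
by apply: cvgN; exact: ef.1.
Qed.

Lemma egrowthB f h : egrowth f -> egrowth h -> egrowth (fun x => f x - h x).
Proof. by move=> ef /egrowthN; exact: egrowthD. Qed.

Lemma egrowth_abs f : egrowth f -> egrowth (fun x => `|f x|).
Proof.
move=> ef; apply: (egrowth_le _ ef ler01) => x; last by rewrite normr_id mul1r.
by apply: cvg_norm; exact: ef.1.
Qed.

Lemma egrowth_expR c : 0 <= c -> egrowth (fun x => expR (c * `|x|)).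
Proof.
move=> c0; split; last first.
  by exists 1, c; split => // x; rewrite mul1r ger0_norm ?expR_ge0.
move=> x; apply: (@continuous_comp _ _ _ (fun x => c * `|x|) expR); last exact: continuous_expR.
by apply: cvgM; [exact: cvg_cst|exact: norm_continuous].
Qed.

Lemma egrowth_id : egrowth (fun x : R => x).
Proof.
apply: (egrowth_le _ (egrowth_expR ler01) ler01) => x; first exact: cvg_id.
rewrite !mul1r (ger0_norm (expR_ge0 _)) (le_trans _ (expR_ge1Dx _))//.
by rewrite lerDr.
Qed.

Lemma egrowth_exp n : egrowth (fun x : R => x ^+ n).
Proof.
elim: n => [|n ih]; first exact: egrowth_cst.
under eq_fun do rewrite exprS; exact: egrowthM egrowth_id ih.
Qed.

Lemma egrowth_affine h m s : egrowth h -> egrowth (fun x => h (m + s * x)).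
Proof.
move=> [ch [K [c [K0 c0 hK]]]]; split.
  move=> x; apply: (@continuous_comp _ _ _ (fun x => m + s * x) h); last exact: ch.
  apply: cvgD; first exact: cvg_cst.
  by apply: cvgM; [exact: cvg_cst|exact: cvg_id].
exists (K * expR (c * `|m|)), (c * `|s|); split; rewrite ?mulr_ge0 ?expR_ge0// => x.
rewrite (le_trans (hK _))// -mulrA ler_wpM2l// -expRD ler_expR -mulrA -mulrDr.
by rewrite ler_wpM2l// (le_trans (ler_normD _ _))// normrM.
Qed.

Lemma egrowth_expRlin a c : egrowth (fun x => expR (x * a - c)).
Proof.
apply: (@egrowth_le (fun x => expR (`|a| * `|x|)) _ (expR `|c|)).
- move=> x; apply: (@continuous_comp _ _ _ (fun x => x * a - c) expR); last exact: continuous_expR.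
  apply: cvgB; last exact: cvg_cst.
  by apply: cvgM; [exact: cvg_id|exact: cvg_cst].
- exact: egrowth_expR.
- exact: expR_ge0.
- move=> x; rewrite !(ger0_norm (expR_ge0 _)) -expRD ler_expR addrC lerD//; last first.
    by rewrite mulrC -normrM ler_norm.
  by rewrite -normrN ler_norm.
Qed.

(** The shift and convolution formulas are established for nonnegative continuous functions. The
    halves of |h| + h and |h| - h extend them by linearity and stay inside the class. *)
Lemma egrowth_split h : egrowth h -> exists hp hn,
  [/\ egrowth hp, egrowth hn, forall x, 0 <= hp x, forall x, 0 <= hn x &
      forall x, h x = hp x - hn x].
Proof.
move=> eh; exists (fun x => 2^-1 * (`|h x| + h x)), (fun x => 2^-1 * (`|h x| - h x)).
split=> [||x|x|x].
- by apply: egrowthM; [exact: egrowth_cst|apply: egrowthD => //; exact: egrowth_abs].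
- by apply: egrowthM; [exact: egrowth_cst|apply: egrowthB => //; exact: egrowth_abs].
- by rewrite mulr_ge0// -lerBlDr sub0r -normrN ler_norm.
- by rewrite mulr_ge0// subr_ge0 ler_norm.
- by field.
Qed.

Lemma ENB f h : egrowth f -> egrowth h -> EN (fun x => f x - h x) = EN f - EN h.
Proof. by move=> /egrowth_L1 f1 /egrowth_L1 h1; exact: ExB. Qed.

Lemma EN_shift dl h : egrowth h ->
  EN (fun z => h (z + dl)) = EN (fun z => h z * expR (z * dl - dl ^+ 2 / 2)).
Proof.
move=> /egrowth_split[hp [hn [ep en p0 n0 e]]].
have ee := egrowth_expRlin dl (dl ^+ 2 / 2).
have E k : egrowth k -> (forall x, 0 <= k x) ->
    EN (fun z => k (z + dl)) = EN (fun z => k z * expR (z * dl - dl ^+ 2 / 2)).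
  by move=> ek k0; rewrite /EN /Ex /Rintegral gauss_shift//; exact: ek.1.
have es k : egrowth k -> egrowth (fun z => k (z + dl)).
  by move=> /(egrowth_affine dl 1); under eq_fun do rewrite mul1r addrC.
transitivity (EN (fun z => hp (z + dl) - hn (z + dl))).
  by apply: eq_Ex => z; rewrite e.
rewrite ENB ?E//; [|exact: es..].
rewrite -ENB; [|exact: egrowthM..].
by apply: eq_Ex => z; rewrite e mulrBl.
Qed.

Lemma EN_conv x s t h : 0 < s -> 0 < t -> egrowth h ->
  EN (fun w => EN (fun z => h (x + s * w + t * z))) =
  EN (fun z => h (x + Num.sqrt (s ^+ 2 + t ^+ 2) * z)).
Proof.
move=> s0 t0 /egrowth_split[hp [hn [ep en p0 n0 e]]].
have E k : egrowth k -> (forall x, 0 <= k x) ->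
    L1 gauss (fun w => EN (fun z => k (x + s * w + t * z))) /\
    EN (fun w => EN (fun z => k (x + s * w + t * z))) =
    EN (fun z => k (x + Num.sqrt (s ^+ 2 + t ^+ 2) * z)).
  move=> ek k0.
  have Ei w : (EN (fun z => k (x + s * w + t * z)))%:E =
      (\int[gauss]_z (k (x + s * w + t * z))%:E)%E.
    by rewrite EFin_Ex//; apply/egrowth_L1/egrowth_affine.
  have Eo := gauss_convolution x s0 t0 ek.1 k0.
  split; last first.
    rewrite /EN {1 3}/Ex /Rintegral -Eo; congr fine.
    by apply: eq_integral => w _; exact: Ei.
  apply: L1_ge0 => [|w|].
  - apply/measurable_EFinP.
    apply: (eq_measurable_fun (fun w => (\int[gauss]_z (k (x + s * w + t * z))%:E)%E)).
      by move=> w _; rewrite /= Ei.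
    apply: (@measurable_fun_fubini_tonelli_F _ _ _ _ R gauss
      (fun wz => (k (x + s * wz.1 + t * wz.2))%:E)).
    + apply/measurable_EFinP; apply: (measurableT_comp (cont_meas ek.1)).
      by apply: measurable_funD; [apply: measurable_funD => //|]; apply: measurable_funM.
    + by move=> wz; rewrite lee_fin.
  - exact: Ex_ge0.
  - under eq_integral do rewrite Ei.
    rewrite Eo EFin_Ex ?ltry//.
    by apply/egrowth_L1/egrowth_affine.
have [lp Ep] := E _ ep p0; have [ln En] := E _ en n0.
transitivity (EN (fun w => EN (fun z => hp (x + s * w + t * z)) - EN (fun z => hn (x + s * w + t * z)))).
  apply: eq_Ex => w; rewrite -ENB; [|exact: egrowth_affine..].
  by apply: eq_Ex => z.
rewrite [LHS]ExB// -!/(EN _) Ep En -ENB; [|exact: egrowth_affine..].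
by apply: eq_Ex => z.
Qed.

End gaussian_expectation.

(** * Gaussian moments up to order four *)

Section moments.
Context (R : realType).
Implicit Types (f h : R -> R) (c m s t x y z dl w : R).

(** Since (n + k)! >= k!, the tail of the series is bounded by |w|^n times the whole series at
    |w|. *)
Lemma expR_taylor n w :
  `|expR w - \sum_(0 <= k < n) w ^+ k / k`!%:R| <= `|w| ^+ n * expR `|w|.
Proof.
have cw := @is_cvg_series_exp_coeff R w.
have cN := @is_cvg_series_exp_coeff R `|w|.
have le1 N : series (exp_coeff `|w|) N <= expR `|w|.
  apply: nondecreasing_cvgn_le => //; apply: nondecreasing_series => k _ _.
  by rewrite /exp_coeff/= divr_ge0// exprn_ge0.
have bnd N : (n <= N)%N ->
    `|series (exp_coeff w) N - \sum_(0 <= k < n) w ^+ k / k`!%:R| <= `|w| ^+ n * expR `|w|.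
  move=> nN; rewrite [series _ _](_ : _ = \sum_(0 <= k < N) w ^+ k / k`!%:R)//.
  rewrite (@big_cat_nat _ _ _ n)//= addrAC subrr add0r.
  rewrite (le_trans (ler_norm_sum _ _ _))//.
  rewrite (@le_trans _ _ (`|w| ^+ n * series (exp_coeff `|w|) (N - n)%N))//; last first.
    by rewrite ler_wpM2l// exprn_ge0.
  rewrite -{1}[n]add0n big_addn /series/= mulr_sumr; apply: ler_sum => k _.
  rewrite normrM normrX addnC exprD -mulrA ler_wpM2l ?exprn_ge0//.
  rewrite /exp_coeff/= ler_wpM2l ?exprn_ge0// ger0_norm ?invr_ge0//.
  by rewrite lef_pV2 ?posrE ?ltr0n ?fact_gt0// ler_nat leq_fact// leq_addl.
have cc : `|series (exp_coeff w) N - \sum_(0 <= k < n) w ^+ k / k`!%:R| @[N --> \oo]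
   --> `|expR w - \sum_(0 <= k < n) w ^+ k / k`!%:R|.
  by apply: cvg_norm; apply: cvgB; [exact: cw|exact: cvg_cst].
rewrite -(cvg_lim _ cc)//; apply: limr_le; first exact: cvgP cc.
by exists n.
Qed.

Lemma poly_small_eq0 n (a : nat -> R) C :
  (forall dl, 0 < dl <= 1 ->
    `|\sum_(0 <= k < n) a k * dl ^+ k| <= C * dl ^+ n) ->
  forall k, (k < n)%N -> a k = 0.
Proof.
elim: n a => [//|n ih] a h.
pose B := `|C| + \sum_(0 <= k < n) `|a k.+1|.
have B0 : 0 <= B by rewrite addr_ge0// sumr_ge0.
have S dl : \sum_(0 <= k < n.+1) a k * dl ^+ k =
    a 0%N + dl * \sum_(0 <= k < n) a k.+1 * dl ^+ k.
  rewrite big_nat_recl// expr0 mulr1 mulr_sumr; congr (_ + _).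
  by apply: eq_bigr => i _; rewrite exprS mulrCA.
have a0 : a 0%N = 0.
  apply/eqP; rewrite -normr_le0 leNgt; apply/negP => a0.
  pose dl := Num.min 1 (`|a 0%N| / (2 * (B + 1))).
  have B1 : 0 < 2 * (B + 1) by rewrite mulr_gt0// ltr_wpDl.
  have d0 : 0 < dl by rewrite lt_min ltr01 divr_gt0.
  have d1 : dl <= 1 by rewrite ge_min lexx.
  have dB : dl * B <= `|a 0%N| / 2.
    rewrite (@le_trans _ _ (`|a 0%N| / (2 * (B + 1)) * (B + 1)))//.
      by apply: ler_pM => //; [exact: ltW|rewrite ge_min lexx orbT|rewrite lerDl].
    by rewrite invfM mulrA mulfVK// gt_eqF// ltr_wpDl.
  have := h dl; rewrite d0 d1 S => /(_ erefl) hd.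
  have d01 k : dl ^+ k <= 1 by rewrite exprn_ile1// ltW.
  have : `|a 0%N| <= dl * B.
    have -> : a 0%N = (a 0%N + dl * \sum_(0 <= k < n) a k.+1 * dl ^+ k) -
       dl * \sum_(0 <= k < n) a k.+1 * dl ^+ k by rewrite addrK.
    rewrite (le_trans (ler_normB _ _))// mulrDr lerD//.
      rewrite (le_trans hd)// exprS mulrCA ler_wpM2l ?(ltW d0)//.
      by rewrite (le_trans (ler_norm _))// normrM ler_piMr// ger0_norm ?exprn_ge0// ltW.
    rewrite normrM ger0_norm ?(ltW d0)// ler_wpM2l ?(ltW d0)//.
    rewrite (le_trans (ler_norm_sum _ _ _))//; apply: ler_sum => k _.
    by rewrite normrM ler_piMr// ger0_norm ?exprn_ge0// ltW.
  by move: dB a0; lra.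
case=> [//|k]; rewrite ltnS => kn.
apply: (ih (fun k => a k.+1)) => // dl /[dup] /andP[d0 _] /h.
rewrite S a0 add0r normrM (gtr0_norm d0) exprS mulrCA.
by rewrite ler_pM2l.
Qed.

Lemma EN_abs_le f h : egrowth f -> egrowth h -> (forall x, `|f x| <= h x) -> `|EN f| <= EN h.
Proof. by move=> /egrowth_L1 f1 /egrowth_L1 h1; exact: (abs_Ex_le (L1_measurable f1) h1). Qed.

Lemma EN_mgf dl : EN (fun z => expR (z * dl)) = expR (dl ^+ 2 / 2).
Proof.
have := EN_shift dl (egrowth_cst (1 : R)).
rewrite [LHS]Ex_cst => e.
have -> : (fun z => expR (z * dl)) = (fun z => expR (dl ^+ 2 / 2) *
    (1 * expR (z * dl - dl ^+ 2 / 2))).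
  by apply/funext => z; rewrite mul1r -expRD subrKC.
rewrite [LHS]ExZ; last by apply: egrowth_L1; apply: egrowthM; [exact: egrowth_cst|exact: egrowth_expRlin].
by rewrite -/(EN _) -e mulr1.
Qed.

Lemma egrowthZ c f : egrowth f -> egrowth (fun x => c * f x).
Proof. by move=> ef; apply: egrowthM => //; exact: egrowth_cst. Qed.

(** The moments are read off from E e^{dl N} = e^{dl^2/2}: both sides have an expansion at dl = 0 up
    to O(dl^5), and the coefficients must agree by [poly_small_eq0]. *)
Lemma EN_moments : [/\ EN (fun z : R => z) = 0, EN (fun z : R => z ^+ 2) = 1,
  EN (fun z : R => z ^+ 3) = 0 & EN (fun z : R => z ^+ 4) = 3].
Proof.
(* The coefficients of e^{dl^2/2} up to degree 4. *)
pose b (k : nat) : R := match k with 0 => 1 | 2 => 2^-1 | 4 => 8^-1 | _ => 0 end.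
pose a k := EN (fun z => z ^+ k) / k`!%:R - b k.
pose C := EN (fun z => `|z| ^+ 5 * expR (1 * `|z|)) + expR 1.
have egA : egrowth (fun z : R => `|z| ^+ 5 * expR (1 * `|z|)).
  apply: egrowthM; last exact: egrowth_expR.
  by have := egrowth_abs (@egrowth_exp R 5); under eq_fun do rewrite normrX.
have key dl : 0 < dl <= 1 -> `|\sum_(0 <= k < 5) a k * dl ^+ k| <= C * dl ^+ 5.
  move=> /andP[d0 d1].
  have es k : egrowth (fun z => (z * dl) ^+ k / k`!%:R).
    have := egrowthZ (dl ^+ k / k`!%:R) (@egrowth_exp R k).
    by under eq_fun do rewrite mulrC mulrA -exprMn.
  have e0 : egrowth (fun z => expR (z * dl)).
    by have := @egrowth_expRlin R dl 0; under eq_fun do rewrite subr0.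
  have iS := L1_sum (index_iota 0 5) (fun k => egrowth_L1 (es k)).
  have e1 : EN (fun z => expR (z * dl) - \sum_(0 <= k < 5) (z * dl) ^+ k / k`!%:R) =
      expR (dl ^+ 2 / 2) - \sum_(0 <= k < 5) EN (fun z => z ^+ k) / k`!%:R * dl ^+ k.
    rewrite [LHS]ExB//; last exact: egrowth_L1.
    rewrite -/(EN _) EN_mgf; congr (_ - _).
    rewrite Ex_sum => [|k]; last exact/egrowth_L1.
    apply: eq_bigr => k _; rewrite mulrAC -[RHS]mulrA mulrC.
    rewrite -[in RHS]ExZ; last exact/egrowth_L1/egrowth_exp.
    by apply: eq_Ex => z; rewrite exprMn; ring.
  have h1 : `|expR (dl ^+ 2 / 2) - \sum_(0 <= k < 5) EN (fun z => z ^+ k) / k`!%:R * dl ^+ k|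
      <= EN (fun z => `|z| ^+ 5 * expR (1 * `|z|)) * dl ^+ 5.
    rewrite -e1 mulrC -[leRHS]ExZ; last exact/egrowth_L1.
    apply: abs_Ex_le; [|exact/L1Z/egrowth_L1|].
      exact: (L1_measurable (L1B (egrowth_L1 e0) iS)).
    move=> z; rewrite (le_trans (expR_taylor 5 _))// normrM exprMn (gtr0_norm d0).
    rewrite mulrAC mulrC; rewrite ler_wpM2l ?exprn_ge0 ?(ltW d0)//.
    rewrite ler_wpM2l ?exprn_ge0// ler_expR mul1r ler_piMr//.
  have h2 : `|expR (dl ^+ 2 / 2) - \sum_(0 <= k < 5) b k * dl ^+ k| <= expR 1 * dl ^+ 5.
    have d2 : dl ^+ 2 <= 1 by rewrite exprn_ile1// ltW.
    have d20 : 0 <= dl ^+ 2 by exact: sqr_ge0.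
    have -> : \sum_(0 <= k < 5) b k * dl ^+ k = \sum_(0 <= k < 3) (dl ^+ 2 / 2) ^+ k / k`!%:R.
      by rewrite unlock /= /reducebig/= !factS fact0; field.
    rewrite (le_trans (expR_taylor 3 _))// ger0_norm ?divr_ge0// mulrC.
    apply: ler_pM; rewrite ?expR_ge0 ?exprn_ge0 ?divr_ge0//.
      by rewrite ler_expR; lra.
    have -> : (dl ^+ 2 / 2) ^+ 3 = dl ^+ 5 * (dl / 8) by field.
    by rewrite ler_piMr ?exprn_ge0 ?(ltW d0)//; lra.
  have -> : \sum_(0 <= k < 5) a k * dl ^+ k =
     (expR (dl ^+ 2 / 2) - \sum_(0 <= k < 5) b k * dl ^+ k) -
     (expR (dl ^+ 2 / 2) - \sum_(0 <= k < 5) EN (fun z => z ^+ k) / k`!%:R * dl ^+ k).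
    rewrite opprB [RHS]addrC addrA subrK -sumrB.
    by apply: eq_bigr => k _; rewrite /a mulrBl.
  by rewrite (le_trans (ler_normB _ _))// mulrDl addrC lerD.
have := poly_small_eq0 key; rewrite /a => h.
split.
- by move: (h 1%N erefl); rewrite subr0 divr1.
- by move: (h 2%N erefl) => /=; rewrite !factS fact0; lra.
- by move: (h 3%N erefl) => /=; rewrite subr0 => /eqP; rewrite mulf_eq0 invr_eq0 pnatr_eq0 orbF => /eqP.
- by move: (h 4%N erefl) => /=; rewrite !factS fact0; lra.
Qed.

End moments.

(** * Regularity and uniqueness deduced from Taylor estimates *)

Section continuity.
Context (R : realType).
Implicit Types (f h : R -> R) (c m s t x y z dl w r : R).

Lemma locally_lipschitz_continuous (g : R -> R) :
  (forall x, exists B, forall y, `|y| <= 1 -> `|g (x + y) - g x| <= B * `|y|) ->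
  continuous g.
Proof.
move=> h x; have [B hB] := h x; apply/cvgrPdist_le => e e0.
have B0 : 0 < `|B| + 1 by rewrite ltr_wpDl.
exists (Num.min 1 (e / (`|B| + 1))) => /=; first by rewrite lt_min ltr01 divr_gt0.
move=> y /= /ltW; rewrite le_min distrC => /andP[y1 ye].
have := hB (y - x) y1; rewrite subrKC distrC => /le_trans; apply.
rewrite (@le_trans _ _ ((`|B| + 1) * `|y - x|))//.
  by rewrite ler_wpM2r// (le_trans (ler_norm _))// lerDl.
by rewrite mulrC -ler_pdivlMr.
Qed.

(** With a cubic remainder, the differences of [taylor2_coef] make [h2] Lipschitz; then [h1] and [h]
    are locally Lipschitz by their own expansions. Continuity of a smoothed function and of its
    derivatives is obtained in this way, without differentiating under the integral sign. *)
Lemma taylor2_continuous (h h1 h2 om : R -> R) C : 0 <= C ->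
  taylor2 h h1 h2 om -> (forall u v, 0 <= u -> u <= v -> om u <= om v) ->
  (forall y, 0 <= y -> om y <= C * y ^+ 3) ->
  [/\ continuous h, continuous h1 & continuous h2].
Proof.
move=> C0 ht om_nd omC.
have sq1 y : `|y| <= 1 -> `|y| ^+ 2 <= `|y|.
  by move=> y1; rewrite expr2 ler_piMr.
have cb y : `|y| <= 1 -> `|y| ^+ 3 <= `|y|.
  by move=> y1; rewrite exprS ler_piMr// exprn_ile1.
have om2 y : om (2 * `|y|) <= 8 * C * `|y| ^+ 3.
  by rewrite (le_trans (omC _ _))// ?mulr_ge0// exprMn; lra.
have H2 x y : `|h2 (x + y) - h2 x| <= 40 * C * `|y|.
  have [->|y0] := eqVneq y 0; first by rewrite addr0 subrr normr0 mulr0.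
  have [q _] := taylor2_coef ht om_nd x y.
  rewrite -(@ler_pM2r _ (y ^+ 2)) ?exprn_even_gt0// (le_trans q)//.
  have := om2 y; rewrite exprS real_normK ?num_real//; lra.
have H1 x y : `|h1 (x + y) - h1 x - h2 x * y| <= 16 * C * `|y| ^+ 2.
  have [->|y0] := eqVneq y 0.
    by rewrite addr0 subrr mulr0 subr0 normr0 expr0n mulr0.
  have [_ q] := taylor2_coef ht om_nd x y.
  rewrite -(@ler_pM2r _ `|y|) ?normr_gt0// (le_trans q)//.
  have := om2 y; rewrite exprSr; lra.
split; apply: locally_lipschitz_continuous => x.
- exists (`|h1 x| + `|h2 x| + C) => y y1.
  have := ht x y => /le_trans /(_ (omC _ (normr_ge0 _))) hy.
  have -> : h (x + y) - h x = (h (x + y) - h x - h1 x * y - h2 x * y ^+ 2 / 2)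
     + h1 x * y + h2 x / 2 * y ^+ 2 by ring.
  rewrite (le_trans (ler_normD _ _))// (le_trans (lerD (ler_normD _ _) (lexx _)))//.
  rewrite (normrM (h1 x)) (normrM (h2 x / 2)) (normrM (h2 x)) normrX.
  have a1 : C * `|y| ^+ 3 <= C * `|y| by rewrite ler_wpM2l// cb.
  have a2 : `|h2 x| * `|2^-1| * `|y| ^+ 2 <= `|h2 x| * `|y|.
    rewrite -mulrA ler_wpM2l// ger0_norm ?invr_ge0//.
    by have := sq1 _ y1; have := sqr_ge0 `|y|; lra.
  by lra.
- exists (`|h2 x| + 16 * C) => y y1.
  have -> : h1 (x + y) - h1 x = (h1 (x + y) - h1 x - h2 x * y) + h2 x * y by ring.
  rewrite (le_trans (ler_normD _ _))// normrM.
  have a1 : 16 * C * `|y| ^+ 2 <= 16 * C * `|y| by rewrite ler_wpM2l ?mulr_ge0// sq1.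
  by have := H1 x y; lra.
- by exists (40 * C) => y _.
Qed.

(** Adding the expansions at y and - y removes the first-order terms, and comparing the two sums
    gives |h2 x - k2 x| y^2 <= 4 C y^3 for every y > 0. *)
Lemma taylor2_unique (h h1 h2 k1 k2 om1 om2 : R -> R) C x : 0 <= C ->
  taylor2 h h1 h2 om1 -> taylor2 h k1 k2 om2 ->
  (forall y, 0 <= y -> om1 y <= C * y ^+ 3) ->
  (forall y, 0 <= y -> om2 y <= C * y ^+ 3) -> h2 x = k2 x.
Proof.
move=> C0 hh hk o1 o2.
have key y : 0 < y -> `|h2 x - k2 x| <= 4 * C * y.
  move=> y0.
  have := le_trans (hh x y) (o1 _ (normr_ge0 _)).
  have := le_trans (hh x (- y)) (o1 _ (normr_ge0 _)).
  have := le_trans (hk x y) (o2 _ (normr_ge0 _)).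
  have := le_trans (hk x (- y)) (o2 _ (normr_ge0 _)).
  rewrite normrN (gtr0_norm y0) !ler_norml sqrrN.
  move=> /andP[a1 a2] /andP[b1 b2] /andP[c1 c2] /andP[d1 d2].
  apply/andP; split; rewrite -(@ler_pM2r _ (y ^+ 2)) ?exprn_gt0//;
  rewrite !exprS expr0 in a1 a2 b1 b2 c1 c2 d1 d2 *; lra.
apply/eqP; rewrite -subr_eq0 -normr_le0 leNgt; apply/negP => n0.
have C1 : 0 < 4 * C + 1 by rewrite ltr_wpDl// mulr_ge0.
have := key (`|h2 x - k2 x| / (2 * (4 * C + 1))).
rewrite divr_gt0// ?mulr_gt0// => /(_ erefl).
rewrite leNgt => /negP; apply.
rewrite mulrA ltr_pdivrMr ?mulr_gt0// mulrC.
by rewrite ltr_pM2l//; lra.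
Qed.

Lemma powR_le_1D3 r x : 0 < r <= 3 -> 0 <= x -> x `^ r <= 1 + x ^+ 3.
Proof.
move=> /andP[r0 r3] x0; have [x1|x1] := leP x 1.
  rewrite (@le_trans _ _ 1)//; last by rewrite lerDl exprn_ge0.
  rewrite [leRHS](_ : 1 = 1 `^ r); last by rewrite powR1.
  by apply: ge0_ler_powR => //; rewrite ?nnegrE//; exact: ltW.
rewrite (@le_trans _ _ (x `^ 3%:R))//; first by apply: ler_powR => //; exact: ltW.
by rewrite powR_mulrn// lerDr.
Qed.

End continuity.

(** * Gaussian smoothing *)

Section modulus.
Context (R : realType).
Implicit Types (r s y : R).

(* Up to a constant, y^2 * gmod r s y bounds the second-order Taylor remainder of a function
   of Lambda_r convolved with N(0, s^2), see [U_taylor2]. *)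
Definition gmod r s y := s `^ (r - 2) * Num.min (y / s) ((y / s) `^ Num.max (r - 2) 0).

Lemma gmod_ge0 r s y : 0 <= s -> 0 <= y -> 0 <= gmod r s y.
Proof.
by move=> s0 y0; rewrite /gmod mulr_ge0 ?powR_ge0// le_min powR_ge0 divr_ge0.
Qed.

Lemma gmod_nd r s y y' : 0 <= s -> 0 <= y -> y <= y' -> gmod r s y <= gmod r s y'.
Proof.
move=> s0 y0 yy; rewrite /gmod ler_wpM2l ?powR_ge0//.
have h : y / s <= y' / s by rewrite ler_wpM2r ?invr_ge0.
rewrite le_min !ge_min h/=; apply/orP; right; apply: ge0_ler_powR => //.
- by rewrite le_max lexx orbT.
- by rewrite nnegrE divr_ge0.
- by rewrite nnegrE divr_ge0// (le_trans y0).
Qed.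

Lemma gmod_double r s y : r <= 3 -> 0 <= s -> 0 <= y ->
  gmod r s (2 * y) <= 2 * gmod r s y.
Proof.
move=> r3 s0 y0; rewrite /gmod mulrCA ler_wpM2l ?powR_ge0//.
have u0 : 0 <= y / s by rewrite divr_ge0.
rewrite -mulrA; move: (y / s) u0 => u u0.
rewrite minr_pMr// le_min !ge_min lexx/= powRM//.
apply/orP; right; rewrite ler_wpM2r ?powR_ge0//.
rewrite -[leRHS](powRr1 (ler0n R 2)); apply: ler_powR; first by rewrite ler1n.
by rewrite ge_max ler01 andbT; lra.
Qed.

Lemma gmod_lin r s y : 0 < s -> 0 <= y -> gmod r s y <= s `^ (r - 2) / s * y.
Proof.
move=> s0 y0; rewrite /gmod -mulrA ler_wpM2l ?powR_ge0// mulrC.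
by rewrite ge_min lexx.
Qed.

End modulus.

Section smoothing.
Context (R : realType).
Implicit Types (f h p : R -> R) (c m s t x y z dl w r : R).

(* With N standard normal, U s f x = E f(x + s N); V1 s f and V2 s f are its first and second
   derivatives in x, the Hermite weights N and N^2 - 1 coming from integration by parts. *)
Definition smooth p s f x := EN (fun z => f (x + s * z) * p z).
Definition U s f := smooth (fun=> 1) s f.
Definition V1 s f x := smooth (fun z => z) s f x / s.
Definition V2 s f x := smooth (fun z => z ^+ 2 - 1) s f x / s ^+ 2.

(* Second-order Taylor remainder in dl of the shifted density
   e^{z dl - dl^2/2}; it annihilates polynomials of degree at most 2. *)
Definition shift_kernel dl z :=
  expR (z * dl - dl ^+ 2 / 2) - 1 - z * dl - (z ^+ 2 - 1) * dl ^+ 2 / 2.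

Lemma egrowth_shift_kernel dl : egrowth (shift_kernel dl).
Proof.
apply: egrowthB; last first.
  have -> : (fun z => (z ^+ 2 - 1) * dl ^+ 2 / 2) =
      (fun z : R => (dl ^+ 2 / 2) * (z ^+ 2 - 1)) by apply/funext => z; ring.
  by apply: egrowthZ; apply: egrowthB; [exact: egrowth_exp|exact: egrowth_cst].
apply: egrowthB; last by under eq_fun do rewrite mulrC; apply: egrowthZ; exact: egrowth_id.
by apply: egrowthB; [exact: egrowth_expRlin|exact: egrowth_cst].
Qed.

Lemma shift_kernel_le dl z : `|dl| <= 1 ->
  `|shift_kernel dl z| <= 7 * `|dl| ^+ 3 * expR (2 * (`|z| + 1)).
Proof.
move=> d1; set w := z * dl - dl ^+ 2 / 2.
have z0 : 0 <= `|z| by [].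
have z1 : 1 <= `|z| + 1 by rewrite lerDr.
have d0 : 0 <= `|dl| by [].
have wd : `|w| <= `|dl| * (`|z| + 1).
  rewrite /w (le_trans (ler_normB _ _))// !normrM normfV (ger0_norm (ler0n _ 2)).
  have : `|dl| * `|dl| / 2 <= `|dl| by nra.
  by nra.
have wz : `|w| <= `|z| + 1 by rewrite (le_trans wd)// ler_piMl// ltW// (lt_le_trans ltr01).
(* With w = z dl - dl^2/2, the polynomial 1 + w + w^2/2 contains 1 + z dl + (z^2 - 1) dl^2/2
   together with the cubic and quartic terms - z dl^3/2 + dl^4/8. The two summands contribute 6 and
   1 to the constant 7. *)
have -> : shift_kernel dl z =
    (expR w - \sum_(0 <= k < 3) w ^+ k / k`!%:R) + dl ^+ 3 * (dl / 8 - z / 2).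
  by rewrite unlock /= /reducebig/= !factS fact0 /shift_kernel -/w /w; field.
have e1 : `|z| + 1 <= expR (`|z| + 1).
  by rewrite (le_trans _ (expR_ge1Dx _))// lerDr.
have e0 : 1 <= expR (`|z| + 1) by rewrite (le_trans z1).
have e3 : (`|z| + 1) ^+ 3 <= 6 * expR (`|z| + 1).
  have := @expR_ge1Dxn R (`|z| + 1) 2 (le_trans ler01 z1).
  by rewrite !factS fact0 /=; lra.
have e2 : expR (2 * (`|z| + 1)) = expR (`|z| + 1) ^+ 2 by rewrite -expRM_natl.
rewrite (le_trans (ler_normD _ _))// e2.
have b1 := expR_taylor 3 w.
have b2 : `|w| ^+ 3 * expR `|w| <= 6 * `|dl| ^+ 3 * expR (`|z| + 1) ^+ 2.
  rewrite (@le_trans _ _ ((`|dl| * (`|z| + 1)) ^+ 3 * expR (`|z| + 1)))//.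
    apply: ler_pM; rewrite ?expR_ge0 ?exprn_ge0 ?ler_expR//.
    by apply: lerXn2r; rewrite ?nnegrE ?mulr_ge0 ?addr_ge0.
  rewrite exprMn [expR _ ^+ 2]expr2 [leRHS]mulrA ler_wpM2r ?expR_ge0//.
  by have := ler_wpM2l (exprn_ge0 3 d0) e3; lra.
have b3 : `|dl ^+ 3 * (dl / 8 - z / 2)| <= `|dl| ^+ 3 * expR (`|z| + 1) ^+ 2.
  rewrite normrM normrX ler_wpM2l ?exprn_ge0//.
  rewrite (@le_trans _ _ (expR (`|z| + 1)))//; last by rewrite expr2 ler_peMr ?expR_ge0.
  rewrite (le_trans _ e1)// (le_trans (ler_normB _ _))// !normrM !normfV !(ger0_norm (ler0n _ _)).
  by lra.
by lra.
Qed.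

Lemma EN_cst c : EN (fun=> c) = c.
Proof. exact: Ex_cst. Qed.

Lemma ENZ c f : egrowth f -> EN (fun x => c * f x) = c * EN f.
Proof. by move=> /egrowth_L1 f1; exact: ExZ. Qed.

Lemma END f h : egrowth f -> egrowth h -> EN (fun x => f x + h x) = EN f + EN h.
Proof. by move=> /egrowth_L1 f1 /egrowth_L1 h1; exact: ExD. Qed.

Lemma eq_EN f h : f =1 h -> EN f = EN h.
Proof. by move=> /funext ->. Qed.

Lemma EN_shift_kernel f dl : egrowth f -> EN (fun z => f z * shift_kernel dl z) =
  EN (fun z => f (z + dl)) - EN f - dl * EN (fun z => f z * z)
    - dl ^+ 2 / 2 * EN (fun z => f z * (z ^+ 2 - 1)).
Proof.
move=> ef; rewrite EN_shift//.
have e1 : egrowth (fun z => f z * expR (z * dl - dl ^+ 2 / 2)) by apply: egrowthM => //; exact: egrowth_expRlin.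
have e2 : egrowth (fun z => f z * z) by apply: egrowthM => //; exact: egrowth_id.
have e3 : egrowth (fun z => f z * (z ^+ 2 - 1)).
  by apply: egrowthM => //; apply: egrowthB; [exact: egrowth_exp|exact: egrowth_cst].
rewrite -ENZ// -ENZ// -ENB// -ENB//; last 2 first.
- exact: egrowthB.
- exact: egrowthZ.
rewrite -ENB//; last 2 first.
- by apply: egrowthB; [exact: egrowthB|exact: egrowthZ].
- exact: egrowthZ.
by apply: eq_EN => z; rewrite /shift_kernel; field.
Qed.

Lemma EN_quadratic_shift_kernel (a b c dl : R) :
  EN (fun z => (a + b * z + c * z ^+ 2) * shift_kernel dl z) = 0.
Proof.
have [m1 m2 m3 m4] := EN_moments R.
have E5 a0 a1 a2 a3 a4 : egrowth (fun z : R => a0 + a1 * z + a2 * z ^+ 2 + a3 * z ^+ 3 + a4 * z ^+ 4) /\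
    EN (fun z : R => a0 + a1 * z + a2 * z ^+ 2 + a3 * z ^+ 3 + a4 * z ^+ 4) = a0 + a2 + 3 * a4.
  have i n k : egrowth (fun z : R => k * z ^+ n) by apply: egrowthZ; exact: egrowth_exp.
  have i1 k : egrowth (fun z : R => k * z) by apply: egrowthZ; exact: egrowth_id.
  have c0 := egrowth_cst a0.
  have j1 := egrowthD c0 (i1 a1); have j2 := egrowthD j1 (i 2%N a2); have j3 := egrowthD j2 (i 3%N a3).
  split; first exact: egrowthD j3 (i 4%N a4).
  rewrite END// END// END// END// EN_cst !ENZ ?m1 ?m2 ?m3 ?m4; try exact: egrowth_exp; try exact: egrowth_id.
  by ring.
have q0 : (fun z : R => a + b * z + c * z ^+ 2) =
    fun z => a + b * z + c * z ^+ 2 + 0 * z ^+ 3 + 0 * z ^+ 4.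
  by apply/funext => z; ring.
have eq : egrowth (fun z : R => a + b * z + c * z ^+ 2) by rewrite q0; exact: (E5 _ _ _ _ _).1.
rewrite EN_shift_kernel//.
have -> : EN (fun z => a + b * z + c * z ^+ 2) = a + c by rewrite q0 (E5 _ _ _ _ _).2; ring.
have -> : EN (fun z => a + b * (z + dl) + c * (z + dl) ^+ 2) = a + b * dl + c * dl ^+ 2 + c.
  rewrite (eq_EN (h := fun z => (a + b * dl + c * dl ^+ 2) + (b + 2 * c * dl) * z + c * z ^+ 2 + 0 * z ^+ 3 + 0 * z ^+ 4)); last by move=> z; ring.
  by rewrite (E5 _ _ _ _ _).2; ring.
have -> : EN (fun z => (a + b * z + c * z ^+ 2) * z) = b.
  rewrite (eq_EN (h := fun z => 0 + a * z + b * z ^+ 2 + c * z ^+ 3 + 0 * z ^+ 4)); last by move=> z; ring.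
  by rewrite (E5 _ _ _ _ _).2; ring.
have -> : EN (fun z => (a + b * z + c * z ^+ 2) * (z ^+ 2 - 1)) = 2 * c.
  rewrite (eq_EN (h := fun z => - a + - b * z + (a - c) * z ^+ 2 + b * z ^+ 3 + c * z ^+ 4)); last by move=> z; ring.
  by rewrite (E5 _ _ _ _ _).2; ring.
by field.
Qed.

End smoothing.

(** * Taylor estimates of the smoothed function *)

Section smoothing_taylor.
Context (R : realType).
Implicit Types (f h p : R -> R) (c m s t x y z dl w r : R).

Lemma taylor2_egrowth r f f1 f2 : 0 < r <= 3 -> continuous f ->
  taylor2 f f1 f2 (fun y => y `^ r) -> egrowth f.
Proof.
move=> r03 cf ft.
pose h x := `|f 0| + `|f1 0| * `|x| + `|f2 0| * `|x| ^+ 2 + (1 + `|x| ^+ 3).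
have ea n : egrowth (fun x : R => `|x| ^+ n).
  by have := egrowth_abs (@egrowth_exp R n); under eq_fun do rewrite normrX.
have eh : egrowth h.
  apply: egrowthD; last by apply: egrowthD => //; exact: egrowth_cst.
  apply: egrowthD; last by apply: egrowthZ.
  by apply: egrowthD; [exact: egrowth_cst|apply: egrowthZ; exact: ea 1%N].
apply: (egrowth_le cf eh ler01) => x; rewrite mul1r.
have hx : `|f x| <= h x; last by rewrite (le_trans hx)// ler_norm.
have := le_trans (ft 0 x) (powR_le_1D3 r03 (normr_ge0 x)); rewrite add0r => hx.
have -> : f x = (f x - f 0 - f1 0 * x - f2 0 * x ^+ 2 / 2) + f 0 + f1 0 * x + f2 0 * x ^+ 2 / 2.
  by ring.
rewrite (le_trans (ler_normD _ _))// (le_trans (lerD (ler_normD _ _) (lexx _)))//.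
rewrite (le_trans (lerD (lerD (ler_normD _ _) (lexx _)) (lexx _)))//.
have -> : `|f2 0 * x ^+ 2 / 2| = `|f2 0| * `|x| ^+ 2 / 2.
  by rewrite (normrM _ 2^-1) (normrM (f2 0)) normrX normfV (ger0_norm (ler0n _ 2)).
rewrite normrM /h; have : 0 <= `|f2 0| * `|x| ^+ 2 by rewrite mulr_ge0 ?exprn_ge0.
by lra.
Qed.

(** [W1] and [W2] dominate the dependence of the integrand on z in the regimes |y| <= s and |y| >= s
    respectively. *)
Definition W1 z := (1 + `|z| ^+ 3) * expR (2 * (`|z| + 1)).
Definition W2 z := (1 + (`|z| + 1) ^+ 3) * (1 + `|z| + `|z| ^+ 2).
Definition KT := 7 * EN W1 + 4 * EN W2.

Let ea n : egrowth (fun x : R => `|x| ^+ n).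
Proof. by have := egrowth_abs (@egrowth_exp R n); under eq_fun do rewrite normrX. Qed.

Lemma egrowth_W1 : egrowth W1.
Proof.
apply: egrowthM; first by apply: egrowthD => //; exact: egrowth_cst.
under eq_fun do rewrite mulrDr expRD.
by apply: egrowthM; [exact: egrowth_expR|exact: egrowth_cst].
Qed.

Lemma egrowth_W2 : egrowth W2.
Proof.
have e1 : egrowth (fun z : R => `|z| + 1) by apply: egrowthD; [exact: ea 1%N|exact: egrowth_cst].
apply: egrowthM.
  apply: egrowthD; first exact: egrowth_cst.
  have -> : (fun z : R => (`|z| + 1) ^+ 3) = (fun z => (`|z| + 1) * ((`|z| + 1) * (`|z| + 1))).
    by apply/funext => z; rewrite !exprS expr0 mulr1.
  by do 2 apply: egrowthM => //.
apply: egrowthD => //.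
by apply: egrowthD; [exact: egrowth_cst|exact: ea 1%N].
Qed.

Lemma EN_W_ge0 : 0 <= EN W1 /\ 0 <= EN W2.
Proof.
split; apply: Ex_ge0 => z.
  by rewrite mulr_ge0 ?expR_ge0 ?addr_ge0 ?exprn_ge0.
by rewrite mulr_ge0 ?addr_ge0 ?exprn_ge0 ?addr_ge0.
Qed.

Lemma KT_ge0 : 0 <= KT.
Proof. by have [a b] := EN_W_ge0; rewrite addr_ge0// mulr_ge0. Qed.

Variables (r : R) (f f1 f2 : R -> R).
Hypothesis r03 : 0 < r <= 3.
Hypothesis cf : continuous f.
Hypothesis ft : taylor2 f f1 f2 (fun y => y `^ r).

Let ef := taylor2_egrowth r03 cf ft.

Lemma U_increment s x y : 0 < s ->
  U s f (x + y) - U s f x - V1 s f x * y - V2 s f x * y ^+ 2 / 2 =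
  EN (fun z => f (x + s * z) * shift_kernel (y / s) z).
Proof.
move=> s0; rewrite (@EN_shift_kernel _ (fun z => f (x + s * z))); last exact: egrowth_affine.
rewrite /U /V1 /V2 /smooth.
have e1 a : EN (fun z => f (a + s * z) * 1) = EN (fun z => f (a + s * z)).
  by apply: eq_EN => z; rewrite mulr1.
rewrite !e1; have -> : EN (fun z => f (x + s * (z + y / s))) = EN (fun z => f (x + y + s * z)).
  by apply: eq_EN => z; congr f; field; rewrite gt_eqF.
by field; rewrite gt_eqF.
Qed.

Let Rx s x z := f (x + s * z) - f x - f1 x * (s * z) - f2 x * (s * z) ^+ 2 / 2.

Let egrowth_Rx s x : egrowth (Rx s x).
Proof.
apply: egrowthB; last first.
  have -> : (fun z => f2 x * (s * z) ^+ 2 / 2) = fun z => (f2 x * s ^+ 2 / 2) * z ^+ 2.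
    by apply/funext => z; ring.
  by apply: egrowthZ; exact: egrowth_exp.
apply: egrowthB; last first.
  by under eq_fun do rewrite mulrA; apply: egrowthZ; exact: egrowth_id.
by apply: egrowthB; [exact: egrowth_affine|exact: egrowth_cst].
Qed.

Let Rx_le s x z : 0 < s -> `|Rx s x z| <= s `^ r * `|z| `^ r.
Proof. by move=> s0; rewrite (le_trans (ft _ _))// normrM gtr0_norm// powRM// ltW. Qed.

(** The kernel annihilates quadratic polynomials, so the Taylor polynomial of f at x drops out and
    only a remainder of size s^r |z|^r meets the kernel. In this way smoothing keeps the order r of
    f. *)
Let U_increment_Rx s x y : 0 < s ->
  U s f (x + y) - U s f x - V1 s f x * y - V2 s f x * y ^+ 2 / 2 =
  EN (fun z => Rx s x z * shift_kernel (y / s) z).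
Proof.
move=> s0; rewrite U_increment//.
have := EN_quadratic_shift_kernel (f x) (f1 x * s) (f2 x * s ^+ 2 / 2) (y / s).
have ek := egrowth_shift_kernel (y / s).
have eq : egrowth (fun z : R => f x + f1 x * s * z + f2 x * s ^+ 2 / 2 * z ^+ 2).
  apply: egrowthD; last by apply: egrowthZ; exact: egrowth_exp.
  by apply: egrowthD; [exact: egrowth_cst|apply: egrowthZ; exact: egrowth_id].
move=> h; rewrite -[RHS]addr0 -h -END; [|exact: egrowthM..].
by apply: eq_EN => z; rewrite /Rx; ring.
Qed.

Let small s x y : 0 < s -> `|y / s| <= 1 ->
  `|EN (fun z => Rx s x z * shift_kernel (y / s) z)| <=
  7 * EN W1 * (s `^ r * `|y / s| ^+ 3).
Proof.
move=> s0 d1; set dl := y / s.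
apply: (@le_trans _ _ (EN (fun z => (7 * (s `^ r * `|dl| ^+ 3)) * W1 z))).
  apply: EN_abs_le; [by apply: egrowthM => //; exact: egrowth_shift_kernel|by apply: egrowthZ; exact: egrowth_W1|].
  move=> z; rewrite normrM.
  have a1 := Rx_le x z s0; have a2 := powR_le_1D3 r03 (normr_ge0 z).
  have a3 : `|Rx s x z| <= s `^ r * (1 + `|z| ^+ 3).
    by rewrite (le_trans a1)// ler_wpM2l ?powR_ge0.
  rewrite (le_trans (ler_pM _ _ a3 (shift_kernel_le z d1)))// /W1.
  by rewrite le_eqVlt; apply/orP; left; apply/eqP; rewrite -/dl; ring.
rewrite ENZ; last exact: egrowth_W1.
by rewrite le_eqVlt; apply/orP; left; apply/eqP; ring.
Qed.

(** For |y| >= s the cancellation inside the kernel brings no gain: its four terms are bounded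
    separately. *)
Let large s x y : 0 < s -> 1 <= `|y / s| ->
  `|EN (fun z => Rx s x z * shift_kernel (y / s) z)| <=
  EN W2 * (s `^ r * (`|y / s| `^ r + 3 * `|y / s| ^+ 2)).
Proof.
move=> s0 d1; set dl := y / s; rewrite EN_shift_kernel//.
have s00 := ltW s0.
have K0 := EN_W_ge0.2.
have sr0 : 0 <= s `^ r by exact: powR_ge0.
have r00 : 0 <= r by case/andP : r03 => /ltW.
have w1 z : 1 <= 1 + `|z| + `|z| ^+ 2.
  by rewrite -addrA lerDl addr_ge0 ?exprn_ge0.
have w2 z : 1 + `|z| ^+ 3 <= 1 + (`|z| + 1) ^+ 3.
  by rewrite lerD2l; apply: lerXn2r; rewrite ?nnegrE ?addr_ge0// lerDl.
have w3 z : 0 <= 1 + `|z| ^+ 3 by rewrite addr_ge0 ?exprn_ge0.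
have gen h c : egrowth h -> 0 <= c -> (forall z, `|h z| <= c * W2 z) -> `|EN h| <= c * EN W2.
  move=> eh c0 hW; rewrite -ENZ; last exact: egrowth_W2.
  by apply: EN_abs_le => //; apply: egrowthZ; exact: egrowth_W2.
have RW k p : egrowth p -> k = s `^ r -> (forall z, `|p z| <= 1 + `|z| + `|z| ^+ 2) ->
    `|EN (fun z => Rx s x z * p z)| <= k * EN W2.
  move=> ep -> pz; apply: gen => //; first exact: egrowthM.
  move=> z; rewrite normrM mulrA ler_pM//.
  rewrite (le_trans (Rx_le x z s0))// ler_wpM2l//.
  by rewrite (le_trans (powR_le_1D3 r03 (normr_ge0 z))).
have b1 : `|EN (fun z => Rx s x (z + dl))| <= (s `^ r * `|dl| `^ r) * EN W2.
  apply: gen; first by have := egrowth_affine dl 1 (egrowth_Rx s x); under eq_fun do rewrite mul1r addrC.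
    by rewrite mulr_ge0// powR_ge0.
  move=> z; rewrite (le_trans (Rx_le x _ s0))// -mulrA ler_wpM2l//.
  rewrite (@le_trans _ _ ((`|dl| * (`|z| + 1)) `^ r))//.
    apply: ge0_ler_powR; rewrite ?nnegrE ?mulr_ge0 ?addr_ge0//.
    rewrite (le_trans (ler_normD _ _))// mulrDr mulr1 lerD2r.
    by rewrite ler_peMl.
  rewrite powRM ?addr_ge0// ler_wpM2l ?powR_ge0//.
  by rewrite (le_trans (powR_le_1D3 r03 _)) ?addr_ge0// /W2 ler_peMr// addr_ge0 ?exprn_ge0 ?addr_ge0.
have b2 : `|EN (Rx s x)| <= s `^ r * EN W2.
  rewrite (_ : EN _ = EN (fun z => Rx s x z * 1)); last by apply: eq_EN => z; rewrite mulr1.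
  by apply: RW => // [|z]; [exact: egrowth_cst|rewrite normr1].
have b3 : `|EN (fun z => Rx s x z * z)| <= s `^ r * EN W2.
  apply: RW => // [|z]; first exact: egrowth_id.
  by rewrite addrAC lerDr addr_ge0 ?exprn_ge0.
have b4 : `|EN (fun z => Rx s x z * (z ^+ 2 - 1))| <= s `^ r * EN W2.
  apply: RW => // [|z]; first by apply: egrowthB; [exact: egrowth_exp|exact: egrowth_cst].
  rewrite (le_trans (ler_normB _ _))// normr1 normrX addrC lerD2r.
  by rewrite lerDl.
rewrite (le_trans (ler_normB _ _))// (le_trans (lerD (ler_normB _ _) (lexx _)))//.
rewrite (le_trans (lerD (lerD (ler_normB _ _) (lexx _)) (lexx _)))//.
rewrite (normrM dl) (normrM (dl ^+ 2 / 2)) (normrM (dl ^+ 2)) normrX normfV (ger0_norm (ler0n _ 2)).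
have d2 : `|dl| <= `|dl| ^+ 2 by rewrite expr2 ler_peMr.
have d3 : 1 <= `|dl| ^+ 2 by rewrite (le_trans d1).
have k0 : 0 <= s `^ r * EN W2 by rewrite mulr_ge0.
have := ler_wpM2l (normr_ge0 dl) b3.
have := ler_wpM2l (sqr_ge0 `|dl|) b4.
have := ler_wpM2r k0 d2.
have := ler_wpM2r k0 d3.
by move: b1 b2; rewrite -/dl; lra.
Qed.

Lemma U_taylor2 s : 0 < s ->
  taylor2 (U s f) (V1 s f) (V2 s f) (fun y => KT * (y ^+ 2 * gmod r s y)).
Proof.
move=> s0 x y; rewrite U_increment_Rx//.
have [r0 r3] := andP r03.
have s00 := ltW s0.
have [K1 K2] := EN_W_ge0.
have dE : `|y / s| = `|y| / s by rewrite normrM normfV (gtr0_norm s0).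
have srE : s `^ r = s `^ (r - 2) * s ^+ 2.
  rewrite -powR_mulrn// -powRD ?subrK//.
  by rewrite gt_eqF ?implybT.
have yE : `|y| ^+ 2 * s `^ (r - 2) = s `^ r * `|y / s| ^+ 2.
  by rewrite srE dE expr_div_n; field; rewrite gt_eqF.
rewrite /gmod [X in KT * X]mulrA yE -dE.
have P0 : 0 <= s `^ r * `|y / s| ^+ 2 by rewrite mulr_ge0 ?powR_ge0 ?exprn_ge0.
(* For |y| <= s the minimum in [gmod] is |y| / s, matching the cubic bound. For |y| > s it is (|y| /
   s)^b, and r <= 2 + b makes |y / s|^2 |y / s|^b dominate both |y / s|^r and |y / s|^2. *)
set b := Num.max _ _.
have b0 : 0 <= b by rewrite /b le_max lexx orbT.
have b1 : b <= 1 by rewrite /b ge_max ler01 andbT; lra.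
have [d1|d1] := leP `|y / s| 1.
  rewrite (le_trans (small x s0 d1))//.
  have [y0|y0] := eqVneq `|y / s| 0.
    by rewrite y0 !expr0n/= !(mulr0, mul0r).
  have -> : Num.min `|y / s| (`|y / s| `^ b) = `|y / s|.
    by apply/min_idPl/ger1_powR => //; rewrite d1 andbT lt_neqAle eq_sym y0/=.
  rewrite (_ : s `^ r * _ ^+ 3 = s `^ r * `|y / s| ^+ 2 * `|y / s|); last by ring.
  by apply: ler_wpM2r; [rewrite mulr_ge0|rewrite /KT lerDl mulr_ge0].
have d1' := ltW d1.
rewrite (le_trans (large x s0 d1'))//.
have -> : Num.min `|y / s| (`|y / s| `^ b) = `|y / s| `^ b.
  by apply/min_idPr; exact: ler1_powR.
rewrite (@le_trans _ _ (4 * EN W2 * (s `^ r * `|y / s| ^+ 2 * `|y / s| `^ b)))//; last first.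
  by apply: ler_wpM2r; [rewrite mulr_ge0 ?powR_ge0|rewrite /KT lerDr mulr_ge0].
have e1 : `|y / s| `^ r <= `|y / s| ^+ 2 * `|y / s| `^ b.
  have dn0 : `|y / s| != 0 by rewrite gt_eqF// (lt_trans ltr01 d1).
  rewrite -powR_mulrn// -powRD ?dn0 ?implybT//.
  by apply: ler_powR => //; rewrite /b -lerBlDl le_max lexx.
have e2 : `|y / s| ^+ 2 <= `|y / s| ^+ 2 * `|y / s| `^ b.
  rewrite ler_peMr ?exprn_ge0// -(powRr0 `|y / s|).
  by apply: ler_powR.
have := mulr_ge0 K2 (powR_ge0 s r) => KS.
have := ler_wpM2l KS e1; have := ler_wpM2l KS e2; lra.
Qed.

Lemma U1_sub_le x : `|U 1 f x - f x| <= EN W2 + `|f2 x|.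
Proof.
have [m1 m2 _ _] := EN_moments R.
have -> : U 1 f x - f x = EN (Rx 1 x) + f2 x / 2.
  have e1 : egrowth (fun z : R => f1 x * z) by apply: egrowthZ; exact: egrowth_id.
  have e2 : egrowth (fun z : R => f2 x / 2 * z ^+ 2) by apply: egrowthZ; exact: egrowth_exp.
  have -> : U 1 f x = EN (fun z => Rx 1 x z + f x + f1 x * z + f2 x / 2 * z ^+ 2).
    by apply: eq_EN => z; rewrite /Rx mul1r; field.
  have e0 : egrowth (fun z => Rx 1 x z + f x) by apply: egrowthD => //; exact: egrowth_cst.
  have e3 := egrowthD e0 e1.
  rewrite (END e3 e2) (END e0 e1) (END (egrowth_Rx 1 x) (egrowth_cst _)) EN_cst.
  rewrite (ENZ _ (@egrowth_id R)) (ENZ _ (@egrowth_exp R 2)) m1 m2; ring.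
rewrite (le_trans (ler_normD _ _))// lerD//; last first.
  by rewrite normrM normfV (ger0_norm (ler0n _ 2)) ler_pdivrMr// ler_peMr// ler1n.
apply: EN_abs_le => // [|z]; first exact: egrowth_W2.
rewrite (le_trans (Rx_le x z ltr01))// powR1 mul1r.
rewrite (le_trans (powR_le_1D3 r03 (normr_ge0 z)))// /W2.
have h : 0 <= `|z| by [].
have h2 : 0 <= `|z| ^+ 2 by exact: sqr_ge0.
rewrite (@le_trans _ _ (1 + (`|z| + 1) ^+ 3))//.
  by rewrite lerD2l; apply: lerXn2r; rewrite ?nnegrE ?addr_ge0// lerDl.
by rewrite ler_peMr ?addr_ge0 ?exprn_ge0 ?addr_ge0// -addrA lerDl addr_ge0.
Qed.

Let r3 : r <= 3. Proof. by case/andP : r03. Qed.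

Lemma smoothing_om_nd s u v : 0 <= s -> 0 <= u -> u <= v ->
  KT * (u ^+ 2 * gmod r s u) <= KT * (v ^+ 2 * gmod r s v).
Proof.
move=> s0 u0 uv; rewrite ler_wpM2l ?KT_ge0// ler_pM ?exprn_ge0 ?gmod_ge0 ?gmod_nd//.
by apply: lerXn2r; rewrite ?nnegrE// (le_trans u0).
Qed.

Let om_cub s y : 0 < s -> 0 <= y ->
  KT * (y ^+ 2 * gmod r s y) <= KT * (s `^ (r - 2) / s) * y ^+ 3.
Proof.
move=> s0 y0; rewrite -mulrA ler_wpM2l ?KT_ge0//.
have := ler_wpM2l (sqr_ge0 y) (gmod_lin r s0 y0).
by rewrite (exprS _ 2); lra.
Qed.

Let C_ge0 s : 0 < s -> 0 <= KT * (s `^ (r - 2) / s).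
Proof. by move=> s0; rewrite mulr_ge0 ?KT_ge0// divr_ge0 ?powR_ge0// ltW. Qed.

Lemma U_continuous s : 0 < s ->
  [/\ continuous (U s f), continuous (V1 s f) & continuous (V2 s f)].
Proof.
move=> s0; apply: (taylor2_continuous (C_ge0 s0) (U_taylor2 s0)).
- by move=> u v; apply: smoothing_om_nd; exact: ltW.
- by move=> y; exact: om_cub.
Qed.

(** Second differences of the Taylor estimate of [U s f]. The constant is 5 * 4 * 2: the factors
    come from [taylor2_coef], from (2 y)^2 and from [gmod_double]. *)
Lemma V2_modulus s x x' : 0 < s ->
  `|V2 s f x' - V2 s f x| <= 40 * KT * gmod r s `|x' - x|.
Proof.
move=> s0; have s00 := ltW s0.
set y := x' - x; have -> : x' = x + y by rewrite addrC subrK.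
have [->|y0] := eqVneq y 0.
  by rewrite addr0 subrr normr0 mulr_ge0 ?gmod_ge0// mulr_ge0 ?KT_ge0.
have [q _] := taylor2_coef (U_taylor2 s0) (fun u v => @smoothing_om_nd s u v s00) x y.
rewrite -(@ler_pM2r _ (y ^+ 2)) ?exprn_even_gt0// (le_trans q)//.
rewrite exprMn real_normK ?num_real//.
have P0 : 0 <= KT * y ^+ 2 by rewrite mulr_ge0 ?KT_ge0// sqr_ge0.
by have := ler_wpM2l P0 (gmod_double r3 s00 (normr_ge0 y)); lra.
Qed.

Lemma egrowth_smooth p s : egrowth p -> continuous (smooth p s f) -> egrowth (smooth p s f).
Proof.
move=> ep cs; split => //.
have [_ [K [c [K0 c0 fK]]]] := ef.
have eA : egrowth (fun z => expR (c * `|s| * `|z|) * `|p z|).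
  by apply: egrowthM; [apply: egrowth_expR; rewrite mulr_ge0|exact: egrowth_abs].
exists (K * EN (fun z => expR (c * `|s| * `|z|) * `|p z|)), c; split=> //.
  by rewrite mulr_ge0// Ex_ge0// => z; rewrite mulr_ge0 ?expR_ge0.
move=> x; rewrite mulrAC -[leRHS]ENZ//.
apply: EN_abs_le; [by apply: egrowthM => //; exact: egrowth_affine|exact: egrowthZ|].
move=> z; rewrite normrM mulrA; apply: ler_wpM2r => //.
rewrite (le_trans (fK _))// -[leRHS]mulrA; apply: ler_wpM2l => //.
rewrite -expRD ler_expR -mulrA -mulrDr ler_wpM2l//.
by rewrite (le_trans (ler_normD _ _))// normrM.
Qed.

Lemma egrowth_U s : 0 < s -> [/\ egrowth (U s f), egrowth (V1 s f) & egrowth (V2 s f)].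
Proof.
move=> s0; have [c0 c1 c2] := U_continuous s0.
have div p n : continuous (fun x => smooth p s f x / s ^+ n) -> continuous (smooth p s f).
  move=> h; have -> : smooth p s f = fun x => (smooth p s f x / s ^+ n) * s ^+ n.
    by apply/funext => x; rewrite divfK// expf_neq0// gt_eqF.
  by move=> x; apply: cvgM; [exact: h|exact: cvg_cst].
have quo p n : egrowth (smooth p s f) -> egrowth (fun x => smooth p s f x / s ^+ n).
  by move=> h; under eq_fun do rewrite mulrC; apply: egrowthZ.
split.
- by apply: egrowth_smooth => //; exact: egrowth_cst.
- by apply: (quo _ 1%N); apply: egrowth_smooth; [exact: egrowth_id|exact: (div _ 1%N)].
- apply: (quo _ 2%N); apply: egrowth_smooth; last exact: (div _ 2%N).
  by apply: egrowthB; [exact: egrowth_exp|exact: egrowth_cst].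
Qed.

Lemma U_semigroup s t x : 0 < s -> 0 < t ->
  U (Num.sqrt (s ^+ 2 + t ^+ 2)) f x = EN (fun w => U t f (x + s * w)).
Proof.
move=> s0 t0; rewrite /U /smooth.
transitivity (EN (fun z => f (x + Num.sqrt (s ^+ 2 + t ^+ 2) * z))).
  by apply: eq_EN => z; rewrite mulr1.
rewrite -(EN_conv x s0 t0 ef); apply: eq_EN => w; apply: eq_EN => z.
by rewrite mulr1.
Qed.

(** Both sides are second-order Taylor coefficients of the same function, by [U_semigroup]: one from
    smoothing at the total bandwidth, the other from averaging the expansion at bandwidth t.
    Uniqueness of the coefficient identifies them. *)
Lemma V2_semigroup s t x : 0 < s -> 0 < t ->
  V2 (Num.sqrt (s ^+ 2 + t ^+ 2)) f x = EN (fun w => V2 t f (x + s * w)).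
Proof.
move=> s0 t0; set q := Num.sqrt _.
have q0 : 0 < q by rewrite sqrtr_gt0 addr_gt0// exprn_gt0.
have [eU e1 e2] := egrowth_U t0.
apply: (@taylor2_unique _ (U q f) (V1 q f) (V2 q f)
  (fun x => EN (fun w => V1 t f (x + s * w))) (fun x => EN (fun w => V2 t f (x + s * w)))
  (fun y => KT * (y ^+ 2 * gmod r q y)) (fun y => KT * (y ^+ 2 * gmod r t y))
  (KT * (q `^ (r - 2) / q) + KT * (t `^ (r - 2) / t))).
- by rewrite addr_ge0 ?C_ge0.
- exact: U_taylor2.
- move=> u y; rewrite !U_semigroup//.
  have EU a : egrowth (fun w => U t f (a + s * w)) by exact: egrowth_affine.
  have E1 : egrowth (fun w => y * V1 t f (u + s * w)) by apply: egrowthZ; exact: egrowth_affine.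
  have E2 : egrowth (fun w => (y ^+ 2 / 2) * V2 t f (u + s * w)) by apply: egrowthZ; exact: egrowth_affine.
  have -> : EN (fun w => U t f (u + y + s * w)) - EN (fun w => U t f (u + s * w)) -
      EN (fun w => V1 t f (u + s * w)) * y - EN (fun w => V2 t f (u + s * w)) * y ^+ 2 / 2 =
      EN (fun w => U t f (u + y + s * w) - U t f (u + s * w) - y * V1 t f (u + s * w) -
       (y ^+ 2 / 2) * V2 t f (u + s * w)).
    rewrite [in RHS]ENB//; last by apply: egrowthB => //; exact: egrowthB.
    rewrite [in RHS]ENB//; last exact: egrowthB.
    rewrite ENB// !ENZ; [|exact: egrowth_affine..].
    move: (EN _) (EN _) (EN _) (EN _) => x1 x2 x3 x4; by ring.
  rewrite -[leRHS]EN_cst; apply: EN_abs_le; last 1 first.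
  + move=> w; have := U_taylor2 t0 (u + s * w) y.
    by rewrite (addrAC u y); apply: le_trans; rewrite le_eqVlt; apply/orP; left; apply/eqP; congr `|_|; ring.
  + by apply: egrowthB => //; apply: egrowthB => //; exact: egrowthB.
  + exact: egrowth_cst.
- move=> y y0; apply: (le_trans (om_cub q0 y0)).
  apply: ler_wpM2r; first exact: exprn_ge0.
  by apply: ler_wpDr => //; exact: C_ge0.
- move=> y y0; apply: (le_trans (om_cub t0 y0)).
  apply: ler_wpM2r; first exact: exprn_ge0.
  by apply: ler_wpDl => //; exact: C_ge0.
Qed.

Lemma L1_gmod s t : 0 <= s -> 0 < t -> L1 (gauss R) (fun w => gmod r t (s * `|w|)).
Proof.
move=> s0 t0.
have e : egrowth (fun w : R => t `^ (r - 2) / t * (s * `|w|)).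
  by apply: egrowthZ; apply: egrowthZ; exact: ea 1%N.
apply: (L1_dom _ (egrowth_L1 e)) => [|w].
  rewrite /gmod; apply: measurable_funM => //; apply: measurable_minr.
    by apply: measurable_funM => //; apply: measurable_funM.
  by apply: measurable_powRf; apply: measurable_funM => //; apply: measurable_funM.
rewrite ger0_norm ?gmod_ge0 ?mulr_ge0 ?(ltW t0)//.
by apply: gmod_lin; rewrite ?mulr_ge0.
Qed.

(** A change of bandwidth is an average over translations by s N, so the modulus in time follows
    from the modulus in space. *)
Lemma V2_time_modulus s t x : 0 < s -> 0 < t ->
  `|V2 (Num.sqrt (s ^+ 2 + t ^+ 2)) f x - V2 t f x| <=
  40 * KT * EN (fun w => gmod r t (s * `|w|)).
Proof.
move=> s0 t0; rewrite V2_semigroup//.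
have [_ _ e2] := egrowth_U t0.
have E2 : egrowth (fun w => V2 t f (x + s * w)) by exact: egrowth_affine.
rewrite -{1}(EN_cst (V2 t f x)) -ENB//; last exact: egrowth_cst.
have iG := L1_gmod (ltW s0) t0.
rewrite -[leRHS]ExZ//; apply: abs_Ex_le; last 1 first.
- move=> w; rewrite (le_trans (V2_modulus _ _ t0))//.
  by rewrite addrC addKr normrM (gtr0_norm s0).
- by apply: L1_measurable; apply: egrowth_L1; apply: egrowthB => //; exact: egrowth_cst.
- exact: L1Z.
Qed.

End smoothing_taylor.

(** * Deterministic sums *)

Section power_sums.
Context (R : realType).
Implicit Types (a b t x y v p r : R).

(** The tangent at 1 of the concave function v^a, obtained from Young's inequality with second
    factor 1. *)
Lemma powR_bernoulli a v : 0 <= a <= 1 -> 0 <= v -> v `^ a <= 1 + a * (v - 1).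
Proof.
move=> /andP[a0 a1] v0.
have [->|an0] := eqVneq a 0; first by rewrite powRr0 mul0r addr0.
have [->|an1] := eqVneq a 1; first by rewrite powRr1// mul1r subrKC.
have a0' : 0 < a by rewrite lt_neqAle eq_sym an0.
have a1' : 0 < 1 - a by rewrite subr_gt0 lt_neqAle an1.
have := @conjugate_powR R (v `^ a) 1 a^-1 (1 - a)^-1 (powR_ge0 _ _) ler01.
rewrite !invr_gt0 !invrK subrKC => /(_ a0' a1' erefl).
by rewrite mulr1 -powRrM divff// powRr1// powR1; lra.
Qed.

Lemma powR_neq0_add x a b : 0 < x -> x `^ (a + b) = x `^ a * x `^ b.
Proof. by move=> x0; rewrite powRD// (gt_eqF x0) implybT. Qed.

Lemma powR_sub1 a x : 0 < x -> x `^ (a - 1) = x `^ a / x.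
Proof.
by move=> x0; rewrite powR_neq0_add// powR_inv1// ltW.
Qed.

Lemma powR_incr_ge a (i : nat) : 0 < a <= 1 ->
  a * i.+1%:R `^ (a - 1) <= i.+1%:R `^ a - i%:R `^ a :> R.
Proof.
move=> /andP[a0 a1]; set x : R := i.+1%:R.
have x0 : 0 < x by rewrite ltr0n.
have xi : i%:R = x - 1 :> R by rewrite /x -natr1 addrK.
have -> : i%:R `^ a = x `^ a * (i%:R / x) `^ a.
  by rewrite -powRM ?divr_ge0 ?ler0n//; congr (_ `^ _); field; rewrite gt_eqF.
have v0 : 0 <= i%:R / x by rewrite divr_ge0// ltW.
have := @powR_bernoulli a (i%:R / x); rewrite (ltW a0) a1 => /(_ erefl v0) h.
rewrite powR_sub1//.
have e : i%:R / x - 1 = - x^-1 by rewrite xi; field; rewrite gt_eqF.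
rewrite e in h.
have := ler_wpM2l (powR_ge0 x a) h; clearbody x; lra.
Qed.

Lemma sum_powR_le a (K : nat) : 0 < a <= 1 ->
  \sum_(1 <= i < K.+1) i%:R `^ (a - 1) <= K%:R `^ a / a :> R.
Proof.
move=> /[dup] a01 /andP[a0 a1]; elim: K => [|K ih].
  by rewrite big_geq// divr_ge0 ?powR_ge0// ltW.
rewrite big_nat_recr//= ler_pdivlMr// mulrDl.
have := powR_incr_ge K a01; move: ih; rewrite ler_pdivlMr//; lra.
Qed.

Lemma powRN_incr_ge b (i : nat) : 0 < b <= 1 ->
  b * i.+2%:R `^ (- b - 1) <= i.+1%:R `^ (- b) - i.+2%:R `^ (- b) :> R.
Proof.
move=> /andP[b0 b1]; set x : R := i.+2%:R.
have x0 : 0 < x by rewrite ltr0n.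
have xi : i.+1%:R = x - 1 :> R by rewrite /x -[i.+2]addn1 natrD addrK.
have i0 : 0 < i.+1%:R :> R by rewrite ltr0n.
have v0 : 0 < i.+1%:R / x by rewrite divr_gt0.
have -> : i.+1%:R `^ (- b) = x `^ (- b) * (i.+1%:R / x) `^ (- b).
  rewrite -powRM ?(ltW v0) ?(ltW x0)//; congr (_ `^ _); field; rewrite gt_eqF//.
have := @powR_bernoulli b (i.+1%:R / x); rewrite (ltW b0) b1 => /(_ erefl (ltW v0)) h.
rewrite powR_sub1//.
have e : i.+1%:R / x - 1 = - x^-1 by rewrite xi; field; rewrite gt_eqF.
rewrite e in h.
(* The bound (1 - 1/x)^b <= 1 - b/x is inverted by means of (1 - b/x) (1 + b/x) <= 1. *)
have ib : 1 + b / x <= (i.+1%:R / x) `^ (- b).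
  have P : 0 < 1 + b / x by rewrite addr_gt0// divr_gt0.
  rewrite powRN -[leLHS]invrK lef_pV2 ?posrE ?invr_gt0 ?powR_gt0//.
  rewrite (le_trans h)// -[leRHS]mul1r ler_pdivlMr//.
  have : 0 <= b / x * (b / x) by rewrite mulr_ge0// divr_ge0// ltW.
  clearbody x; lra.
have := ler_wpM2l (powR_ge0 x (- b)) ib; clearbody x; lra.
Qed.

(** Comparison with a telescoping sum of i^{-b}. The first term is set apart because for N = 0 the
    node before it would be 0. *)
Lemma sum_powRN_le b (N K : nat) : 0 < b <= 1 ->
  \sum_(N.+1 <= i < K) i%:R `^ (- b - 1) <= (1 + b^-1) * N.+1%:R `^ (- b) :> R.
Proof.
move=> /[dup] b01 /andP[b0 b1].
have [KN|NK] := leqP K N.+1.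
  by rewrite big_geq// mulr_ge0 ?powR_ge0// addr_ge0// invr_ge0 ltW.
rewrite big_ltn// mulrDl mul1r lerD//.
  by apply: ler_powR; [rewrite ler1n|lra].
rewrite mulrC ler_pdivlMr//.
have N0 : (N.+2 <= K)%N by [].
have : (\sum_(N.+2 <= i < K) i%:R `^ (- b - 1)) * b <= N.+1%:R `^ (- b) - K.-1%:R `^ (- b) :> R.
  rewrite -(subnKC N0); elim: (K - N.+2)%N => [|k ih].
    by rewrite addn0 big_geq// mul0r subrr.
  rewrite addnS big_nat_recr/=; last by rewrite leq_addr.
  rewrite mulrDl; move: ih; rewrite addSn/=.
  have := powRN_incr_ge (N + k) b01; rewrite -!addSn; lra.
by have := powR_ge0 (K.-1%:R : R) (- b); lra.
Qed.

Lemma sum_inv_le (K : nat) : (0 < K)%N ->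
  \sum_(1 <= i < K.+1) i%:R^-1 <= 1 + ln K%:R :> R.
Proof.
elim: K => [//|[|K] ih _]; first by rewrite big_nat1 ln1 addr0 invr1.
rewrite big_nat_recr//=; set x : R := K.+2%:R.
have x0 : 0 < x by rewrite ltr0n.
have k0 : 0 < K.+1%:R :> R by rewrite ltr0n.
have : ln (K.+1%:R / x) <= - x^-1.
  have -> : K.+1%:R / x = 1 + - x^-1.
    have -> : K.+1%:R = x - 1 :> R by rewrite /x -[K.+2]addn1 natrD addrK.
    by rewrite mulrBl divff ?gt_eqF// mul1r.
  apply: le_ln1Dx; rewrite ltrN2 invf_lt1// /x ltr1n//.
rewrite ln_div ?posrE//.
by have := ih isT; clearbody x; lra.
Qed.

End power_sums.

(** * Sums of the modulus over a grid of times *)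

Section modulus_sum.
Context (R : realType).
Implicit Types (a b t x y v p r : R).

(* n^{-r/2} * rate p r n is the rate of convergence for the martingale. *)
Definition rate p r (n : nat) : R :=
  if r == p - 2 then (if r < 1 then 1 else 1 + ln n%:R) else n%:R `^ ((r + 2 - p) / 2).

Lemma rate_ge0 p r n : 0 <= rate p r n.
Proof.
rewrite /rate; case: ifP => _; last exact: powR_ge0.
case: ifP => // _; rewrite addr_ge0//.
case: n => [|n]; first by rewrite ln0.
by rewrite ln_ge0// ler1n.
Qed.

(** The exponent p - 2 lies between max(r - 2, 0) and 1, so u^{p-2} is at least the minimum of u and
    u^{max(r-2,0)}, whether u <= 1 or u >= 1. *)
Lemma gmod_powR p r s y : 2 < p <= 3 -> r <= p -> 0 < s -> 0 <= y ->
  gmod r s y <= s `^ (r - p) * y `^ (p - 2).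
Proof.
move=> /andP[p2 p3] rp s0 y0; rewrite /gmod.
have u0 : 0 <= y / s by rewrite divr_ge0// ltW.
have -> : s `^ (r - p) * y `^ (p - 2) = s `^ (r - 2) * (y / s) `^ (p - 2).
  rewrite powRM ?invr_ge0 ?(ltW s0)// mulrA mulrAC; congr (_ * _).
  rewrite -powR_inv1 ?(ltW s0)// -powRrM -powR_neq0_add//.
  by congr (_ `^ _); ring.
rewrite ler_wpM2l ?powR_ge0// ge_min.
have [u1|u1] := leP (y / s) 1.
  have [->|n0] := eqVneq (y / s) 0; first by rewrite powR_ge0.
  by rewrite ger1_powR ?u1 ?andbT//; [rewrite lt_neqAle eq_sym n0|lra].
apply/orP; right; apply: ler_powR; first exact: ltW.
by rewrite ge_max; apply/andP; split; lra.
Qed.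

Let sqrt_powR t e : 0 <= t -> Num.sqrt t `^ e = t `^ (e / 2).
Proof. by move=> t0; rewrite -powR12_sqrt// -powRrM; congr (_ `^ _); ring. Qed.

Let sum_gt p r (m n K : nat) y : 2 < p <= 3 -> p - 2 < r <= p -> (0 < m)%N ->
  (K * m <= n)%N -> 0 <= y ->
  \sum_(1 <= i < K.+1) gmod r (Num.sqrt (i * m)%:R) y <=
  (2 / (r + 2 - p)) / m%:R * n%:R `^ ((r + 2 - p) / 2) * y `^ (p - 2).
Proof.
move=> p23 /andP[r1 r2] m0 Kn y0.
have m0' : 0 < m%:R :> R by rewrite ltr0n.
set a := (r + 2 - p) / 2.
have a01 : 0 < a <= 1 by rewrite /a; apply/andP; split; lra.
have [a0 a1] := andP a01.
apply: (@le_trans _ _ (\sum_(1 <= i < K.+1) m%:R `^ (a - 1) * y `^ (p - 2) * i%:R `^ (a - 1))).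
  rewrite big_nat_cond [leRHS]big_nat_cond; apply: ler_sum => i /andP[/andP[i1 _] _].
  have im0 : 0 < (i * m)%:R :> R by rewrite ltr0n muln_gt0 i1.
  rewrite (le_trans (gmod_powR p23 r2 _ y0)) ?sqrtr_gt0// sqrt_powR ?(ltW im0)//.
  rewrite (_ : (r - p) / 2 = a - 1); last by rewrite /a; field.
  by rewrite natrM powRM// (mulrC (i%:R `^ _)) mulrAC.
rewrite -mulr_sumr.
rewrite (le_trans (ler_wpM2l _ (sum_powR_le K a01))) ?mulr_ge0 ?powR_ge0//.
rewrite powR_sub1//.
have -> : 2 / (r + 2 - p) = a^-1 by rewrite /a invf_div.
have h : m%:R `^ a * K%:R `^ a <= n%:R `^ a :> R.
  rewrite -powRM// -natrM; apply: ge0_ler_powR; rewrite ?nnegrE ?(ltW a0)//.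
  by rewrite ler_nat mulnC.
have P : 0 <= a^-1 / m%:R * y `^ (p - 2) by rewrite mulr_ge0 ?powR_ge0// divr_ge0// invr_ge0 ltW.
by have := ler_wpM2l P h; lra.
Qed.

Let sum_log p r (m n K : nat) y : p = 3 -> r = 1 -> (0 < m)%N ->
  (K * m <= n)%N -> 0 <= y ->
  \sum_(1 <= i < K.+1) gmod r (Num.sqrt (i * m)%:R) y <=
  m%:R^-1 * (1 + ln n%:R) * y `^ (p - 2).
Proof.
move=> -> -> m0 Kn y0.
have m0' : 0 < m%:R :> R by rewrite ltr0n.
have [->|K0] := posnP K.
  rewrite big_geq// !mulr_ge0 ?powR_ge0//.
  rewrite addr_ge0//; case: (n) => [|k]; first by rewrite ln0.
  by rewrite ln_ge0// ler1n.
apply: (@le_trans _ _ (\sum_(1 <= i < K.+1) m%:R^-1 * y `^ (3 - 2) * i%:R^-1)).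
  rewrite big_nat_cond [leRHS]big_nat_cond; apply: ler_sum => i /andP[/andP[i1 _] _].
  have im0 : 0 < (i * m)%:R :> R by rewrite ltr0n muln_gt0 i1.
  have g : gmod 1 (Num.sqrt (i * m)%:R) y <= Num.sqrt (i * m)%:R `^ (1 - 3) * y `^ (3 - 2).
    by apply: gmod_powR; [apply/andP; split; lra|lra|rewrite sqrtr_gt0|].
  rewrite (le_trans g)//.
  rewrite sqrt_powR ?(ltW im0)// (_ : (1 - 3) / 2 = -1); last by field.
  by rewrite powR_inv1 ?(ltW im0)// natrM invfM mulrC mulrA mulrAC (mulrC (m%:R^-1)).
rewrite -mulr_sumr.
have P : 0 <= m%:R^-1 * y `^ (3 - 2) by rewrite mulr_ge0 ?powR_ge0.
rewrite (le_trans (ler_wpM2l P (sum_inv_le R K0)))// mulrAC ler_wpM2r ?powR_ge0//.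
rewrite ler_wpM2l// lerD2l ler_ln ?posrE ?ltr0n// ?ler_nat.
  by rewrite (leq_trans _ Kn)// leq_pmulr.
by rewrite (leq_trans _ Kn)// muln_gt0 K0.
Qed.

(** The sum is cut at i = y^2 / m, where the bandwidth sqrt(i m) reaches y. Before the cut the
    minimum in [gmod] is bounded by 1, after it by y / s. The terms are then of order i^{r/2-1} and
    i^{(r-3)/2}, and both partial sums are of order y^r / m. *)
Let sum_eq r (m K : nat) y : 0 < r < 1 -> (0 < m)%N -> 0 <= y ->
  \sum_(1 <= i < K.+1) gmod r (Num.sqrt (i * m)%:R) y <=
  (2 / r + 1 + 2 / (1 - r)) / m%:R * y `^ r.
Proof.
move=> /andP[r0 r1] m0 y0.
have m0' : 0 < m%:R :> R by rewrite ltr0n.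
have C0 : 0 <= 2 / r + 1 + 2 / (1 - r).
  by rewrite !addr_ge0// divr_ge0// ?ltW// subr_gt0.
have [->|yn0] := eqVneq y 0.
  rewrite big1 => [|i _]; first by rewrite mulr_ge0 ?powR_ge0// divr_ge0.
  by rewrite /gmod mul0r min_l ?mulr0// powR_ge0.
have y0' : 0 < y by rewrite lt_neqAle eq_sym yn0.
set Y := y ^+ 2 / m%:R.
have Y0 : 0 < Y by rewrite divr_gt0// exprn_gt0.
pose N := Num.truncn Y.
have /andP[NY YN] : N%:R <= Y < N.+1%:R by apply: truncn_itv; exact: ltW.
set a := r / 2; set b := (1 - r) / 2.
have a01 : 0 < a <= 1 by rewrite /a; apply/andP; split; lra.
have b01 : 0 < b <= 1 by rewrite /b; apply/andP; split; lra.
have [a0 a1] := andP a01; have [b0 b1] := andP b01.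
have g1 (i : nat) : (0 < i)%N -> gmod r (Num.sqrt (i * m)%:R) y <= m%:R `^ (a - 1) * i%:R `^ (a - 1).
  move=> i0; have im0 : 0 <= (i * m)%:R :> R by [].
  rewrite /gmod max_r; last by lra.
  rewrite powRr0 -powRM// -natrM mulnC sqrt_powR//.
  rewrite (_ : (r - 2) / 2 = a - 1); last by rewrite /a; field.
  by rewrite ler_piMr ?powR_ge0// ge_min lexx orbT.
have g2 (i : nat) : (0 < i)%N -> gmod r (Num.sqrt (i * m)%:R) y <=
    m%:R `^ (a - 1) * Y `^ (2^-1) * i%:R `^ (- b - 1).
  move=> i0; have im0 : 0 < (i * m)%:R :> R by rewrite ltr0n muln_gt0 i0.
  have s0 : 0 < Num.sqrt (i * m)%:R :> R by rewrite sqrtr_gt0.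
  rewrite (le_trans (gmod_lin _ s0 y0))//.
  have -> : y = Y `^ 2^-1 * m%:R `^ 2^-1.
    by rewrite -powRM ?(ltW Y0)// /Y divfK ?gt_eqF// powR12_sqrt ?sqr_ge0// sqrtr_sqr gtr0_norm.
  have -> : Num.sqrt (i * m)%:R `^ (r - 2) / Num.sqrt (i * m)%:R = (i * m)%:R `^ (- b - 1) :> R.
    rewrite -powR12_sqrt ?(ltW im0)// -[X in _ / X]powRr1 ?powR_ge0// -powRB; last first.
      by rewrite powR_eq0 (gt_eqF im0) implybT.
    by rewrite -powRrM; congr (_ `^ _); rewrite /b; field.
  rewrite natrM powRM//.
  have -> : m%:R `^ (a - 1) = m%:R `^ (- b - 1) * m%:R `^ 2^-1 :> R.
    rewrite -powR_neq0_add//.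
    by congr (_ `^ _); rewrite /a /b; field.
  by rewrite le_eqVlt; apply/orP; left; apply/eqP; ring.
(* The range is extended to max(K, N) so that it can be cut at N in every case. *)
apply: (@le_trans _ _ (\sum_(1 <= i < (maxn K N).+1) gmod r (Num.sqrt (i * m)%:R) y)).
  rewrite [leRHS](@big_cat_nat _ _ _ K.+1)//= ?ltnS ?leq_maxl// lerDl.
  by apply: sumr_ge0 => i _; rewrite gmod_ge0.
rewrite (@big_cat_nat _ _ _ N.+1)//= ?ltnS ?leq_maxr//.
have s1 : \sum_(1 <= i < N.+1) gmod r (Num.sqrt (i * m)%:R) y <= m%:R `^ (a - 1) * (Y `^ a / a).
  apply: (@le_trans _ _ (\sum_(1 <= i < N.+1) m%:R `^ (a - 1) * i%:R `^ (a - 1))).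
    rewrite big_nat_cond [leRHS]big_nat_cond; apply: ler_sum => i /andP[/andP[i1 _] _].
    exact: g1.
  rewrite -mulr_sumr ler_wpM2l ?powR_ge0// (le_trans (sum_powR_le N a01))//.
  rewrite ler_pM2r ?invr_gt0//; apply: ge0_ler_powR; rewrite ?nnegrE ?(ltW a0) ?(ltW Y0)//.
have s2 : \sum_(N.+1 <= i < (maxn K N).+1) gmod r (Num.sqrt (i * m)%:R) y <=
    m%:R `^ (a - 1) * (Y `^ a * (1 + b^-1)).
  apply: (@le_trans _ _ (\sum_(N.+1 <= i < (maxn K N).+1)
      m%:R `^ (a - 1) * Y `^ (2^-1) * i%:R `^ (- b - 1))).
    rewrite big_nat_cond [leRHS]big_nat_cond; apply: ler_sum => i /andP[/andP[i1 _] _].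
    by apply: g2; exact: leq_ltn_trans i1.
  rewrite -mulr_sumr -mulrA ler_wpM2l ?powR_ge0//.
  rewrite (le_trans (ler_wpM2l (powR_ge0 _ _) (sum_powRN_le N _ b01)))//.
  have -> : Y `^ a = Y `^ 2^-1 * Y `^ (- b).
    rewrite -powR_neq0_add//.
    by congr (_ `^ _); rewrite /a /b; field.
  rewrite mulrCA mulrC ler_wpM2r//; first by rewrite addr_ge0// invr_ge0 ltW.
  rewrite ler_wpM2l ?powR_ge0// !powRN lef_pV2 ?posrE ?powR_gt0//.
  by apply: ge0_ler_powR; rewrite ?nnegrE ?(ltW b0) ?(ltW Y0)// ltW.
have e : m%:R `^ (a - 1) * Y `^ a = m%:R^-1 * y `^ r.
  rewrite powR_sub1// mulrAC -powRM ?(ltW Y0)//.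
  rewrite /Y mulrC (mulrC m%:R) divfK ?gt_eqF// -powR_mulrn// -powRrM.
  by congr (_ * _ `^ _); rewrite /a; field.
rewrite (le_trans (lerD s1 s2))//.
have -> : 2 / r = a^-1 by rewrite /a invf_div.
have -> : 2 / (1 - r) = b^-1 by rewrite /b invf_div.
rewrite mulrA [X in _ + X]mulrA e.
by rewrite le_eqVlt; apply/orP; left; apply/eqP; ring.
Qed.

(** By [gmod_powR] the terms are of order i^{(r-p)/2}. This exponent exceeds -1 for r > p - 2 and
    equals -1 for r = p - 2; in the latter case r >= 1 forces r = 1 and p = 3. *)
Lemma gmod_sum p r : 2 < p <= 3 -> p - 2 <= r <= p -> (r = p - 2 -> r <= 1) ->
  exists C, 0 < C /\ forall m n K y, (0 < m)%N -> (K * m <= n)%N -> 0 <= y ->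
  \sum_(1 <= i < K.+1) gmod r (Num.sqrt (i * m)%:R) y <=
  C / m%:R * rate p r n * y `^ (p - 2).
Proof.
move=> /[dup] p23 /andP[p2 p3] /andP[r1 r2] _; rewrite /rate.
have [re|rn] := eqVneq r (p - 2).
  have [rl|rl] := ltP r 1.
    exists (2 / r + 1 + 2 / (1 - r)); split.
      by rewrite addr_gt0// ?addr_gt0// divr_gt0//; lra.
    move=> m n K y m0 Kn y0; rewrite mulr1 -re; apply: sum_eq => //.
    by rewrite rl andbT; lra.
  exists 1; split => // m n K y m0 Kn y0; rewrite mul1r.
  by apply: (@sum_log p) => //; lra.
exists (2 / (r + 2 - p)).
have rp : p - 2 < r by rewrite lt_neqAle eq_sym rn.
split; first by rewrite divr_gt0//; lra.
by move=> m n K y m0 Kn y0; apply: sum_gt => //; rewrite rp.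
Qed.

End modulus_sum.

(** * Moments of order p *)

Section power_inequalities.
Context (R : realType).
Implicit Types (a b x y p : R).

Lemma ge0_powR_mono x y p : 0 <= p -> 0 <= x -> x <= y -> x `^ p <= y `^ p.
Proof.
by move=> p0 x0 xy; apply: ge0_ler_powR => //; rewrite nnegrE// (le_trans x0).
Qed.

Lemma powR_sqr x : `|x| `^ 2 = x ^+ 2.
Proof. by rewrite powR_mulrn// real_normK ?num_real. Qed.

Lemma powR_mul_le p a b (al be : R) : 0 <= a -> 0 <= b -> 0 <= al -> 0 <= be ->
  al + be <= p -> a `^ al * b `^ be <= 1 + a `^ p + b `^ p.
Proof.
move=> a0 b0 al0 be0 abp.
wlog ab : a b al be a0 b0 al0 be0 abp / a <= b => [h|].
  have [/h|/ltW ba] := leP a b; first exact.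
  by rewrite mulrC addrAC; apply: h => //; rewrite addrC.
rewrite (@le_trans _ _ (1 + b `^ p))//; last by rewrite lerD2r lerDl powR_ge0.
apply: (@le_trans _ _ (b `^ al * b `^ be)).
  by rewrite ler_wpM2r ?powR_ge0// ge0_powR_mono.
have [b1|b1] := leP b 1.
  rewrite (@le_trans _ _ 1)//; last by rewrite lerDl powR_ge0.
  have h1 := ge0_powR_mono al0 b0 b1; have h2 := ge0_powR_mono be0 b0 b1.
  by rewrite !powR1 in h1 h2; rewrite -[leRHS]mulr1 ler_pM ?powR_ge0.
rewrite -powR_neq0_add ?(lt_trans ltr01)//.
rewrite (@le_trans _ _ (b `^ p))// ?lerDr//.
by apply: ler_powR => //; exact: ltW.
Qed.

Lemma powR_add_le p x y : 0 <= p <= 3 -> `|x + y| `^ p <= 8 * (`|x| `^ p + `|y| `^ p).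
Proof.
move=> /andP[p0 p3].
wlog xy : x y / `|x| <= `|y| => [h|].
  have [/h|/ltW/h] := leP `|x| `|y|; first exact.
  by rewrite addrC (addrC (`|y| `^ p)).
apply: (@le_trans _ _ ((2 * `|y|) `^ p)).
  apply: ge0_powR_mono => //; rewrite (le_trans (ler_normD _ _))//.
  by rewrite mulr_natl mulr2n lerD2r.
rewrite powRM// ler_pM ?powR_ge0//; last by rewrite lerDr powR_ge0.
rewrite (@le_trans _ _ (2 `^ 3%:R))//; first by apply: ler_powR => //; rewrite ler1n.
by rewrite powR_mulrn//; lra.
Qed.

(** For |y| <= |x|, write y = s x and (1 + s)^p = (1 + s)^{p-2} (1 + s)^2, and bound the first
    factor by Bernoulli: the result is at most 1 + p s + 4 s^2. For |y| > |x| the left side is at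
    most 8 |y|^p and the linear term at least - 3 |y|^p, which explains 11. *)
Lemma powR_taylor p x y : 2 <= p <= 3 ->
  `|x + y| `^ p <= `|x| `^ p + p * `|x| `^ (p - 2) * x * y
    + 11 * (`|x| `^ (p - 2) * y ^+ 2 + `|y| `^ p).
Proof.
move=> /andP[p2 p3].
have x2 : 0 <= `|x| `^ (p - 2) by exact: powR_ge0.
have yp : 0 <= `|y| `^ p by exact: powR_ge0.
have xp : 0 <= `|x| `^ p by exact: powR_ge0.
have [yx|xy] := leP `|y| `|x|.
  have [x0|x0] := eqVneq x 0.
    rewrite x0 normr0 normr_le0 in yx; rewrite (eqP yx) x0 !addr0 normr0 !(mulr0, mul0r, expr0n)/=.
    by rewrite add0r addr0 lerDl mulr_ge0// powR_ge0.
  have ax : 0 < `|x| by rewrite normr_gt0.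
  set s := y / x.
  have s1 : `|s| <= 1 by rewrite /s normrM normfV ler_pdivrMr// mul1r.
  have s1' : 0 <= 1 + s by move: s1; rewrite ler_norml => /andP[+ _]; lra.
  have -> : x + y = x * (1 + s) by rewrite /s; field.
  have -> : y = x * s by rewrite /s; field.
  rewrite normrM powRM// (ger0_norm s1').
  have xE : `|x| `^ p = `|x| `^ (p - 2) * x ^+ 2.
    by rewrite -powR_sqr -powR_neq0_add// subrK.
  have sE : (1 + s) `^ p <= 1 + p * s + 4 * s ^+ 2.
    have := @powR_bernoulli R (p - 2) (1 + s); rewrite addrAC subrr add0r.
    have -> : 0 <= p - 2 <= 1 by apply/andP; split; lra.
    move=> /(_ erefl s1') h.
    have [e|e] := eqVneq (1 + s) 0.
      rewrite e powR0; last by rewrite gt_eqF//; lra.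
      by rewrite (_ : s = -1); [lra|lra].
    have -> : (1 + s) `^ p = (1 + s) `^ (p - 2) * (1 + s) ^+ 2.
      by rewrite -powR_mulrn// -powR_neq0_add ?subrK// lt_neqAle eq_sym e.
    rewrite (le_trans (ler_wpM2r (sqr_ge0 _) h))//.
    have s3 : s ^+ 3 <= s ^+ 2.
      rewrite exprS; apply: ler_piMl; first exact: sqr_ge0.
      by rewrite (le_trans (ler_norm _)).
    have s2 : 0 <= s ^+ 2 by exact: sqr_ge0.
    have a1 : (p - 2) * s ^+ 3 <= (p - 2) * s ^+ 2 by rewrite ler_wpM2l//; lra.
    have a2 : (p - 2) * s ^+ 2 <= 1 * s ^+ 2 by rewrite ler_wpM2r//; lra.
    by lra.
  rewrite xE.
  have P : 0 <= `|x| `^ (p - 2) * x ^+ 2 by rewrite mulr_ge0// sqr_ge0.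
  have Q : 0 <= `|x * s| `^ p by exact: powR_ge0.
  have := ler_wpM2l P sE.
  have : 0 <= `|x| `^ (p - 2) * x ^+ 2 * s ^+ 2 by rewrite mulr_ge0// sqr_ge0.
  by lra.
have y0 : 0 < `|y| by rewrite (le_lt_trans _ xy).
have h1 : `|x + y| `^ p <= 8 * `|y| `^ p.
  apply: (@le_trans _ _ ((2 * `|y|) `^ p)).
    apply: ge0_powR_mono => //; first by lra.
    by rewrite (le_trans (ler_normD _ _))// mulr_natl mulr2n lerD2r ltW.
  rewrite powRM// ler_wpM2r//.
  rewrite (@le_trans _ _ (2 `^ 3%:R))//; first by apply: ler_powR => //; rewrite ler1n.
  by rewrite powR_mulrn//; lra.
have h2 : - (3 * `|y| `^ p) <= p * `|x| `^ (p - 2) * x * y.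
  apply: (@le_trans _ _ (- `|p * `|x| `^ (p - 2) * x * y|)); last first.
    by move: (_ * y) => u; have := lexx `|u|; rewrite {1}ler_norml => /andP[].
  rewrite lerN2 !normrM (ger0_norm x2) (ger0_norm (_ : 0 <= p)); last by lra.
  rewrite -!mulrA ler_pM ?mulr_ge0//; first by lra.
  have -> : `|y| `^ p = `|y| `^ (p - 2) * (`|y| * `|y|).
    by rewrite -expr2 -powR_mulrn// -powR_neq0_add// subrK.
  rewrite ler_pM ?mulr_ge0//; last by rewrite ler_wpM2r// ltW.
  by apply: ge0_powR_mono => //; [lra|exact: ltW].
have : 0 <= `|x| `^ (p - 2) * y ^+ 2 by rewrite mulr_ge0// sqr_ge0.
by lra.
Qed.

(** In (s + v)^q = s (s + v)^{q-1} + v (s + v)^{q-1} the last term is at least v s^{q-1} and at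
    least v^q, hence at least their mean. *)
Lemma powR_superadd (q s v : R) : 1 <= q -> 0 <= s -> 0 <= v ->
  s `^ q + 2^-1 * (s `^ (q - 1) * v + v `^ q) <= (s + v) `^ q.
Proof.
move=> q1 s0 v0.
have E u : 0 <= u -> u `^ q = u * u `^ (q - 1) by move=> u0; rewrite mulr_powRB1//; lra.
rewrite (E (s + v)) ?addr_ge0// (E s)// (E v)// mulrDl.
have a1 : s `^ (q - 1) <= (s + v) `^ (q - 1) by apply: ge0_powR_mono; rewrite ?lerDl//; lra.
have a2 : v `^ (q - 1) <= (s + v) `^ (q - 1) by apply: ge0_powR_mono; rewrite ?lerDr//; lra.
have := ler_wpM2l s0 a1; have := ler_wpM2l v0 a1; have := ler_wpM2l v0 a2.
by lra.
Qed.

End power_inequalities.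

(** * Functions with a moment of order p *)

Section Lp.
Context d (T : measurableType d) (R : realType) (P : probability T R) (p : R).
Hypothesis p23 : 2 < p <= 3.
Implicit Types f g h : T -> R.

Definition Lp f := measurable_fun [set: T] f /\ L1 P (fun w => `|f w| `^ p).
Definition Np f := Ex P (fun w => `|f w| `^ p).

Let p0 : 0 < p. Proof. by case/andP : p23 => p2 _; lra. Qed.
Let p03 : 0 <= p <= 3. Proof. by case/andP : p23 => p2 p3; apply/andP; split; lra. Qed.

Lemma Np_ge0 f : 0 <= Np f.
Proof. by apply: Ex_ge0 => w; exact: powR_ge0. Qed.

Lemma LpD f g : Lp f -> Lp g -> Lp (fun w => f w + g w).
Proof.
move=> [mf pf] [mg pg]; split; first exact: measurable_funD.
apply: (L1_dom _ (L1Z 8 (L1D pf pg))) => [|w].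
  by apply: measurable_powRf; apply: measurableT_comp => //; exact: measurable_funD.
by rewrite ger0_norm ?powR_ge0// powR_add_le.
Qed.

Lemma LpZ c f : Lp f -> Lp (fun w => c * f w).
Proof.
move=> [mf pf]; split; first exact: measurable_funM.
by apply: eq_L1 (L1Z (`|c| `^ p) pf) => w; rewrite normrM powRM.
Qed.

Lemma Np_scale c f : Lp f -> Np (fun w => c * f w) = `|c| `^ p * Np f.
Proof.
move=> [mf pf]; rewrite -ExZ//; apply: eq_Ex => w.
by rewrite normrM powRM.
Qed.

Lemma LpN f : Lp f -> Lp (fun w => - f w).
Proof. by move=> /(LpZ (-1)); under eq_fun do rewrite mulN1r. Qed.

Lemma LpB f g : Lp f -> Lp g -> Lp (fun w => f w - g w).
Proof. by move=> f1 /LpN; exact: LpD. Qed.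

Lemma Lp_cst c : Lp (fun=> c).
Proof. by split => //; exact: L1_cst. Qed.

Lemma Lp_sum I (s : seq I) (F : I -> T -> R) : (forall i, Lp (F i)) ->
  Lp (fun w => \sum_(i <- s) F i w).
Proof.
move=> iF; elim: s => [|i s IH].
  by have := Lp_cst 0; congr Lp; apply/funext => x; rewrite big_nil.
have := LpD (iF i) IH; congr Lp.
by apply/funext => x; rewrite big_cons.
Qed.

Lemma L1_prod f g h (al be C : R) : Lp f -> Lp g -> 0 <= al -> 0 <= be ->
  al + be <= p -> measurable_fun [set: T] h ->
  (forall w, `|h w| <= C * (`|f w| `^ al * `|g w| `^ be)) -> L1 P h.
Proof.
move=> [mf pf] [mg pg] al0 be0 abp mh hC.
apply: (L1_dom mh (L1Z `|C| (L1D (L1D (L1_cst P 1) pf) pg))) => w.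
rewrite (le_trans (hC w))// (@le_trans _ _ (`|C| * (`|f w| `^ al * `|g w| `^ be)))//.
  by rewrite ler_wpM2r ?ler_norm// mulr_ge0 ?powR_ge0.
by rewrite ler_wpM2l// powR_mul_le.
Qed.

Lemma L1_pow f al : Lp f -> 0 <= al <= p -> L1 P (fun w => `|f w| `^ al).
Proof.
move=> pf /andP[al0 alp].
apply: (L1_prod (C := 1) pf (Lp_cst 1) al0 (lexx 0)); rewrite ?addr0//.
  by apply: measurable_powRf; apply: measurableT_comp => //; exact: pf.1.
by move=> w; rewrite normr1 powR1 mulr1 mul1r ger0_norm ?powR_ge0.
Qed.

Lemma Lp_L1 f : Lp f -> L1 P f.
Proof.
move=> pf; apply: (L1_dom pf.1 (L1_pow (al := 1) pf _)).
  by case/andP : p23 => p2 _; apply/andP; split; lra.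
by move=> w; rewrite powRr1.
Qed.

Lemma Lp_sqr f : Lp f -> L1 P (fun w => f w ^+ 2).
Proof.
move=> pf; apply: (eq_L1 _ (L1_pow (al := 2) pf _)).
  by move=> w; rewrite powR_sqr.
by case/andP : p23 => p2 _; apply/andP; split; lra.
Qed.

Lemma Lp_mul f g : Lp f -> Lp g -> L1 P (fun w => f w * g w).
Proof.
move=> pf pg; apply: (@L1_prod f g _ 1 1 1) => //.
- by case/andP : p23 => p2 _; lra.
- by apply: measurable_funM; [exact: pf.1|exact: pg.1].
- by move=> w; rewrite !powRr1// mul1r normrM.
Qed.

Lemma Ex_pow_le f al : Lp f -> 0 < al <= p ->
  Ex P (fun w => `|f w| `^ al) <= Np f `^ (al / p).
Proof.
move=> pf /andP[al0 alp].
have [->|alnp] := eqVneq al p; first by rewrite divff ?gt_eqF// powRr1 ?Np_ge0.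
have t01 : 0 < al / p < 1 by rewrite divr_gt0//= ltr_pdivrMr// mul1r lt_neqAle alnp.
have [_] := @holder_Ex _ _ _ P (fun w => `|f w| `^ p) (fun=> 1) _ t01
  (fun w => powR_ge0 _ _) (fun=> ler01) pf.2 (L1_cst P 1).
rewrite Ex_cst powR1 mulr1; apply: le_trans.
rewrite le_eqVlt; apply/orP; left; apply/eqP; apply: eq_Ex => w.
by rewrite mulr1 -powRrM mulrCA divff ?gt_eqF// mulr1.
Qed.

Lemma Ex_prod_le f g al be : Lp f -> Lp g -> 0 < al -> 0 < be -> al + be = p ->
  Ex P (fun w => `|f w| `^ al * `|g w| `^ be) <= Np f `^ (al / p) * Np g `^ (be / p).
Proof.
move=> pf pg al0 be0 e.
have t01 : 0 < al / p < 1 by rewrite divr_gt0//= ltr_pdivrMr// mul1r; lra.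
have e1 : 1 - al / p = be / p by rewrite -e; field; rewrite gt_eqF// e.
have [_] := @holder_Ex _ _ _ P (fun w => `|f w| `^ p) (fun w => `|g w| `^ p) _ t01
  (fun w => powR_ge0 _ _) (fun w => powR_ge0 _ _) pf.2 pg.2.
rewrite e1; apply: le_trans.
rewrite le_eqVlt; apply/orP; left; apply/eqP; apply: eq_Ex => w.
by rewrite -!powRrM !(mulrCA p) !divff ?gt_eqF// !mulr1.
Qed.

End Lp.

Lemma powR_inv (R : realType) (a e : R) : 0 <= a -> a^-1 `^ e = (a `^ e)^-1.
Proof.
by move=> a0; rewrite -powR_inv1// -powRrM mulrC powRrM powR_inv1// powR_ge0.
Qed.

Lemma powR_sqrV_le (R : realType) (B q : R) : 1 <= B -> 2^-1 <= q ->
  (B ^+ 2)^-1 `^ q <= B^-1.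
Proof.
move=> B1 q1; have B0 : 0 < B by rewrite (lt_le_trans ltr01).
rewrite powR_inv ?exprn_ge0 ?(ltW B0)// lef_pV2 ?posrE ?powR_gt0 ?exprn_gt0//.
rewrite -powR_mulrn ?(ltW B0)// -powRrM -[leLHS]powRr1 ?(ltW B0)//.
by apply: ler_powR => //; lra.
Qed.

(** Here E is the moment of one increment, N that of the partial sum, s the sum of the squared
    coefficients so far and v the next squared coefficient. The choice B = 2 * 11 makes each error
    term at most one half of a quantity that [powR_superadd] provides with the factor 1/2. The power
    (B^2)^{-2/p} <= B^{-1} requires p <= 4. *)
Lemma burkholder_step (R : realType) (p B E N s v : R) : 2 < p <= 3 -> B = 22 ->
  0 <= E -> 0 <= N -> 0 <= s -> 0 <= v -> N <= B ^+ 2 * E * s `^ (p / 2) ->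
  N + 11 * (N `^ ((p - 2) / p) * (v * E `^ (2 / p)) + v `^ (p / 2) * E) <=
  B ^+ 2 * E * (s + v) `^ (p / 2).
Proof.
move=> /andP[p2 p3] BE E0 N0 s0 v0 ih.
have B0 : 0 < B by rewrite BE ltr0n.
have B1 : 1 <= B by rewrite BE ler1n.
have B20 : 0 < B ^+ 2 by rewrite exprn_gt0.
have pn0 : p != 0 by rewrite gt_eqF//; lra.
set K := B ^+ 2 * E in ih *.
have K0 : 0 <= K by exact: mulr_ge0 (ltW B20) E0.
have KE : E = K / B ^+ 2 by rewrite /K mulrC mulKf// gt_eqF.
clearbody K.
have q0 : 0 <= (p - 2) / p by rewrite divr_ge0//; lra.
have a1 : N `^ ((p - 2) / p) <= K `^ ((p - 2) / p) * s `^ (p / 2 - 1).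
  rewrite (le_trans (ge0_powR_mono q0 N0 ih))// powRM ?powR_ge0// -powRrM.
  rewrite le_eqVlt; apply/orP; left; apply/eqP; congr (_ * _ `^ _).
  by field; rewrite pn0.
have a2 : E `^ (2 / p) <= K `^ (2 / p) / B.
  rewrite KE powRM ?invr_ge0 ?(ltW B20)//.
  apply: ler_wpM2l; first exact: powR_ge0.
  by apply: powR_sqrV_le => //; rewrite ler_pdivlMr//; lra.
have KK : K `^ ((p - 2) / p) * K `^ (2 / p) = K.
  rewrite -powRD; last by rewrite -mulrDl subrK divff// oner_eq0.
  by rewrite -mulrDl subrK divff ?powRr1.
have a3 : N `^ ((p - 2) / p) * (v * E `^ (2 / p)) <= K / B * (s `^ (p / 2 - 1) * v).
  have -> : K / B * (s `^ (p / 2 - 1) * v) =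
      K `^ ((p - 2) / p) * s `^ (p / 2 - 1) * (v * (K `^ (2 / p) / B)).
    by rewrite -{1}KK; ring.
  apply: ler_pM => //; [exact: powR_ge0|by rewrite mulr_ge0 ?powR_ge0|].
  exact: ler_wpM2l.
have qq : 1 <= p / 2 by lra.
have sup := ler_wpM2l K0 (powR_superadd qq s0 v0).
have w0 : 0 <= K * v `^ (p / 2) by rewrite mulr_ge0 ?powR_ge0.
have u0 : 0 <= K * (s `^ (p / 2 - 1) * v) by rewrite !mulr_ge0 ?powR_ge0.
have a4 : v `^ (p / 2) * E <= K * v `^ (p / 2) / B.
  have -> : v `^ (p / 2) * E = K * v `^ (p / 2) / B ^+ 2 by rewrite KE; ring.
  rewrite ler_wpM2l// lef_pV2 ?posrE//.
  by rewrite expr2; apply: ler_peMl; rewrite ?(ltW B0).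
have e1 : 11 * (K / B * (s `^ (p / 2 - 1) * v)) = 2^-1 * (K * (s `^ (p / 2 - 1) * v)).
  by rewrite BE; field.
have e2 : 11 * (K * v `^ (p / 2) / B) = 2^-1 * (K * v `^ (p / 2)).
  by rewrite BE; field.
clear BE KE KK a1 a2; move: ih a3 sup a4 e1 e2; lra.
Qed.

(** Counted from the right, block j of length m starts at n - (j+1) m. Blocks 2 i and 2 i + 1
    together form block i of length 2 m; the last clause separates a true starting point of the
    earlier one from a truncated one. *)
Lemma dyadic_blocks n m i : (0 < n)%N -> (0 < m)%N ->
  [/\ (n - i.*2.+1 * m < n)%N, (n - i.*2.+2 * m < n)%N,
      (n - i.*2.+2 * m <= n - i.*2.+1 * m)%N,
      (n - i.+1 * (m + m) = n - i.*2.+2 * m)%N &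
      ((i.*2.+2 * m <= n)%N -> (n - i.*2.+1 * m = m + (n - i.*2.+2 * m))%N) /\
      ((n <= i.*2.+2 * m)%N -> (n - i.*2.+2 * m = 0)%N)].
Proof.
move=> n0 m0; rewrite -muln2 !mulSn.
have -> : (i * (m + m) = i * 2 * m)%N by rewrite addnn -mul2n mulnA.
move: (i * 2 * m)%N => q.
by split; try split; lia.
Qed.

Lemma dyadic_times n m i : (0 < m)%N -> (i.*2.+2 * m <= n)%N ->
  [/\ (0 < i.*2.+1 * m)%N, (n - (n - i.*2.+1 * m) = i.*2.+1 * m)%N &
      (n - (n - i.*2.+2 * m) = i.*2.+1 * m + m)%N].
Proof.
by move=> m0; rewrite !mulSn; move: (i.*2 * m)%N => q h; split; lia.
Qed.

Lemma sum_double (V : nmodType) (F : nat -> V) K :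
  \sum_(0 <= j < K.*2) F j = \sum_(0 <= i < K) (F i.*2 + F i.*2.+1).
Proof.
elim: K => [|K IH]; first by rewrite !big_geq.
by rewrite doubleS !big_nat_recr//= IH addrA.
Qed.

Lemma sum_odd_le (R : realType) (F : nat -> R) K : (forall j, 0 <= F j) ->
  \sum_(0 <= i < K) F i.*2.+1 <= \sum_(1 <= j < K.*2.+1) F j.
Proof.
move=> F0; rewrite big_add1/= (sum_double (fun j => F j.+1)).
by apply: ler_sum => i _; rewrite lerDl.
Qed.

(** * Martingales *)

Section martingale.
Context d (T : measurableType d) (R : realType) (P : probability T R).
Variables (tau : T -> T).
Hypothesis mtau : measurable_fun [set: T] tau.
Hypothesis mp : forall B, measurable B -> P (tau @^-1` B) = P B.
Variable F0 : set (set T).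
Hypothesis sF : sigma_algebra [set: T] F0.
Hypothesis Fm : F0 `<=` measurable.
Hypothesis Finc : F0 `<=` preimage_set_system [set: T] tau F0.

Definition Fk k := preimage_set_system [set: T] (iter k tau) F0.

Lemma iter_measurable k : measurable_fun [set: T] (iter k tau).
Proof.
elim: k => [|k ih]; first exact: measurable_id.
exact: (measurableT_comp mtau ih).
Qed.

Lemma iter_mp k B : measurable B -> P (iter k tau @^-1` B) = P B.
Proof.
move=> mB; elim: k => [|k ih]; first by rewrite preimage_id.
have -> : iter k.+1 tau @^-1` B = tau @^-1` (iter k tau @^-1` B).
  by apply/seteqP; split => w; rewrite /= -iterSr.
rewrite mp// -[X in measurable X]setTI; exact: iter_measurable.
Qed.

Lemma Fk0 : Fk 0 = F0.
Proof.
apply/seteqP; split => [B [C FC <-]|B FB]; first by rewrite setTI preimage_id.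
by exists B => //; rewrite setTI preimage_id.
Qed.

Lemma sigma_Fk k : sigma_algebra [set: T] (Fk k).
Proof. exact: sigma_algebra_preimage. Qed.

Lemma Fk_measurable k : Fk k `<=` measurable.
Proof. by move=> _ [B FB <-]; apply: iter_measurable => //; exact: Fm. Qed.

Lemma Fk_le k l : (k <= l)%N -> Fk k `<=` Fk l.
Proof.
move=> /subnK <-; elim: (l - k)%N => [//|n ih] B /ih [C FC <-].
have [D FD DC] := Finc FC; exists D => //.
by rewrite -DC !setTI; apply/seteqP; split => w.
Qed.

Lemma meas_wrt_le k l (Y : T -> R) : (k <= l)%N -> meas_wrt (Fk k) Y -> meas_wrt (Fk l) Y.
Proof.
by move=> kl /(meas_wrtP (sigma_Fk k)) h; apply/(meas_wrtP (sigma_Fk l)) => B /h; exact: Fk_le.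
Qed.

Lemma meas_wrt_comp k s (Y : T -> R) : meas_wrt (Fk k) Y -> meas_wrt (Fk (k + s)) (Y \o iter s tau).
Proof.
move=> /(meas_wrtP (sigma_Fk k)) h; apply/(meas_wrtP (sigma_Fk (k + s))) => _ [B mB <-].
have [C FC CY] := h (Y @^-1` B) (ex_intro2 _ _ B mB (setTI _)).
exists C => //; rewrite !setTI in CY *.
rewrite comp_preimage -CY -comp_preimage.
by apply/seteqP; split => w /=; rewrite iterD.
Qed.

Lemma meas_wrt_comp0 s (Y : T -> R) : meas_wrt F0 Y -> meas_wrt (Fk s) (Y \o iter s tau).
Proof. by rewrite -{1}Fk0 => h; exact: (@meas_wrt_comp 0 s). Qed.

Lemma L1_iter k (f : T -> R) : L1 P f -> L1 P (f \o iter k tau).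
Proof. by apply: (L1_mp (iter_measurable k)) => B mB; exact: iter_mp. Qed.

Lemma Ex_iter k (f : T -> R) : L1 P f -> Ex P (f \o iter k tau) = Ex P f.
Proof. by apply: (Ex_mp (iter_measurable k)) => B mB; exact: iter_mp. Qed.

Lemma Rint_iter k (W : T -> R) : L1 P W -> (forall B, F0 B -> Rintegral P B W = 0) ->
  forall B, Fk k B -> Rintegral P B (W \o iter k tau) = 0.
Proof.
move=> iW W0 _ [C FC <-]; rewrite setTI.
rewrite (Ex_mp_set (iter_measurable k) _ (Fm FC) iW) ?W0//.
by move=> B mB; exact: iter_mp.
Qed.

Lemma Ex_pull k (W Y : T -> R) : L1 P W -> (forall B, F0 B -> Rintegral P B W = 0) ->
  meas_wrt (Fk k) Y -> L1 P (fun w => Y w * W (iter k tau w)) ->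
  Ex P (fun w => Y w * W (iter k tau w)) = 0.
Proof.
move=> iW W0 mY iYW.
apply: (Ex_pullout (sigma_Fk k) (@Fk_measurable k) (W := W \o iter k tau)) => //.
  exact: L1_iter.
exact: Rint_iter.
Qed.

Variables (p : R) (e0 : T -> R).
Hypothesis p23 : 2 < p <= 3.
Hypothesis me0 : meas_wrt F0 e0.
Hypothesis pe0 : Lp P p e0.
Hypothesis mds : forall B, F0 B -> Rintegral P B (e0 \o tau) = 0.

Definition eps k := e0 \o iter k tau.
Definition wsum (c : nat -> R) n w := \sum_(0 <= j < n) c j * eps j.+1 w.

Let p2 : 2 < p. Proof. by case/andP : p23. Qed.
Let p3 : p <= 3. Proof. by case/andP : p23. Qed.
Let p0 : 0 < p. Proof. by move: p2; lra. Qed.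
Let ph0 : 0 < p / 2. Proof. by move: p2; lra. Qed.
Let ph : p / 2 != 0. Proof. by rewrite gt_eqF. Qed.
Let pn0 : p != 0. Proof. by rewrite gt_eqF. Qed.
Let p2_ge0 : 0 <= (p - 2) / p. Proof. by move: p2 => ?; rewrite divr_ge0//; lra. Qed.

Lemma Lp_iter k f : Lp P p f -> Lp P p (f \o iter k tau).
Proof.
move=> [mf pf]; split; first exact: (measurableT_comp mf (iter_measurable k)).
exact: (L1_iter k pf).
Qed.

Lemma Np_iter k f : Lp P p f -> Np P p (f \o iter k tau) = Np P p f.
Proof. by move=> [mf pf]; exact: (Ex_iter k pf). Qed.

Lemma Lp_eps k : Lp P p (eps k).
Proof. exact: Lp_iter. Qed.

Lemma meas_wrt_eps k l : (k <= l)%N -> meas_wrt (Fk l) (eps k).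
Proof. by move=> kl; apply: (meas_wrt_le kl); exact: meas_wrt_comp0. Qed.

Lemma meas_wrt_wsum c n l : (n <= l)%N -> meas_wrt (Fk l) (wsum c n).
Proof.
move=> nl; rewrite /wsum /meas_wrt.
elim: n nl => [|n ih] nl.
  rewrite (_ : (fun w => _) = fun=> 0)//.
  by apply/funext => w; rewrite big_geq.
under eq_fun do rewrite big_nat_recr//=.
apply: measurable_funD; first exact: ih (ltnW nl).
by apply: measurable_funM => //; exact: meas_wrt_eps.
Qed.

Lemma Lp_wsum c n : Lp P p (wsum c n).
Proof. by apply: (Lp_sum p23) => j; apply: LpZ; exact: Lp_eps. Qed.

Lemma Ex_mds k Y : meas_wrt (Fk k) Y -> L1 P (fun w => Y w * eps k.+1 w) ->
  Ex P (fun w => Y w * eps k.+1 w) = 0.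
Proof.
move=> mY iY; have e w : eps k.+1 w = (e0 \o tau) (iter k tau w) by rewrite /eps /= -iterS.
have -> : (fun w => Y w * eps k.+1 w) = (fun w => Y w * (e0 \o tau) (iter k tau w)).
  by apply/funext => w; rewrite e.
apply: (@Ex_pull k (e0 \o tau)) => //; first exact: (L1_iter 1 (Lp_L1 p23 pe0)).
Qed.

(** Burkholder's inequality by induction on n. Expanding |S + D|^p around the previous sum S with
    [powR_taylor], the linear term is centred by the martingale property, and Hölder's inequality
    bounds |S|^{p-2} D^2. Weights are needed because the inequality serves both M_n and R_n. *)
Lemma wsum_Np_le c n :
  Np P p (wsum c n) <= 22 ^+ 2 * Np P p e0 * (\sum_(0 <= j < n) c j ^+ 2) `^ (p / 2).
Proof.
have q2 := p2; have q3 := p3; have pt : 2 <= p <= 3 by apply/andP; split; lra.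
have [E [EE E0]] : exists E, Np P p e0 = E /\ 0 <= E by exists (Np P p e0); rewrite Np_ge0.
have [B BE] : exists B : R, B = 22 by eexists.
rewrite EE -BE.
elim: n => [|n ih].
  rewrite [X in X `^ _]big_geq// (powR0 ph) mulr0.
  rewrite /Np (_ : (fun w => _) = fun=> 0) ?Ex_cst//.
  by apply/funext => w; rewrite /wsum big_geq// normr0 powR0.
rewrite big_nat_recr//=; set s := \sum_(0 <= j < n) _ in ih *; set v := c n ^+ 2.
have s0 : 0 <= s by apply: sumr_ge0 => j _; exact: sqr_ge0.
have v0 : 0 <= v by exact: sqr_ge0.
pose S := wsum c n; pose D w := c n * eps n.+1 w.
have pS : Lp P p S by exact: Lp_wsum.
have pD : Lp P p D by apply: LpZ; exact: Lp_eps.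
have i1 : L1 P (fun w => (p * `|S w| `^ (p - 2) * S w * c n) * eps n.+1 w).
  apply: (L1_prod (al := p - 1) (be := 1) (C := p * `|c n|) pS (Lp_eps n.+1)).
  - by rewrite subr_ge0 ltW// (lt_trans _ p2)// ltr1n.
  - by [].
  - by rewrite subrK.
  - apply: measurable_funM; last exact: (Lp_eps n.+1).1.
    apply: measurable_funM => //; apply: measurable_funM; last exact: pS.1.
    apply: measurable_funM => //; apply: measurable_powRf.
    by apply: measurableT_comp => //; exact: pS.1.
  - move=> w; rewrite !normrM (ger0_norm (powR_ge0 _ _)) (ger0_norm (ltW p0)).
    rewrite powRr1// le_eqVlt; apply/orP; left; apply/eqP.
    have -> : `|S w| `^ (p - 1) = `|S w| * `|S w| `^ (p - 1 - 1).
      by rewrite mulr_powRB1// subr_gt0 (lt_trans _ p2)// ltr1n.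
    have -> : p - 1 - 1 = p - 2 by ring.
    by ring.
have i2 : L1 P (fun w => `|S w| `^ (p - 2) * D w ^+ 2).
  apply: (L1_prod (al := p - 2) (be := 2) (C := 1) pS pD).
  - by rewrite subr_ge0 ltW.
  - by [].
  - by rewrite subrK.
  - apply: measurable_funM; first by apply: measurable_powRf; apply: measurableT_comp => //; exact: pS.1.
    by apply: measurable_funX; exact: pD.1.
  - by move=> w; rewrite mul1r normrM (ger0_norm (powR_ge0 _ _)) powR_sqr normrX real_normK ?num_real.
have z1 : Ex P (fun w => (p * `|S w| `^ (p - 2) * S w * c n) * eps n.+1 w) = 0.
  apply: Ex_mds => //.
  have mS : meas_wrt (Fk n) S by exact: meas_wrt_wsum.
  rewrite /meas_wrt in mS *; apply: measurable_funM => //; apply: measurable_funM => //.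
  apply: measurable_funM => //; apply: measurable_powRf.
  exact: measurableT_comp.
have b2 : Ex P (fun w => `|S w| `^ (p - 2) * D w ^+ 2) <=
    Np P p S `^ ((p - 2) / p) * (v * E `^ (2 / p)).
  have e2 : Np P p D `^ (2 / p) = v * E `^ (2 / p).
    rewrite Np_scale; last exact: Lp_eps.
    by rewrite Np_iter// EE powRM ?powR_ge0// -powRrM mulrCA divff ?mulr1 ?powR_sqr.
  rewrite -e2 (_ : (fun w => _) = (fun w => `|S w| `^ (p - 2) * `|D w| `^ 2)).
    by apply: (Ex_prod_le p23 pS pD); [rewrite subr_gt0|rewrite ltr0n|rewrite subrK].
  by apply/funext => w; rewrite powR_sqr.
have b3 : Np P p D = v `^ (p / 2) * E.
  rewrite Np_scale; last exact: Lp_eps.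
  rewrite Np_iter// EE; congr (_ * _); rewrite /v -powR_sqr -powRrM.
  by congr (_ `^ _); field.
have step : Np P p (wsum c n.+1) <= Np P p S + 11 *
    (Np P p S `^ ((p - 2) / p) * (v * E `^ (2 / p)) + v `^ (p / 2) * E).
  have i12 := L1D i2 pD.2.
  have i0 := L1D pS.2 i1.
  apply: (@le_trans _ _ (Ex P (fun w => `|S w| `^ p + (p * `|S w| `^ (p - 2) * S w * c n) * eps n.+1 w
     + 11 * (`|S w| `^ (p - 2) * D w ^+ 2 + `|D w| `^ p)))).
    apply: le_Ex; [exact: (Lp_wsum c n.+1).2|exact: L1D i0 (L1Z 11 i12)|].
    move=> w; have -> : wsum c n.+1 w = S w + D w by rewrite /wsum big_nat_recr.
    apply: (le_trans (powR_taylor (S w) (D w) pt)).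
    have -> : p * `|S w| `^ (p - 2) * S w * D w =
        p * `|S w| `^ (p - 2) * S w * c n * eps n.+1 w by exact: mulrA.
    exact: lexx.
  rewrite (ExD i0 (L1Z 11 i12)) (ExD pS.2 i1) z1 addr0 lerD2l (ExZ 11 i12) ler_wpM2l//.
  by rewrite (ExD i2 pD.2) -/(Np P p D) b3 lerD2r.
by rewrite (le_trans step)//; apply: burkholder_step => //; exact: Np_ge0.
Qed.

Definition pgrowth a (g : R -> R) := continuous g /\
  exists C, 0 <= C /\ forall x, `|g x| <= C * (1 + `|x| `^ a).

Lemma pgrowth_measurable a g (Y : T -> R) : pgrowth a g -> measurable_fun [set: T] Y ->
  measurable_fun [set: T] (fun w => g (Y w)).
Proof. by move=> [cg _] mY; apply: (measurableT_comp (continuous_measurable_fun cg) mY). Qed.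

Lemma pgrowth_meas_wrt a g F (Y : T -> R) : pgrowth a g -> meas_wrt F Y -> meas_wrt F (fun w => g (Y w)).
Proof.
move=> [cg _] mY; rewrite /meas_wrt.
exact: (measurableT_comp (continuous_measurable_fun cg) mY).
Qed.

Lemma L1_pgrowth a b g (Y X h : T -> R) : pgrowth a g -> 0 <= a -> 0 <= b -> a + b <= p ->
  Lp P p Y -> Lp P p X -> measurable_fun [set: T] h ->
  (forall w, `|h w| <= `|X w| `^ b) -> L1 P (fun w => g (Y w) * h w).
Proof.
move=> gg a0 b0 abp pY pX mh hX.
have [cg [C [C0 gC]]] := gg.
have mX : measurable_fun [set: T] (fun w => `|X w| `^ b).
  by apply: measurable_powRf; apply: measurableT_comp => //; exact: pX.1.
have mY : measurable_fun [set: T] (fun w => `|Y w| `^ a).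
  by apply: measurable_powRf; apply: measurableT_comp => //; exact: pY.1.
have i1 : L1 P (fun w => `|X w| `^ b) by apply: (L1_pow pX); apply/andP; split; lra.
have i2 : L1 P (fun w => `|Y w| `^ a * `|X w| `^ b).
  apply: (L1_prod (al := a) (be := b) (C := 1) pY pX) => //.
    exact: measurable_funM.
  by move=> w; rewrite mul1r ger0_norm// mulr_ge0 ?powR_ge0.
apply: (L1_dom _ (L1Z C (L1D i1 i2))).
  by apply: measurable_funM => //; apply: (pgrowth_measurable gg); exact: pY.1.
move=> w; rewrite normrM -[X in _ <= C * (X + _)]mul1r -mulrDl mulrA.
by apply: ler_pM.
Qed.

Definition M n w := \sum_(0 <= j < n) eps j.+1 w.
Definition Q n w := \sum_(0 <= j < n) (eps j.+1 w ^+ 2 - 1).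

Lemma M_wsum n : M n = wsum (fun=> 1) n.
Proof. by apply/funext => w; apply: eq_bigr => j _; rewrite mul1r. Qed.

Lemma Lp_M n : Lp P p (M n).
Proof. by rewrite M_wsum; exact: Lp_wsum. Qed.

Lemma meas_wrt_M n l : (n <= l)%N -> meas_wrt (Fk l) (M n).
Proof. by rewrite M_wsum; exact: meas_wrt_wsum. Qed.

Lemma Np_M n : Np P p (M n) <= 22 ^+ 2 * Np P p e0 * n%:R `^ (p / 2).
Proof.
rewrite M_wsum; have := wsum_Np_le (fun=> 1) n.
by rewrite expr1n sumr_const_nat subn0.
Qed.

Lemma eps_add k j w : eps (k + j) w = eps j (iter k tau w).
Proof. by rewrite /eps/= addnC iterD. Qed.

Lemma M_add k m w : M (k + m) w = M k w + M m (iter k tau w).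
Proof.
rewrite /M (@big_cat_nat _ _ _ k)//= ?leq_addr//; congr (_ + _).
rewrite -{1}[k]add0n big_addn addKn; apply: eq_bigr => j _.
by rewrite -eps_add addnS addnC.
Qed.

Lemma Q_add k m w : Q (k + m) w = Q k w + Q m (iter k tau w).
Proof.
rewrite /Q (@big_cat_nat _ _ _ k)//= ?leq_addr//; congr (_ + _).
rewrite -{1}[k]add0n big_addn addKn; apply: eq_bigr => j _.
by rewrite -eps_add addnS addnC.
Qed.

Lemma L1_Q n : L1 P (Q n).
Proof.
apply: L1_sum => j; apply: L1B; last exact: L1_cst.
by apply: (Lp_sqr p23); exact: Lp_eps.
Qed.

Lemma L1_pgrowth_Q a g (Y : T -> R) n s : pgrowth a g -> 0 <= a -> a + 2 <= p -> Lp P p Y ->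
  L1 P (fun w => g (Y w) * Q n (iter s tau w)).
Proof.
move=> gg a0 ap pY.
have -> : (fun w => g (Y w) * Q n (iter s tau w)) =
    (fun w => \sum_(0 <= j < n) (g (Y w) * eps (s + j.+1) w ^+ 2 - g (Y w) * 1)).
  apply/funext => w; rewrite /Q mulr_sumr; apply: eq_bigr => j _.
  by rewrite -eps_add mulrBr.
apply: L1_sum => j; apply: L1B.
  apply: (L1_pgrowth (b := 2) gg a0 _ ap pY (Lp_eps (s + j.+1))) => //.
    by apply: measurable_funX; exact: (Lp_eps _).1.
  by move=> w; rewrite powR_sqr normrX real_normK ?num_real.
apply: (L1_pgrowth (b := 0) gg a0 _ _ pY (Lp_cst P p 1)) => //; first by lra.
by move=> w; rewrite powRr0 normr1.
Qed.

Variables (r : R) (f f1 f2 : R -> R).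
Hypothesis hr : p - 2 <= r <= p.
Hypothesis cf : continuous f.
Hypothesis ft : taylor2 f f1 f2 (fun y => y `^ r).
Hypothesis e1 : Ex P (fun w => e0 w ^+ 2) = 1.

Let r03 : 0 < r <= 3.
Proof. by move: hr p2 p3 => /andP[? ?] ? ?; apply/andP; split; lra. Qed.
Let rp : r <= p. Proof. by case/andP : hr. Qed.

(** The order p - 2 is the largest for which V2(M_k) times a squared increment is integrable under p
    moments. *)
Lemma V2_pgrowth s : 0 < s -> pgrowth (p - 2) (V2 s f).
Proof.
move=> s0; have [_ _ c2] := U_continuous r03 cf ft s0; split => //.
have K0 := KT_ge0 R.
have A0 : 0 <= 40 * KT R * s `^ (r - p) by rewrite !mulr_ge0 ?powR_ge0.
exists (`|V2 s f 0| + 40 * KT R * s `^ (r - p)); split; first exact: addr_ge0.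
move=> x; have := V2_modulus r03 cf ft 0 x s0; rewrite subr0 => h.
have g := gmod_powR p23 rp s0 (normr_ge0 x).
have h2 : `|V2 s f x| <= `|V2 s f 0| + 40 * KT R * s `^ (r - p) * `|x| `^ (p - 2).
  have -> : V2 s f x = V2 s f 0 + (V2 s f x - V2 s f 0) by rewrite addrC subrK.
  apply: (le_trans (ler_normD _ _)); rewrite lerD2l; apply: (le_trans h).
  by rewrite -[leRHS]mulrA; apply: ler_wpM2l => //; exact: mulr_ge0.
apply: (le_trans h2); rewrite [leRHS]mulrDl; apply: lerD.
  by apply: ler_peMr => //; rewrite lerDl powR_ge0.
by apply: ler_wpM2l => //; rewrite lerDr.
Qed.

Lemma U_pgrowth s : 0 < s -> pgrowth p (U s f).
Proof.
move=> s0; have [c0 _ _] := U_continuous r03 cf ft s0; split => //.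
have K0 := KT_ge0 R.
have A0 : 0 <= KT R * s `^ (r - p) by rewrite mulr_ge0 ?powR_ge0.
set a : R := `|U s f 0|; set b : R := `|V1 s f 0|; set c : R := `|V2 s f 0|.
have [a0 b0 c00] : [/\ 0 <= a, 0 <= b & 0 <= c] by split; exact: normr_ge0.
exists (a + b + c + KT R * s `^ (r - p)); split; first by rewrite !addr_ge0.
move=> x; have := U_taylor2 r03 cf ft s0 0 x; rewrite add0r => h.
have x0 := normr_ge0 x.
have g := gmod_powR p23 rp s0 x0.
have X2 : `|x| ^+ 2 * `|x| `^ (p - 2) = `|x| `^ p.
  by rewrite -powR_mulrn// -powRD ?subrKC// gt_eqF.
have P0 := powR_ge0 `|x| p.
have l1 : `|x| <= 1 + `|x| `^ p.
  have := powR_mul_le (p := p) (b := 1) (al := 1) (be := 0) x0 ler01 ler01 (lexx _).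
  rewrite powRr0 mulr1 powRr1// powR1; have h2 := p2.
  by case: (lerP `|x| 1) => x1 _; [rewrite (le_trans x1)// lerDl|
    rewrite (@le_trans _ _ (`|x| `^ p))// ?lerDr// -[leLHS]powRr1// ler_powR ?(ltW x1)//; lra].
have l2 : `|x| ^+ 2 <= 1 + `|x| `^ p.
  have h2 := p2; case: (lerP `|x| 1) => x1.
    by apply: (@le_trans _ _ 1); [exact: exprn_ile1|rewrite lerDl].
  rewrite (@le_trans _ _ (`|x| `^ p))// ?lerDr// -powR_mulrn// ler_powR ?(ltW x1)//.
  by rewrite (ltW h2).
have h3 : KT R * (`|x| ^+ 2 * gmod r s `|x|) <= KT R * s `^ (r - p) * `|x| `^ p.
  rewrite -mulrA; apply: ler_wpM2l => //; rewrite -X2 [leRHS]mulrCA.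
  by apply: ler_wpM2l => //; exact: exprn_ge0.
have h4 : `|U s f x| <= a + b * `|x| + c * `|x| ^+ 2 + KT R * s `^ (r - p) * `|x| `^ p.
  have -> : U s f x = U s f 0 + V1 s f 0 * x + V2 s f 0 * x ^+ 2 / 2 +
     (U s f x - U s f 0 - V1 s f 0 * x - V2 s f 0 * x ^+ 2 / 2) by ring.
  apply: (le_trans (ler_normD _ _)); apply: lerD; last exact: (le_trans h h3).
  apply: (le_trans (ler_normD _ _)); apply: lerD; last first.
    rewrite normrM normrM normrX normfV (ger0_norm (ler0n R 2)) -/c.
    by rewrite ler_pdivrMr// ler_peMr ?mulr_ge0 ?exprn_ge0// ler1n.
  by apply: (le_trans (ler_normD _ _)); rewrite lerD2l normrM.
apply: (le_trans h4); rewrite [leRHS]mulrDl; apply: lerD; last first.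
  by apply: ler_wpM2l => //; rewrite lerDr.
rewrite [leRHS]mulrDl; apply: lerD; last exact: ler_wpM2l.
rewrite [leRHS]mulrDl; apply: lerD; last exact: ler_wpM2l.
by apply: ler_peMr => //; rewrite lerDl.
Qed.

Lemma V1_pgrowth s : 0 < s -> pgrowth (p - 1) (V1 s f).
Proof.
move=> s0; have [_ c1 _] := U_continuous r03 cf ft s0; split => //.
have K0 := KT_ge0 R; have h2 := p2.
set A := KT R * s `^ (r - p).
have A0 : 0 <= A by rewrite mulr_ge0 ?powR_ge0.
set b : R := `|V1 s f 0|; set c : R := `|V2 s f 0|.
have [b0 c00] : 0 <= b /\ 0 <= c by split; exact: normr_ge0.
exists (b + c + 16 * A); split; first by rewrite !addr_ge0// mulr_ge0.
move=> x; have x0 := normr_ge0 x.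
have [_ h] := taylor2_coef (U_taylor2 r03 cf ft s0)
  (fun u v u0 uv => smoothing_om_nd r (ltW s0) u0 uv) 0 x.
move: h; rewrite add0r => h.
have P0 := powR_ge0 `|x| (p - 1).
have l1 : `|x| <= 1 + `|x| `^ (p - 1).
  case: (lerP `|x| 1) => x1; first by rewrite (le_trans x1)// lerDl.
  rewrite (@le_trans _ _ (`|x| `^ (p - 1)))// ?lerDr// -[leLHS]powRr1// ler_powR ?(ltW x1)//; lra.
have h4 : `|V1 s f x - V1 s f 0 - V2 s f 0 * x| <= 16 * A * `|x| `^ (p - 1).
  have [->|xn0] := eqVneq x 0.
    by rewrite mulr0 subrr subr0 normr0 !mulr_ge0 ?powR_ge0.
  have xp : 0 < `|x| by rewrite normr_gt0.
  rewrite -(ler_pM2r xp); apply: (le_trans h).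
  have g1 := gmod_double (y := `|x|) (proj2 (andP r03)) (ltW s0) x0.
  have g2 := gmod_powR p23 rp s0 x0.
  have -> : `|x| `^ (p - 1) = `|x| * `|x| `^ (p - 2).
    by rewrite -{2}[`|x|]powRr1// -powR_neq0_add//; congr (_ `^ _); ring.
  have g3 : gmod r s (2 * `|x|) <= 2 * (s `^ (r - p) * `|x| `^ (p - 2)).
    by apply: (le_trans g1); apply: ler_wpM2l.
  have -> : 16 * A * (`|x| * `|x| `^ (p - 2)) * `|x| =
     2 * (KT R * ((2 * `|x|) ^+ 2 * (2 * (s `^ (r - p) * `|x| `^ (p - 2))))).
    by rewrite /A; ring.
  apply: ler_wpM2l => //; apply: ler_wpM2l => //.
  by apply: ler_wpM2l g3; exact: sqr_ge0.
have -> : V1 s f x = V1 s f 0 + V2 s f 0 * x + (V1 s f x - V1 s f 0 - V2 s f 0 * x) by ring.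
apply: (le_trans (ler_normD _ _)); rewrite mulrDl; apply: lerD; last first.
  by apply: (le_trans h4); apply: ler_wpM2l; [exact: mulr_ge0|rewrite lerDr].
apply: (le_trans (ler_normD _ _)); rewrite mulrDl; apply: lerD.
  by apply: ler_peMr => //; rewrite lerDl.
by rewrite normrM; apply: ler_wpM2l.
Qed.

Lemma L1_pgrowth0 a g (Y : T -> R) : pgrowth a g -> 0 <= a <= p -> Lp P p Y ->
  L1 P (fun w => g (Y w)).
Proof.
move=> gg /andP[a0 ap] pY.
apply: (eq_L1 (f := fun w => g (Y w) * 1)) => [w|]; first by rewrite mulr1.
apply: (L1_pgrowth (b := 0) gg a0 _ _ pY (Lp_cst P p 1)) => //; first by rewrite addr0.
by move=> w; rewrite powRr0 normr1.
Qed.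

Lemma measurable_powR_norm dd (S : measurableType dd) (Y : S -> R) a :
  measurable_fun [set: S] Y -> measurable_fun [set: S] (fun w => `|Y w| `^ a).
Proof. by move=> mY; apply: measurable_powRf; exact: measurableT_comp. Qed.

Lemma measurable_gmod dd (S : measurableType dd) s (Y : S -> R) :
  measurable_fun [set: S] Y -> measurable_fun [set: S] (fun w => gmod r s `|Y w|).
Proof.
move=> mY; have mN : measurable_fun [set: S] (fun w => `|Y w|) by exact: measurableT_comp.
rewrite /gmod; apply: measurable_funM => //; apply: measurable_minr.
  exact: measurable_funM.
by apply: measurable_powRf; exact: measurable_funM.
Qed.

Lemma gmod0 y : gmod r 0 y = 0.
Proof. by rewrite /gmod invr0 !mulr0 min_l ?mulr0 ?powR_ge0. Qed.

Lemma L1_gmod_sqr s (Y X : T -> R) : 0 < s -> Lp P p Y -> Lp P p X ->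
  L1 P (fun w => X w ^+ 2 * gmod r s `|Y w|).
Proof.
move=> s0 pY pX; have h2 := p2.
apply: (L1_prod (al := p - 2) (be := 2) (C := s `^ (r - p)) pY pX); [lra|lra|lra| |].
  apply: measurable_funM; last by apply: measurable_gmod; exact: pY.1.
  by apply: measurable_funX; exact: pX.1.
move=> w; rewrite ger0_norm; last by rewrite mulr_ge0 ?sqr_ge0 ?gmod_ge0 ?(ltW s0).
rewrite powR_sqr mulrA mulrC; apply: ler_wpM2r; first exact: sqr_ge0.
exact: gmod_powR.
Qed.

Lemma L1_gauss_gmod s : 0 < s -> L1 (gauss R) (fun w => w ^+ 2 * gmod r s `|w|).
Proof.
move=> s0.
have e : egrowth (fun w : R => s `^ (r - 2) / s * `|w| ^+ 3).
  have -> : (fun w : R => s `^ (r - 2) / s * `|w| ^+ 3) =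
      (fun w => s `^ (r - 2) / s * `|w ^+ 3|) by apply/funext => w; rewrite normrX.
  by apply: egrowthZ; apply: egrowth_abs; exact: egrowth_exp.
apply: (L1_dom _ (egrowth_L1 e)).
  by apply: measurable_funM => //; apply: measurable_gmod.
suff h (w : R) : `|w ^+ 2 * gmod r s `|w| | <= s `^ (r - 2) / s * `|w| ^+ 3 by [].
rewrite ger0_norm; last by rewrite mulr_ge0 ?sqr_ge0 ?gmod_ge0 ?(ltW s0).
have := gmod_lin r s0 (normr_ge0 w); move: (gmod r s `|w|) => g hg.
rewrite -(real_normK (num_real w)) [`|w| ^+ 3]exprSr mulrCA.
by apply: ler_wpM2l; first exact: exprn_ge0.
Qed.

(** One Gaussian step of unit variance: the semigroup turns it into a change of bandwidth, the
    first-order term vanishes and N^2 has mean 1. *)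
Lemma U_step s x : 0 < s ->
  `|U (Num.sqrt (1 + s ^+ 2)) f x - U s f x - V2 s f x / 2| <=
  KT R * EN (fun w => w ^+ 2 * gmod r s `|w|).
Proof.
move=> s0.
have := U_semigroup r03 cf ft x ltr01 s0; rewrite expr1n => ->.
have [e0' _ _] := egrowth_U r03 cf ft s0.
have E0 : egrowth (fun w => U s f (x + 1 * w)) by exact: egrowth_affine.
have eq : egrowth (fun w : R => V1 s f x * w + V2 s f x / 2 * w ^+ 2).
  by apply: egrowthD; apply: egrowthZ; [exact: egrowth_id|exact: egrowth_exp].
have eE : EN (fun w => V1 s f x * w + V2 s f x / 2 * w ^+ 2) = V2 s f x / 2.
  have [m1 m2 _ _] := EN_moments R.
  rewrite END ?ENZ ?m1 ?m2; [by rewrite mulr0 mulr1 add0r|exact: egrowth_exp|exact: egrowth_id|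
    by apply: egrowthZ; exact: egrowth_id|by apply: egrowthZ; exact: egrowth_exp].
have -> : EN (fun w => U s f (x + 1 * w)) - U s f x - V2 s f x / 2 =
    EN (fun w => U s f (x + 1 * w) - U s f x - (V1 s f x * w + V2 s f x / 2 * w ^+ 2)).
  rewrite ENB ?eE ?ENB ?EN_cst//; first exact: egrowth_cst.
  by apply: egrowthB => //; exact: egrowth_cst.
have iG := L1_gauss_gmod s0.
rewrite -[leRHS]ExZ//; apply: abs_Ex_le; last 1 first.
- move=> w; have := U_taylor2 r03 cf ft s0 x w; rewrite mul1r real_normK ?num_real//.
  by congr (_ <= _); congr (`|_|); field.
- apply: L1_measurable; apply: egrowth_L1; apply: egrowthB => //.
  by apply: egrowthB => //; exact: egrowth_cst.
- exact: L1Z.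
Qed.

Definition sqrtn t : R := Num.sqrt t%:R.

Lemma sqrtn_gt0 t : (0 < t)%N -> 0 < sqrtn t.
Proof. by move=> t0; rewrite sqrtr_gt0 ltr0n. Qed.

Lemma sqrtn_add t u : sqrtn (t + u) = Num.sqrt (sqrtn t ^+ 2 + sqrtn u ^+ 2).
Proof. by rewrite /sqrtn !sqr_sqrtr// -natrD. Qed.

(** Twice the second-order error of step k when t steps remain. It would vanish if eps_{k+1}^2 had
    conditional mean 1 given F_k. *)
Definition variance_term k t := Ex P (fun w => V2 (sqrtn t) f (M k w) * (eps k.+1 w ^+ 2 - 1)).

Lemma L1_variance_term k t : (0 < t)%N ->
  L1 P (fun w => V2 (sqrtn t) f (M k w) * (eps k.+1 w ^+ 2 - 1)).
Proof.
move=> t0; have h2 := p2.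
have pp : 0 <= p - 2 <= p by apply/andP; split; lra.
apply: (eq_L1 (f := fun w => V2 (sqrtn t) f (M k w) * Q 1 (iter k tau w))) => [w|].
  by rewrite /Q big_nat1 -eps_add addn1.
by apply: (L1_pgrowth_Q _ _ (V2_pgrowth (sqrtn_gt0 t0)) _ _ (Lp_M k)); [case/andP: pp|lra].
Qed.

(** A martingale step and a Gaussian step are both expanded around M_k at bandwidth sqrt(t). The
    first-order terms are centred, and the second-order terms differ by half of [variance_term]. *)
Lemma lindeberg_step k t : (0 < t)%N ->
  `|Ex P (fun w => U (sqrtn t) f (M k.+1 w)) - Ex P (fun w => U (sqrtn t.+1) f (M k w))
    - variance_term k t / 2| <=
  KT R * (Ex P (fun w => e0 w ^+ 2 * gmod r (sqrtn t) `|e0 w|) +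
          EN (fun w => w ^+ 2 * gmod r (sqrtn t) `|w|)).
Proof.
move=> t0; have s0 := sqrtn_gt0 t0; have h2 := p2; set s := sqrtn t in s0 *.
have pp : 0 <= p <= p by apply/andP; split; lra.
have s10 : 0 < sqrtn t.+1 by exact: sqrtn_gt0.
have iU k' : L1 P (fun w => U s f (M k' w)) by exact: (L1_pgrowth0 (U_pgrowth s0) pp (Lp_M _)).
have iU1 : L1 P (fun w => U (sqrtn t.+1) f (M k w)).
  exact: (L1_pgrowth0 (U_pgrowth s10) pp (Lp_M _)).
have iV1 : L1 P (fun w => V1 s f (M k w) * eps k.+1 w).
  apply: (L1_pgrowth (b := 1) (V1_pgrowth s0) _ _ _ (Lp_M k) (Lp_eps k.+1)); [lra|lra|lra| |].
    exact: (Lp_eps _).1.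
  by move=> w; rewrite powRr1.
have iV2 : L1 P (fun w => V2 s f (M k w)).
  by apply: (L1_pgrowth0 (V2_pgrowth s0) _ (Lp_M k)); apply/andP; split; lra.
have iD := L1_variance_term k t0.
have z1 : Ex P (fun w => V1 s f (M k w) * eps k.+1 w) = 0.
  by apply: Ex_mds => //; apply: (pgrowth_meas_wrt (V1_pgrowth s0)); exact: meas_wrt_M.
(* A and B are the third-order remainders of the martingale step and of the Gaussian step. *)
pose A w := U s f (M k.+1 w) - U s f (M k w) - V1 s f (M k w) * eps k.+1 w
  - V2 s f (M k w) * eps k.+1 w ^+ 2 / 2.
pose B w := U (sqrtn t.+1) f (M k w) - U s f (M k w) - V2 s f (M k w) / 2.
have iB : L1 P B.
  apply: L1B; first exact: L1B.
  by apply: (eq_L1 (f := fun w => 2^-1 * V2 s f (M k w))) => [w|]; [rewrite mulrC|exact: L1Z].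
have eA : A =1 fun w => U s f (M k.+1 w) - U (sqrtn t.+1) f (M k w)
    - V1 s f (M k w) * eps k.+1 w
    - 2^-1 * (V2 s f (M k w) * (eps k.+1 w ^+ 2 - 1)) + B w.
  by move=> w; rewrite /A /B; field.
have i3 : L1 P (fun w => U s f (M k.+1 w) - U (sqrtn t.+1) f (M k w)
    - V1 s f (M k w) * eps k.+1 w).
  by apply: L1B => //; exact: L1B.
have iA : L1 P A.
  by apply: (eq_L1 (fsym eA)); apply: L1D => //; apply: L1B => //; exact: L1Z.
have -> : Ex P (fun w => U s f (M k.+1 w)) - Ex P (fun w => U (sqrtn t.+1) f (M k w)) - variance_term k t / 2
   = Ex P A - Ex P B.
  have iD2 := L1Z 2^-1 iD.
  rewrite (eq_Ex P eA) (ExD (L1B i3 iD2) iB) (ExB i3 iD2) (ExB (L1B (iU _) iU1) iV1).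
  by rewrite (ExB (iU k.+1) iU1) z1 (ExZ 2^-1 iD) subr0 addrK [X in _ - X]mulrC.
apply: (le_trans (ler_normB _ _)); rewrite mulrDr; apply: lerD; last first.
  apply: (le_trans (abs_Ex iB)); apply: Ex_le_cst; first exact: L1_abs.
  move=> w; have := U_step (M k w) s0; rewrite /B.
  by have -> : Num.sqrt (1 + s ^+ 2) = sqrtn t.+1
    by rewrite -[t.+1]add1n sqrtn_add /sqrtn sqrtr1 expr1n.
have iG : L1 P (fun w => KT R * (e0 w ^+ 2 * gmod r s `|e0 w|)).
  by apply: L1Z; exact: L1_gmod_sqr.
rewrite -ExZ; last exact: L1_gmod_sqr.
rewrite -(Ex_iter k.+1 iG); apply: abs_Ex_le.
- exact: (L1_measurable iA).
- exact: L1_iter.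
move=> w; have := U_taylor2 r03 cf ft s0 (M k w) (eps k.+1 w).
rewrite real_normK ?num_real//; congr (_ <= _); congr (`|_|).
by rewrite /A -[k.+1]addn1 M_add addn1 /M big_nat1 /eps/= -iterS iterSr.
Qed.

Variable C : R.
Hypothesis C0 : 0 < C.
Hypothesis hC : forall (m n K : nat) y, (0 < m)%N -> (K * m <= n)%N -> 0 <= y ->
  \sum_(1 <= i < K.+1) gmod r (Num.sqrt (i * m)%:R) y <=
  C / m%:R * rate p r n * y `^ (p - 2).

Let sqr_powR x : x ^+ 2 * `|x| `^ (p - 2) = `|x| `^ p.
Proof.
by rewrite -(powR_sqr x) -powRD ?subrKC// gt_eqF.
Qed.

Lemma egrowth_powR : L1 (gauss R) (fun w => `|w| `^ p).
Proof.
have h3 := p3; have h2 := p2.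
have p03 : 0 < p <= 3 by apply/andP; split; lra.
have e : egrowth (fun w : R => 1 + `|w ^+ 3|).
  by apply: egrowthD; [exact: egrowth_cst|apply: egrowth_abs; exact: egrowth_exp].
apply: (L1_dom _ (egrowth_L1 e)); first exact: measurable_powR_norm.
by move=> w; rewrite ger0_norm ?powR_ge0// normrX; exact: powR_le_1D3.
Qed.

(** The steps telescope. The extra Gaussian step leaves bandwidth 1 at the end and sqrt(n+1) at the
    start, so that every expansion is made at a bandwidth sqrt(t) with 1 <= t <= n. *)
Lemma lindeberg_sum n : (0 < n)%N ->
  `|Ex P (fun w => U 1 f (M n w)) - U (sqrtn n.+1) f 0
    - (\sum_(0 <= k < n) variance_term k (n - k)) / 2| <=
  KT R * C * (Np P p e0 + EN (fun w : R => `|w| `^ p)) * rate p r n.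
Proof.
move=> n0; have K0 := KT_ge0 R.
pose G k := Ex P (fun w => U (sqrtn (n.+1 - k)) f (M k w)).
have e : Ex P (fun w => U 1 f (M n w)) - U (sqrtn n.+1) f 0 =
    \sum_(0 <= k < n) (G k.+1 - G k).
  rewrite telescope_sumr// /G subSnn subn0 /sqrtn sqrtr1; congr (_ - _).
  rewrite -[LHS](Ex_cst P); apply: eq_Ex => w.
  by rewrite /M big_geq.
rewrite e mulr_suml -sumrB.
apply: (@le_trans _ _ (\sum_(0 <= k < n) (KT R *
  (Ex P (fun w => e0 w ^+ 2 * gmod r (sqrtn (n - k)) `|e0 w|) +
          EN (fun w => w ^+ 2 * gmod r (sqrtn (n - k)) `|w|))))).
  apply: (le_trans (ler_norm_sum _ _ _)).
  rewrite [leLHS]big_nat_cond [leRHS]big_nat_cond.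
  apply: ler_sum => k /andP[/andP[_ kn] _].
  rewrite /G subSS subSn ?(ltnW kn)//.
  by apply: lindeberg_step; rewrite subn_gt0.
have rev (F : nat -> R) : \sum_(0 <= k < n) F (n - k)%N = \sum_(1 <= t < n.+1) F t.
  rewrite big_nat_rev/= big_add1/=; rewrite !big_nat; apply: eq_bigr => k /andP[_ kn].
  by rewrite add0n subKn.
rewrite (rev (fun t => KT R * (Ex P (fun w => e0 w ^+ 2 * gmod r (sqrtn t) `|e0 w|) +
          EN (fun w => w ^+ 2 * gmod r (sqrtn t) `|w|)))).
rewrite -mulr_sumr -!mulrA; apply: ler_wpM2l => //.
rewrite big_split/= mulrCA mulrDl.
have hb x : \sum_(1 <= t < n.+1) x ^+ 2 * gmod r (sqrtn t) `|x| <=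
    `|x| `^ p * (C * rate p r n).
  rewrite -mulr_sumr -sqr_powR -[leRHS]mulrA; apply: ler_wpM2l; first exact: sqr_ge0.
  rewrite [leRHS]mulrC; have := hC (m := 1) (n := n) (K := n) isT _ (normr_ge0 x).
  by rewrite muln1 leqnn divr1 => /(_ isT); under eq_bigr do rewrite muln1.
apply: lerD.
  have [me pe] := pe0.
  have ii t : L1 P (fun w => e0 w ^+ 2 * gmod r (sqrtn t) `|e0 w|).
    case: (posnP t) => [->|t0]; last exact: L1_gmod_sqr (sqrtn_gt0 t0) pe0 pe0.
    by apply: (eq_L1 (f := fun=> 0)) => [w|]; [rewrite /sqrtn sqrtr0 gmod0 mulr0|exact: L1_cst].
  rewrite -Ex_sum// [leRHS]mulrC -ExZ//.
  by apply: le_Ex => //; [exact: L1_sum|exact: L1Z|move=> w; rewrite [leRHS]mulrC; exact: hb].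
have ii t : L1 (gauss R) (fun w => w ^+ 2 * gmod r (sqrtn t) `|w|).
  case: (posnP t) => [->|t0]; last exact: L1_gauss_gmod (sqrtn_gt0 t0).
  by apply: (eq_L1 (f := fun=> 0)) => [w|]; [rewrite /sqrtn sqrtr0 gmod0 mulr0|exact: L1_cst].
have ie := egrowth_powR.
rewrite -Ex_sum// [leRHS]mulrC -ExZ//.
by apply: le_Ex => //; [exact: L1_sum|exact: L1Z|move=> w; rewrite [leRHS]mulrC; exact: hb].
Qed.

(** * Second-order errors and dyadic blocks *)

Variable Z : nat -> T -> R.
Hypothesis mZ : forall m, meas_wrt F0 (Z m).
Hypothesis pZ : forall m, Lp P p (fun w => `|Z m w| `^ 2^-1).
(* Z m is a version of E(Q_m | F0). *)
Hypothesis hZ : forall m B, F0 B -> Rintegral P B (fun w => Q m w - Z m w) = 0.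

(* The L^{p/2} norm of Z m, written through |Z m|^{1/2} so that only moments of order p occur. *)
Definition normZ m := Np P p (fun w => `|Z m w| `^ 2^-1) `^ (2 / p).

Let sqrZ m w : (`|Z m w| `^ 2^-1) ^+ 2 = `|Z m w|.
Proof. by rewrite -powR_mulrn ?powR_ge0// -powRrM mulVf// powRr1. Qed.

Lemma normZ_ge0 m : 0 <= normZ m. Proof. exact: powR_ge0. Qed.

Lemma L1_Z m : L1 P (Z m).
Proof.
apply: (L1_dom (meas_wrt_measurable sF Fm (mZ m)) (Lp_sqr p23 (pZ m))) => w.
by rewrite sqrZ.
Qed.

Lemma Ex_Z_le m : Ex P (fun w => `|Z m w|) <= normZ m.
Proof.
have h2 := p2; have h : 0 < (2 : R) <= p by apply/andP; split; lra.
have := Ex_pow_le p23 (pZ m) h; apply: le_trans.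
rewrite le_eqVlt; apply/orP; left; apply/eqP; apply: eq_Ex => w.
by rewrite powR_sqr sqrZ.
Qed.

Definition bM := (22 ^+ 2 * Np P p e0) `^ ((p - 2) / p).

Lemma bM_ge0 : 0 <= bM. Proof. exact: powR_ge0. Qed.

(** Hölder's inequality with exponents p / (p - 2) and p / 2, followed by the moment bound on M_j.
    Time k is free because the law of Z is invariant. *)
Lemma Ex_MZ_le j m k :
  L1 P (fun w => `|M j w| `^ (p - 2) * `|Z m (iter k tau w)|) /\
  Ex P (fun w => `|M j w| `^ (p - 2) * `|Z m (iter k tau w)|) <=
  bM * j%:R `^ ((p - 2) / 2) * normZ m.
Proof.
have h2 := p2; have pz := Lp_iter k (pZ m).
have e w : `|M j w| `^ (p - 2) * `|Z m (iter k tau w)| =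
    `|M j w| `^ (p - 2) * `|((fun w => `|Z m w| `^ 2^-1) \o iter k tau) w| `^ 2.
  by rewrite powR_sqr/= sqrZ.
split.
  apply: (eq_L1 (fsym e)); apply: (L1_prod (al := p - 2) (be := 2) (C := 1) (Lp_M j) pz).
  - lra.
  - lra.
  - lra.
  - apply: measurable_funM; first by apply: measurable_powR_norm; exact: (Lp_M j).1.
    by apply: measurable_powR_norm; exact: pz.1.
  - by move=> w; rewrite mul1r ger0_norm// mulr_ge0 ?powR_ge0.
rewrite (eq_Ex P e).
have := Ex_prod_le p23 (Lp_M j) pz (al := p - 2) (be := 2).
rewrite subr_gt0 h2 ltr0n subrK (Np_iter _ (pZ m)) => /(_ isT isT erefl) h.
apply: (le_trans h); apply: ler_wpM2r; first exact: powR_ge0.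
have -> : bM * j%:R `^ ((p - 2) / 2) =
    (22 ^+ 2 * Np P p e0 * j%:R `^ (p / 2)) `^ ((p - 2) / p).
  have n0 := Np_ge0 P p e0.
  have n1 : 0 <= 22 ^+ 2 * Np P p e0 by rewrite mulr_ge0// exprn_ge0// ler0n.
  rewrite powRM ?powR_ge0// -powRrM; congr (_ * _ `^ _).
  by field; exact: pn0.
apply: ge0_powR_mono => //; [exact: Np_ge0|exact: Np_M].
Qed.

(** Subtracting the value at 0 does not change the variance terms, as the centred squares have mean
    0; it makes the coefficient vanish at time 0, where M_0 = 0. *)
Definition V2c n s x := V2 (sqrtn (n - s)) f x - V2 (sqrtn (n - s)) f 0.

Lemma V2c_pgrowth n s : (s < n)%N -> pgrowth (p - 2) (V2c n s).
Proof.
move=> sn; have t0 : 0 < sqrtn (n - s) by apply: sqrtn_gt0; rewrite subn_gt0.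
have [cg [D [D0 gD]]] := V2_pgrowth t0; split.
  by move=> x; apply: continuousB; [exact: cg|exact: cst_continuous].
exists (D + `|V2 (sqrtn (n - s)) f 0|); split; first exact: addr_ge0.
move=> x; apply: (le_trans (ler_normB _ _)); rewrite mulrDl; apply: lerD => //.
by apply: ler_peMr => //; rewrite lerDl powR_ge0.
Qed.

Lemma V2c0 n w : V2c n 0 (M 0 w) = 0.
Proof. by rewrite /V2c /M big_geq// subrr. Qed.

(* [0, n] is cut from the right into blocks of length m. Subtraction being truncated, a block
   reaching 0 starts at time 0, where M 0 = 0 and V2c vanishes: it contributes nothing. *)
Definition block_term n m j :=
  Ex P (fun w => V2c n (n - j.+1 * m) (M (n - j.+1 * m) w) *
                 Q m (iter (n - j.+1 * m) tau w)).

Lemma block_term0 n m j : (n <= j.+1 * m)%N -> block_term n m j = 0.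
Proof.
rewrite -subn_eq0 /block_term => /eqP ->.
by rewrite -[RHS](Ex_cst P); apply: eq_Ex => w; rewrite V2c0 mul0r.
Qed.

Lemma L1_cQ n s m k : (s < n)%N ->
  L1 P (fun w => V2c n s (M s w) * Q m (iter k tau w)).
Proof.
by move=> sn; have h2 := p2; apply: (L1_pgrowth_Q _ _ (V2c_pgrowth sn) _ _ (Lp_M s)); lra.
Qed.

Lemma L1_cZ n s m k : (s < n)%N ->
  L1 P (fun w => V2c n s (M s w) * Z m (iter k tau w)).
Proof.
move=> sn; have h2 := p2; have pz := Lp_iter k (pZ m).
apply: (L1_pgrowth (b := 2) (V2c_pgrowth sn) _ _ _ (Lp_M s) pz); [lra|lra|lra| |].
  exact: measurableT_comp (meas_wrt_measurable sF Fm (mZ m)) (iter_measurable k).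
by move=> w; rewrite powR_sqr/= sqrZ.
Qed.

(** The long block weights both halves by the coefficient at its start s1, the short blocks weight
    the later half by the coefficient at s2. The difference is the later half times the increment of
    the coefficient. That increment is measurable at time s2, so Q_m may be replaced by its
    conditional expectation. *)
Lemma block_term_pair n m i : (0 < n)%N -> (0 < m)%N ->
  block_term n m i.*2 + block_term n m i.*2.+1 - block_term n (m + m) i =
  Ex P (fun w => (V2c n (n - i.*2.+1 * m) (M (n - i.*2.+1 * m) w) -
                  V2c n (n - i.*2.+2 * m) (M (n - i.*2.+2 * m) w)) *
                 Z m (iter (n - i.*2.+1 * m) tau w)).
Proof.
move=> n0 m0.
set s2 := (n - i.*2.+1 * m)%N; set s1 := (n - i.*2.+2 * m)%N.
have [s2n s1n s12 es1 [e12 e1z]] := dyadic_blocks i n0 m0; rewrite -/s1 -/s2 in s2n s1n s12 es1 e12 e1z.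
transitivity (Ex P (fun w => (V2c n s2 (M s2 w) - V2c n s1 (M s1 w)) * Q m (iter s2 tau w))).
  rewrite (eq_Ex P (g := fun w => V2c n s2 (M s2 w) * Q m (iter s2 tau w) -
     V2c n s1 (M s1 w) * Q m (iter s2 tau w))); last by move=> w; rewrite mulrBl.
  rewrite ExB; [|exact: L1_cQ|exact: L1_cQ].
  rewrite /block_term -/s2 -/s1 es1 -addrA; congr (_ + _); rewrite -opprB; congr (- _).
  (* If the earlier block is truncated, it starts at 0 and every term carrying its coefficient
     vanishes. *)
  case: (leqP (i.*2.+2 * m) n) => h.
    rewrite (eq_Ex P (g := fun w => V2c n s1 (M s1 w) * Q m (iter s1 tau w) +
      V2c n s1 (M s1 w) * Q m (iter s2 tau w))); last first.
      by move=> w; rewrite Q_add (e12 h) iterD mulrDr.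
    by rewrite ExD; [rewrite addrC addKr|exact: L1_cQ|exact: L1_cQ].
  rewrite (e1z (ltnW h)).
  have e0' k l : Ex P (fun w => V2c n 0 (M 0 w) * Q k (iter l tau w)) = 0.
    by rewrite -[RHS](Ex_cst P); apply: eq_Ex => w; rewrite V2c0 mul0r.
  by rewrite !e0' subrr.
apply/eqP; rewrite -subr_eq0; apply/eqP.
have L2 : L1 P (fun w => (V2c n s2 (M s2 w) - V2c n s1 (M s1 w)) * Q m (iter s2 tau w)).
  apply: (eq_L1 (f := fun w => V2c n s2 (M s2 w) * Q m (iter s2 tau w) -
     V2c n s1 (M s1 w) * Q m (iter s2 tau w))); first by move=> w; rewrite [RHS]mulrBl.
  by apply: L1B; exact: L1_cQ.
have L3 : L1 P (fun w => (V2c n s2 (M s2 w) - V2c n s1 (M s1 w)) * Z m (iter s2 tau w)).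
  apply: (eq_L1 (f := fun w => V2c n s2 (M s2 w) * Z m (iter s2 tau w) -
     V2c n s1 (M s1 w) * Z m (iter s2 tau w))); first by move=> w; rewrite [RHS]mulrBl.
  by apply: L1B; exact: L1_cZ.
rewrite -ExB//.
pose D w := V2c n s2 (M s2 w) - V2c n s1 (M s1 w).
rewrite (eq_Ex P (g := fun w => D w * (Q m (iter s2 tau w) - Z m (iter s2 tau w)))); last first.
  by move=> w; rewrite mulrBr.
apply: (Ex_pull (W := fun w => Q m w - Z m w)).
- by apply: L1B; [exact: L1_Q|exact: L1_Z].
- exact: hZ.
- have m1 : meas_wrt (Fk s2) (fun w => V2c n s2 (M s2 w)) by apply: (pgrowth_meas_wrt (V2c_pgrowth s2n)); exact: meas_wrt_M.
  have m2 : meas_wrt (Fk s2) (fun w => V2c n s1 (M s1 w)).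
    by apply: (pgrowth_meas_wrt (V2c_pgrowth s1n)); exact: meas_wrt_M.
  by rewrite /meas_wrt /D; apply: measurable_funB.
- by apply: (eq_L1 _ (L1B L2 L3)) => w; rewrite /D/= mulrBr.
Qed.

Lemma V2_ts_modulus t m x : (0 < t)%N -> (0 < m)%N ->
  `|V2 (sqrtn (t + m)) f x - V2 (sqrtn t) f x| <=
  40 * KT R * EN (fun w => gmod r (sqrtn t) (sqrtn m * `|w|)).
Proof.
move=> t0 m0; rewrite addnC sqrtn_add.
by have := V2_time_modulus r03 cf ft x (sqrtn_gt0 m0) (sqrtn_gt0 t0).
Qed.

Let K40 : 0 <= 40 * KT R. Proof. by have h := KT_ge0 R; apply: mulr_ge0. Qed.

Lemma L1_gmod_Z t j m k : (0 < t)%N ->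
  L1 P (fun w => gmod r (sqrtn t) `|M j w| * `|Z m (iter k tau w)|).
Proof.
move=> t0; have pz := Lp_iter k (pZ m).
apply: (eq_L1 (f := fun w => ((fun w => `|Z m w| `^ 2^-1) \o iter k tau) w ^+ 2 *
  gmod r (sqrtn t) `|M j w|)) => [w|]; first by rewrite /= sqrZ mulrC.
exact: (L1_gmod_sqr (sqrtn_gt0 t0) (Lp_M j) pz).
Qed.

Lemma L1_DZ n s1 s2 m k : (s1 < n)%N -> (s2 < n)%N ->
  L1 P (fun w => (V2c n s2 (M s2 w) - V2c n s1 (M s1 w)) * Z m (iter k tau w)).
Proof.
move=> n1 n2; apply: (eq_L1 (f := fun w => V2c n s2 (M s2 w) * Z m (iter k tau w) -
     V2c n s1 (M s1 w) * Z m (iter k tau w))); first by move=> w; rewrite [RHS]mulrBl.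
by apply: L1B; exact: L1_cZ.
Qed.

Definition block_diff n m i :=
  Ex P (fun w => (V2c n (n - i.*2.+1 * m) (M (n - i.*2.+1 * m) w) -
                  V2c n (n - i.*2.+2 * m) (M (n - i.*2.+2 * m) w)) *
                 Z m (iter (n - i.*2.+1 * m) tau w)).

(** The coefficient changes in space, from M_{s1} to M_{s2} at bandwidth sqrt(t), and in time, from
    bandwidth sqrt(t + m) to sqrt(t). The change in time is taken at M_{s1} and, because of the
    centring, at 0, hence the factor 2. Invariance then shifts time s1 to 0. *)
Lemma block_diff_full n m i : (0 < n)%N -> (0 < m)%N -> (i.*2.+2 * m <= n)%N ->
  `|block_diff n m i| <= 40 * KT R *
    (Ex P (fun w => gmod r (sqrtn (i.*2.+1 * m)) `|M m w| * `|Z m (iter m tau w)|) +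
     2 * EN (fun w => gmod r (sqrtn (i.*2.+1 * m)) (sqrtn m * `|w|)) * normZ m).
Proof.
move=> n0 m0 h.
have [s2n s1n s12 _ [e12 _]] := dyadic_blocks i n0 m0.
have [t0 tn1 tn2] := dyadic_times m0 h.
rewrite /block_diff; move: s2n s1n s12 {e12}(e12 h) tn1 tn2.
set s2 := (n - i.*2.+1 * m)%N; set s1 := (n - i.*2.+2 * m)%N; set t := (i.*2.+1 * m)%N.
move=> s2n s1n s12 e12 tn1 tn2.
set e := EN _.
have it := L1_gmod_Z m m m t0.
have iz : L1 P (fun w => `|Z m w|) by apply: L1_abs; exact: L1_Z.
pose H w := gmod r (sqrtn t) `|M m w| * `|Z m (iter m tau w)| + 2 * e * `|Z m (iter m tau w)|.
have iH : L1 P H by apply: L1D => //; apply: L1Z; exact: (L1_iter m iz).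
have bD w : `|V2c n s2 (M s2 w) - V2c n s1 (M s1 w)| <=
    40 * KT R * (gmod r (sqrtn t) `|M m (iter s1 tau w)| + 2 * e).
  rewrite /V2c tn1 tn2.
  have -> : V2 (sqrtn t) f (M s2 w) - V2 (sqrtn t) f 0 - (V2 (sqrtn (t + m)) f (M s1 w) - V2 (sqrtn (t + m)) f 0) =
    (V2 (sqrtn t) f (M s2 w) - V2 (sqrtn t) f (M s1 w)) +
    ((V2 (sqrtn (t + m)) f 0 - V2 (sqrtn t) f 0) - (V2 (sqrtn (t + m)) f (M s1 w) - V2 (sqrtn t) f (M s1 w))).
    by ring.
  rewrite [leRHS]mulrDr; apply: (le_trans (ler_normD _ _)); apply: lerD.
    have := V2_modulus r03 cf ft (M s1 w) (M s2 w) (sqrtn_gt0 t0).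
    have -> // : M s2 w - M s1 w = M m (iter s1 tau w).
    by rewrite e12 [(m + s1)%N]addnC M_add [M s1 w + _]addrC addrK.
  apply: (le_trans (ler_normB _ _)).
  rewrite (_ : 2 * e = e + e) ?[leRHS]mulrDr; last by rewrite mulr_natl.
  by apply: lerD; exact: V2_ts_modulus.
have iD := L1_DZ m s2 s1n s2n.
apply: (@le_trans _ _ (Ex P (fun w => 40 * KT R * H (iter s1 tau w)))).
  apply: abs_Ex_le; first exact: L1_measurable iD.
    by apply: L1Z; exact: (L1_iter s1 iH).
  move=> w; rewrite normrM /H e12 iterD -mulrDl mulrA; apply: ler_wpM2r => //.
  by rewrite -e12; exact: bD.
rewrite (ExZ _ (L1_iter s1 iH)); apply: ler_wpM2l => //.
rewrite (Ex_iter s1 iH) ExD//; last by apply: L1Z; exact: (L1_iter m iz).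
rewrite lerD2l (ExZ _ (L1_iter m iz)) (Ex_iter m iz); apply: ler_wpM2l; last exact: Ex_Z_le.
apply: mulr_ge0 => //; apply: Ex_ge0 => w; apply: gmod_ge0; rewrite ?mulr_ge0 ?sqrtr_ge0//.
Qed.

(** The earlier block starts at 0, so its coefficient is 0, and the later one starts at a time s2 <=
    m. The remaining term is bounded by a single summand of the sum in [hC], which is where the
    distance from M_{s2} to 0 is paid for. *)
Lemma block_diff_edge n m i : (0 < n)%N -> (0 < m)%N ->
  (i.*2.+1 * m < n)%N -> (n <= i.*2.+2 * m)%N ->
  `|block_diff n m i| <= 40 * KT R *
    (C / m%:R * rate p r n * (bM * m%:R `^ ((p - 2) / 2) * normZ m)).
Proof.
move=> n0 m0 h1 h2.
have [s2n s1n _ _ [_ e1z]] := dyadic_blocks i n0 m0.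
have hs : (n - i.*2.+1 * m <= m)%N by rewrite leq_subLR addnC; move: h2; rewrite mulSn.
have t0 : (0 < i.*2.+1 * m)%N by rewrite muln_gt0.
have tn : (n - (n - i.*2.+1 * m) = i.*2.+1 * m)%N by rewrite subKn// ltnW.
rewrite /block_diff (e1z h2); move: s2n hs tn h1 t0 {e1z}.
set s2 := (n - i.*2.+1 * m)%N; set t := (i.*2.+1 * m)%N => s2n hs tn h1 t0.
have [iMZ bMZ] := Ex_MZ_le s2 m s2.
have D0 : 0 <= C / m%:R * rate p r n.
  have Cge := ltW C0; apply: mulr_ge0; last exact: rate_ge0.
  by apply: divr_ge0.
apply: (@le_trans _ _ (Ex P (fun w => 40 * KT R * (C / m%:R * rate p r n) *
    (`|M s2 w| `^ (p - 2) * `|Z m (iter s2 tau w)|)))).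
  apply: abs_Ex_le; [exact: L1_measurable (L1_DZ _ _ n0 s2n)|exact: L1Z|].
  move=> w; rewrite normrM mulrA; apply: ler_wpM2r => //.
  rewrite V2c0 subr0 /V2c tn; apply: (le_trans (V2_modulus r03 cf ft 0 (M s2 w) (sqrtn_gt0 t0))).
  rewrite subr0 -[leRHS]mulrA; apply: ler_wpM2l => //.
  have := hC (m := m) (n := n) (K := i.*2.+1) m0 (ltnW h1) (normr_ge0 (M s2 w)).
  apply: le_trans; rewrite big_nat_recr//= lerDr.
  by apply: sumr_ge0 => j _; apply: gmod_ge0 => //; exact: sqrtr_ge0.
rewrite ExZ// -mulrA; apply: ler_wpM2l => //; apply: ler_wpM2l => //.
apply: (le_trans bMZ); apply: ler_wpM2r; first exact: normZ_ge0.
apply: ler_wpM2l; first exact: bM_ge0.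
apply: ge0_powR_mono; [|exact: ler0n|by rewrite ler_nat].
have hp2 := p2; lra.
Qed.

Lemma block_diff_zero n m i : (n <= i.*2.+1 * m)%N -> block_diff n m i = 0.
Proof.
move=> h; have h1 : (n - i.*2.+1 * m = 0)%N by apply/eqP; rewrite subn_eq0.
have h2 : (n - i.*2.+2 * m = 0)%N.
  by apply/eqP; rewrite subn_eq0 (leq_trans h)// mulSn leq_addl.
rewrite /block_diff h1 h2 -[RHS](Ex_cst P); apply: eq_Ex => w.
by rewrite subrr mul0r.
Qed.

Definition gM := EN (fun w : R => `|w| `^ (p - 2)).

Lemma L1_gM : L1 (gauss R) (fun w => `|w| `^ (p - 2)).
Proof.
have h3 := p3; have h2 := p2.
have p03 : 0 < p - 2 <= 3 by apply/andP; split; lra.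
have e : egrowth (fun w : R => 1 + `|w ^+ 3|).
  by apply: egrowthD; [exact: egrowth_cst|apply: egrowth_abs; exact: egrowth_exp].
apply: (L1_dom _ (egrowth_L1 e)); first exact: measurable_powR_norm.
by move=> w; rewrite ger0_norm ?powR_ge0// normrX; exact: powR_le_1D3.
Qed.

Lemma odd_gmod_sum n m K y : (0 < m)%N -> (K.*2 * m <= n)%N -> 0 <= y ->
  \sum_(0 <= i < K) gmod r (sqrtn (i.*2.+1 * m)) y <= C / m%:R * rate p r n * y `^ (p - 2).
Proof.
move=> m0 h y0; apply: le_trans (hC m0 h y0).
apply: (sum_odd_le (F := fun j => gmod r (sqrtn (j * m)) y)) => j.
by apply: gmod_ge0 => //; exact: sqrtr_ge0.
Qed.

Lemma full_blocks_le n m : (0 < n)%N -> (0 < m)%N ->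
  \sum_(0 <= i < n %/ m.*2) `|block_diff n m i| <=
  40 * KT R * (C / m%:R * rate p r n * ((bM + 2 * gM) * m%:R `^ ((p - 2) / 2) * normZ m)).
Proof.
move=> n0 m0; set K := (n %/ m.*2)%N.
have Kn : (K.*2 * m <= n)%N by rewrite -doubleMl doubleMr leq_divM.
have KTn := K40; have zge := normZ_ge0 m.
apply: (@le_trans _ _ (\sum_(0 <= i < K) 40 * KT R *
    (Ex P (fun w => gmod r (sqrtn (i.*2.+1 * m)) `|M m w| * `|Z m (iter m tau w)|) +
     2 * EN (fun w => gmod r (sqrtn (i.*2.+1 * m)) (sqrtn m * `|w|)) * normZ m))).
  rewrite [leLHS]big_nat [leRHS]big_nat; apply: ler_sum => i /andP[_ iK].
  apply: block_diff_full => //; apply: leq_trans Kn.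
  by rewrite leq_mul2r orbC -doubleS leq_double iK.
rewrite -mulr_sumr; apply: ler_wpM2l => //; rewrite big_split/=.
rewrite mulrDl mulrDl mulrDr; apply: lerD.
  have [iMZ bMZ] := Ex_MZ_le m m m.
  have D0 : 0 <= C / m%:R * rate p r n.
    by apply: mulr_ge0; [apply: divr_ge0 => //; exact: ltW C0|exact: rate_ge0].
  apply: (@le_trans _ _ (Ex P (fun w => C / m%:R * rate p r n *
     (`|M m w| `^ (p - 2) * `|Z m (iter m tau w)|)))).
    rewrite -Ex_sum; last by move=> i; apply: L1_gmod_Z; rewrite muln_gt0.
    apply: le_Ex; [|exact: L1Z|].
      by apply: L1_sum => i; apply: L1_gmod_Z; rewrite muln_gt0.
    move=> w; rewrite -mulr_suml mulrA; apply: ler_wpM2r => //.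
    exact: odd_gmod_sum.
  by rewrite ExZ//; apply: ler_wpM2l.
rewrite -mulr_suml [leRHS]mulrA; apply: ler_wpM2r => //.
rewrite -mulr_sumr.
have -> (c g q : R) : c * (2 * g * q) = 2 * (c * (g * q)) by ring.
apply: ler_wpM2l => //.
have ii i : L1 (gauss R) (fun w => gmod r (sqrtn (i.*2.+1 * m)) (sqrtn m * `|w|)).
  by apply: L1_gmod; [exact: sqrtr_ge0|apply: sqrtn_gt0; rewrite muln_gt0].
have iw := L1_gM.
rewrite -Ex_sum// [gM * _]mulrC mulrA /gM -ExZ//.
apply: le_Ex; [exact: L1_sum|exact: L1Z|move=> w].
have m2 : 0 <= sqrtn m * `|w| by apply: mulr_ge0 => //; exact: sqrtr_ge0.
apply: (le_trans (odd_gmod_sum m0 Kn m2)).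
rewrite powRM//; last exact: sqrtr_ge0.
by rewrite /sqrtn -powR12_sqrt// -powRrM mulrA [2^-1 * _]mulrC.
Qed.

Lemma level_le n m : (0 < n)%N -> (0 < m)%N ->
  `|\sum_(0 <= j < n) block_term n m j - \sum_(0 <= j < n) block_term n (m + m) j| <=
  80 * KT R * (C / m%:R * rate p r n * ((bM + gM) * m%:R `^ ((p - 2) / 2) * normZ m)).
Proof.
move=> n0 m0.
(* The added blocks start at 0 and contribute nothing; with 2 n blocks they can be grouped in
   pairs. *)
have -> : \sum_(0 <= j < n) block_term n m j = \sum_(0 <= j < n.*2) block_term n m j.
  rewrite [RHS](@big_cat_nat _ _ _ n)//=; last by rewrite -addnn leq_addr.
  rewrite [X in _ + X](_ : _ = 0) ?addr0// big_nat big1// => j /andP[nj _].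
  by apply: block_term0; rewrite (leq_trans nj)// (leq_trans (leqnSn j))// leq_pmulr.
rewrite sum_double -sumrB.
under eq_bigr do rewrite block_term_pair//.
(* Pairs of index below n / (2 m) lie inside [0, n]. Only the pair of index n / (2 m) can be cut by
   0, and later pairs vanish. *)
have e : \sum_(0 <= i < n) `|block_diff n m i| <= \sum_(0 <= i < n %/ m.*2) `|block_diff n m i| + `|block_diff n m (n %/ m.*2)|.
  rewrite -(big_nat_recr _ 0%N)//=.
  have := leq_total n (n %/ m.*2).+1 => /orP[h|h].
    by rewrite [leRHS](@big_cat_nat _ _ _ n)//= lerDl sumr_ge0.
  rewrite [leLHS](@big_cat_nat _ _ _ (n %/ m.*2).+1)//=.
  rewrite [X in _ + X <= _](_ : _ = 0) ?addr0// big_nat big1// => i /andP[hi _].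
  rewrite block_diff_zero ?normr0//; have := ltn_ceil n (_ : 0 < m.*2)%N.
  rewrite double_gt0 => /(_ m0) => hn; apply: (leq_trans (ltnW hn)).
  rewrite -doubleMr doubleMl leq_mul2r; apply/orP; right.
  by rewrite (leq_trans _ (leqnSn _))// leq_double.
apply: (le_trans (ler_norm_sum _ _ _)); apply: (le_trans e).
have KTn := K40; have zge := normZ_ge0 m.
have D0 : 0 <= C / m%:R * rate p r n.
  by apply: mulr_ge0; [apply: divr_ge0 => //; exact: ltW C0|exact: rate_ge0].
have edge : `|block_diff n m (n %/ m.*2)| <= 40 * KT R *
    (C / m%:R * rate p r n * (bM * m%:R `^ ((p - 2) / 2) * normZ m)).
  case: (leqP n ((n %/ m.*2).*2.+1 * m)) => h.
    rewrite block_diff_zero// normr0; apply: mulr_ge0 => //; apply: mulr_ge0 => //.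
    by apply: mulr_ge0 => //; apply: mulr_ge0; rewrite ?bM_ge0 ?powR_ge0.
  apply: block_diff_edge => //; have := ltn_ceil n (_ : 0 < m.*2)%N.
  rewrite double_gt0 => /(_ m0) => hn; apply: (leq_trans (ltnW hn)).
  by rewrite -doubleMr doubleMl doubleS.
apply: (le_trans (lerD (full_blocks_le n0 m0) edge)).
set a := C / _ * _; set k := KT R; set b := bM; set g := gM; set z := normZ m; set q := _ `^ _.
by rewrite le_eqVlt; apply/orP; left; apply/eqP; ring.
Qed.

Lemma block_term_1 n j : (j < n)%N -> block_term n 1 j = variance_term (n - j.+1) (n - (n - j.+1)).
Proof.
move=> jn; have n0 : (0 < n)%N by exact: leq_ltn_trans jn.
have sn : (n - j.+1 < n)%N by rewrite ltn_subrL.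
rewrite /block_term muln1; set s := (n - j.+1)%N in sn *.
have t0 : (0 < n - s)%N by rewrite subn_gt0.
have iD := L1_variance_term s t0.
have iq : L1 P (fun w => V2 (sqrtn (n - s)) f 0 * Q 1 (iter s tau w)).
  by apply: L1Z; exact: (L1_iter s (L1_Q 1)).
have qe w : Q 1 (iter s tau w) = eps s.+1 w ^+ 2 - 1.
  by rewrite /Q big_nat1 -eps_add addn1.
rewrite (eq_Ex P (g := fun w => V2 (sqrtn (n - s)) f (M s w) * (eps s.+1 w ^+ 2 - 1) -
   V2 (sqrtn (n - s)) f 0 * Q 1 (iter s tau w))); last first.
  by move=> w; rewrite /V2c -qe mulrBl.
rewrite (ExB iD iq) (ExZ _ (L1_iter s (L1_Q 1))) (Ex_iter s (L1_Q 1)).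
suff -> : Ex P (Q 1) = 0 by rewrite mulr0 subr0.
rewrite (eq_Ex P (g := fun w => eps 1 w ^+ 2 - 1)); last by move=> w; rewrite /Q big_nat1.
have i1 : L1 P (fun w => eps 1 w ^+ 2) by exact: (Lp_sqr p23 (Lp_eps 1)).
rewrite (ExB i1 (L1_cst P 1)).
have h := Ex_iter 1 (Lp_sqr p23 pe0).
by rewrite Ex_cst [X in X - _](_ : _ = 1) ?subrr// -e1 -h.
Qed.

Lemma sum_variance_term n : \sum_(0 <= k < n) variance_term k (n - k) = \sum_(0 <= j < n) block_term n 1 j.
Proof.
rewrite big_nat_rev/= big_nat [RHS]big_nat; apply: eq_bigr => j /andP[_ jn].
by rewrite block_term_1// add0n.
Qed.

(** Blocks of length 1 give back the variance terms, and blocks of length 2^N >= n all start at 0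
    and vanish. The sum is therefore a telescoping sum over the levels in between. *)
Lemma dyadic_le n N : (0 < n)%N -> (n <= 2 ^ N)%N ->
  `|\sum_(0 <= k < n) variance_term k (n - k)| <= 80 * KT R * C * (bM + gM) *
    (\sum_(0 <= l < N) (2 ^ l)%:R `^ (p / 2 - 2) * normZ (2 ^ l)) * rate p r n.
Proof.
move=> n0 nN; pose S m := \sum_(0 <= j < n) block_term n m j.
have SN : S (2 ^ N)%N = 0.
  rewrite /S big1// => j _; apply: block_term0; apply: (leq_trans nN).
  by rewrite leq_pmull.
have -> : \sum_(0 <= k < n) variance_term k (n - k) = - \sum_(0 <= l < N) (S (2 ^ l.+1)%N - S (2 ^ l)%N).
  by rewrite (telescope_sumr (fun l => S (2 ^ l)%N))// SN expn0 sub0r opprK sum_variance_term.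
rewrite normrN; apply: (le_trans (ler_norm_sum _ _ _)).
rewrite mulrAC mulr_sumr; apply: ler_sum => l _.
rewrite distrC expnS mul2n -addnn; apply: (le_trans (level_le n0 _)).
  by rewrite expn_gt0.
set m := (2 ^ l)%:R; have m0 : (0 : R) < m by rewrite ltr0n expn_gt0.
have -> : m `^ (p / 2 - 2) = m `^ ((p - 2) / 2) / m.
  by rewrite -powR_sub1//; congr (_ `^ _); field.
set k := KT R; set b := bM; set g := gM; set z := normZ _; set q := _ `^ _; set a := rate _ _ _.
by rewrite le_eqVlt; apply/orP; left; apply/eqP; ring.
Qed.

(** * Removing the unit smoothing *)

Hypothesis f20 : f2 0 = 0.
Hypothesis f2r : r <= 2 -> f2 = fun=> 0.

Lemma rate_ge1 n : (0 < n)%N -> 1 <= rate p r n.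
Proof.
move=> n0; have n1 : 1 <= n%:R :> R by rewrite ler1n.
rewrite /rate; case: ifP => _; first by case: ifP => _ //; rewrite lerDl ln_ge0.
rewrite -[leLHS](powRr0 n%:R); apply: ler_powR => //.
by move: hr => /andP[h _]; apply: divr_ge0 => //; lra.
Qed.

Lemma f2_le x : `|f2 x| <= 40 * `|x| `^ Num.max (r - 2) 0.
Proof.
case: (lerP r 2) => h.
  by rewrite f2r// normr0; apply: mulr_ge0 => //; exact: powR_ge0.
have -> : Num.max (r - 2) 0 = r - 2 by rewrite max_l// subr_ge0 ltW.
have [->|x0] := eqVneq x 0.
  by rewrite f20 normr0; apply: mulr_ge0 => //; exact: powR_ge0.
have [h1 _] := taylor2_powR_coef r03 ft 0 x; move: h1; rewrite add0r f20 subr0.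
have xp : 0 < `|x| by rewrite normr_gt0.
have -> : `|x| `^ r = `|x| `^ (r - 2) * x ^+ 2.
  by rewrite -powR_sqr -powR_neq0_add// subrK.
by rewrite mulrA ler_pM2r// exprn_even_gt0.
Qed.

Lemma f_pgrowth : pgrowth p f.
Proof.
split => //.
set a : R := `|f 0|; set b : R := `|f1 0|; exists (a + b + 1).
have [a0 b0] : 0 <= a /\ 0 <= b by split; exact: normr_ge0.
split; first by rewrite !addr_ge0.
move=> x; have := ft 0 x; rewrite add0r f20 mul0r mul0r subr0 => h.
have x0 := normr_ge0 x; have h2 := p2; have [hr1 hr2] := andP hr; have r0 : 0 < r by lra.
have P0 := powR_ge0 `|x| p.
have pw a' : 0 < a' <= p -> `|x| `^ a' <= 1 + `|x| `^ p.
  move=> /andP[a'0 a'p]; case: (lerP `|x| 1) => x1.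
    apply: (@le_trans _ _ 1); last by rewrite lerDl.
    by have := ge0_powR_mono (ltW a'0) x0 x1; rewrite powR1.
  apply: (@le_trans _ _ (`|x| `^ p)); last by rewrite lerDr.
  by apply: ler_powR => //; exact: ltW.
have l1 : `|x| <= 1 + `|x| `^ p.
  by rewrite -[leLHS]powRr1//; apply: pw; apply/andP; split; lra.
have l2 : `|x| `^ r <= 1 + `|x| `^ p by apply: pw; apply/andP; split.
have -> : f x = f 0 + f1 0 * x + (f x - f 0 - f1 0 * x) by ring.
rewrite !mulrDl mul1r; apply: (le_trans (ler_normD _ _)); apply: lerD; last exact: le_trans h l2.
apply: (le_trans (ler_normD _ _)); apply: lerD.
  by apply: ler_peMr => //; rewrite lerDl.
by rewrite normrM; apply: ler_wpM2l.
Qed.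

Let r20 : 0 <= Num.max (r - 2) 0 <= p.
Proof.
move: hr p2 => /andP[h1 h2] h3; rewrite le_max lexx orbT/= ge_max.
by apply/andP; split; lra.
Qed.

Let max_rate n : (0 < n)%N -> n%:R `^ (Num.max (r - 2) 0 / 2) <= rate p r n.
Proof.
move=> n0; have n1 : 1 <= n%:R :> R by rewrite ler1n.
case: (lerP r 2) => h.
  by rewrite max_r ?subr_le0// mul0r powRr0; exact: rate_ge1.
rewrite max_l ?subr_ge0 ?(ltW h)// /rate; case: eqP => [h'|_]; first by have := p3; lra.
by apply: ler_powR => //; rewrite ler_pM2r ?invr_gt0//; have := p3; lra.
Qed.

Definition gmax := EN (fun w : R => `|w| `^ Num.max (r - 2) 0).

Let L1_gmax : L1 (gauss R) (fun w => `|w| `^ Num.max (r - 2) 0).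
Proof.
have [m0 mp'] := andP r20; have h3 := p3.
have e : egrowth (fun w : R => 2 + `|w ^+ 3|).
  by apply: egrowthD; [exact: egrowth_cst|apply: egrowth_abs; exact: egrowth_exp].
apply: (L1_dom _ (egrowth_L1 e)); first exact: measurable_powR_norm.
move=> w; rewrite ger0_norm ?powR_ge0// normrX.
move: m0; rewrite le_eqVlt => /predU1P[<-|m0].
  by rewrite powRr0; apply: ler_wpDr; [exact: exprn_ge0|rewrite ler1n].
apply: (@le_trans _ _ (1 + `|w| ^+ 3)); last by rewrite lerD2r ler1n.
by apply: powR_le_1D3 => //; apply/andP; split => //; lra.
Qed.

Definition bMr := (22 ^+ 2 * Np P p e0) `^ (Num.max (r - 2) 0 / p).

Let Ex_M_max n : Ex P (fun w => `|M n w| `^ Num.max (r - 2) 0) <=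
  (1 + bMr) * n%:R `^ (Num.max (r - 2) 0 / 2).
Proof.
have [] := andP r20; set q := Num.max _ _; rewrite le_eqVlt => /predU1P[q0 _|q0 qp].
  rewrite -q0 mul0r powRr0 mulr1; apply: Ex_le_cst.
    by apply: (eq_L1 (f := fun=> 1)) => [w|]; [rewrite powRr0|exact: L1_cst].
  by move=> w; rewrite powRr0 lerDl powR_ge0.
have h : 0 < q <= p by rewrite q0.
apply: (le_trans (Ex_pow_le p23 (Lp_M n) h)).
have n0 := Np_ge0 P p e0.
have n1 : 0 <= 22 ^+ 2 * Np P p e0 by rewrite mulr_ge0// exprn_ge0// ler0n.
apply: (@le_trans _ _ (bMr * n%:R `^ (q / 2))); last first.
  by apply: ler_wpM2r; [exact: powR_ge0|rewrite lerDr].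
have -> : bMr * n%:R `^ (q / 2) =
    (22 ^+ 2 * Np P p e0 * n%:R `^ (p / 2)) `^ (q / p).
  rewrite powRM ?powR_ge0// -powRrM; congr (_ * _ `^ _).
  by field; exact: pn0.
apply: ge0_powR_mono; [|exact: Np_ge0|exact: Np_M].
by apply: divr_ge0; exact: ltW.
Qed.

Let U1_sub x : `|U 1 f x - f x| <= EN (@W2 R) + 40 * `|x| `^ Num.max (r - 2) 0.
Proof. by apply: (le_trans (U1_sub_le r03 cf ft x)); rewrite lerD2l f2_le. Qed.

Let L1_fM n : L1 P (fun w => f (M n w)).
Proof. by have h := p0; apply: (L1_pgrowth0 f_pgrowth _ (Lp_M n)); rewrite lexx ltW. Qed.

(** Smoothing at bandwidth 1 changes f at x by at most a constant plus a multiple of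
    |x|^{max(r-2,0)}. At M_n the mean of this power is of order n^{max(r-2,0)/2}, which the rate
    dominates since p <= 3. *)
Lemma unsmooth_M n : (0 < n)%N ->
  `|Ex P (fun w => U 1 f (M n w)) - Ex P (fun w => f (M n w))| <=
  (EN (@W2 R) + 40 * (1 + bMr)) * rate p r n.
Proof.
move=> n0; have w0 : 0 <= EN (@W2 R) by case: (EN_W_ge0 R).
have iU : L1 P (fun w => U 1 f (M n w)).
  by have h := p0; apply: (L1_pgrowth0 (U_pgrowth ltr01) _ (Lp_M n)); rewrite lexx ltW.
have iq : L1 P (fun w => `|M n w| `^ Num.max (r - 2) 0) by exact: (L1_pow (Lp_M n)).
rewrite -ExB//.
apply: (@le_trans _ _ (Ex P (fun w => EN (@W2 R) + 40 * `|M n w| `^ Num.max (r - 2) 0))).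
  apply: abs_Ex_le; [exact: L1_measurable (L1B iU (L1_fM n))| |move=> w; exact: U1_sub].
  by apply: L1D; [exact: L1_cst|exact: L1Z].
rewrite ExD; [|exact: L1_cst|exact: L1Z].
rewrite Ex_cst (ExZ 40 iq) [leRHS]mulrDl; apply: lerD; first by apply: ler_peMr => //; exact: rate_ge1.
rewrite -[leRHS]mulrA; apply: ler_wpM2l => //; apply: (le_trans (Ex_M_max n)).
by apply: ler_wpM2l; [rewrite addr_ge0 ?powR_ge0|exact: max_rate].
Qed.

Lemma unsmooth_gauss n : (0 < n)%N ->
  `|U (sqrtn n.+1) f 0 - EN (fun w => f (sqrtn n * w))| <=
  (EN (@W2 R) + 40 * gmax) * rate p r n.
Proof.
move=> n0; have w0 : 0 <= EN (@W2 R) by case: (EN_W_ge0 R).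
have s0 := sqrtn_gt0 n0; have ef := taylor2_egrowth r03 cf ft.
have -> : U (sqrtn n.+1) f 0 = EN (fun w => U 1 f (0 + sqrtn n * w)).
  rewrite -(U_semigroup r03 cf ft)//; congr (U _ f 0).
  by rewrite -addn1 sqrtn_add /sqrtn sqrtr1.
have [eU _ _] := egrowth_U r03 cf ft ltr01.
have eU' : egrowth (fun w => U 1 f (0 + sqrtn n * w)) by exact: egrowth_affine.
have ef' : egrowth (fun w => f (sqrtn n * w)).
  have := egrowth_affine 0 (sqrtn n) ef; congr egrowth; apply/funext => w; by rewrite add0r.
have iw := L1_gmax.
have e w : `|sqrtn n * w| `^ Num.max (r - 2) 0 =
    n%:R `^ (Num.max (r - 2) 0 / 2) * `|w| `^ Num.max (r - 2) 0.
  rewrite normrM (ger0_norm (ltW s0)) powRM//; last exact: ltW.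
  by rewrite /sqrtn -powR12_sqrt// -powRrM [2^-1 * _]mulrC.
rewrite -ENB//.
apply: (@le_trans _ _ (EN (fun w => EN (@W2 R) + 40 * n%:R `^ (Num.max (r - 2) 0 / 2) * `|w| `^ Num.max (r - 2) 0))).
  apply: abs_Ex_le; [exact: L1_measurable (egrowth_L1 (egrowthB eU' ef'))| |].
    by apply: L1D; [exact: L1_cst|exact: L1Z].
  by move=> w; rewrite -mulrA -e add0r; exact: U1_sub.
rewrite [leLHS]ExD; [|exact: L1_cst|exact: L1Z].
rewrite Ex_cst (ExZ _ iw) [leRHS]mulrDl; apply: lerD; first by apply: ler_peMr => //; exact: rate_ge1.
rewrite -!mulrA; apply: ler_wpM2l => //; rewrite mulrC; apply: ler_wpM2l; last exact: max_rate.
by apply: Ex_ge0 => w; exact: powR_ge0.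
Qed.

Variable B : R.
Hypothesis hB : forall N, \sum_(0 <= l < N) (2 ^ l)%:R `^ (p / 2 - 2) * normZ (2 ^ l) <= B.

Lemma clt_bound n : (0 < n)%N ->
  `|Ex P (fun w => f (M n w)) - EN (fun w => f (sqrtn n * w))| <=
  (KT R * C * (Np P p e0 + EN (fun w : R => `|w| `^ p))
   + 80 * KT R * C * (bM + gM) * B
   + (EN (@W2 R) + 40 * (1 + bMr)) + (EN (@W2 R) + 40 * gmax)) * rate p r n.
Proof.
move=> n0; have K0 := KT_ge0 R; have Cge := ltW C0.
have g0 : 0 <= gM by apply: Ex_ge0 => w; exact: powR_ge0.
have h1 := lindeberg_sum n0; have h2 := unsmooth_M n0; have h3 := unsmooth_gauss n0.
have h4 := dyadic_le (N := n) n0 (ltnW (ltn_expl n (isT : 1 < 2)%N)).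
have h5 : 80 * KT R * C * (bM + gM) * (\sum_(0 <= l < n) (2 ^ l)%:R `^ (p / 2 - 2) * normZ (2 ^ l)) * rate p r n <=
   80 * KT R * C * (bM + gM) * B * rate p r n.
  apply: ler_wpM2r; first exact: rate_ge0.
  apply: ler_wpM2l => //; apply: mulr_ge0; last by rewrite addr_ge0 ?bM_ge0.
  by apply: mulr_ge0 => //; apply: mulr_ge0.
have h6 := le_trans h4 h5.
move: h1 h2 h3 h6 {h4 h5}.
set x1 := Ex P _; set x2 := U _ f 0; set x3 := Ex P _; set x4 := EN (fun w => f _); set S := \sum_(0 <= k < n) _.
set A1 := KT R * C * _; set A2 := 80 * _ * _ * _ * _; set A3 := _ + 40 * (1 + _); set A4 := _ + 40 * gmax; set rr := rate _ _ _.
move=> h1 h2 h3 h6.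
have -> : x3 - x4 = (x1 - x2 - S / 2) + S / 2 - (x1 - x3) + (x2 - x4) by ring.
rewrite [leRHS]mulrDl; apply: (le_trans (ler_normD _ _)); apply: lerD => //.
rewrite [leRHS]mulrDl; apply: (le_trans (ler_normB _ _)); apply: lerD => //.
rewrite [leRHS]mulrDl; apply: (le_trans (ler_normD _ _)); apply: lerD => //.
rewrite normrM normfV (ger0_norm (ler0n R 2)) ler_pdivrMr// (le_trans h6)//.
by apply: ler_peMr; [exact: le_trans h6|rewrite ler1n].
Qed.

End martingale.

(** * Dyadic condensation of the series *)

Section dyadic_subadditive.
Context (R : realType).
Variables (V : nat -> R) (q S : R).
Hypothesis V0 : forall k, 0 <= V k.
Hypothesis Vsub : forall a b, V (a + b)%N <= V a + V b.
Hypothesis q3 : q <= 3.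
Hypothesis VS : forall K, \sum_(1 <= k < K) k%:R `^ (q - 3) * V k <= S.

Let block l := \sum_(2 ^ l <= k < 2 ^ l.+2) k%:R `^ (q - 3) * V k.

(* By subadditivity 2 h V(4 h) <= 2 sum_{h <= k < 4 h} V(k). *)
Let term_le l : (2 ^ l.+2)%:R `^ (q - 2) * V (2 ^ l.+2) <= 4 * block l.
Proof.
rewrite /block; have -> : (2 ^ l.+2 = 4 * 2 ^ l)%N by rewrite !expnS mulnA.
have h0 : (0 < 2 ^ l)%N by rewrite expn_gt0.
move: (2 ^ l)%N h0 => h h0.
have dbl : (2 * h)%:R * V (4 * h)%N <= 2 * \sum_(h <= k < 4 * h) V k.
  have hl : (h <= 3 * h)%N by rewrite leq_pmull.
  have e1 : (2 * h)%:R * V (4 * h)%N = \sum_(h <= k < 3 * h) V (4 * h)%N.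
    by rewrite sumr_const_nat mulr_natl; congr (_ *+ _); lia.
  have e2 : \sum_(h <= k < 3 * h) V (4 * h)%N <=
      \sum_(h <= k < 3 * h) (V k + V (4 * h - k)%N).
    rewrite [leLHS]big_nat [leRHS]big_nat; apply: ler_sum => k /andP[_ kh].
    have <- : (k + (4 * h - k) = 4 * h)%N by lia.
    by rewrite addKn; exact: Vsub.
  rewrite e1; apply: (le_trans e2); rewrite big_split/= mulr_natl mulr2n.
  apply: lerD.
    rewrite [leRHS](@big_cat_nat _ _ _ (3 * h))//=; last by rewrite leq_mul2r orbT.
    by rewrite lerDl sumr_ge0.
  have -> : \sum_(h <= k < 3 * h) V (4 * h - k)%N = \sum_(h.+1 <= k < (3 * h).+1) V k.
    rewrite big_nat_rev/= [RHS]big_add1/= [LHS]big_nat [RHS]big_nat.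
    by apply: eq_bigr => k /andP[_ kh]; congr V; lia.
  rewrite [leRHS](@big_cat_nat _ _ _ h.+1)//=; last by lia.
  rewrite [X in _ <= _ + X](@big_cat_nat _ _ _ (3 * h).+1)//=; [|by lia].
  by rewrite addrCA lerDl addr_ge0 ?sumr_ge0.
have hp : (0 : R) < (4 * h)%:R by rewrite ltr0n muln_gt0.
have -> : (4 * h)%:R `^ (q - 2) = (4 * h)%:R `^ (q - 3) * (4 * h)%:R :> R.
  rewrite -[X in _ * X]powRr1 ?(ltW hp)// -powR_neq0_add//; congr (_ `^ _); ring.
have -> : (4 * h)%:R = 2 * (2 * h)%:R :> R by rewrite -natrM mulnA.
rewrite -mulrA -mulrA; have h2 : 0 <= (4 * h)%:R `^ (q - 3) :> R by exact: powR_ge0.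
rewrite -natrM mulnA.
apply: (@le_trans _ _ ((4 * h)%:R `^ (q - 3) * (2 * (2 * \sum_(h <= k < 4 * h) V k)))).
  by apply: ler_wpM2l => //; apply: ler_wpM2l.
have -> (x y : R) : x * (2 * (2 * y)) = 4 * (x * y) by ring.
apply: ler_wpM2l => //.
rewrite mulr_sumr [leLHS]big_nat [leRHS]big_nat; apply: ler_sum => k /andP[hk kh].
apply: ler_wpM2r => //; have k0 : (0 : R) < k%:R by rewrite ltr0n (leq_trans h0).
rewrite -[q - 3]opprB !powRN lef_pV2 ?posrE ?powR_gt0//.
by apply: ge0_powR_mono; [rewrite subr_ge0|exact: ltW|rewrite ler_nat ltnW].
Qed.

(** Each integer lies in at most two of the intervals from 2^l to 2^{l+2}, so the blocks add up to
    at most 2 S, and 8 = 4 * 2. The first two terms are kept apart because [term_le] starts at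
    exponent l + 2. *)
Lemma dyadic_sum_le N : \sum_(0 <= l < N) (2 ^ l)%:R `^ (q - 2) * V (2 ^ l) <=
  V 1 + 2 `^ (q - 2) * V 2 + 8 * S.
Proof.
have t0 l : 0 <= (2 ^ l)%:R `^ (q - 2) * V (2 ^ l) by rewrite mulr_ge0 ?powR_ge0.
have b0 a b : 0 <= \sum_(a <= k < b) k%:R `^ (q - 3) * V k.
  by apply: sumr_ge0 => k _; rewrite mulr_ge0 ?powR_ge0.
have S0 : 0 <= S by apply: le_trans (VS 0).
have bl : \sum_(0 <= l < N) block l <= 2 * S.
  have bl' : \sum_(0 <= l < N) block l =
      \sum_(1 <= k < 2 ^ N) k%:R `^ (q - 3) * V k + \sum_(2 <= k < 2 ^ N.+1) k%:R `^ (q - 3) * V k.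
    elim: N => [|n IH]; first by rewrite !big_geq// addr0.
    rewrite big_nat_recr//= IH /block.
    have le1 : (1 <= 2 ^ n)%N by rewrite expn_gt0.
    have le2 : (2 ^ n <= 2 ^ n.+1)%N by rewrite leq_exp2l.
    have le3 : (2 ^ n.+1 <= 2 ^ n.+2)%N by rewrite leq_exp2l.
    have le4 : (2 <= 2 ^ n.+1)%N by rewrite expnS leq_pmulr.
    rewrite (@big_cat_nat _ _ _ (2 ^ n.+1) (2 ^ n))//= addrACA.
    by rewrite -!big_cat_nat//.
  rewrite bl' mulr_natl mulr2n; apply: lerD => //.
  apply: le_trans (VS (2 ^ N.+1)); rewrite [leRHS](@big_cat_nat _ _ _ 2)//=.
    by rewrite lerDr.
  by rewrite expnS leq_pmulr// expn_gt0.
apply: (@le_trans _ _ (\sum_(0 <= l < N.+2) (2 ^ l)%:R `^ (q - 2) * V (2 ^ l))).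
  by rewrite !big_nat_recr//= -addrA lerDl addr_ge0.
rewrite big_nat_recl// big_nat_recl//= addrA expn0 powR1 mul1r expn1.
rewrite lerD2l.
have -> : 8 * S = 4 * (2 * S) by ring.
apply: (@le_trans _ _ (4 * \sum_(0 <= l < N) block l)).
  by rewrite mulr_sumr; apply: ler_sum => l _; exact: term_le.
by apply: ler_wpM2l.
Qed.

End dyadic_subadditive.

(** * Conditional expectations of the centred squares *)

Section conditional_variance.
Context d (T : measurableType d) (R : realType) (P : probability T R).
Variables (tau : T -> T).
Hypothesis mtau : measurable_fun [set: T] tau.
Hypothesis mp : forall B, measurable B -> P (tau @^-1` B) = P B.
Variable F0 : set (set T).
Hypothesis sF : sigma_algebra [set: T] F0.
Hypothesis Fm : F0 `<=` measurable.
Hypothesis Finc : F0 `<=` preimage_set_system [set: T] tau F0.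
Variables (p : R) (e0 : T -> R).
Hypothesis p23 : 2 < p <= 3.
Hypothesis me0 : meas_wrt F0 e0.
Hypothesis pe0 : Lp P p e0.
Hypothesis mds : forall B, F0 B -> Rintegral P B (e0 \o tau) = 0.
Variable Z : nat -> T -> R.
Hypothesis mZ : forall m, meas_wrt F0 (Z m).
Hypothesis pZ : forall m, Lp P p (fun w => `|Z m w| `^ 2^-1).
Hypothesis hZ : forall m B, F0 B -> Rintegral P B (fun w => Q tau e0 m w - Z m w) = 0.

Let p2 : 2 < p. Proof. by case/andP : p23. Qed.

Let sqrZ m w : (`|Z m w| `^ 2^-1) ^+ 2 = `|Z m w|.
Proof. by rewrite -powR_mulrn ?powR_ge0// -powRrM mulVf// powRr1. Qed.

Let iZ m : L1 P (Z m).
Proof. by apply: (L1_Z sF Fm p23). Qed.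

(** Proved by duality. The function xi = Z |Z|^{p/2-2}, with Z = Z_{a+b}, attains the L^{p/2} norm
    of Z. It is F0-measurable, so Z may be replaced by Q_{a+b} = Q_a + Q_b o tau^a under the
    expectation, and then each piece by its own Z, because F0 is contained in F_a. *)
Lemma normZ_subadd a b : normZ P p Z (a + b) <= normZ P p Z a + normZ P p Z b.
Proof.
have hp2 := p2; have pp0 : 0 < p by lra.
have pn0 : p != 0 by exact: lt0r_neq0.
have pn : 2 / p != 0 by apply: lt0r_neq0; exact: divr_gt0.
set n := (a + b)%N; pose xi w := Z n w * `|Z n w| `^ (p / 2 - 2).
pose z m := fun w => `|Z m w| `^ 2^-1.
have axi w : `|xi w| <= `|z n w| `^ (p - 2).
  have [Z0|Z0] := eqVneq (Z n w) 0; first by rewrite /xi Z0 mul0r normr0 powR_ge0.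
  rewrite /xi normrM [`|_ `^ _|]ger0_norm ?powR_ge0// -{1}[`|Z n w|]powRr1//.
  rewrite -powR_neq0_add ?normr_gt0// /z (ger0_norm (powR_ge0 _ _)) -powRrM.
  by rewrite le_eqVlt; apply/orP; left; apply/eqP; congr (_ `^ _); field.
have mxi : meas_wrt F0 xi.
  rewrite /meas_wrt; apply: measurable_funM; first exact: mZ.
  by apply: measurable_powR_norm; exact: mZ.
have mxi' := meas_wrt_measurable sF Fm mxi.
have dom (h : T -> R) (X : T -> R) : Lp P p X -> measurable_fun [set: T] h ->
    (forall w, `|h w| <= X w ^+ 2) -> L1 P (fun w => xi w * h w).
  move=> pX mh hX.
  apply: (L1_prod (al := p - 2) (be := 2) (C := 1) (pZ n) pX); [lra|lra|lra| |].
    exact: measurable_funM.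
  move=> w; rewrite mul1r normrM powR_sqr; apply: ler_pM => //; exact: axi.
have iQ m k : L1 P (fun w => xi w * Q tau e0 m (iter k tau w)).
  have -> : (fun w => xi w * Q tau e0 m (iter k tau w)) =
    (fun w => \sum_(0 <= j < m) (xi w * eps tau e0 (k + j.+1) w ^+ 2 - xi w * 1)).
    apply/funext => w; rewrite /Q mulr_sumr; apply: eq_bigr => j _.
    by rewrite -eps_add mulrBr.
  apply: L1_sum => j; apply: L1B.
    apply: (dom _ _ (Lp_eps mtau mp pe0 (k + j.+1))).
      by apply: measurable_funX; exact: (Lp_eps mtau mp pe0 _).1.
    by move=> w; rewrite normrX real_normK ?num_real.
  by apply: (dom _ _ (Lp_cst P p 1)) => // w; rewrite normr1 expr1n.
have iZk m k : L1 P (fun w => xi w * Z m (iter k tau w)).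
  apply: (dom _ _ (Lp_iter mtau mp k (pZ m))) => [|w]; last by rewrite /= sqrZ.
  exact: measurableT_comp (meas_wrt_measurable sF Fm (mZ m)) (iter_measurable mtau k).
have QZ m k : Ex P (fun w => xi w * Q tau e0 m (iter k tau w)) =
    Ex P (fun w => xi w * Z m (iter k tau w)).
  apply/eqP; rewrite -subr_eq0 -ExB//; apply/eqP.
  rewrite (eq_Ex P (g := fun w => xi w * (Q tau e0 m (iter k tau w) - Z m (iter k tau w)))); last first.
    by move=> w; rewrite mulrBr.
  apply: (Ex_pull mtau mp sF Fm (W := fun w => Q tau e0 m w - Z m w)).
  - by apply: L1B => //; exact: (L1_Q mtau mp p23 pe0).
  - exact: hZ.
  - by apply: (meas_wrt_le sF Finc (leq0n k)); rewrite Fk0.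
  - by apply: (eq_L1 _ (L1B (iQ m k) (iZk m k))) => w; rewrite mulrBr.
have N0 := Np_ge0 P p (z n); set N := Np P p (z n) in N0.
have eN : N = Ex P (fun w => xi w * Z n w).
  apply: eq_Ex => w; rewrite /xi mulrAC -expr2 -powR_sqr /z (ger0_norm (powR_ge0 _ _)).
  rewrite -powRrM; have [->|Zn] := eqVneq (Z n w) 0.
    have ph : 2^-1 * p != 0 by apply: lt0r_neq0; exact: mulr_gt0.
    by rewrite normr0 (powR0 ph) (@powR0 _ 2) ?mul0r// gt_eqF.
  by rewrite -powR_neq0_add ?normr_gt0//; congr (_ `^ _); field.
have bd m k : Ex P (fun w => xi w * Z m (iter k tau w)) <= N `^ ((p - 2) / p) * normZ P p Z m.
  have pz := Lp_iter mtau mp k (pZ m).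
  have h := Ex_prod_le p23 (pZ n) pz (al := p - 2) (be := 2).
  move: h; rewrite subr_gt0 hp2 ltr0n subrK (Np_iter mtau mp _ (pZ m)) => /(_ isT isT erefl).
  apply: le_trans; apply: le_Ex => //.
    apply: (L1_prod (al := p - 2) (be := 2) (C := 1) (pZ n) pz); [lra|lra|lra| |].
      apply: measurable_funM; apply: measurable_powR_norm; first exact: (pZ n).1.
      exact: pz.1.
    by move=> w; rewrite mul1r ger0_norm// mulr_ge0 ?powR_ge0.
  move=> w; apply: (le_trans (ler_norm _)); rewrite normrM; apply: ler_pM => //.
  by rewrite powR_sqr/= sqrZ.
have fin : N <= N `^ ((p - 2) / p) * (normZ P p Z a + normZ P p Z b).
  rewrite [leLHS]eN mulrDr.
  have := QZ n 0%N => /= <-.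
  rewrite (eq_Ex P (g := fun w => xi w * Q tau e0 a (iter 0 tau w) + xi w * Q tau e0 b (iter a tau w))); last first.
    by move=> w; rewrite Q_add mulrDr.
  by rewrite ExD// !QZ; apply: lerD; exact: bd.
(* [fin] reads N <= N^{(p-2)/p} times the desired bound, and the norm is N^{2/p}: when N > 0 it
   remains to divide. *)
have [Nz|Nn] := eqVneq N 0.
  have -> : normZ P p Z n = N `^ (2 / p) by [].
  by rewrite Nz (powR0 pn); apply: addr_ge0; exact: normZ_ge0.
have Np0 : 0 < N by rewrite lt_neqAle eq_sym Nn.
rewrite -(ler_pM2l (powR_gt0 ((p - 2) / p) Np0)); apply: le_trans fin.
have -> : normZ P p Z n = N `^ (2 / p) by [].
rewrite -powR_neq0_add// le_eqVlt; apply/orP; left; apply/eqP.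
rewrite -[RHS]powRr1//; congr (_ `^ _); field; exact: pn0.
Qed.

(** This links Z to the hypothesis on the series: in M_{n+1}^2 = M_n^2 + 2 M_n eps_{n+1} +
    eps_{n+1}^2 the cross term is orthogonal to F0. The constant n appears whatever the variance,
    since Q_n subtracts 1 from each square. *)
Lemma Rint_M_sqr n B : F0 B ->
  Rintegral P B (fun w => M tau e0 n w ^+ 2 - n%:R - Q tau e0 n w) = 0.
Proof.
move=> FB; have mB := Fm FB.
have pM n' := Lp_M mtau mp p23 pe0 n'.
have mI : meas_wrt F0 (\1_B : T -> R).
  have gB : <<s F0 >> B by rewrite (gsF sF).
  exact: measurable_indic.
have I1 w : `|(\1_B w : R)| <= 1.
  by rewrite indicE; case: (_ \in _); rewrite ?normr1 ?normr0.
have toEx (g : T -> R) : Rintegral P B g = Ex P (fun w => \1_B w * g w).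
  rewrite /Ex /Rintegral; congr fine; rewrite integral_mkcond; apply: eq_integral => w _.
  by rewrite patchE indicE; case: (w \in B); rewrite ?mul1r ?mul0r.
have idom (g : T -> R) : L1 P g -> L1 P (fun w => \1_B w * g w).
  move=> ig; apply: (L1_dom _ (L1_abs ig)).
    by apply: measurable_funM; [exact: measurable_indic|exact: L1_measurable ig].
  by move=> w; rewrite normrM ler_piMl.
rewrite toEx; elim: n => [|n IH].
  rewrite -[RHS](Ex_cst P); apply: eq_Ex => w.
  by rewrite /M /Q !big_geq// expr0n !subrr mulr0.
have iM n' : L1 P (fun w => M tau e0 n' w ^+ 2) by exact: (Lp_sqr p23 (pM n')).
have iQ n' := L1_Q mtau mp p23 pe0 n'.
have iX : L1 P (fun w => M tau e0 n w * eps tau e0 n.+1 w).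
  exact: (Lp_mul p23 (pM n) (Lp_eps mtau mp pe0 _)).
have i1 : L1 P (fun w => \1_B w * (M tau e0 n w ^+ 2 - n%:R - Q tau e0 n w)).
  by apply: idom; apply: L1B => //; apply: L1B => //; exact: L1_cst.
have i2 : L1 P (fun w => \1_B w * M tau e0 n w * eps tau e0 n.+1 w).
  by apply: (eq_L1 _ (idom _ iX)) => w; rewrite mulrA.
rewrite (eq_Ex P (g := fun w => \1_B w * (M tau e0 n w ^+ 2 - n%:R - Q tau e0 n w) +
   2 * (\1_B w * M tau e0 n w * eps tau e0 n.+1 w))); last first.
  move=> w; rewrite /M /Q !big_nat_recr//=.
  set s := \sum_(0 <= i < n) eps tau e0 i.+1 w.
  set t := \sum_(0 <= i < n) (eps tau e0 i.+1 w ^+ 2 - 1).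
  set e := eps _ _ _ _; set x := \1_B w; move: s t e x => s t e x.
  by rewrite -natr1; ring.
rewrite (ExD i1 (L1Z 2 i2)) IH (ExZ 2 i2) add0r.
rewrite (Ex_mds mtau mp sF Fm p23 pe0 mds) ?mulr0//.
rewrite /meas_wrt; apply: measurable_funM; last exact: (meas_wrt_M sF Finc me0 (leqnn n)).
by apply: (meas_wrt_le sF Finc (leq0n n)); rewrite Fk0.
Qed.

End conditional_variance.

(** * Normalised test functions and the martingale bound *)

Section zolotarev_class.
Context (R : realType).

(* Functions of Lambda_r normalised by removing their second-order Taylor polynomial at 0. *)
Definition normalized_Lambda r (f : R -> R) := [/\ continuous f, f 0 = 0 & exists f1 f2 : R -> R,
  [/\ taylor2 f f1 f2 (fun y => y `^ r), r <= 1 -> f1 = fun=> 0, r <= 2 -> f2 = fun=> 0,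
      f1 0 = 0 & f2 0 = 0]].

(** The class is homogeneous of degree r. Bounds for M_n, uniform over the class, thus transfer to
    any multiple of M_n at the price of the r-th power of the factor. *)
Lemma normalized_Lambda_scale r f c : 0 < c -> normalized_Lambda r f -> normalized_Lambda r (fun x => c `^ (- r) * f (c * x)).
Proof.
move=> c0 [cf f0 [f1 [f2 [ft h1 h2 f10 f20]]]]; split.
- move=> x; apply: (@continuousM _ _ (fun=> c `^ (- r)) (fun x => f (c * x))).
    exact: cst_continuous.
  apply: continuous_comp; last exact: cf.
  exact: mulrl_continuous.
- by rewrite mulr0 f0 mulr0.
exists (fun x => c `^ (- r) * c * f1 (c * x)), (fun x => c `^ (- r) * c ^+ 2 * f2 (c * x)).
split.
- move=> x y; have := ft (c * x) (c * y).
  rewrite normrM (gtr0_norm c0) powRM// ?(ltW c0)// => h.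
  have cr : c `^ (- r) * c `^ r = 1 by rewrite -powR_neq0_add// addNr powRr0.
  have cr0 := powR_ge0 c (- r).
  have -> : c `^ (- r) * f (c * (x + y)) - c `^ (- r) * f (c * x) -
     c `^ (- r) * c * f1 (c * x) * y - c `^ (- r) * c ^+ 2 * f2 (c * x) * y ^+ 2 / 2 =
     c `^ (- r) * (f (c * x + c * y) - f (c * x) - f1 (c * x) * (c * y) - f2 (c * x) * (c * y) ^+ 2 / 2).
    by rewrite mulrDr; field.
  rewrite normrM (ger0_norm cr0).
  have -> : `|y| `^ r = c `^ (- r) * (c `^ r * `|y| `^ r) by rewrite mulrA cr mul1r.
  exact: ler_wpM2l.
- by move=> /h1 ->; apply/funext => x; rewrite mulr0.
- by move=> /h2 ->; apply/funext => x; rewrite mulr0.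
- by rewrite mulr0 f10 mulr0.
- by rewrite mulr0 f20 mulr0.
Qed.

Lemma normalized_Lambda_egrowth r f : 0 < r <= 3 -> normalized_Lambda r f -> egrowth f.
Proof. by move=> r03 [cf _ [f1 [f2 [ft _ _ _ _]]]]; exact: taylor2_egrowth r03 cf ft. Qed.

Lemma normalized_Lambda_increment_le1 r f : r <= 1 -> normalized_Lambda r f -> forall x y, `|f y - f x| <= `|y - x| `^ r.
Proof.
move=> r1 [_ _ [f1 [f2 [ft h1 h2 _ _]]]] x y.
have := ft x (y - x); rewrite subrKC h1// h2; last by apply: (le_trans r1); rewrite ler1n.
by rewrite !mul0r !subr0.
Qed.

Lemma normalized_Lambda_increment r f : 1 < r <= 3 -> normalized_Lambda r f ->
  forall x y, `|f y - f x| <= 37 * (`|y - x| * (`|x| + `|y|) `^ (r - 1)).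
Proof.
by move=> r13 [_ _ [f1 [f2 [ft _ h2 f10 f20]]]]; exact: (taylor2_increment r13 ft h2 f10 f20).
Qed.

End zolotarev_class.

Lemma normalized_Lambda_L1 d (T : measurableType d) (R : realType) (P : probability T R) (p r : R)
    (f : R -> R) (Y : T -> R) : 2 < p <= 3 -> p - 2 <= r <= p -> normalized_Lambda r f -> Lp P p Y ->
  L1 P (fun w => f (Y w)).
Proof.
move=> p23 hr [cf _ [f1 [f2 [ft _ _ _ f20]]]] pY; have [p2 p3] := andP p23.
apply: (L1_pgrowth0 (f_pgrowth p23 hr cf ft f20) _ pY).
by rewrite lexx andbT; lra.
Qed.

Section martingale_clt.
Context d (T : measurableType d) (R : realType) (P : probability T R).
Variables (tau : T -> T).
Hypothesis mtau : measurable_fun [set: T] tau.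
Hypothesis mp : forall B, measurable B -> P (tau @^-1` B) = P B.
Variable F0 : set (set T).
Hypothesis sF : sigma_algebra [set: T] F0.
Hypothesis Fm : F0 `<=` measurable.
Hypothesis Finc : F0 `<=` preimage_set_system [set: T] tau F0.
Variables (p : R) (e0 : T -> R).
Hypothesis p23 : 2 < p <= 3.
Hypothesis me0 : meas_wrt F0 e0.
Hypothesis pe0 : Lp P p e0.
Hypothesis mds : forall B, F0 B -> Rintegral P B (e0 \o tau) = 0.
Hypothesis e1 : Ex P (fun w => e0 w ^+ 2) = 1.
Variable Z : nat -> T -> R.
Hypothesis mZ : forall m, meas_wrt F0 (Z m).
Hypothesis pZ : forall m, Lp P p (fun w => `|Z m w| `^ 2^-1).
Hypothesis hZ : forall m B, F0 B -> Rintegral P B (fun w => Q tau e0 m w - Z m w) = 0.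
Variable S : R.
Hypothesis hS : forall K, \sum_(1 <= k < K) k%:R `^ (p / 2 - 3) * normZ P p Z k <= S.

Lemma clt_uniform r : p - 2 <= r <= p -> exists C, 0 <= C /\
  forall f n, normalized_Lambda r f -> (0 < n)%N ->
  `|Ex P (fun w => f (M tau e0 n w)) - EN (fun w => f (Num.sqrt n%:R * w))| <= C * rate p r n.
Proof.
move=> hr; have [p2 p3] := andP p23.
have r1 : r = p - 2 -> r <= 1 by move=> ->; lra.
have [C [C0 hC]] := gmod_sum p23 hr r1.
have q3 : p / 2 <= 3 by lra.
have hB := dyadic_sum_le (normZ_ge0 P p Z)
  (normZ_subadd mtau mp sF Fm Finc p23 pe0 mZ pZ hZ) q3 hS.
eexists; split; last first.
  move=> f n [cf _ [f1 [f2 [ft _ h2 _ f20]]]] n0.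
  have := clt_bound mtau mp sF Fm Finc p23 me0 pe0 mds hr cf ft e1 C0 hC mZ pZ hZ f20 h2 hB n0.
  move/le_trans; apply; apply: ler_wpM2r; [exact: rate_ge0|exact: ler_norm].
exact: normr_ge0.
Qed.

Lemma clt_scaled r : p - 2 <= r <= p -> exists C, 0 <= C /\
  forall f s n, normalized_Lambda r f -> 0 < s -> (0 < n)%N ->
  `|Ex P (fun w => f (s / Num.sqrt n%:R * M tau e0 n w)) - EN (fun w => f (s * w))| <=
  C * s `^ r * (n%:R `^ (- (r / 2)) * rate p r n).
Proof.
move=> hr; have [C [C0 hC]] := clt_uniform hr; exists C; split => // f s n nf s0 n0.
have sn0 : 0 < Num.sqrt n%:R :> R by rewrite sqrtr_gt0 ltr0n.
set c := s / Num.sqrt n%:R; have c0 : 0 < c by exact: divr_gt0.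
have := hC _ n (normalized_Lambda_scale c0 nf) n0.
have [p2 p3] := andP p23; have [r1 r2] := andP hr.
have r03 : 0 < r <= 3 by apply/andP; split; lra.
have pM := Lp_M mtau mp p23 pe0 n.
have iM : L1 P (fun w => f (c * M tau e0 n w)).
  exact: (normalized_Lambda_L1 p23 hr nf (LpZ c pM)).
have ef : egrowth (fun w => f (s * w)).
  have := egrowth_affine 0 s (normalized_Lambda_egrowth r03 nf); congr egrowth; apply/funext => w; by rewrite add0r.
rewrite (ExZ _ iM) (_ : EN _ = c `^ (- r) * EN (fun w => f (s * w))); last first.
  rewrite -ENZ//; apply: eq_EN => w.
  by congr (_ * f _); rewrite mulrA /c divfK// gt_eqF.
rewrite -mulrBr normrM (ger0_norm (powR_ge0 _ _)) => h.
have cr : c `^ r * c `^ (- r) = 1 by rewrite -powR_neq0_add// subrr powRr0.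
move: h; set x : R := `|Ex P _ - _|; move: x => x h.
have -> : x = c `^ r * (c `^ (- r) * x) by rewrite mulrA cr mul1r.
have -> : C * s `^ r * (n%:R `^ (- (r / 2)) * rate p r n) = c `^ r * (C * rate p r n).
  rewrite /c powRM ?invr_ge0 ?(ltW s0) ?(ltW sn0)// powR_inv ?(ltW sn0)//.
  rewrite powRN -powR12_sqrt// -powRrM [2^-1 * r]mulrC; ring.
by apply: ler_wpM2l; first exact: powR_ge0.
Qed.

End martingale_clt.

(** * Linear processes *)

Section Lp_limits.
Context d (T : measurableType d) (R : realType) (P : probability T R) (p : R).
Hypothesis p23 : 2 < p <= 3.

Let p2 : 2 < p. Proof. by case/andP : p23. Qed.
Let p3 : p <= 3. Proof. by case/andP : p23. Qed.
Let p0 : 0 < p. Proof. by move: p2; lra. Qed.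

(** When al + be < p, Hölder's inequality leaves g with a moment of order s = be p / (p - al), at
    most p, which is then compared with the moment of order p. *)
Lemma Ex_prod_le_sub f g al be : Lp P p f -> Lp P p g -> 0 < al < p -> 0 < be ->
  al + be <= p ->
  L1 P (fun w => `|f w| `^ al * `|g w| `^ be) /\
  Ex P (fun w => `|f w| `^ al * `|g w| `^ be) <=
    Np P p f `^ (al / p) * Np P p g `^ (be / p).
Proof.
move=> pf pg /andP[al0 alp] be0 abp; have pp := p0.
set t := al / p; set s := be * p / (p - al).
have t01 : 0 < t < 1 by rewrite /t divr_gt0//= ltr_pdivrMr// mul1r.
have pal : 0 < p - al by rewrite subr_gt0.
have s0 : 0 < s <= p.
  rewrite /s divr_gt0 ?mulr_gt0//= ler_pdivrMr// [leRHS]mulrC ler_pM2r//; lra.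
have s0' : 0 <= s <= p by case/andP : s0 => /ltW -> ->.
have [i h] := holder_Ex t01 (fun w => powR_ge0 `|f w| p) (fun w => powR_ge0 `|g w| s)
  pf.2 (L1_pow pg s0').
have e w : (`|f w| `^ p) `^ t * (`|g w| `^ s) `^ (1 - t) = `|f w| `^ al * `|g w| `^ be.
  rewrite -!powRrM; congr (_ `^ _ * _ `^ _); rewrite /t /s; first by field; exact: lt0r_neq0.
  by field; rewrite !lt0r_neq0.
split; first exact: (eq_L1 e i).
rewrite -(eq_Ex P e); apply: (le_trans h); apply: ler_wpM2l; first exact: powR_ge0.
have := Ex_pow_le p23 pg s0.
move/(ge0_powR_mono (_ : 0 <= 1 - t) (Ex_ge0 _ (fun w => powR_ge0 `|g w| s))) => h2.
have t1 : 0 <= 1 - t by case/andP : t01 => _ t1; rewrite subr_ge0 ltW.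
apply: (le_trans (h2 t1)); rewrite -powRrM le_eqVlt; apply/orP; left; apply/eqP.
by congr (_ `^ _); rewrite /t /s; field; rewrite !lt0r_neq0.
Qed.

Let trunc_le (a b K : R) : 0 <= a -> 0 <= b -> 0 <= K ->
  Num.min (a + b) K `^ p <= 8 * (a `^ p + K `^ (p - 2) * b ^+ 2).
Proof.
move=> a0 b0 K0; have pp := p0; have hp2 := p2; have hp3 := p3.
have mb0 : 0 <= Num.min b K by rewrite le_min b0.
have h1 : Num.min (a + b) K <= a + Num.min b K.
  by rewrite /Num.min; case: ltP => h1; case: ltP => h2; lra.
have m0 : 0 <= Num.min (a + b) K by rewrite le_min K0 addr_ge0.
apply: (@le_trans _ _ ((a + Num.min b K) `^ p)); first by apply: ge0_powR_mono => //; exact: ltW.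
have p03 : 0 <= p <= 3 by apply/andP; split; lra.
have := powR_add_le a (Num.min b K) p03.
rewrite !ger0_norm ?addr_ge0// => h2; apply: (le_trans h2); apply: ler_wpM2l => //.
rewrite lerD2l.
have [->|bn] := eqVneq (Num.min b K) 0.
  by rewrite powR0 ?lt0r_neq0// mulr_ge0 ?powR_ge0 ?sqr_ge0.
have bp : 0 < Num.min b K by rewrite lt_neqAle eq_sym bn.
have -> : Num.min b K `^ p = Num.min b K `^ (p - 2) * Num.min b K ^+ 2.
  by rewrite -(powR_mulrn 2 mb0) -powR_neq0_add// subrK.
apply: ler_pM; [exact: powR_ge0|exact: exprn_ge0| |].
  by apply: ge0_powR_mono => //; [lra|rewrite ge_min lexx orbT].
by rewrite ler_pXn2r ?nnegrE// ge_min lexx.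
Qed.

(* min(|Y|, K)^p <= 8 (|W|^p + (1 + K^{p-2}) |Y - W|^2), then let K tend to infinity. *)
Lemma Lp_L2_limit (Y : T -> R) B : measurable_fun [set: T] Y ->
  (forall dl, 0 < dl -> exists W, [/\ Lp P p W, Np P p W <= B,
    L1 P (fun w => (Y w - W w) ^+ 2) & Ex P (fun w => (Y w - W w) ^+ 2) <= dl]) ->
  Lp P p Y /\ Np P p Y <= 8 * B.
Proof.
move=> mY app; have pp := p0; have p03 : 0 <= p <= 3 by apply/andP; split; [exact: ltW|exact: p3].
pose g (k : nat) w := (Num.min `|Y w| k%:R `^ p)%:E : \bar R.
have mY' : measurable_fun [set: T] (fun w => `|Y w|) by exact: measurableT_comp.
have mg k : measurable_fun [set: T] (fun w => Num.min `|Y w| k%:R `^ p).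
  by apply: measurable_powRf; apply: measurable_minr.
have ig k : L1 P (fun w => Num.min `|Y w| k%:R `^ p).
  apply: (L1_dom (mg k) (L1_cst P (k%:R `^ p))) => w.
  rewrite ger0_norm ?powR_ge0//; apply: ge0_powR_mono; [exact: ltW|by rewrite le_min normr_ge0 ler0n|].
  by rewrite ge_min lexx orbT.
have bg k : Ex P (fun w => Num.min `|Y w| k%:R `^ p) <= 8 * B.
  apply/ler_addgt0Pr => e e0.
  have K0 : 0 <= (k%:R : R) `^ (p - 2) by exact: powR_ge0.
  have dl0 : 0 < e / (8 * (1 + (k%:R : R) `^ (p - 2))) by rewrite divr_gt0// mulr_gt0// ltr_pwDl.
  have [W [pW NW iW eW]] := app _ dl0.
  have i2 := L1Z ((k%:R : R) `^ (p - 2)) iW.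
  apply: (@le_trans _ _ (Ex P (fun w => 8 * (`|W w| `^ p + k%:R `^ (p - 2) * (Y w - W w) ^+ 2)))).
    apply: le_Ex => //; first by apply: L1Z; apply: L1D => //; exact: pW.2.
    move=> w; have := trunc_le (normr_ge0 (W w)) (normr_ge0 (Y w - W w)) (ler0n R k).
    rewrite -normrX [`|(_ - _) ^+ 2|]ger0_norm ?sqr_ge0//; apply: le_trans.
    apply: ge0_powR_mono; [exact: ltW|by rewrite le_min normr_ge0 ler0n|].
    have tri : `|Y w| <= `|W w| + `|Y w - W w|.
      by rewrite -{1}[Y w](subrK (W w)) addrC; exact: ler_normD.
    rewrite le_min !ge_min lexx orbT andbT.
    by rewrite tri.
  have i3 : L1 P (fun w => `|W w| `^ p) by exact: pW.2.
  rewrite (ExZ _ (L1D i3 i2)) (ExD i3 i2) (ExZ _ iW) mulrDr; apply: lerD.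
    by apply: ler_wpM2l.
  apply: (@le_trans _ _ (8 * ((1 + (k%:R : R) `^ (p - 2)) * (e / (8 * (1 + (k%:R : R) `^ (p - 2))))))).
    apply: ler_wpM2l => //; apply: ler_pM => //; [exact: Ex_ge0 (fun w => sqr_ge0 _)|by rewrite lerDr].
  rewrite le_eqVlt; apply/orP; left; apply/eqP; field.
  by apply: lt0r_neq0; exact: ltr_pwDl.
have lim : (\int[P]_w (`|Y w| `^ p)%:E <= (8 * B)%:E)%E.
  have -> : (\int[P]_w (`|Y w| `^ p)%:E = \int[P]_w limn (fun k => g k w))%E.
    apply: eq_integral => w _; apply/esym/cvg_lim => //; apply: cvg_near_cst.
    have h := archi_boundP (normr_ge0 (Y w)); exists (Num.bound `|Y w|) => // k /= bk.
    by rewrite /g min_l// (le_trans (ltW h))// ler_nat.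
  rewrite monotone_convergence//; last 3 first.
  - by move=> k; apply/measurable_EFinP; exact: mg.
  - by move=> k w _; rewrite lee_fin powR_ge0.
  - move=> w _ a b ab; rewrite lee_fin; apply: ge0_powR_mono; [exact: ltW|by rewrite le_min normr_ge0 ler0n|].
    by rewrite le_min !ge_min lexx/= ler_nat ab orbT.
  apply: lime_le; last first.
    by near=> k; rewrite (EFin_Ex (ig k)) lee_fin; exact: bg.
  apply: ereal_nondecreasing_is_cvgn => a b ab; apply: ge0_le_integral => //.
  - by move=> w _; rewrite lee_fin powR_ge0.
  - by apply/measurable_EFinP; exact: mg.
  - by apply/measurable_EFinP; exact: mg.
  - move=> w _; rewrite lee_fin; apply: ge0_powR_mono; [exact: ltW|by rewrite le_min normr_ge0 ler0n|].
    by rewrite le_min !ge_min lexx/= ler_nat ab orbT.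
have iY : L1 P (fun w => `|Y w| `^ p).
  apply: L1_ge0; [exact: measurable_powR_norm|by move=> w; exact: powR_ge0|].
  by apply: (le_lt_trans lim); exact: ltry.
split; first by split.
by rewrite -lee_fin /Np -EFin_Ex.
Unshelve. all: by end_near.
Qed.

End Lp_limits.

Lemma sqr_sum_le (R : realType) n (y : nat -> R) :
  (\sum_(0 <= k < n) y k) ^+ 2 <= n%:R * \sum_(0 <= k < n) y k ^+ 2.
Proof.
have -> : (\sum_(0 <= k < n) y k) ^+ 2 = \sum_(0 <= k < n) \sum_(0 <= l < n) y k * y l.
  by rewrite expr2 mulr_suml; apply: eq_bigr => k _; rewrite mulr_sumr.
apply: (@le_trans _ _ (\sum_(0 <= k < n) \sum_(0 <= l < n) (y k ^+ 2 / 2 + y l ^+ 2 / 2))).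
  apply: ler_sum => k _; apply: ler_sum => l _.
  by have := sqr_ge0 (y k - y l); rewrite sqrrB; lra.
under eq_bigr do rewrite big_split/= sumr_const_nat subn0.
rewrite big_split/= sumr_const_nat subn0 sumrMnl mulr_natl -mulrnDl -big_split/=.
by rewrite le_eqVlt; apply/orP; left; apply/eqP; congr (_ *+ _); apply: eq_bigr => k _; lra.
Qed.

Lemma zsum_window (V : nmodType) (v : int -> V) (k u : nat) : (k <= u)%N ->
  zsum v (u - k, u + k)%N = \sum_(0 <= l < u.*2.+1) v (k%:Z - (l%:Z - u%:Z))%R.
Proof.
move=> ku; rewrite /zsum/= [RHS](@big_cat_nat _ _ _ (u + k).+1)//=; last first.
  by rewrite ltnS -addnn leq_add2l.
rewrite addrC; congr (_ + _).
  have -> : u.*2.+1 = ((u - k) + (u + k).+1)%N by rewrite addnS addnCA subnK// addnn.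
  rewrite -{1}[(u + k).+1]add0n big_addn addnK [LHS]big_nat [RHS]big_nat.
  by apply: eq_bigr => j /andP[_ ju]; congr v; lia.
rewrite [RHS]big_nat_rev/= add0n [LHS]big_nat [RHS]big_nat.
apply: eq_bigr => j /andP[_ ju]; congr v; rewrite subSS.
by move: ju; rewrite ltnS => ju; rewrite -subzn//; lia.
Qed.

Lemma zsum_bcoef (R : realType) (a : int -> R) (A : R) (v : int -> R) mn :
  zsum (fun j => bcoef a A j * v j) mn = zsum (fun j => a j * v j) mn - A * v 0.
Proof.
rewrite /zsum !(big_nat_recl mn.2)//= /bcoef eqxx mulrBl.
rewrite -!addrA; congr (_ + _); rewrite [- _ + _]addrC.
by rewrite !addrA; congr (_ - _).
Qed.

Section iterz.
Variables (T : Type) (tau tauV : T -> T).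
Hypothesis tauVK : cancel tauV tau.

Lemma iter_cancel n w : iter n tau (iter n tauV w) = w.
Proof. by elim: n w => [//|n IH] w; rewrite iterS iterSr -[X in tau X]/(iter n tau _) IH tauVK. Qed.

Lemma iterz_sub (l u : nat) w :
  iterz tau tauV (l%:Z - u%:Z) w = iter l tau (iter u tauV w).
Proof.
case: (leqP u l) => h.
  by rewrite subzn//= -{2}(subnK h) iterD iter_cancel.
have -> : (l%:Z - u%:Z = Negz (u - l).-1)%R by rewrite NegzE; lia.
rewrite /= -iterS prednK ?subn_gt0//.
by rewrite -{2}(subnKC (ltnW h)) iterD iter_cancel.
Qed.

End iterz.

(** * Coefficients of the remainder *)

Section window_coefficients.
Context (R : realType) (a : int -> R) (A : R).
Hypothesis ha : ell2 a.

(** The coefficient of eps_j in R_n = S_n - A M_n; [Acoef] is the sum of its squares over j. *)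
Definition Dcoef n (j : int) : R := \sum_(1 <= k < n.+1) bcoef a A (k%:Z - j).

Let esum_bcoef : (\esum_(j in [set: int]) (bcoef a A j ^+ 2)%:E < +oo)%E.
Proof.
pose g (j : int) : \bar R := ((if j == 0 then A ^+ 2 else 0) : R)%:E.
have g0 j : (0 <= g j)%E by rewrite /g lee_fin; case: ifP => _ //; exact: sqr_ge0.
have a0 j : (0 <= (a j ^+ 2)%:E)%E by rewrite lee_fin sqr_ge0.
have gfin : (\esum_(j in [set: int]) g j < +oo)%E.
  have -> : (\esum_(j in [set: int]) g j = \esum_(j in [set (0%R : int)]) (A ^+ 2)%:E)%E.
    rewrite [RHS]esum_mkcond; apply: eq_esum => j _; rewrite /g.
    have -> : (j \in [set (0%R : int)]) = (j == 0) by apply/idP/idP => [/set_mem ->|/eqP ->] //; exact: mem_set.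
    by case: ifP.
  by rewrite esum_set1 ?ltry// lee_fin sqr_ge0.
have le j : [set: int] j -> ((bcoef a A j ^+ 2)%:E <= (((a j ^+ 2)%:E + (a j ^+ 2)%:E) + (g j + g j)))%E.
  move=> _; rewrite /g -!EFinD lee_fin /bcoef; case: eqP => [->|_].
    have := sqr_ge0 (a 0 + A); rewrite sqrrD sqrrB; lra.
  by have := sqr_ge0 (a j); lra.
apply: (le_lt_trans (le_esum le)).
rewrite esumD; [|by move=> j _; rewrite adde_ge0|by move=> j _; rewrite adde_ge0].
by rewrite !esumD// !lte_add_pinfty.
Qed.

Let Dcoef0 j : Dcoef 0 j = 0. Proof. by rewrite /Dcoef big_geq. Qed.

Let DcoefS n j : Dcoef n.+1 j = Dcoef n j + bcoef a A (n.+1%:Z - j).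
Proof. by rewrite /Dcoef big_nat_recr. Qed.

(** Needed because [fine] sends an infinite sum to 0, which would make [Acoef] useless as an upper
    bound. The proof is (x + y)^2 <= 2 x^2 + 2 y^2, applied once per term of [Dcoef]. *)
Lemma Acoef_fin n : (\esum_(j in [set: int]) (Dcoef n j ^+ 2)%:E < +oo)%E.
Proof.
have p0 n' j : (0 <= (Dcoef n' j ^+ 2)%:E)%E by rewrite lee_fin sqr_ge0.
elim: n => [|n IH].
  rewrite (eq_esum (b := fun=> 0%E)) ?esum1// => j _.
  by rewrite Dcoef0 expr0n.
have b0 j : (0 <= (bcoef a A (n.+1%:Z - j) ^+ 2)%:E)%E by rewrite lee_fin sqr_ge0.
have bfin : (\esum_(j in [set: int]) (bcoef a A (n.+1%:Z - j) ^+ 2)%:E < +oo)%E.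
  have bij : set_bij [set: int] [set: int] (fun j => n.+1%:Z - j).
    split => //; first by move=> x y _ _ /addrI /oppr_inj.
    by move=> y _; exists (n.+1%:Z - y) => //; rewrite subKr.
  by rewrite -(reindex_esum _ _ _ (fun j => (bcoef a A j ^+ 2)%:E) bij).
have le j : [set: int] j -> ((Dcoef n.+1 j ^+ 2)%:E <=
   ((Dcoef n j ^+ 2)%:E + (Dcoef n j ^+ 2)%:E) +
   ((bcoef a A (n.+1%:Z - j) ^+ 2)%:E + (bcoef a A (n.+1%:Z - j) ^+ 2)%:E))%E.
  move=> _; rewrite -!EFinD lee_fin DcoefS.
  move: (Dcoef n j) (bcoef _ _ _) => x y.
  by have := sqr_ge0 (x - y); rewrite sqrrB sqrrD; lra.
apply: (le_lt_trans (le_esum le)).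
rewrite esumD; [|by move=> j _; rewrite adde_ge0|by move=> j _; rewrite adde_ge0].
by rewrite !esumD// !lte_add_pinfty.
Qed.

Lemma Acoef_ge0 n : 0 <= Acoef a A n.
Proof. by apply: fine_ge0; apply: esum_ge0 => j _; rewrite lee_fin sqr_ge0. Qed.

Lemma Dcoef_sum_le n u N :
  \sum_(0 <= l < N) Dcoef n (l%:Z - u%:Z) ^+ 2 <= Acoef a A n.
Proof.
rewrite -lee_fin /Acoef fineK; last first.
  rewrite ge0_fin_numE; first exact: Acoef_fin.
  by apply: esum_ge0 => j _; rewrite lee_fin sqr_ge0.
pose r := [seq (l%:Z - u%:Z)%R | l <- index_iota 0 N].
have ur : uniq r by rewrite map_inj_uniq ?iota_uniq// => x y /addIr [].
apply: esum_ge; exists [set` r]; first by split => //; exact: finite_seq.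
by rewrite -fsbig_seq// big_map sumEFin.
Qed.

End window_coefficients.

(** * The remainder S_n - A M_n *)

Section linear_process.
Context d (T : measurableType d) (R : realType) (P : probability T R).
Variables (tau tauV : T -> T).
Hypothesis htau : invertible_measure_preserving P tau tauV.
Variable F0 : set (set T).
Hypothesis sF : sigma_algebra [set: T] F0.
Hypothesis Fm : F0 `<=` measurable.
Hypothesis Finc : F0 `<=` preimage_set_system [set: T] tau F0.
Variables (p : R) (e0 : T -> R).
Hypothesis p23 : 2 < p <= 3.
Hypothesis me0 : meas_wrt F0 e0.
Hypothesis pe0 : Lp P p e0.
Hypothesis mds : forall B, F0 B -> Rintegral P B (e0 \o tau) = 0.
Variables (a : int -> R) (A : R).
Hypothesis ha : ell2 a.
Variable X : int -> {mfun T >-> R}.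
Hypothesis hX : forall k : int, zseries_cvg_L2 P
      (fun j w => a j * stationary_seq tau tauV e0 (k - j) w) (X k).

Let mtau : measurable_fun [set: T] tau. Proof. by case: htau. Qed.
Let mtauV : measurable_fun [set: T] tauV. Proof. by case: htau. Qed.
Let mp B : measurable B -> P (tau @^-1` B) = P B. Proof. by case: htau => _ _ _ _; apply. Qed.
Let tauK : cancel tau tauV. Proof. by case: htau. Qed.
Let tauVK : cancel tauV tau. Proof. by case: htau. Qed.

Let mpV B : measurable B -> P (tauV @^-1` B) = P B.
Proof.
move=> mB; rewrite -(mp (B := tauV @^-1` B)).
  by congr (P _); apply/funext => w; rewrite /preimage/= tauK.
by rewrite -[tauV @^-1` B]setTI; exact: mtauV.
Qed.

Lemma partial_sumE n w : partial_sum X n w = \sum_(1 <= k < n.+1) X k%:Z w.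
Proof.
rewrite /partial_sum; elim: n => [|n IH]; first by rewrite !big_geq.
by rewrite [RHS]big_nat_recr//= -IH [in LHS]big_nat_recr.
Qed.

(* Truncating the series of X_k to k - u <= j <= k + u leaves the same eps_i, |i| <= u, for
   all k; window n u is what then remains of R_n. *)
Definition window n u w := \sum_(0 <= l < u.*2.+1)
  Dcoef a A n (l%:Z - u%:Z) * e0 (iterz tau tauV (l%:Z - u%:Z) w).

(** The window involves negative times. Composing with the power u + 1 of [tauV], which preserves
    the law, turns it into a sum over times 1 to 2 u + 1, to which Burkholder's inequality applies.
    The bound does not depend on u. *)
Lemma window_Lp n u : Lp P p (window n u) /\
  Np P p (window n u) <= 22 ^+ 2 * Np P p e0 * Acoef a A n `^ (p / 2).
Proof.
have [p2 p3] := andP p23.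
have e : window n u = wsum tau e0 (fun l => Dcoef a A n (l%:Z - u%:Z)) u.*2.+1 \o iter u.+1 tauV.
  apply/funext => w; apply: eq_bigr => l _; rewrite (iterz_sub tauVK).
  by rewrite /eps/= -iterS iterSr tauVK.
have pw := Lp_wsum mtau mp p23 pe0 (fun l => Dcoef a A n (l%:Z - u%:Z)) u.*2.+1.
rewrite e; split; first exact: (Lp_iter mtauV mpV u.+1 pw).
rewrite (Np_iter mtauV mpV u.+1 pw).
apply: (le_trans (wsum_Np_le mtau mp sF Fm Finc p23 me0 pe0 mds _ _)).
apply: ler_wpM2l; first by rewrite mulr_ge0 ?Np_ge0// exprn_ge0// ler0n.
apply: ge0_powR_mono; [lra|by apply: sumr_ge0 => j _; exact: sqr_ge0|].
exact: Dcoef_sum_le.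
Qed.

Lemma window_sum n u w : (n <= u)%N ->
  window n u w = \sum_(1 <= k < n.+1)
    (zsum (fun j => a j * stationary_seq tau tauV e0 (k%:Z - j) w) (u - k, u + k)%N)
    - A * M tau e0 n w.
Proof.
move=> nu; rewrite /M big_mkord -[X in A * X](big_mkord xpredT (fun j => eps tau e0 j.+1 w)).
rewrite -(big_add1 _ _ 0%N n.+1 xpredT (fun j => eps tau e0 j w)) mulr_sumr -sumrB.
transitivity (\sum_(1 <= k < n.+1) zsum (fun j => bcoef a A j * stationary_seq tau tauV e0 (k%:Z - j) w) (u - k, u + k)%N).
  rewrite [RHS]big_nat; under [RHS]eq_bigr => k /andP[_ kn].
    rewrite (zsum_window (fun j => bcoef a A j * stationary_seq tau tauV e0 (k%:Z - j) w)); last first.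
      by rewrite (leq_trans _ nu).
    over.
  rewrite -big_nat exchange_big/=; apply: eq_bigr => l _.
  rewrite mulr_suml; apply: eq_bigr => k _; rewrite /stationary_seq/=.
  by rewrite subKr.
apply: eq_bigr => k _; rewrite zsum_bcoef subr0.
by rewrite /stationary_seq /eps.
Qed.

Let Lp_iterz i : Lp P p (e0 \o iterz tau tauV i).
Proof. by case: i => n; [exact: (Lp_iter mtau mp n pe0)|exact: (Lp_iter mtauV mpV n.+1 pe0)]. Qed.

Lemma L2_near (k : nat) dl : 0 < dl -> exists N, forall u, (N <= u)%N ->
  L1 P (fun w => (X k w - zsum (fun j => a j * stationary_seq tau tauV e0 (k%:Z - j) w)
    (u - k, u + k)%N) ^+ 2) /\
  Ex P (fun w => (X k w - zsum (fun j => a j * stationary_seq tau tauV e0 (k%:Z - j) w)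
    (u - k, u + k)%N) ^+ 2) <= dl.
Proof.
move=> dl0; pose s := Num.sqrt dl; have s0 : 0 < s by rewrite sqrtr_gt0.
have := hX k; rewrite /zseries_cvg_L2 => /fine_cvgP[fin /cvgrPdist_lt/(_ s s0) lt].
have /= [[P1 P2] [[N1 _ h1] [N2 _ h2]] h] := filterI fin lt.
exists (maxn N1 N2 + k)%N => u uN.
pose z w := zsum (fun j => a j * stationary_seq tau tauV e0 (k%:Z - j) w) (u - k, u + k)%N.
suff : L1 P (fun w => (X k w - z w) ^+ 2) /\ Ex P (fun w => (X k w - z w) ^+ 2) <= dl by [].
have mz : measurable_fun [set: T] z.
  rewrite /z /zsum; apply: measurable_funD; apply: measurable_sum => j;
    apply: measurable_funM => //; exact: (Lp_iterz _).1.
have mD : measurable_fun [set: T] (fun w => X k w - z w).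
  by apply: measurable_funB => //; exact: measurable_funPT.
have [] := h (u - k, u + k)%N.
  split => /=; [apply: h1|apply: h2] => /=.
    by rewrite leq_subRL; [rewrite addnC (leq_trans _ uN)// leq_add2r leq_maxl|rewrite (leq_trans _ uN)// leq_addl].
  by rewrite (leq_trans _ (leq_addr k u))// (leq_trans _ uN)// (leq_trans (leq_maxr N1 N2))// leq_addr.
rewrite sub0r normrN /=.
set NN := ('N[P]_2%:E[_])%E => finN; rewrite ger0_norm ?fine_ge0 ?Lnorm_ge0// => ltN.
have eqN : (NN `^ 2 = \int[P]_w ((X k w - z w) ^+ 2)%:E)%E.
  rewrite /NN poweR_Lnorm ?gt_eqF//; apply: eq_integral => w _ /=.
  by rewrite powR_sqr -/(z w) -sqrrN opprB.
have NE : NN = (fine NN)%:E by rewrite fineK.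
have fN0 : 0 <= fine NN by rewrite fine_ge0// Lnorm_ge0.
have eq2 : (\int[P]_w ((X k w - z w) ^+ 2)%:E = (fine NN ^+ 2)%:E)%E.
  by rewrite -eqN NE poweR_EFin/= -powR_mulrn.
have i : L1 P (fun w => (X k w - z w) ^+ 2).
  apply: L1_ge0; [exact: measurable_funX|by move=> w; exact: sqr_ge0|].
  by rewrite eq2 ltry.
split => //; rewrite -lee_fin -EFin_Ex// eq2 lee_fin.
have -> : dl = s ^+ 2 by rewrite sqr_sqrtr// ltW.
by rewrite ler_pXn2r ?nnegrE ?(ltW s0)// ltW.
Qed.

Definition remainder n w := partial_sum X n w - A * M tau e0 n w.

Lemma remainder_measurable n : measurable_fun [set: T] (remainder n).
Proof.
apply: measurable_funB; first exact: measurable_funPT.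
by apply: measurable_funM => //; exact: (Lp_M mtau mp p23 pe0 n).1.
Qed.

Lemma remainder_approx n dl : 0 < dl -> exists u,
  L1 P (fun w => (remainder n w - window n u w) ^+ 2) /\
  Ex P (fun w => (remainder n w - window n u w) ^+ 2) <= dl.
Proof.
move=> dl0.
(* Cauchy-Schwarz for a sum of n terms costs n, and there are n errors to add, so each must be below
   dl / (n+1)^2. *)
have e0' : 0 < dl / (n.+1%:R ^+ 2) by rewrite divr_gt0// exprn_gt0// ltr0n.
have /choice[N hN] := fun k => L2_near k e0'.
(* A common truncation index: it is at least n and exceeds every N k with k <= n. *)
pose u := (n + \sum_(0 <= k < n.+1) N k)%N.
have Nu k : (k <= n)%N -> (N k <= u)%N.
  move=> kn; rewrite /u (leq_trans _ (leq_addl _ _))//.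
  by rewrite (@big_cat_nat _ _ _ k)//= ?(leqW kn)// (leq_trans _ (leq_addl _ _))//
    big_ltn// leq_addr.
have [pW _] := window_Lp n u.
pose Y k w := X k%:Z w - zsum (fun j => a j * stationary_seq tau tauV e0 (k%:Z - j) w) (u - k, u + k)%N.
have eR w : remainder n w - window n u w = \sum_(0 <= k < n) Y k.+1 w.
  rewrite /remainder partial_sumE window_sum ?leq_addr// /Y sumrB !big_add1/=.
  by ring.
have iY k : (k < n)%N -> L1 P (fun w => Y k.+1 w ^+ 2) by move=> kn; case: (hN k.+1 u (Nu _ kn)).
have bY k : (k < n)%N -> Ex P (fun w => Y k.+1 w ^+ 2) <= dl / n.+1%:R ^+ 2.
  by move=> kn; case: (hN k.+1 u (Nu _ kn)).
pose Y' k w := if (k < n)%N then Y k.+1 w else 0.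
have iY' k : L1 P (fun w => Y' k w ^+ 2).
  rewrite /Y'; case: ltnP => kn; first exact: iY.
  by apply: (eq_L1 (f := fun=> 0)) => [w|]; [rewrite expr0n|exact: L1_cst].
have bY' k : Ex P (fun w => Y' k w ^+ 2) <= dl / n.+1%:R ^+ 2.
  rewrite /Y'; case: ltnP => kn; first exact: bY.
  rewrite (eq_Ex P (g := fun=> 0)); last by move=> w; rewrite expr0n.
  by rewrite Ex_cst ltW.
have eR' w : remainder n w - window n u w = \sum_(0 <= k < n) Y' k w.
  rewrite eR [LHS]big_nat [RHS]big_nat; apply: eq_bigr => k /andP[_ kn].
  by rewrite /Y' kn.
have iS : L1 P (fun w => n%:R * \sum_(0 <= k < n) Y' k w ^+ 2) by apply: L1Z; exact: L1_sum.
have mS : measurable_fun [set: T] (fun w => (remainder n w - window n u w) ^+ 2).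
  by apply: measurable_funX; apply: measurable_funB; [exact: remainder_measurable|exact: pW.1].
have le w : (remainder n w - window n u w) ^+ 2 <= n%:R * \sum_(0 <= k < n) Y' k w ^+ 2.
  by rewrite eR'; exact: sqr_sum_le.
have iD : L1 P (fun w => (remainder n w - window n u w) ^+ 2).
  by apply: (L1_dom mS iS) => w; rewrite ger0_norm ?sqr_ge0.
exists u; split => //.
apply: (le_trans (le_Ex iD iS le)); rewrite ExZ; last exact: L1_sum.
rewrite Ex_sum//; apply: (@le_trans _ _ (n%:R * \sum_(0 <= k < n) (dl / n.+1%:R ^+ 2))).
  by apply: ler_wpM2l => //; apply: ler_sum => k _.
have -> : \sum_(0 <= k < n) dl / n.+1%:R ^+ 2 = n%:R * (dl / n.+1%:R ^+ 2) :> R.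
  by rewrite sumr_const_nat subn0 mulr_natl.
have n1 : (0 : R) < n.+1%:R ^+ 2 by rewrite exprn_gt0// ltr0n.
rewrite mulrA -expr2 mulrCA ger_pMr// ler_pdivrMr// mul1r ler_pXn2r ?nnegrE//.
by rewrite ler_nat.
Qed.

Lemma remainder_Lp n : Lp P p (remainder n) /\
  Np P p (remainder n) <= 8 * (22 ^+ 2 * Np P p e0 * Acoef a A n `^ (p / 2)).
Proof.
apply: (Lp_L2_limit p23 (remainder_measurable n)) => dl dl0.
have [u [iD bD]] := remainder_approx n dl0; have [pW NW] := window_Lp n u.
by exists (window n u).
Qed.

Lemma Ex_e0 : Ex P e0 = 0.
Proof.
rewrite -(Ex_mp mtau mp (Lp_L1 p23 pe0)); apply: mds.
by case: sF => F_0 FC _; rewrite -(setD0 [set: T]); exact: FC.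
Qed.

(** The windows are centred and approximate the remainder in L^2. The passage from L^2 to L^1 uses
    |x| <= s + x^2 / s with s = e / 2, once the mean square error is at most s^2. *)
Lemma Ex_remainder n : Ex P (remainder n) = 0.
Proof.
apply/eqP; rewrite -normr_eq0 eq_le normr_ge0 andbT; apply/ler_addgt0Pr => e e_gt0.
rewrite add0r; have s0 : 0 < e / 2 by rewrite divr_gt0.
have [u [iD bD]] := remainder_approx n (exprn_gt0 2 s0).
have [pW _] := window_Lp n u; have [pR _] := remainder_Lp n.
have iW := Lp_L1 p23 pW; have iR := Lp_L1 p23 pR.
have W0 : Ex P (window n u) = 0.
  have ie i : L1 P (fun w => e0 (iterz tau tauV i w)) by exact: (Lp_L1 p23 (Lp_iterz i)).
  rewrite /window Ex_sum; last by move=> l; apply: L1Z; exact: ie.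
  apply: big1 => l _; rewrite (ExZ _ (ie _)).
  have -> : Ex P (fun w => e0 (iterz tau tauV (l%:Z - u%:Z) w)) = Ex P e0.
    case: (l%:Z - u%:Z) => m /=; first exact: (Ex_iter mtau mp m (Lp_L1 p23 pe0)).
    exact: (Ex_iter mtauV mpV m.+1 (Lp_L1 p23 pe0)).
  by rewrite Ex_e0 mulr0.
rewrite -[Ex P _]subr0 -W0 -ExB//.
have i2 : L1 P (fun w => e / 2 + (e / 2)^-1 * (remainder n w - window n u w) ^+ 2).
  by apply: L1D; [exact: L1_cst|exact: L1Z].
apply: (@le_trans _ _ (Ex P (fun w => e / 2 + (e / 2)^-1 * (remainder n w - window n u w) ^+ 2))).
  apply: abs_Ex_le => //; first exact: L1_measurable (L1B iR iW).
  move=> w; move: (remainder n w - window n u w) (e / 2) s0 => x s s0.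
  rewrite -(ler_pM2l s0) mulrDr mulrA mulfV ?mul1r ?gt_eqF//.
  have := sqr_ge0 (`|x| - s); rewrite sqrrB real_normK ?num_real// => h.
  have := mulr_ge0 (ltW s0) (normr_ge0 x); have := sqr_ge0 s; nra.
rewrite ExD; [|exact: L1_cst|exact: L1Z].
rewrite Ex_cst ExZ// [leRHS](_ : e = e / 2 + e / 2); last by field.
rewrite lerD2l mulrC ler_pdivrMr//.
Qed.

End linear_process.

Lemma mul_add_le (R : realFieldType) (a b q y : R) : 0 <= a -> 0 <= b -> 0 <= q -> 0 <= y ->
  a * q + b * y <= (a + b) * (q + y).
Proof.
move=> a0 b0 q0 y0; rewrite -subr_ge0.
have -> : (a + b) * (q + y) - (a * q + b * y) = a * y + b * q by ring.
by rewrite addr_ge0 ?mulr_ge0.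
Qed.

(** * Test functions at two close random variables *)

Section transfer.
Context d (T : measurableType d) (R : realType) (P : probability T R) (p r : R).
Hypothesis p23 : 2 < p <= 3.
Hypothesis hr : p - 2 <= r <= p.
Variables (f : R -> R) (U V : T -> R).
Hypothesis nf : normalized_Lambda r f.
Hypothesis pU : Lp P p U.
Hypothesis pV : Lp P p V.

Let iU := normalized_Lambda_L1 p23 hr nf pU.
Let iV := normalized_Lambda_L1 p23 hr nf pV.

Lemma transfer_le1 : r <= 1 ->
  `|Ex P (fun w => f (V w)) - Ex P (fun w => f (U w))| <= Np P p (fun w => V w - U w) `^ (r / p).
Proof.
move=> r1; have [h1 h2] := andP hr; have [h3 h4] := andP p23.
have pD := LpB p23 pV pU; rewrite -ExB//.
have r0p : 0 < r <= p by apply/andP; split; lra.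
have r0p' : 0 <= r <= p by apply/andP; split; lra.
apply: le_trans (Ex_pow_le p23 pD r0p).
apply: abs_Ex_le; [exact: L1_measurable (L1B iV iU)|exact: L1_pow pD r0p'|].
by move=> w; exact: normalized_Lambda_increment_le1.
Qed.

Lemma Lp_abs (g : T -> R) : Lp P p g -> Lp P p (fun w => `|g w|).
Proof.
move=> [mg ig]; split; first exact: measurableT_comp.
by apply: (eq_L1 _ ig) => w; rewrite normr_id.
Qed.

(** Whatever r > 1, only the first power of V - U is gained; for r <= 1 it is the r-th power. Hence
    the exponent min(r, 1) / 2 of A_n / n in the final bounds, and the same condition on A_n for all
    r > 1. *)
Lemma transfer_gt1 : 1 < r ->
  `|Ex P (fun w => f (V w)) - Ex P (fun w => f (U w))| <=
  37 * (Np P p (fun w => V w - U w) `^ (1 / p) *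
        Np P p (fun w => `|U w| + `|V w|) `^ ((r - 1) / p)).
Proof.
move=> r1; have [h1 h2] := andP hr; have [h3 h4] := andP p23.
have pD := LpB p23 pV pU; have pS := LpD p23 (Lp_abs pU) (Lp_abs pV).
have a1 : 0 < (1 : R) < p by apply/andP; split; lra.
have b1 : 0 < r - 1 by lra.
have r13 : 1 < r <= 3 by apply/andP; split; lra.
have ab : 1 + (r - 1) <= p by lra.
have [i h] := Ex_prod_le_sub p23 pD pS a1 b1 ab.
rewrite -ExB//; apply: (@le_trans _ _ (37 * Ex P (fun w => `|V w - U w| `^ 1 * `| `|U w| + `|V w| | `^ (r - 1)))); last first.
  by apply: ler_wpM2l.
rewrite -ExZ//; apply: abs_Ex_le; [exact: L1_measurable (L1B iV iU)|exact: L1Z|].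
move=> w; rewrite powRr1// (ger0_norm (addr_ge0 (normr_ge0 (U w)) (normr_ge0 (V w)))).
exact: (normalized_Lambda_increment r13 nf).
Qed.

End transfer.

Lemma Np_add_le d (T : measurableType d) (R : realType) (P : probability T R) (p : R)
    (f g : T -> R) : 2 < p <= 3 -> Lp P p f -> Lp P p g ->
  Np P p (fun w => f w + g w) <= 8 * (Np P p f + Np P p g).
Proof.
move=> p23 pf pg; have [h3 h4] := andP p23.
have pfg := LpD p23 pf pg.
rewrite /Np -(ExD pf.2 pg.2) -(ExZ _ (L1D pf.2 pg.2)).
apply: le_Ex; [exact: pfg.2|by apply: L1Z; apply: L1D; [exact: pf.2|exact: pg.2]|].
by move=> w; apply: powR_add_le; apply/andP; split; lra.
Qed.

Lemma Np_eq0 d (T : measurableType d) (R : realType) (P : probability T R) (p : R)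
    (f : T -> R) : 2 < p <= 3 -> Lp P p f -> Ex P (fun w => f w ^+ 2) = 0 -> Np P p f = 0.
Proof.
move=> p23 pf f0; have [h3 h4] := andP p23.
have pn : p != 0 by rewrite gt_eqF//; lra.
have mf : measurable_fun [set: T] f by exact: pf.1.
have : (\int[P]_w `|(f w ^+ 2)%:E| = 0)%E.
  have i2 := Lp_sqr p23 pf; rewrite -[RHS]/(0 : R)%:E -f0 -(EFin_Ex i2).
  by apply: eq_integral => w _; rewrite gee0_abs// lee_fin sqr_ge0.
have m2 : measurable_fun [set: T] (fun w => (f w ^+ 2)%:E).
  by apply/measurable_EFinP; exact: measurable_funX.
move/(ae_eq_integral_abs P measurableT m2).1 => ae0.
rewrite /Np -[Ex _ _]/(fine _).
rewrite (ae_eq_integral (cst 0%E))//.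
- by rewrite integral0.
- by apply/measurable_EFinP; exact: measurable_powR_norm.
- apply: filterS ae0 => w /= h _; have /eqP := h Logic.I.
  rewrite eqe sqrf_eq0 => /eqP ->.
  by rewrite normr0 powR0.
Qed.

(** * Variance of S_n and comparison with the martingale *)

Section variance.
Context d (T : measurableType d) (R : realType) (P : probability T R).
Variables (tau tauV : T -> T).
Hypothesis htau : invertible_measure_preserving P tau tauV.
Variable F0 : set (set T).
Hypothesis sF : sigma_algebra [set: T] F0.
Hypothesis Fm : F0 `<=` measurable.
Hypothesis Finc : F0 `<=` preimage_set_system [set: T] tau F0.
Variables (p : R) (e0 : T -> R).
Hypothesis p23 : 2 < p <= 3.
Hypothesis me0 : meas_wrt F0 e0.
Hypothesis pe0 : Lp P p e0.
Hypothesis mds : forall B, F0 B -> Rintegral P B (e0 \o tau) = 0.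
Variables (a : int -> R) (A : R).
Hypothesis ha : ell2 a.
Variable X : int -> {mfun T >-> R}.
Hypothesis hX : forall k : int, zseries_cvg_L2 P
      (fun j w => a j * stationary_seq tau tauV e0 (k - j) w) (X k).

Let mtau : measurable_fun [set: T] tau. Proof. by case: htau. Qed.
Let mp B : measurable B -> P (tau @^-1` B) = P B. Proof. by case: htau => _ _ _ _; apply. Qed.
Let p2 : 2 < p. Proof. by case/andP : p23. Qed.
Let p3 : p <= 3. Proof. by case/andP : p23. Qed.
Let p0 : 0 < p. Proof. by move: p2; lra. Qed.

Let pM n := Lp_M mtau mp p23 pe0 n.
Let pR n : Lp P p (remainder tau e0 A X n).
Proof. exact: (remainder_Lp htau sF Fm Finc p23 me0 pe0 mds A ha hX n).1. Qed.

Definition K0 := 22 ^+ 2 * Np P p e0.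
Let K0_ge0 : 0 <= K0. Proof. by rewrite mulr_ge0 ?Np_ge0// exprn_ge0// ler0n. Qed.

Let Np_R n : Np P p (remainder tau e0 A X n) <= 8 * (K0 * Acoef a A n `^ (p / 2)).
Proof. exact: (remainder_Lp htau sF Fm Finc p23 me0 pe0 mds A ha hX n).2. Qed.

Let v := Ex P (fun w => e0 w ^+ 2).
Let v0 : 0 <= v. Proof. by apply: Ex_ge0 => w; exact: sqr_ge0. Qed.
Let A0 n := Acoef_ge0 a A n.

Lemma Ex_M_sqr n : Ex P (fun w => M tau e0 n w ^+ 2) = n%:R * v.
Proof.
have setTF : F0 setT by case: sF => F_0 FC _; rewrite -(setD0 [set: T]); exact: FC.
have h := Rint_M_sqr mtau mp sF Fm Finc p23 me0 pe0 mds n setTF.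
have iM := Lp_sqr p23 (pM n); have iQ := L1_Q mtau mp p23 pe0 n.
have ie k : L1 P (fun w => eps tau e0 k w ^+ 2) by exact: (Lp_sqr p23 (Lp_eps mtau mp pe0 k)).
have iq k : L1 P (fun w => eps tau e0 k w ^+ 2 - 1) by apply: L1B => //; exact: L1_cst.
move: h; rewrite -[Rintegral _ _ _]/(Ex P _) ExB//; last by apply: L1B => //; exact: L1_cst.
rewrite ExB//; last exact: L1_cst.
rewrite Ex_cst /Q Ex_sum//.
under eq_bigr => j _.
  rewrite ExB//; last exact: L1_cst.
  rewrite Ex_cst (Ex_iter mtau mp j.+1 (Lp_sqr p23 pe0)).
  over.
rewrite sumr_const_nat subn0 -/v mulrnBl -[1 *+ n]/(n%:R) => /eqP.
by rewrite subr_eq0 subr_eq subrK => /eqP ->; rewrite mulr_natl.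
Qed.

Definition CR := (8 * K0) `^ (2 / p).

Lemma Ex_remainder_sqr n : Ex P (fun w => remainder tau e0 A X n w ^+ 2) <= CR * Acoef a A n.
Proof.
have h2 : 0 < (2 : R) <= p by apply/andP; split => //; exact: ltW.
have := Ex_pow_le p23 (pR n) h2.
rewrite (eq_Ex P (g := fun w => remainder tau e0 A X n w ^+ 2)); last by move=> w; rewrite powR_sqr.
move=> h; apply: (le_trans h).
have -> : CR * Acoef a A n = (8 * (K0 * Acoef a A n `^ (p / 2))) `^ (2 / p).
  have c0 : 0 <= 8 * K0 by exact: mulr_ge0.
  rewrite mulrA (powRM _ c0 (powR_ge0 _ _)) -powRrM.
  rewrite (_ : p / 2 * (2 / p) = 1) ?powRr1//; field; exact: lt0r_neq0.
apply: ge0_powR_mono; [by apply: divr_ge0 => //; exact: ltW|exact: Np_ge0|exact: Np_R].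
Qed.

Lemma partial_sum_split n w : partial_sum X n w = A * M tau e0 n w + remainder tau e0 A X n w.
Proof. by rewrite /remainder addrC subrK. Qed.

Lemma Lp_partial_sum n : Lp P p (partial_sum X n).
Proof.
have := LpD p23 (LpZ A (pM n)) (pR n).
by congr (Lp P p _); apply/funext => w; rewrite partial_sum_split.
Qed.

Lemma Ex_partial_sum n : Ex P (partial_sum X n) = 0.
Proof.
have iM := Lp_L1 p23 (pM n); have iR := Lp_L1 p23 (pR n).
rewrite (eq_Ex P (partial_sum_split n)) ExD//; last exact: L1Z.
rewrite ExZ// (Ex_remainder htau sF Fm Finc p23 me0 pe0 mds A ha hX) addr0.
have e k : L1 P (eps tau e0 k) by exact: (Lp_L1 p23 (Lp_eps mtau mp pe0 k)).
rewrite /M Ex_sum// big1 ?mulr0// => j _.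
rewrite (Ex_iter mtau mp j.+1 (Lp_L1 p23 pe0)).
exact: (Ex_e0 htau sF p23 pe0 mds).
Qed.

Lemma sigma2_nE n : sigma2_n P X n = n%:R^-1 * Ex P (fun w => partial_sum X n w ^+ 2).
Proof.
rewrite /sigma2_n unlock /Ex /Rintegral; congr (_ * fine _).
Qed.

(** S_n^2 is expanded as A^2 M_n^2 + 2 A M_n R_n + R_n^2. The cross term is bounded by
    Cauchy-Schwarz and gives the square root, the last one gives A_n / n. *)
Lemma sigma2_bound n : (0 < n)%N ->
  `|sigma2_n P X n - A ^+ 2 * v| <= (2 * `|A| * Num.sqrt (v * CR) + CR) *
    (Num.sqrt (Acoef a A n / n%:R) + Acoef a A n / n%:R).
Proof.
move=> n0; have nR : (0 : R) < n%:R by rewrite ltr0n.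
have An := A0 n.
have iM := Lp_sqr p23 (pM n); have iR := Lp_sqr p23 (pR n).
have iMR := Lp_mul p23 (pM n) (pR n).
set rem := remainder _ _ _ _ _ in iR iMR.
have e : Ex P (fun w => partial_sum X n w ^+ 2) =
    A ^+ 2 * (n%:R * v) + 2 * A * Ex P (fun w => M tau e0 n w * rem w) + Ex P (fun w => rem w ^+ 2).
  rewrite -Ex_M_sqr -(ExZ _ iM) -(ExZ _ iMR) -ExD; [|exact: L1Z|exact: L1Z].
  rewrite -ExD//; last by apply: L1D; exact: L1Z.
  by apply: eq_Ex => w; rewrite partial_sum_split -/rem; ring.
have CR0 : 0 <= CR by exact: powR_ge0.
have hR := Ex_remainder_sqr n; rewrite -/rem in hR.
have hR0 : 0 <= Ex P (fun w => rem w ^+ 2) by apply: Ex_ge0 => w; exact: sqr_ge0.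
have hMR : `|Ex P (fun w => M tau e0 n w * rem w)| <= Num.sqrt (v * CR) * Num.sqrt (Acoef a A n / n%:R) * n%:R.
  have t01 : 0 < (2^-1 : R) < 1 by apply/andP; split; lra.
  have [i h] := holder_Ex t01 (fun w => sqr_ge0 (M tau e0 n w)) (fun w => sqr_ge0 (rem w)) iM iR.
  have ew w : (M tau e0 n w ^+ 2) `^ 2^-1 * (rem w ^+ 2) `^ (1 - 2^-1) = `|M tau e0 n w * rem w|.
    have -> : 1 - 2^-1 = 2^-1 :> R by field.
    by rewrite !powR12_sqrt ?sqr_ge0// !sqrtr_sqr normrM.
  apply: (le_trans (abs_Ex iMR)); rewrite -(eq_Ex P ew); apply: (le_trans h).
  have -> : 1 - 2^-1 = 2^-1 :> R by field.
  rewrite Ex_M_sqr !powR12_sqrt ?mulr_ge0//.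
  apply: (@le_trans _ _ (Num.sqrt (n%:R * v) * Num.sqrt (CR * Acoef a A n))).
    by apply: ler_wpM2l; [exact: sqrtr_ge0|exact: ler_wsqrtr].
  rewrite -!sqrtrM ?mulr_ge0//.
  have -> : n%:R * v * (CR * Acoef a A n) = v * CR * (Acoef a A n / n%:R) * n%:R ^+ 2.
    by field; exact: lt0r_neq0.
  rewrite [X in X <= _]sqrtrM ?mulr_ge0 ?divr_ge0//.
  by rewrite sqrtr_sqr ger0_norm.
rewrite sigma2_nE e.
set x := Acoef a A n / n%:R; set q := Num.sqrt x; set s := Num.sqrt (v * CR) in hMR *.
have x0 : 0 <= x by rewrite divr_ge0.
have [q0 s0] : 0 <= q /\ 0 <= s by split; exact: sqrtr_ge0.
rewrite -/x -/q in hMR.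
have -> : n%:R^-1 * (A ^+ 2 * (n%:R * v) + 2 * A * Ex P (fun w => M tau e0 n w * rem w) +
     Ex P (fun w => rem w ^+ 2)) - A ^+ 2 * v =
   2 * A * (Ex P (fun w => M tau e0 n w * rem w) / n%:R) + Ex P (fun w => rem w ^+ 2) / n%:R.
  by field; exact: lt0r_neq0.
have h1 : `|Ex P (fun w => M tau e0 n w * rem w) / n%:R| <= s * q.
  by rewrite normrM normfV [`|n%:R|]ger0_norm// ler_pdivrMr.
have h2 : Ex P (fun w => rem w ^+ 2) / n%:R <= CR * x.
  by rewrite /x mulrA ler_pM2r// invr_gt0.
apply: (le_trans (ler_normD _ _)).
rewrite [`|_ / _|]ger0_norm ?divr_ge0// normrM normrM (ger0_norm (ler0n R 2)).
apply: (@le_trans _ _ (2 * `|A| * (s * q) + CR * x)).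
  by apply: lerD => //; apply: ler_wpM2l => //; exact: mulr_ge0.
rewrite [leRHS]mulrDl; apply: lerD.
  by rewrite mulrA; apply: ler_wpM2l; [rewrite !mulr_ge0|rewrite lerDl].
by apply: ler_wpM2l => //; rewrite lerDr.
Qed.

Lemma sigma2_cvg : Acoef a A =o_\oo (fun n : nat => n%:R : R) ->
  sigma2_n P X n @[n --> \oo] --> A ^+ 2 * v.
Proof.
move=> /eqoP ho.
set C := 2 * `|A| * Num.sqrt (v * CR) + CR.
have C0 : 0 <= C by rewrite addr_ge0 ?mulr_ge0 ?powR_ge0 ?sqrtr_ge0.
apply/cvgrPdist_le => e e0'.
(* For y = A_n / n <= 1 one has y <= sqrt(y), so the bound becomes 2 C sqrt(y); the second entry of
   the minimum makes this at most e. *)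
pose x := Num.min 1 ((e / (2 * (C + 1))) ^+ 2).
have C1 : 0 < 2 * (C + 1) by rewrite mulr_gt0// ltr_wpDl.
have x0 : 0 < x by rewrite /x lt_min ltr01 exprn_gt0// divr_gt0.
near=> n; have n0 : (0 < n)%N by near: n; exact: nbhs_infty_gt.
have nR : (0 : R) < n%:R by rewrite ltr0n.
have hA : Acoef a A n / n%:R <= x.
  have : `|Acoef a A n| <= x * `|n%:R| by near: n; exact: ho.
  by rewrite !ger0_norm ?ler0n// ler_pdivrMr.
rewrite distrC; apply: (le_trans (sigma2_bound n0)); rewrite -/C.
have y0 : 0 <= Acoef a A n / n%:R by rewrite divr_ge0.
set y := Acoef a A n / n%:R in hA y0 *.
have y1 : y <= Num.sqrt y.
  have y1' : y <= 1 by apply: (le_trans hA); rewrite ge_min lexx.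
  have q0 := sqrtr_ge0 y; rewrite -{1}(sqr_sqrtr y0) expr2 -[leRHS]mulr1.
  by apply: ler_wpM2l => //; rewrite -sqrtr1; exact: ler_wsqrtr.
have hs : Num.sqrt y <= e / (2 * (C + 1)).
  rewrite -[leRHS]ger0_norm ?divr_ge0 ?(ltW e0') ?(ltW C1)// -sqrtr_sqr.
  by apply: ler_wsqrtr; apply: (le_trans hA); rewrite ge_min lexx orbT.
apply: (@le_trans _ _ (C * (2 * (e / (2 * (C + 1)))))).
  by apply: ler_wpM2l => //; rewrite mulr_natl mulr2n; apply: lerD => //; exact: le_trans y1 hs.
have -> : C * (2 * (e / (2 * (C + 1)))) = e * (C / (C + 1)).
  by field; rewrite lt0r_neq0// ltr_wpDl.
rewrite ger_pMr// ler_pdivrMr ?mul1r ?lerDl//.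
by rewrite ltr_wpDl.
Unshelve. all: by end_near.
Qed.

Definition inv_sqrtn n : R := n%:R `^ (- 2^-1).
Let Vn n w := inv_sqrtn n * partial_sum X n w.
Let sd := `|A| * Num.sqrt v.
(** If sd = 0, then A = 0 or eps_0 = 0 almost surely, and A M_n is null. The comparison variable is
    then exactly 0, like the degenerate Gaussian limit, so no central limit bound is required. *)
Let Un n w := (if sd == 0 then 0 else A * inv_sqrtn n) * M tau e0 n w.

Let pV n : Lp P p (Vn n). Proof. by apply: LpZ; exact: Lp_partial_sum. Qed.
Let pU n : Lp P p (Un n). Proof. by apply: LpZ; exact: pM. Qed.

Let inv_sqrtn0 n : 0 <= inv_sqrtn n. Proof. exact: powR_ge0. Qed.

Let inv_sqrtn_powR n : (0 < n)%N -> inv_sqrtn n `^ p * n%:R `^ (p / 2) = 1.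
Proof.
move=> n0; have nR : (0 : R) < n%:R by rewrite ltr0n.
rewrite /inv_sqrtn -powRrM -powR_neq0_add//.
by rewrite (_ : _ + _ = 0) ?powRr0//; field.
Qed.

Let Np_M_le n : Np P p (M tau e0 n) <= K0 * n%:R `^ (p / 2).
Proof. exact: (Np_M mtau mp sF Fm Finc p23 me0 pe0 mds n). Qed.

Let Np_U n : (0 < n)%N -> Np P p (Un n) <= `|A| `^ p * K0.
Proof.
move=> n0; rewrite /Un Np_scale//; have Ap := powR_ge0 `|A| p.
case: eqP => _.
  have pn := lt0r_neq0 p0.
  by rewrite normr0 (powR0 pn) mul0r mulr_ge0.
rewrite normrM (powRM _ (normr_ge0 A) (normr_ge0 _)) (ger0_norm (inv_sqrtn0 n)) -mulrA.
apply: ler_wpM2l => //.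
rewrite -[leRHS]mulr1 -(inv_sqrtn_powR n0) mulrCA; apply: ler_wpM2l => //; exact: powR_ge0.
Qed.

Let sd_eq0 n : sd = 0 -> `|A| `^ p * Np P p (M tau e0 n) = 0.
Proof.
move=> /eqP; rewrite mulf_eq0 => /orP[/eqP ->|].
  by rewrite powR0 ?mul0r// lt0r_neq0.
rewrite sqrtr_eq0 => vle; have ve : v = 0 by apply/eqP; rewrite eq_le vle v0.
have := Np_M_le n; rewrite /K0 (Np_eq0 p23 pe0 ve) mulr0 mul0r => h.
have -> : Np P p (M tau e0 n) = 0 by apply/eqP; rewrite eq_le h Np_ge0.
by rewrite mulr0.
Qed.

Let Np_VU n : (0 < n)%N ->
  Np P p (fun w => Vn n w - Un n w) <= 64 * K0 * (Acoef a A n / n%:R) `^ (p / 2).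
Proof.
move=> n0; have nR : (0 : R) < n%:R by rewrite ltr0n.
have cA : inv_sqrtn n `^ p * Acoef a A n `^ (p / 2) = (Acoef a A n / n%:R) `^ (p / 2).
  have ni : 0 <= (n%:R : R)^-1 by rewrite invr_ge0.
  rewrite (powRM _ (A0 n) ni) (powR_inv _ (ltW nR)) mulrC; congr (_ * _).
  by rewrite /inv_sqrtn -powRrM -powRN; congr (_ `^ _); field.
have Ap := powR_ge0 `|A| p; have cp := powR_ge0 (inv_sqrtn n) p.
(* The constant 64 = 8 * 8 also covers the degenerate case, where S_n is split as A M_n + R_n at the
   cost of another factor 8. *)
have NpS : Np P p (fun w => partial_sum X n w - (if sd == 0 then 0 else A) * M tau e0 n w) <=
    64 * K0 * Acoef a A n `^ (p / 2).
  have x0 := powR_ge0 (Acoef a A n) (p / 2).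
  have KA : 0 <= K0 * Acoef a A n `^ (p / 2) by exact: mulr_ge0.
  case: eqP => [s0|_]; last first.
    by apply: (le_trans (Np_R n)); rewrite -mulrA; apply: ler_wpM2r => //; rewrite ler_nat.
  have -> : (fun w => partial_sum X n w - 0 * M tau e0 n w) = fun w => A * M tau e0 n w + remainder tau e0 A X n w.
    by apply/funext => w; rewrite mul0r subr0 partial_sum_split.
  apply: (le_trans (Np_add_le p23 (LpZ A (pM n)) (pR n))).
  rewrite (Np_scale A (pM n)) sd_eq0// add0r.
  have -> : 64 * K0 * Acoef a A n `^ (p / 2) = 8 * (8 * (K0 * Acoef a A n `^ (p / 2))) by ring.
  by apply: ler_wpM2l.
have pS := LpB p23 (Lp_partial_sum n) (LpZ (if sd == 0 then 0 else A) (pM n)).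
rewrite (_ : (fun w => Vn n w - Un n w) = fun w => inv_sqrtn n * (partial_sum X n w - (if sd == 0 then 0 else A) * M tau e0 n w)); last first.
  by apply/funext => w; rewrite /Vn /Un; case: ifP => _; ring.
rewrite (Np_scale _ pS) (ger0_norm (inv_sqrtn0 n)) -cA [leRHS]mulrCA; exact: ler_wpM2l.
Qed.

Variable r : R.
Hypothesis hr : p - 2 <= r <= p.
Hypothesis hclt : 0 < sd -> exists C, 0 <= C /\ forall f n, normalized_Lambda r f -> (0 < n)%N ->
  `|Ex P (fun w => f (A * inv_sqrtn n * M tau e0 n w)) - EN (fun w => f (sd * w))| <=
  C * (n%:R `^ (- (r / 2)) * rate p r n).

Let r03 : 0 < r <= 3.
Proof. by move: hr p2 p3 => /andP[? ?] ? ?; apply/andP; split; lra. Qed.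

Lemma normalized_Lambda_bound : exists C, 0 <= C /\ forall f n, normalized_Lambda r f -> (0 < n)%N -> Acoef a A n <= n%:R ->
  `|Ex P (fun w => f (inv_sqrtn n * partial_sum X n w)) - EN (fun w => f (sd * w))| <=
  C * (n%:R `^ (- (r / 2)) * rate p r n + (Acoef a A n / n%:R) `^ (Num.min r 1 / 2)).
Proof.
have sd0 : 0 <= sd by rewrite mulr_ge0 ?sqrtr_ge0.
have [C1 [C10 hC1]] : exists C, 0 <= C /\ forall f n, normalized_Lambda r f -> (0 < n)%N ->
    `|Ex P (fun w => f (Un n w)) - EN (fun w => f (sd * w))| <=
    C * (n%:R `^ (- (r / 2)) * rate p r n).
  have [s0|sn] := eqVneq sd 0; last first.
    have sp : 0 < sd by rewrite lt_neqAle eq_sym sn.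
    have [C [C0 hC]] := hclt sp; exists C; split => // f n nf n0.
    by rewrite /Un (negbTE sn); exact: hC.
  exists 0; split => // f n [_ f0 _] n0; rewrite mul0r.
  rewrite (eq_Ex P (g := fun=> 0)); last by move=> w; rewrite /Un s0 eqxx mul0r f0.
  rewrite (eq_EN (h := fun=> 0)); last by move=> w; rewrite s0 mul0r f0.
  by rewrite Ex_cst EN_cst subrr normr0.
pose a1 := `|A| `^ p * K0; pose G := 8 * (a1 + 8 * (64 * K0 + a1)).
have Ap : 0 <= a1 by rewrite mulr_ge0 ?powR_ge0.
have K640 : 0 <= 64 * K0 by exact: mulr_ge0.
(* G bounds the p-th moment of |U_n| + |V_n| when A_n <= n. The two summands of C2 serve r <= 1 and
   r > 1. *)
pose C2 := (64 * K0) `^ (r / p) + 37 * ((64 * K0) `^ (1 / p) * G `^ ((r - 1) / p)).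
exists (C1 + C2); split; first by rewrite addr_ge0// addr_ge0 ?powR_ge0// !mulr_ge0 ?powR_ge0.
move=> f n nf n0 An; have nR : (0 : R) < n%:R by rewrite ltr0n.
set x := Acoef a A n / n%:R.
have x0 : 0 <= x by rewrite divr_ge0.
have x1 : x <= 1 by rewrite ler_pdivrMr// mul1r.
have pn := lt0r_neq0 p0.
have tr : `|Ex P (fun w => f (Vn n w)) - Ex P (fun w => f (Un n w))| <= C2 * x `^ (Num.min r 1 / 2).
  have [r0 _] := andP r03.
  case: (lerP r 1) => r1.
    apply: (le_trans (transfer_le1 p23 hr nf (pU n) (pV n) r1)).
    apply: (@le_trans _ _ ((64 * K0 * x `^ (p / 2)) `^ (r / p))).
      by apply: ge0_powR_mono; [rewrite divr_ge0// ltW|exact: Np_ge0|exact: Np_VU].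
    rewrite (powRM _ K640 (powR_ge0 _ _)) -powRrM (_ : p / 2 * (r / p) = r / 2); last by field.
    apply: ler_wpM2r; first exact: powR_ge0.
    by rewrite lerDl !mulr_ge0 ?powR_ge0.
  apply: (le_trans (transfer_gt1 p23 hr nf (pU n) (pV n) r1)).
  have pD := LpB p23 (pV n) (pU n).
  have NV : Np P p (Vn n) <= 8 * (64 * K0 + a1).
    rewrite (_ : Vn n = fun w => (Vn n w - Un n w) + Un n w); last by apply/funext => w; rewrite subrK.
    apply: (le_trans (Np_add_le p23 pD (pU n))); apply: ler_wpM2l => //.
    apply: lerD; last exact: Np_U.
    apply: (le_trans (Np_VU n0)); apply: ler_piMr => //.
    have := ge0_powR_mono (_ : 0 <= p / 2) x0 x1; rewrite powR1; apply.
    by apply: divr_ge0 => //; exact: ltW.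
  have NG : Np P p (fun w => `|Un n w| + `|Vn n w|) <= G.
    apply: (le_trans (Np_add_le p23 (Lp_abs (pU n)) (Lp_abs (pV n)))); apply: ler_wpM2l => //.
    have e (g : T -> R) : Np P p (fun w => `|g w|) = Np P p g.
      by apply: eq_Ex => w; rewrite normr_id.
    by rewrite !e; apply: lerD => //; exact: Np_U.
  rewrite [leRHS]mulrDl; apply: ler_wpDl; first by rewrite mulr_ge0 ?powR_ge0.
  rewrite -[leRHS]mulrA; apply: ler_wpM2l => //.
  rewrite mulrAC; apply: ler_pM; [exact: powR_ge0|exact: powR_ge0| |].
    have -> : (64 * K0) `^ (1 / p) * x `^ (1 / 2) = (64 * K0 * x `^ (p / 2)) `^ (1 / p).
      rewrite (powRM _ K640 (powR_ge0 _ _)) -powRrM.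
      by congr (_ * _ `^ _); field.
    by apply: ge0_powR_mono; [rewrite divr_ge0// ltW|exact: Np_ge0|exact: Np_VU].
  apply: ge0_powR_mono => //; [|exact: Np_ge0].
  by apply: divr_ge0; [rewrite subr_ge0 ltW|exact: ltW].
have -> : Ex P (fun w => f (inv_sqrtn n * partial_sum X n w)) - EN (fun w => f (sd * w)) =
   (Ex P (fun w => f (Vn n w)) - Ex P (fun w => f (Un n w))) +
   (Ex P (fun w => f (Un n w)) - EN (fun w => f (sd * w))) by rewrite addrA subrK.
apply: (le_trans (ler_normD _ _)); rewrite addrC.
have C20 : 0 <= C2 by rewrite addr_ge0 ?powR_ge0// !mulr_ge0 ?powR_ge0.
set q := n%:R `^ _ * _ in hC1 *; set y := x `^ _ in tr *.
have q0 : 0 <= n%:R `^ (- (r / 2)) * rate p r n by apply: mulr_ge0; [exact: powR_ge0|exact: rate_ge0].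
have y0 : 0 <= x `^ (Num.min r 1 / 2) by exact: powR_ge0.
apply: (le_trans (lerD (hC1 f n nf n0) tr)).
exact: mul_add_le.
Qed.

End variance.

(** * Zolotarev distances *)

Section gaussian_scale.
Context (R : realType).

Lemma L1_gauss_powR (r : R) : 0 < r <= 3 -> L1 (gauss R) (fun w => `|w| `^ r).
Proof.
move=> r03; have e : egrowth (fun w : R => 1 + `|w ^+ 3|).
  by apply: egrowthD; [exact: egrowth_cst|apply: egrowth_abs; exact: egrowth_exp].
apply: (L1_dom _ (egrowth_L1 e)); first exact: measurable_powR_norm.
by move=> w; rewrite ger0_norm ?powR_ge0// normrX; exact: powR_le_1D3.
Qed.

(** For r > 2 the target law has variance sigma_n^2, whereas the martingale bound is centred at the
    limit variance; this inequality bridges the two. *)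
Lemma gauss_scale_le (r s t : R) (f : R -> R) : 1 < r <= 3 -> 0 <= s -> 0 <= t -> normalized_Lambda r f ->
  `|EN (fun w => f (s * w)) - EN (fun w => f (t * w))| <=
  37 * (`|s - t| * (s + t) `^ (r - 1)) * EN (fun w : R => `|w| `^ r).
Proof.
move=> r13 s0 t0 nf; have [r1 r3] := andP r13.
have r03 : 0 < r <= 3 by rewrite r3 andbT; lra.
have ef c : egrowth (fun w => f (c * w)).
  by have := egrowth_affine 0 c (normalized_Lambda_egrowth r03 nf); congr egrowth; apply/funext => w; rewrite add0r.
have ir := L1_gauss_powR r03.
rewrite -ENB// -(ExZ _ ir); apply: abs_Ex_le.
- by apply: L1_measurable; apply: egrowth_L1; exact: egrowthB.
- exact: L1Z.
move=> w; have := normalized_Lambda_increment r13 nf (t * w) (s * w); move/le_trans; apply.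
rewrite -mulrBl !normrM (ger0_norm s0) (ger0_norm t0) -mulrDl powRM ?addr_ge0//.
have -> : `|w| `^ r = `|w| * `|w| `^ (r - 1).
  have [->|w0] := eqVneq w 0; first by rewrite normr0 mul0r powR0// gt_eqF//; lra.
  by rewrite -{2}[`|w|]powRr1// -powR_neq0_add ?normr_gt0// addrC subrK.
rewrite [t + s]addrC le_eqVlt; apply/orP; left; apply/eqP.
by move: (_ `^ _) (_ `^ _) => x y; ring.
Qed.

Lemma Lambda_split (r : R) (f : R -> R) : 0 < r <= 3 -> Lambda_class r f ->
  exists g al be ga, [/\ normalized_Lambda r g, forall x, f x = g x + (al + be * x + ga * x ^+ 2) &
    r <= 2 -> ga = 0].
Proof.
move=> r03 /(Lambda_taylor2 r03)[cf [f1 [f2 [ft h1 h2]]]].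
pose g x := f x - (f 0 + f1 0 * x + f2 0 / 2 * x ^+ 2).
exists g, (f 0), (f1 0), (f2 0 / 2); split; last 2 first.
- by move=> x; rewrite /g subrK.
- by move=> /h2 ->; rewrite mul0r.
split.
- have [cq _] : egrowth (fun x => f 0 + f1 0 * x + f2 0 / 2 * x ^+ 2).
    apply: egrowthD; last by apply: egrowthZ; exact: egrowth_exp.
    by apply: egrowthD; [exact: egrowth_cst|apply: egrowthZ; exact: egrowth_id].
  by move=> x; apply: cvgB; [exact: cf|exact: cq].
- by rewrite /g expr0n !mulr0 !addr0 subrr.
exists (fun x => f1 x - f1 0 - f2 0 * x), (fun x => f2 x - f2 0); split.
- by move=> x y; have := ft x y; congr (`|_| <= _); rewrite /g; field.
- by move=> r1; rewrite h1// h2 ?(le_trans r1) ?ler1n//; apply/funext => x; rewrite subrr mul0r subrr.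
- by move=> r2; rewrite h2//; apply/funext => x; rewrite subrr.
- by rewrite mulr0 subr0 subrr.
- by rewrite subrr.
Qed.

End gaussian_scale.

(** * Bounds over the whole class [Lambda_class] *)

Section zolotarev_bounds.
Context d (T : measurableType d) (R : realType) (P : probability T R).
Variables (tau tauV : T -> T).
Hypothesis htau : invertible_measure_preserving P tau tauV.
Variable F0 : set (set T).
Hypothesis sF : sigma_algebra [set: T] F0.
Hypothesis Fm : F0 `<=` measurable.
Hypothesis Finc : F0 `<=` preimage_set_system [set: T] tau F0.
Variables (p : R) (e0 : T -> R).
Hypothesis p23 : 2 < p <= 3.
Hypothesis me0 : meas_wrt F0 e0.
Hypothesis pe0 : Lp P p e0.
Hypothesis mds : forall B, F0 B -> Rintegral P B (e0 \o tau) = 0.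
Variables (a : int -> R) (A : R).
Hypothesis ha : ell2 a.
Variable X : int -> {mfun T >-> R}.
Hypothesis hX : forall k : int, zseries_cvg_L2 P
      (fun j w => a j * stationary_seq tau tauV e0 (k - j) w) (X k).
Variable r : R.
Hypothesis hr : p - 2 <= r <= p.
Let v := Ex P (fun w => e0 w ^+ 2).
Let sd := `|A| * Num.sqrt v.
Hypothesis hclt : 0 < sd -> exists C, 0 <= C /\ forall f n, normalized_Lambda r f -> (0 < n)%N ->
  `|Ex P (fun w => f (A * inv_sqrtn R n * M tau e0 n w)) - EN (fun w => f (sd * w))| <=
  C * (n%:R `^ (- (r / 2)) * rate p r n).

Let r03 : 0 < r <= 3.
Proof. by move: hr p23 => /andP[? ?] /andP[? ?]; apply/andP; split; lra. Qed.

Let pS n : Lp P p (partial_sum X n).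
Proof. exact: (Lp_partial_sum htau sF Fm Finc p23 me0 pe0 mds A ha hX n). Qed.

Let A0 n := Acoef_ge0 a A n.

Lemma normalized_sumE n w : normalized_sum X n w = inv_sqrtn R n * partial_sum X n w.
Proof. by []. Qed.

Let pV n : Lp P p (normalized_sum X n). Proof. exact: (LpZ (inv_sqrtn R n) (pS n)). Qed.

Lemma Lambda_reduce n t f : (0 < n)%N -> (2 < r -> t ^+ 2 = sigma2_n P X n) -> Lambda_class r f ->
  exists g, [/\ normalized_Lambda r g, egrowth f, L1 P (fun w => f (normalized_sum X n w)) &
    Ex P (fun w => f (normalized_sum X n w)) - EN (fun w => f (t * w)) =
    Ex P (fun w => g (inv_sqrtn R n * partial_sum X n w)) - EN (fun w => g (t * w))].
Proof.
move=> n0 ht lf; have [g [al [be [ga [ng fg hga]]]]] := Lambda_split r03 lf.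
have ig := normalized_Lambda_L1 p23 hr ng (pV n); have eg' := normalized_Lambda_egrowth r03 ng.
have i1 := Lp_L1 p23 (pV n); have i2 := Lp_sqr p23 (pV n).
have nR : (0 : R) < n%:R by rewrite ltr0n.
have EV0 : Ex P (normalized_sum X n) = 0.
  rewrite (eq_Ex P (normalized_sumE n)) ExZ; last exact: (Lp_L1 p23 (pS n)).
  by rewrite (Ex_partial_sum htau sF Fm Finc p23 me0 pe0 mds A ha hX) mulr0.
set V := normalized_sum X n in ig i1 i2 EV0 *.
have iq : L1 P (fun w => al + be * V w + ga * V w ^+ 2).
  by apply: L1D; [apply: L1D; [exact: L1_cst|exact: L1Z]|exact: L1Z].
have eq : egrowth (fun x => al + be * x + ga * x ^+ 2).
  apply: egrowthD; last by apply: egrowthZ; exact: egrowth_exp.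
  by apply: egrowthD; [exact: egrowth_cst|apply: egrowthZ; exact: egrowth_id].
have ef : f = fun x => g x + (al + be * x + ga * x ^+ 2) by apply/funext.
exists g; split => //.
- by rewrite ef; exact: egrowthD.
- by rewrite ef; exact: L1D.
have et h : egrowth h -> egrowth (fun w => h (t * w)).
  by move=> /(egrowth_affine 0 t); congr egrowth; apply/funext => w; rewrite add0r.
have -> : Ex P (fun w => f (V w)) = Ex P (fun w => g (V w)) + (al + ga * Ex P (fun w => V w ^+ 2)).
  rewrite ef ExD//; congr (_ + _); rewrite (ExD (L1D (L1_cst P al) (L1Z be i1)) (L1Z ga i2)).
  by rewrite (ExD (L1_cst P al) (L1Z be i1)) (Ex_cst P al) (ExZ be i1) (ExZ ga i2) EV0 mulr0 addr0.
have -> : EN (fun w => f (t * w)) = EN (fun w => g (t * w)) + (al + ga * t ^+ 2).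
  rewrite ef END; [|exact: et|exact: (et _ eq)]; congr (_ + _).
  have [m1 m2 _ _] := EN_moments R.
  rewrite (eq_EN (h := fun w => al + (be * t * w + ga * t ^+ 2 * w ^+ 2))); last by move=> w; ring.
  have e1 : egrowth (fun w : R => be * t * w) by apply: egrowthZ; exact: egrowth_id.
  have e2 : egrowth (fun w : R => ga * t ^+ 2 * w ^+ 2) by apply: egrowthZ; exact: egrowth_exp.
  rewrite (END (egrowth_cst al) (egrowthD e1 e2)) EN_cst (END e1 e2) (ENZ _ (egrowth_id R)) (ENZ _ (egrowth_exp R 2)).
  by rewrite m1 m2 mulr0 add0r mulr1.
have EV : ga * Ex P (fun w => V w ^+ 2) = ga * t ^+ 2.
  case: (lerP r 2) => r2; first by rewrite hga// !mul0r.
  congr (_ * _); rewrite ht// sigma2_nE.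
  rewrite (eq_Ex P (g := fun w => inv_sqrtn R n ^+ 2 * partial_sum X n w ^+ 2)); last first.
    by move=> w; rewrite /V normalized_sumE exprMn.
  rewrite ExZ; last exact: (Lp_sqr p23 (pS n)).
  congr (_ * _); rewrite /inv_sqrtn -powR_mulrn ?powR_ge0// -powRrM.
  by rewrite mulNr mulVf// powR_inv1// ltW.
rewrite EV; set x := Ex P _; set y := EN _; move: x y (al + _) => x y z; ring.
Qed.

Lemma Lambda_bound : r <= 2 -> exists C, 0 <= C /\ forall f n, Lambda_class r f -> (0 < n)%N ->
  Acoef a A n <= n%:R -> [/\ egrowth f, L1 P (fun w => f (normalized_sum X n w)) &
  `|Ex P (fun w => f (normalized_sum X n w)) - EN (fun w => f (sd * w))| <=
  C * (n%:R `^ (- (r / 2)) * rate p r n + (Acoef a A n / n%:R) `^ (Num.min r 1 / 2))].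
Proof.
move=> r2; have [C [C0 hC]] := normalized_Lambda_bound htau sF Fm Finc p23 me0 pe0 mds ha hX hr hclt.
exists C; split => // f n lf n0 An.
have ht : 2 < r -> sd ^+ 2 = sigma2_n P X n by move=> h; have := lt_le_trans h r2; rewrite ltxx.
have [g [ng ef i ->]] := Lambda_reduce n0 ht lf.
by split => //; exact: hC.
Qed.

Lemma Lambda_bound_gt2 : 2 < r -> exists C, 0 <= C /\ forall f n, Lambda_class r f -> (0 < n)%N ->
  Acoef a A n <= n%:R -> [/\ egrowth f, L1 P (fun w => f (normalized_sum X n w)) &
  `|Ex P (fun w => f (normalized_sum X n w)) - EN (fun w => f (Num.sqrt (sigma2_n P X n) * w))| <=
  C * (n%:R `^ (- (r / 2)) * rate p r n + (Acoef a A n / n%:R) `^ 2^-1)].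
Proof.
move=> r2; have [C [C0 hC]] := normalized_Lambda_bound htau sF Fm Finc p23 me0 pe0 mds ha hX hr hclt.
have sd0 : 0 <= sd by rewrite mulr_ge0 ?sqrtr_ge0.
have v0 : 0 <= v by apply: Ex_ge0 => w; exact: sqr_ge0.
have r13 : 1 < r <= 3 by case/andP : r03 => _ ->; rewrite andbT; lra.
pose C1 := 2 * `|A| * Num.sqrt (v * CR P p e0) + CR P p e0.
have C10 : 0 <= C1 by rewrite addr_ge0 ?mulr_ge0 ?powR_ge0 ?sqrtr_ge0.
pose H := 37 * (2 * C1) * (sd + Num.sqrt (sd ^+ 2 + 2 * C1)) `^ (r - 2) * EN (fun w : R => `|w| `^ r).
have G0 : 0 <= EN (fun w : R => `|w| `^ r) by apply: Ex_ge0 => w; exact: powR_ge0.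
have H0 : 0 <= H by rewrite !mulr_ge0 ?powR_ge0.
exists (C + H); split; first exact: addr_ge0.
move=> f n lf n0 An; have nR : (0 : R) < n%:R by rewrite ltr0n.
have sn0 : 0 <= sigma2_n P X n.
  by rewrite sigma2_nE mulr_ge0 ?invr_ge0 ?(ltW nR)//; apply: Ex_ge0 => w; exact: sqr_ge0.
set s := Num.sqrt (sigma2_n P X n); have s0 : 0 <= s by exact: sqrtr_ge0.
have ht : 2 < r -> s ^+ 2 = sigma2_n P X n by move=> _; rewrite sqr_sqrtr.
have [g [ng ef i ->]] := Lambda_reduce n0 ht lf; split => //.
have h1 := hC g n ng n0 An.
have -> : forall x, x - EN (fun w => g (s * w)) =
  (x - EN (fun w => g (sd * w))) + (EN (fun w => g (sd * w)) - EN (fun w => g (s * w))).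
  by move=> x; rewrite addrA subrK.
have rm : Num.min r 1 = 1 by rewrite min_r//; lra.
rewrite rm mul1r in h1.
set x := Acoef a A n / n%:R in h1 *.
have x0 : 0 <= x by rewrite divr_ge0.
have x1 : x <= 1 by rewrite ler_pdivrMr// mul1r.
have q1 : x <= Num.sqrt x.
  have q0 := sqrtr_ge0 x; rewrite -{1}(sqr_sqrtr x0) expr2 -[leRHS]mulr1.
  by apply: ler_wpM2l => //; rewrite -sqrtr1; exact: ler_wsqrtr.
have q11 : Num.sqrt x <= 1 by rewrite -sqrtr1; exact: ler_wsqrtr.
have sd2 : sd ^+ 2 = A ^+ 2 * v by rewrite /sd exprMn sqr_sqrtr// real_normK ?num_real.
have hs2 : `|s ^+ 2 - sd ^+ 2| <= 2 * C1 * Num.sqrt x.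
  rewrite ht// sd2.
  apply: (le_trans (sigma2_bound htau sF Fm Finc p23 me0 pe0 mds A ha hX n0)).
  rewrite -/x -/v -/C1 [2 * C1]mulrC -mulrA; apply: ler_wpM2l => //.
  by rewrite mulr_natl mulr2n lerD2l.
have hs : s <= Num.sqrt (sd ^+ 2 + 2 * C1).
  rewrite -[s]ger0_norm// -sqrtr_sqr; apply: ler_wsqrtr.
  rewrite -lerBlDl; apply: (le_trans (ler_norm _)); apply: (le_trans hs2).
  by apply: ler_piMr => //; exact: mulr_ge0.
have h2 : `|EN (fun w => g (sd * w)) - EN (fun w => g (s * w))| <= H * Num.sqrt x.
  apply: (le_trans (gauss_scale_le r13 sd0 s0 ng)).
  (* Only s^2 - sd^2 is known to be small, and sd may be 0. One of the r - 1 factors sd + s is used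
     to form it, and a nonnegative power remains because r > 2, so no lower bound on sd enters. *)
  have key : `|sd - s| * (sd + s) `^ (r - 1) = `|s ^+ 2 - sd ^+ 2| * (sd + s) `^ (r - 2).
    have [z|z] := eqVneq (sd + s) 0.
      have -> : sd = 0 by apply/eqP; rewrite eq_le sd0 andbT -z lerDl.
      have -> : s = 0 by apply/eqP; rewrite eq_le s0 andbT -z lerDr.
      by rewrite !subrr normr0 !mul0r.
    have zp : 0 < sd + s by rewrite lt_neqAle eq_sym z addr_ge0.
    have -> : (sd + s) `^ (r - 1) = (sd + s) * (sd + s) `^ (r - 2).
      rewrite -{2}[sd + s]powRr1 ?(ltW zp)// -powR_neq0_add//; congr (_ `^ _); ring.
    have nz : `|sd + s| = sd + s by rewrite ger0_norm// ltW.
    rewrite mulrA; congr (_ * _); rewrite -[X in _ * X = _]nz -normrM distrC.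
    by congr (`|_|); ring.
  rewrite key; set Y := (sd + Num.sqrt (sd ^+ 2 + 2 * C1)) `^ (r - 2).
  have -> : H * Num.sqrt x = 37 * (2 * C1 * Num.sqrt x * Y) * EN (fun w : R => `|w| `^ r).
    by rewrite /H -/Y; move: (EN _) (Num.sqrt x) Y => u1 u2 u3; ring.
  apply: ler_wpM2r => //; apply: ler_wpM2l; first by [].
  apply: ler_pM => //; first exact: powR_ge0.
  apply: ge0_powR_mono; [lra|exact: addr_ge0|by rewrite lerD2l].
apply: (le_trans (ler_normD _ _)); apply: (le_trans (lerD h1 h2)).
rewrite -powR12_sqrt//.
have q0 : 0 <= n%:R `^ (- (r / 2)) * rate p r n by apply: mulr_ge0; [exact: powR_ge0|exact: rate_ge0].
have y0 : 0 <= x `^ 2^-1 by exact: powR_ge0.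
rewrite [leRHS]mulrDl lerD2l; apply: ler_wpM2l => //; rewrite lerDr//.
Qed.

End zolotarev_bounds.

(** * Integrals against the laws *)

Section normal_law_integral.
Context (R : realType).

Let integral_ge0 (v : R) (h : R -> R) : 0 <= v -> egrowth h -> (forall x, 0 <= h x) ->
  (\int[normal_law v]_x (h x)%:E = (EN (fun w => h (Num.sqrt v * w)))%:E)%E.
Proof.
move=> v0 eh h0; have mh : measurable_fun [set: R] h by apply: continuous_measurable_fun; exact: eh.1.
rewrite /normal_law; case: eqP => [->|/eqP vn].
  rewrite sqrtr0 (eq_EN (h := fun=> h 0)); last by move=> w; rewrite mul0r.
  rewrite EN_cst integral_dirac//; first by rewrite diracT mul1e.
  exact/measurable_EFinP.
have vp : 0 < v by rewrite lt_neqAle eq_sym vn.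
have s0 : 0 < Num.sqrt v by rewrite sqrtr_gt0.
rewrite ge0_integral_distribution; [|exact/measurable_EFinP|by move=> x; rewrite lee_fin].
rewrite /EN -EFin_Ex; last first.
  apply: egrowth_L1; have := egrowth_affine 0 (Num.sqrt v) eh.
  by congr egrowth; apply/funext => w; rewrite add0r.
have := gauss_affine 0 s0 eh.1 h0.
under eq_integral do rewrite add0r.
move=> ->; rewrite normal_density//.
by apply/measurable_EFinP; exact: cont_meas eh.1.
Qed.

Lemma normal_law_integral (v : R) (f : R -> R) : 0 <= v -> egrowth f ->
  (\int[normal_law v]_x (f x)%:E = (EN (fun w => f (Num.sqrt v * w)))%:E)%E.
Proof.
move=> v0 /egrowth_split[hp [hn [ep en p0 n0 e]]].
have il h : egrowth h -> (forall x, 0 <= h x) -> L1 (normal_law v) h.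
  move=> eh h0; apply: L1_ge0 => //; first by apply: continuous_measurable_fun; exact: eh.1.
  by rewrite integral_ge0// ltry.
have ea h : egrowth h -> egrowth (fun w => h (Num.sqrt v * w)).
  by move=> /(egrowth_affine 0 (Num.sqrt v)); congr egrowth; apply/funext => w; rewrite add0r.
under eq_integral do rewrite e.
rewrite (EFin_Ex (L1B (il _ ep p0) (il _ en n0))) (ExB (il _ ep p0) (il _ en n0)).
rewrite EFinB -(EFin_Ex (il _ ep p0)) -(EFin_Ex (il _ en n0)).
rewrite !integral_ge0// -EFinB -ENB; [|exact: ea|exact: ea].
by congr EFin; apply: eq_EN => w; rewrite e.
Qed.

End normal_law_integral.

Lemma law_integral d (T : measurableType d) (R : realType) (P : probability T R)
    (Y : {mfun T >-> R}) (f : R -> R) : measurable_fun [set: R] f ->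
  L1 P (fun w => f (Y w)) ->
  (\int[law P Y]_x (f x)%:E = (Ex P (fun w => f (Y w)))%:E)%E.
Proof.
move=> mf i; rewrite -EFin_Ex// /law integral_distribution//.
exact/measurable_EFinP.
Qed.

(** The null function shows that the supremum defining the distance is nonnegative, so its absolute
    value is bounded as soon as the supremum is. *)
Lemma Lambda_class0 (R : realType) (r : R) : 0 < r <= 3 -> Lambda_class r (fun=> 0 : R).
Proof.
move=> /andP[r0 r3].
have D0 k : derive1n k (fun=> 0 : R) = (fun=> 0 : R).
  elim: k => [//|k IH]; rewrite derive1nS IH.
  by apply/funext => x; rewrite derive1_cst.
have [l hl] : exists l : nat, l%:R < r <= l.+1%:R.
  case: (lerP r 1) => h1; first by exists 0%N; rewrite r0.
  case: (lerP r 2) => h2; first by exists 1%N; rewrite h1.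
  by exists 2%N; rewrite h2.
exists l; split => //.
- by move=> k x _; rewrite D0; exact: derivable_cst.
- by rewrite D0 => x; exact: cst_continuous.
- by move=> x y; rewrite D0 subrr normr0 powR_ge0.
Qed.

Lemma zolotarev_le d (T : measurableType d) (R : realType) (P : probability T R)
    (Y : {mfun T >-> R}) (r v B : R) : 0 < r <= 3 -> 0 <= v ->
  (forall f, Lambda_class r f -> [/\ egrowth f, L1 P (fun w => f (Y w)) &
    `|Ex P (fun w => f (Y w)) - EN (fun w => f (Num.sqrt v * w))| <= B]) ->
  (`|zolotarev r (law P Y) (normal_law v)| <= B%:E)%E.
Proof.
move=> r03 v0 h.
have e f : Lambda_class r f ->
    (\int[law P Y]_x (f x)%:E - \int[normal_law v]_x (f x)%:E =
     (Ex P (fun w => f (Y w)) - EN (fun w => f (Num.sqrt v * w)))%:E)%E.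
  move=> /h[ef i _]; rewrite normal_law_integral// law_integral//.
  by apply: continuous_measurable_fun; exact: ef.1.
rewrite gee0_abs; last first.
  apply: ereal_sup_ubound; exists (fun=> 0); first exact: Lambda_class0.
  by rewrite !integral0 subee.
apply: ge_ereal_sup => _ [f lf <-].
have [_ _ hb] := h f lf.
by rewrite e// lee_fin; exact: le_trans (ler_norm _) hb.
Qed.

(** * From the hypotheses on conditional expectations to the martingale bound *)

Section hypotheses.
Context d (T : measurableType d) (R : realType) (P : probability T R).
Variables (tau tauV : T -> T).
Hypothesis htau : invertible_measure_preserving P tau tauV.
Variable F0 : set (set T).
Hypothesis sF : sigma_algebra [set: T] F0.
Hypothesis Fm : F0 `<=` measurable.
Hypothesis Finc : F0 `<=` preimage_set_system [set: T] tau F0.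
Variables (p : R) (e0 : {mfun T >-> R}).
Hypothesis p23 : 2 < p <= 3.
Hypothesis heps : is_mds P tau tauV F0 e0.
Hypothesis hepsp : (e0 : T -> R) \in Lfun P p%:E.

Let mtau : measurable_fun [set: T] tau. Proof. by case: htau. Qed.
Let mtauV : measurable_fun [set: T] tauV. Proof. by case: htau. Qed.
Let mp B : measurable B -> P (tau @^-1` B) = P B. Proof. by case: htau => _ _ _ _; apply. Qed.
Let tauK : cancel tau tauV. Proof. by case: htau. Qed.
Let tauVK : cancel tauV tau. Proof. by case: htau. Qed.
Let p2 : 2 < p. Proof. by case/andP : p23. Qed.
Let p0 : 0 < p. Proof. by move: p2; lra. Qed.

Lemma mds_meas_wrt : meas_wrt F0 e0.
Proof. by apply/meas_wrtP; case: heps. Qed.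

Lemma mds_Lp : Lp P p e0.
Proof.
split; first exact: measurable_funPT.
by have := p2 => h; apply: (Lfun_integrable _ hepsp); lra.
Qed.

(** The assumption concerns e0 and F_{-1}, which consists of the preimages of F0 under [tauV]. Each
    B in F0 is the preimage under [tau] of such a set, and invariance moves the statement one step
    forward in time. *)
Lemma mds_Rintegral B : F0 B -> Rintegral P B (e0 \o tau) = 0.
Proof.
move=> FB; pose Fm1 := filtration_of tau tauV F0 (- 1).
have sF1 : sigma_algebra [set: T] Fm1 by exact: sigma_algebra_preimage.
have F1m : Fm1 `<=` measurable.
  by move=> _ [C FC <-]; exact: (mtauV measurableT (Fm FC)).
have [ie _ ce0] := heps.
have [mc ic cE] := cond_expP sF1 F1m ie.
have F1B : Fm1 (tauV @^-1` B) by exists B => //; rewrite setTI.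
have mB1 := F1m _ F1B.
have -> : B = tau @^-1` (tauV @^-1` B) by apply/funext => w; rewrite /preimage/= tauK.
rewrite (Ex_mp_set mtau mp mB1 ie) /Rintegral -(cE _ F1B).
rewrite (ae_eq_integral (cst 0%E))//; first by rewrite integral0.
  by apply: measurable_funS (measurable_int _ ic).
by apply: filterS ce0 => w /= h _; congr EFin.
Qed.

Let e0w := mds_meas_wrt.
Let pe0 := mds_Lp.
Let mds := mds_Rintegral.
Let v := Ex P (fun w => e0 w ^+ 2).

Let ce n := cond_exp P F0 (fun w => n%:R^-1 * M tau e0 n w ^+ 2).

Let iM2 n : L1 P (fun w => n%:R^-1 * M tau e0 n w ^+ 2).
Proof. by apply: L1Z; apply: (Lp_sqr p23); exact: (Lp_M mtau mp p23 pe0). Qed.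

Let is_ce n := cond_expP sF Fm (iM2 n).

Let mce n : meas_wrt F0 (ce n). Proof. by apply/meas_wrtP; case: (is_ce n). Qed.
Let ice n : L1 P (ce n). Proof. by case: (is_ce n). Qed.

Hypothesis hsum : (\sum_(1 <= n <oo) ((n%:R `^ (2 - p / 2))^-1)%:E *
      'N[P]_(p / 2)%:E[(fun w => (ce n w - v)%:E)] < +oo)%E.

Let Nce n : \bar R := ('N[P]_(p / 2)%:E[(fun w => (ce n w - v)%:E)])%E.

Let term_ge0 n : (0 <= ((n%:R `^ (2 - p / 2))^-1)%:E * Nce n)%E.
Proof. by apply: mule_ge0; [rewrite lee_fin invr_ge0 powR_ge0|exact: Lnorm_ge0]. Qed.

Let partial_le K : (\sum_(1 <= n < K) ((n%:R `^ (2 - p / 2))^-1)%:E * Nce n <=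
   \sum_(1 <= n <oo) ((n%:R `^ (2 - p / 2))^-1)%:E * Nce n)%E.
Proof. by apply: nneseries_lim_ge => n _ _; exact: term_ge0. Qed.

(** A convergent series of nonnegative terms with positive weights has finite terms. This is what
    puts the conditional variances in L^{p/2}. *)
Let Nce_fin n : (0 < n)%N -> (Nce n < +oo)%E.
Proof.
move=> n0; have := partial_le n.+1; rewrite big_nat_recr//= => h.
have : (((n%:R `^ (2 - p / 2))^-1)%:E * Nce n < +oo)%E.
  apply: le_lt_trans hsum; apply: le_trans h; rewrite leeDr//.
  by apply: sume_ge0 => k _; exact: term_ge0.
have c0 : 0 < (n%:R `^ (2 - p / 2))^-1 :> R by rewrite invr_gt0 powR_gt0// ltr0n.
case: (Nce n) (Lnorm_ge0 P (p / 2)%:E (fun w => (ce n w - v)%:E)) => [x|//|//] _.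
  by move=> _; rewrite ltry.
by rewrite gt0_muley ?lte_fin// ltxx.
Qed.

Let q0 : p / 2 != 0. Proof. by apply: lt0r_neq0; exact: divr_gt0. Qed.

Let Nce_pow n : (0 < n)%N -> L1 P (fun w => `|ce n w - v| `^ (p / 2)) /\
  Ex P (fun w => `|ce n w - v| `^ (p / 2)) = fine (Nce n) `^ (p / 2).
Proof.
move=> n0; have fN : Nce n \is a fin_num by rewrite ge0_fin_numE ?Lnorm_ge0 ?Nce_fin.
have e : (\int[P]_w (`|ce n w - v| `^ (p / 2))%:E = (fine (Nce n) `^ (p / 2))%:E)%E.
  by rewrite -poweR_EFin fineK// /Nce poweR_Lnorm.
have i : L1 P (fun w => `|ce n w - v| `^ (p / 2)).
  apply: L1_ge0; [|by move=> w; exact: powR_ge0|by rewrite e ltry].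
  apply: measurable_powR_norm; apply: measurable_funB => //; exact: (meas_wrt_measurable sF Fm (mce n)).
by split => //; rewrite /Ex /Rintegral e.
Qed.

(** The increments are multiplied by c = A / sd, which gives variance 1 and absorbs the sign of A:
    sd times the new martingale is A times the old one. *)
Lemma series_clt (A r : R) : p - 2 <= r <= p -> let sd := `|A| * Num.sqrt v in 0 < sd ->
  exists C, 0 <= C /\ forall f n, normalized_Lambda r f -> (0 < n)%N ->
  `|Ex P (fun w => f (A * inv_sqrtn R n * M tau e0 n w)) - EN (fun w => f (sd * w))| <=
  C * (n%:R `^ (- (r / 2)) * rate p r n).
Proof.
move=> hr sd sd0.
have v0 : 0 <= v by apply: Ex_ge0 => w; exact: sqr_ge0.
pose c := A / sd; have inv_sqrtn0 : sd != 0 by exact: lt0r_neq0.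
have c2 : c ^+ 2 * v = 1.
  rewrite /c exprMn exprVn /sd exprMn sqr_sqrtr// real_normK ?num_real//.
  have : sd ^+ 2 != 0 by rewrite expf_neq0.
  rewrite /sd exprMn sqr_sqrtr// real_normK ?num_real// => h.
  by rewrite -mulrA [_^-1 * _]mulrC mulrA mulfV.
pose e1 w := c * e0 w.
have me1 : meas_wrt F0 e1 by rewrite /meas_wrt; apply: measurable_funM => //; exact: e0w.
have pe1 : Lp P p e1 by exact: LpZ.
have setI (g : T -> R) B : measurable B -> L1 P g -> P.-integrable B (EFin \o g).
  by move=> mB; apply: integrableS.
have ie1 : L1 P (e0 \o tau) by exact: (L1_mp mtau mp (Lp_L1 p23 pe0)).
have mds1 B : F0 B -> Rintegral P B (e1 \o tau) = 0.
  move=> FB; have mB := Fm FB.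
  have := mds FB; rewrite -[X in X -> _]/(Rintegral P B (fun w => e0 (tau w)) = 0) => h.
  by rewrite /e1/= RintegralZl ?h ?mulr0//; exact: setI.
have v1 : Ex P (fun w => e1 w ^+ 2) = 1.
  rewrite (eq_Ex P (g := fun w => c ^+ 2 * e0 w ^+ 2)); last by move=> w; rewrite exprMn.
  by rewrite ExZ//; exact: (Lp_sqr p23 pe0).
have Me n w : M tau e1 n w = c * M tau e0 n w by rewrite /M mulr_sumr; apply: eq_bigr.
(* n c^2 (E(M_n^2 / n | F0) - v) is a version of E(Q_n | F0) for the rescaled increments. The value
   at n = 0 is set to 0 because the series starts at 1, and Q_0 = 0. *)
pose Z n w := if n == 0%N then 0 else n%:R * c ^+ 2 * (ce n w - v).
have mZ n : meas_wrt F0 (Z n).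
  rewrite /Z /meas_wrt; case: eqP => _; first exact: measurable_cst.
  by apply: measurable_funM => //; apply: measurable_funB => //; exact: mce.
have Zpow n w : (0 < n)%N -> `| `|Z n w| `^ 2^-1| `^ p = (n%:R * c ^+ 2) `^ (p / 2) * `|ce n w - v| `^ (p / 2).
  move=> n0; rewrite (ger0_norm (powR_ge0 _ _)) -powRrM [2^-1 * p]mulrC /Z gtn_eqF//.
  have k0 : 0 <= n%:R * c ^+ 2 :> R by rewrite mulr_ge0 ?sqr_ge0.
  by rewrite normrM (ger0_norm k0) (powRM _ k0 (normr_ge0 _)).
have pZ n : Lp P p (fun w => `|Z n w| `^ 2^-1).
  split; first by apply: measurable_powR_norm; exact: (meas_wrt_measurable sF Fm (mZ n)).
  case: (posnP n) => [->|n0].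
    apply: (eq_L1 (f := fun=> 0)) => [w|]; last exact: L1_cst.
    by rewrite /Z eqxx normr0 powR0 ?invr_eq0// normr0 powR0// lt0r_neq0.
  by apply: (eq_L1 _ (L1Z ((n%:R * c ^+ 2) `^ (p / 2)) (Nce_pow n0).1)) => w; rewrite Zpow.
have hZ n B : F0 B -> Rintegral P B (fun w => Q tau e1 n w - Z n w) = 0.
  move=> FB; have mB := Fm FB.
  have h1 := Rint_M_sqr mtau mp sF Fm Finc p23 me1 pe1 mds1 n FB.
  case: (posnP n) => [n0|n0].
    have -> : (fun w => Q tau e1 n w - Z n w) = cst 0.
      by apply/funext => w; rewrite n0 /Q big_geq// /Z eqxx subr0.
    by rewrite /Rintegral integral0.
  have h2 := is_cond_exp_Rint Fm (iM2 n) (is_ce n) FB.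
  have nR : n%:R != 0 :> R by rewrite pnatr_eq0 -lt0n.
  have i1 : L1 P (fun w => M tau e1 n w ^+ 2 - n%:R - Q tau e1 n w).
    apply: L1B; last exact: (L1_Q mtau mp p23 pe1).
    by apply: L1B; [apply: (Lp_sqr p23); exact: (Lp_M mtau mp p23 pe1)|exact: L1_cst].
  have i2 : L1 P (fun w => n%:R^-1 * M tau e0 n w ^+ 2 - ce n w) by apply: L1B.
  have -> : (fun w => Q tau e1 n w - Z n w) = fun w =>
    n%:R * c ^+ 2 * (n%:R^-1 * M tau e0 n w ^+ 2 - ce n w) - (M tau e1 n w ^+ 2 - n%:R - Q tau e1 n w).
    apply/funext => w; rewrite /Z gtn_eqF// Me.
    have -> : n%:R * c ^+ 2 * (ce n w - v) = n%:R * c ^+ 2 * ce n w - n%:R by rewrite mulrBr -[X in _ - X]mulrA c2 mulr1.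
    by move: (M _ _ _ _) (Q _ _ _ _) (ce n w) (c) => x y z k; field.
  rewrite RintegralB//; [|by apply: setI => //; exact: L1Z|exact: setI].
  rewrite RintegralZl//; last exact: setI.
  by rewrite h1 h2 mulr0 subrr.
have nZ n : (0 < n)%N -> normZ P p Z n = n%:R * c ^+ 2 * fine (Nce n).
  move=> n0; have [i e] := Nce_pow n0.
  have k0 : 0 <= n%:R * c ^+ 2 :> R by rewrite mulr_ge0 ?sqr_ge0.
  have f0 : 0 <= fine (Nce n) by rewrite fine_ge0// Lnorm_ge0.
  rewrite /normZ /Np (eq_Ex P (g := fun w => (n%:R * c ^+ 2) `^ (p / 2) * `|ce n w - v| `^ (p / 2))); last first.
    by move=> w; rewrite Zpow.
  rewrite ExZ// e powRM ?powR_ge0// -!powRrM.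
  have -> : p / 2 * (2 / p) = 1 by field; exact: lt0r_neq0.
  by rewrite !powRr1.
pose S := c ^+ 2 * fine (\sum_(1 <= n <oo) ((n%:R `^ (2 - p / 2))^-1)%:E * Nce n)%E.
have hS K : \sum_(1 <= k < K) k%:R `^ (p / 2 - 3) * normZ P p Z k <= S.
  have -> : \sum_(1 <= k < K) k%:R `^ (p / 2 - 3) * normZ P p Z k =
      c ^+ 2 * \sum_(1 <= k < K) (k%:R `^ (2 - p / 2))^-1 * fine (Nce k).
    rewrite mulr_sumr big_nat [RHS]big_nat; apply: eq_bigr => k /andP[k0 _].
    rewrite nZ//; have kR : (0 : R) < k%:R by rewrite ltr0n.
    (* The factor k contained in [normZ] turns the weight k^{p/2-3} into k^{p/2-2}, the weight of
       the hypothesis. *)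
    have -> : (k%:R `^ (2 - p / 2))^-1 = k%:R `^ (p / 2 - 3) * k%:R :> R.
      rewrite -powRN -{3}[k%:R]powRr1 ?(ltW kR)// -powR_neq0_add//; congr (_ `^ _); ring.
    by move: (fine _) (_ `^ _) => x y; ring.
  apply: ler_wpM2l; first exact: sqr_ge0.
  have tot : (\sum_(1 <= n <oo) ((n%:R `^ (2 - p / 2))^-1)%:E * Nce n)%E \is a fin_num.
    by rewrite ge0_fin_numE// nneseries_ge0.
  rewrite -lee_fin fineK// (le_trans _ (partial_le K))// -sumEFin.
  rewrite le_eqVlt; apply/orP; left; apply/eqP.
  rewrite big_nat [RHS]big_nat; apply: eq_bigr => k /andP[k0 _].
  by rewrite EFinM fineK// ge0_fin_numE ?Lnorm_ge0 ?Nce_fin.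
have [C [C0 hC]] := clt_scaled mtau mp sF Fm Finc p23 me1 pe1 mds1 v1 mZ pZ hZ hS hr.
exists (C * sd `^ r); split; first by rewrite mulr_ge0 ?powR_ge0.
move=> f n nf n0; have := hC f sd n nf sd0 n0.
rewrite (eq_Ex P (g := fun w => f (A * inv_sqrtn R n * M tau e0 n w)))//.
move=> w; congr f; rewrite Me /c /inv_sqrtn powRN powR12_sqrt//.
have sn : Num.sqrt n%:R != 0 :> R by rewrite lt0r_neq0// sqrtr_gt0 ltr0n.
by field; rewrite inv_sqrtn0 sn.
Qed.

End hypotheses.

(** The assumption on r excludes the logarithmic case; at r = p - 2 < 1 the rate is 1 and n^{-r/2}
    is already n^{1-p/2}. *)
Lemma rate_scale (R : realType) (p r : R) n : (0 < n)%N -> (r = p - 2 -> r < 1) ->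
  n%:R `^ (- (r / 2)) * rate p r n = n%:R `^ (1 - p / 2).
Proof.
move=> n0 h; have nR : (0 : R) < n%:R by rewrite ltr0n.
rewrite /rate; case: eqP => [e|_].
  by rewrite h// mulr1 e; congr (_ `^ _); field.
by rewrite -powR_neq0_add//; congr (_ `^ _); field.
Qed.

Lemma ratio_powR_le (R : realType) (x K e t : R) n : (0 < n)%N -> 0 <= x -> 0 <= K -> 0 <= t ->
  x <= K * n%:R `^ e -> (x / n%:R) `^ t <= K `^ t * n%:R `^ ((e - 1) * t).
Proof.
move=> n0 x0 K0 t0 h; have nR : (0 : R) < n%:R by rewrite ltr0n.
have -> : K `^ t * n%:R `^ ((e - 1) * t) = (K * n%:R `^ (e - 1)) `^ t.
  by rewrite powRM ?powR_ge0// -powRrM.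
apply: ge0_powR_mono => //; first by rewrite divr_ge0// ltW.
by rewrite ler_pdivrMr// -mulrA powR_sub1// divfK// lt0r_neq0.
Qed.

Lemma ebigO_le (R : realType) (u : nat -> \bar R) (g : nat -> R) (C : R) :
  (\forall n \near \oo, (`|u n| <= (C * g n)%:E)%E) -> 0 <= C -> ebigO u g.
Proof.
move=> h C0; exists C; apply: filterS h => n; move/le_trans; apply.
by rewrite lee_fin; apply: ler_wpM2l => //; exact: ler_norm.
Qed.

Theorem theorem4p1 (R : realType) (d : measure_display) (T : measurableType d)
    (P : probability T R) (tau tauV : T -> T)
    (htau : invertible_measure_preserving P tau tauV)
    (F0 : set (set T)) (hF0 : sigma_algebra [set: T] F0)
    (hF0m : F0 `<=` measurable)
    (hF0inc : F0 `<=` preimage_set_system [set: T] tau F0)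
    (a : int -> R) (A : R) (ha : ell2 a) (haA : zseries_cvg a A)
    (p : R) (hp : 2 < p <= 3)
    (eps0 : {mfun T >-> R}) (heps : is_mds P tau tauV F0 eps0)
    (hepsp : (eps0 : T -> R) \in Lfun P p%:E)
    (X : int -> {mfun T >-> R})
    (hX : forall k : int, zseries_cvg_L2 P
      (fun j w => a j * stationary_seq tau tauV eps0 (k - j) w) (X k))
    (hAn : Acoef a A =o_\oo (fun n : nat => n%:R : R)) :
  let eps := stationary_seq tau tauV eps0 in
  let Eeps2 := fine ('E_P[(fun w => (eps0 w ^+ 2)%R)])%E in
  let sigma2 := A ^+ 2 * Eeps2 in
  let law_n := fun n => law P (normalized_sum X n) in
  (sigma2_n P X n @[n --> \oo] --> sigma2) /\
  ((\sum_(1 <= n <oo)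
      ((n%:R `^ (2 - p / 2))^-1)%:E *
      'N[P]_(p / 2)%:E[(fun w =>
         (cond_exp P F0
            (fun w' => n%:R^-1 * (\sum_(1 <= j < n.+1) eps j%:Z w') ^+ 2) w
          - Eeps2)%:E)] < +oo)%E ->
   [/\ p = 3 ->
       Acoef a A =O_\oo (fun=> 1 : R) ->
       ebigO (fun n => zolotarev 1 (law_n n) (normal_law sigma2))
             (fun n => n%:R `^ (- 2^-1) * ln n%:R),
       forall r : R, p - 2 <= r <= 1 -> p != 3 ->
       Acoef a A =O_\oo (fun n : nat => n%:R `^ ((r + 2 - p) / r) : R) ->
       ebigO (fun n => zolotarev r (law_n n) (normal_law sigma2))
             (fun n => n%:R `^ (1 - p / 2)),
       forall r : R, 1 < r <= 2 ->
       Acoef a A =O_\oo (fun n : nat => n%:R `^ (3 - p) : R) ->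
       ebigO (fun n => zolotarev r (law_n n) (normal_law sigma2))
             (fun n => n%:R `^ (1 - p / 2)) &
       forall r : R, 2 < r <= p ->
       Acoef a A =O_\oo (fun n : nat => n%:R `^ (3 - p) : R) ->
       ebigO (fun n => zolotarev r (law_n n) (normal_law (sigma2_n P X n)))
             (fun n => n%:R `^ (1 - p / 2))]).
Proof.
move=> eps Eeps2 sigma2 law_n.
have me0 : meas_wrt F0 eps0 by exact: (mds_meas_wrt hF0 heps).
have pe0 := mds_Lp hp hepsp.
have mds B := @mds_Rintegral _ _ _ P _ _ htau _ hF0 hF0m _ heps B.
have eE : Eeps2 = Ex P (fun w => eps0 w ^+ 2) by rewrite /Eeps2 unlock.
split.
  by rewrite /sigma2 eE; exact: (sigma2_cvg htau hF0 hF0m hF0inc hp me0 pe0 mds ha hX hAn).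
move=> hsum.
have [p2 p3] := andP hp.
have A0 n : 0 <= Acoef a A n by exact: Acoef_ge0.
have v0 : 0 <= Eeps2 by rewrite eE; apply: Ex_ge0 => w; exact: sqr_ge0.
have s20 : 0 <= sigma2 by rewrite mulr_ge0 ?sqr_ge0.
have sdE : `|A| * Num.sqrt (Ex P (fun w => eps0 w ^+ 2)) = Num.sqrt sigma2.
  by rewrite /sigma2 sqrtrM ?sqr_ge0// sqrtr_sqr eE.
have hsum' : (\sum_(1 <= n <oo) ((n%:R `^ (2 - p / 2))^-1)%:E *
      'N[P]_(p / 2)%:E[(fun w => (cond_exp P F0 (fun w' => n%:R^-1 * M tau eps0 n w' ^+ 2) w
        - Ex P (fun w => eps0 w ^+ 2))%:E)] < +oo)%E.
  have ME : (fun n w' => n%:R^-1 * (\sum_(1 <= j < n.+1) eps j%:Z w') ^+ 2) =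
      (fun n w' => n%:R^-1 * M tau eps0 n w' ^+ 2).
    by apply/funext => n; apply/funext => w'; rewrite /M big_add1.
  pose G (F : nat -> T -> R) := (\sum_(1 <= n <oo) ((n%:R `^ (2 - p / 2))^-1)%:E *
      'N[P]_(p / 2)%:E[(fun w => (cond_exp P F0 (F n) w
        - Ex P (fun w => eps0 w ^+ 2))%:E)] < +oo)%E.
  suff : G (fun n w' => n%:R^-1 * M tau eps0 n w' ^+ 2) by [].
  by rewrite -ME /G -eE.
have hclt r (hr : p - 2 <= r <= p) := series_clt htau hF0 hF0m hF0inc hp heps hepsp hsum' (A := A) hr.
(* From A_n = o(n); the bounds below are stated for A_n <= n. *)
have Acle : \forall n \near \oo, Acoef a A n <= n%:R.
  have /eqoP/(_ 1 ltr01) := hAn; apply: filterS => n.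
  by rewrite mul1r !ger0_norm.
have Le2 r : p - 2 <= r <= p -> r <= 2 -> exists C, 0 <= C /\ forall n, (0 < n)%N ->
    Acoef a A n <= n%:R -> (`|zolotarev r (law_n n) (normal_law sigma2)| <=
    (C * (n%:R `^ (- (r / 2)) * rate p r n + (Acoef a A n / n%:R) `^ (Num.min r 1 / 2)))%:E)%E.
  move=> hr r2; have [h1 h2] := andP hr.
  have [C [C0 hC]] := Lambda_bound htau hF0 hF0m hF0inc hp me0 pe0 mds ha hX hr (hclt r hr) r2.
  exists C; split => // n n0 An; apply: zolotarev_le => //; first by apply/andP; split; lra.
  by move=> f lf; rewrite -sdE; exact: hC.
(* For r > 1 the contribution of A_n is (A_n / n)^{1/2}, and A_n = O(n^{3-p}) gives it the exponent
   (3 - p - 1) / 2 = 1 - p / 2. *)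
have An3 r n K : 1 < r -> (0 < n)%N -> 0 <= K -> Acoef a A n <= K * n%:R `^ (3 - p) ->
    n%:R `^ (- (r / 2)) * rate p r n + (Acoef a A n / n%:R) `^ 2^-1 <= (1 + K `^ 2^-1) * n%:R `^ (1 - p / 2).
  move=> r1 n0 K0 hA; rewrite rate_scale//; last by move=> e; lra.
  rewrite mulrDl mul1r lerD2l.
  have h2 : 0 <= (2^-1 : R) by [].
  apply: (le_trans (ratio_powR_le n0 (A0 n) K0 h2 hA)).
  by rewrite (_ : (3 - p - 1) * 2^-1 = 1 - p / 2)//; field.
split.
- move=> p_eq /eqO_exP[K K0 hK].
  have hr : p - 2 <= (1 : R) <= p by apply/andP; split; lra.
  have r2 : (1 : R) <= 2 by rewrite ler1n.
  have [C [C0 hC]] := Le2 1 hr r2.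
  apply: (@ebigO_le _ _ _ (C * (2 + K `^ 2^-1))); last by rewrite mulr_ge0// addr_ge0// powR_ge0.
  near=> n; have n0 : (0 < n)%N by near: n; exact: nbhs_infty_gt.
  have nR : (0 : R) < n%:R by rewrite ltr0n.
  have An : Acoef a A n <= n%:R by near: n.
  apply: (le_trans (hC n n0 An)); rewrite lee_fin -mulrA; apply: ler_wpM2l => //.
  (* Once n >= e the logarithm is at least 1 and absorbs the terms of order n^{-1/2} without
     logarithm. *)
  have ln1 : 1 <= ln n%:R :> R.
    have h : expR 1 <= n%:R :> R by near: n; exact: nbhs_infty_ger.
    by rewrite -[leLHS]expRK ler_ln ?posrE ?expR_gt0.
  have hA : Acoef a A n <= K * n%:R `^ 0.
    have : `|Acoef a A n| <= K * `|1 : R| by near: n.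
    by rewrite normr1 powRr0 ger0_norm.
  have h2 : 0 <= (2^-1 : R) by [].
  have := ratio_powR_le n0 (A0 n) (ltW K0) h2 hA.
  rewrite (_ : (0 - 1) * 2^-1 = - 2^-1); last by field.
  rewrite min_l// mul1r p_eq (_ : rate 3 1 n = 1 + ln n%:R); last first.
    rewrite /rate (_ : 1 == 3 - 2); last by apply/eqP; ring.
    by rewrite ltxx.
  set x := n%:R `^ _; set k := K `^ _; set l := ln _ in ln1 *; set y := _ `^ _ => hy.
  have x0 : 0 <= x by exact: powR_ge0.
  have k0 : 0 <= k by exact: powR_ge0.
  apply: (@le_trans _ _ (x * (1 + l) + k * x)); first by rewrite lerD2l.
  have -> : (2 + k) * (x * l) = x * (1 + l) + k * x + (x + k * x) * (l - 1) by ring.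
  by rewrite lerDl mulr_ge0 ?subr_ge0// addr_ge0// mulr_ge0.
- move=> r /andP[r1 r2] pn3 /eqO_exP[K K0 hK].
  have hr : p - 2 <= r <= p by apply/andP; split; lra.
  have r22 : r <= 2 by lra.
  have r0 : 0 < r by lra.
  have [C [C0 hC]] := Le2 r hr r22.
  apply: (@ebigO_le _ _ _ (C * (1 + K `^ (r / 2)))); last by rewrite mulr_ge0// addr_ge0// powR_ge0.
  near=> n; have n0 : (0 < n)%N by near: n; exact: nbhs_infty_gt.
  have An : Acoef a A n <= n%:R by near: n.
  apply: (le_trans (hC n n0 An)); rewrite lee_fin -mulrA; apply: ler_wpM2l => //.
  have hA : Acoef a A n <= K * n%:R `^ ((r + 2 - p) / r).
    have : `|Acoef a A n| <= K * `|n%:R `^ ((r + 2 - p) / r)| by near: n.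
    by rewrite !ger0_norm ?powR_ge0.
  (* The condition p <> 3 is used here: r = p - 2 then gives r < 1, so no logarithm arises. The
     exponent of A_n is chosen so that ((r + 2 - p) / r - 1) r / 2 = 1 - p / 2. *)
  rewrite min_l// rate_scale//; last by move=> e; rewrite e lt_neqAle; move: pn3 => /eqP pn3; lra.
  rewrite mulrDl mul1r lerD2l.
  have h2 : 0 <= r / 2 by rewrite divr_ge0// ltW.
  apply: (le_trans (ratio_powR_le n0 (A0 n) (ltW K0) h2 hA)).
  rewrite (_ : ((r + 2 - p) / r - 1) * (r / 2) = 1 - p / 2)//.
  by field; rewrite lt0r_neq0.
- move=> r /andP[r1 r2] /eqO_exP[K K0 hK].
  have hr : p - 2 <= r <= p by apply/andP; split; lra.
  have [C [C0 hC]] := Le2 r hr r2.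
  apply: (@ebigO_le _ _ _ (C * (1 + K `^ 2^-1))); last by rewrite mulr_ge0// addr_ge0// powR_ge0.
  near=> n; have n0 : (0 < n)%N by near: n; exact: nbhs_infty_gt.
  have An : Acoef a A n <= n%:R by near: n.
  apply: (le_trans (hC n n0 An)); rewrite lee_fin -mulrA; apply: ler_wpM2l => //.
  rewrite min_r ?(ltW r1)// mul1r; apply: An3 => //; first exact: ltW.
  have : `|Acoef a A n| <= K * `|n%:R `^ (3 - p)| by near: n.
  by rewrite !ger0_norm ?powR_ge0.
- move=> r /andP[r1 r2] /eqO_exP[K K0 hK].
  have hr : p - 2 <= r <= p by apply/andP; split; lra.
  have [C [C0 hC]] := Lambda_bound_gt2 htau hF0 hF0m hF0inc hp me0 pe0 mds ha hX hr (hclt r hr) r1.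
  apply: (@ebigO_le _ _ _ (C * (1 + K `^ 2^-1))); last by rewrite mulr_ge0// addr_ge0// powR_ge0.
  near=> n; have n0 : (0 < n)%N by near: n; exact: nbhs_infty_gt.
  have An : Acoef a A n <= n%:R by near: n.
  have hA : Acoef a A n <= K * n%:R `^ (3 - p).
    have : `|Acoef a A n| <= K * `|n%:R `^ (3 - p)| by near: n.
    by rewrite !ger0_norm ?powR_ge0.
  apply: zolotarev_le; first by apply/andP; split; lra.
    by rewrite sigma2_nE mulr_ge0 ?invr_ge0//; apply: Ex_ge0 => w; exact: sqr_ge0.
  move=> f lf; have [ef i h] := hC f n lf n0 An; split => //.
  apply: (le_trans h); rewrite -mulrA; apply: ler_wpM2l => //.
  by apply: An3 => //; [lra|exact: ltW].
Unshelve. all: by end_near.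
Qed.
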